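(* For each fixed $\lambda \in \mathbb{R}$, let $B^{\lambda,br}$ be a Brownian bridge of length $1$ from $0$ to $\lambda$. Then its Vervaat transform $(V(B^{\lambda,br})_t;\ 0 \leq t \leq 1)$ is a semimartingale with respect to its induced (natural) filtration.
   Context: Vervaat transform: for continuous $f:[0,1]\to\mathbb{R}$ with $f(0)=0$, let $\tau(f)$ be the first time at which $f$ attains its minimum on $[0,1]$. Define $V(f)(t)=f(\tau(f)+t)-f(\tau(f))$ for $0\le t\le 1-\tau(f)$ and $V(f)(t)=f(\tau(f)+t-1)+f(1)-f(\tau(f))$ for $1-\tau(f)\le t\le 1$. *)

(* Defs.v *)
From HB Require Import structures.
From mathcomp Require Import all_boot all_order all_algebra.
From mathcomp Require Import all_classical all_reals all_analysis.
Set Implicit Arguments.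
Unset Strict Implicit.
Unset Printing Implicit Defensive.
Import Order.TTheory GRing.Theory Num.Theory.
Import numFieldNormedType.Exports.
Local Open Scope classical_set_scope.
Local Open Scope ring_scope.

(* Processes indexed by [0, 1] are total functions R -> T -> R whose values
   at times outside [0, 1] are never used. *)

Section vervaat_transform.
Context {R : realType}.
Implicit Type f : R -> R.

Definition argmin_set f : set R :=
  [set t | 0 <= t <= 1 /\ forall s, 0 <= s <= 1 -> f t <= f s].

(* For f continuous on [0, 1], argmin_set f is nonempty and compact, so the
   infimum is attained. *)
Definition first_argmin f : R := inf (argmin_set f).

(* When f 0 = 0 both expressions agree at t = 1 - first_argmin f. *)
Definition vervaat f (t : R) : R :=
  let tau := first_argmin f in
  if t <= 1 - tau then f (tau + t) - f tau
  else f (tau + t - 1) + f 1 - f tau.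

End vervaat_transform.

Section brownian_bridge.
Context {R : realType} {d : measure_display} {T : measurableType d}.
Variable P : probability T R.

(* normal_prob m 0 is the uniform law on [0, 1] in the library, hence the
   separate degenerate case. *)
Definition gaussian_law (m v : R) (A : set R) : \bar R :=
  if v == 0 then dirac m A else normal_prob m (Num.sqrt v) A.

(* The process on [0, 1] is Gaussian (every finite linear combination of its
   values is normal, possibly degenerate), with mean function m and covariance
   function c. *)
Definition gaussian_process (m : R -> R) (c : R -> R -> R)
    (X : R -> {RV P >-> R}) : Prop :=
  forall (n : nat) (t : 'I_n -> R) (a : 'I_n -> R),
    (forall i, 0 <= t i <= 1) ->
    forall A : set R, measurable A ->
      P ((fun w => \sum_(i < n) a i * X (t i) w) @^-1` A) =
      gaussian_law (\sum_(i < n) a i * m (t i))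
        (\sum_(i < n) \sum_(j < n) a i * a j * c (t i) (t j)) A.

(* Brownian bridge of length 1 from 0 to l. The endpoint value l at time 1 is
   enforced almost surely by the mean l and the variance 0 at t = 1. *)
Definition brownian_bridge (l : R) (B : R -> {RV P >-> R}) : Prop :=
  [/\ forall w, {within `[0, 1], continuous (fun t => B t w)},
      forall w, B 0 w = 0 &
      gaussian_process (fun t => l * t) (fun s t => Num.min s t - s * t) B].

End brownian_bridge.

Section semimartingale.
Context {R : realType} {d : measure_display} {T : measurableType d}.
Variable P : probability T R.
Implicit Types (F : R -> set (set T)) (X M A : R -> T -> R) (tau : T -> R).

Definition natural_filtration X (t : R) : set (set T) :=
  <<s \bigcup_(s in `[0, t]) preimage_set_system setT (X s) measurable >>.

Definition filtration F : Prop :=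
  (forall t, 0 <= t <= 1 -> sigma_algebra setT (F t) /\ F t `<=` measurable) /\
  (forall s t, 0 <= s -> s <= t -> t <= 1 -> F s `<=` F t).

Definition measurable_wrt (G : set (set T)) (Y : T -> R) : Prop :=
  forall S : set R, measurable S -> G (Y @^-1` S).

Definition adapted F X : Prop :=
  forall t, 0 <= t <= 1 -> measurable_wrt (F t) (X t).

Definition is_cond_exp (G : set (set T)) (X Y : T -> R) : Prop :=
  [/\ measurable_wrt G Y, P.-integrable setT (EFin \o Y) &
      forall S, G S ->
        (\int[P]_(w in S) (Y w)%:E = \int[P]_(w in S) (X w)%:E)%E].

Definition martingale F M : Prop :=
  [/\ adapted F M,
      forall t, 0 <= t <= 1 -> P.-integrable setT (EFin \o M t) &
      forall s t, 0 <= s -> s <= t -> t <= 1 -> is_cond_exp (F s) (M t) (M s)].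

Definition cadlag (f : R -> R) : Prop :=
  (forall t, 0 <= t < 1 -> f x @[x --> t^'+] --> f t) /\
  (forall t, 0 < t <= 1 -> cvg (f x @[x --> t^'-])).

Definition stopping_time F tau : Prop :=
  (forall w, 0 <= tau w <= 1) /\
  (forall t, 0 <= t <= 1 -> F t [set w | tau w <= t]).

(* On the closed time interval [0, 1], a localizing sequence must almost surely
   reach the terminal time 1. *)
Definition localizing_sequence F (tau : nat -> T -> R) : Prop :=
  [/\ forall n, stopping_time F (tau n),
      forall n w, tau n w <= tau n.+1 w &
      {ae P, forall w, exists n, tau n w = 1}].

(* Filtrations are not assumed to be complete, so path properties are only
   required almost surely. *)
Definition local_martingale F M : Prop :=
  [/\ adapted F M, {ae P, forall w, cadlag (fun t => M t w)} &
      exists tau : nat -> T -> R, localizing_sequence F tau /\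
        forall n, martingale F (fun t w => M (Num.min t (tau n w)) w - M 0 w)].

Definition finite_variation_process F A : Prop :=
  [/\ adapted F A, {ae P, forall w, cadlag (fun t => A t w)} &
      {ae P, forall w, bounded_variation 0 1 (fun t => A t w)}].

Definition semimartingale F X : Prop :=
  [/\ filtration F, adapted F X &
      exists M A : R -> T -> R,
        [/\ local_martingale F M, finite_variation_process F A,
            forall w, M 0 w = 0 /\ A 0 w = 0 &
            forall t w, 0 <= t <= 1 -> X t w = X 0 w + M t w + A t w]].

End semimartingale.

(* Main.v *)
Require Import Defs.
From HB Require Import structures.
From mathcomp Require Import all_boot all_order all_algebra.
From mathcomp Require Import all_classical all_reals all_analysis.
From mathcomp Require Import measurable_realfun.
From mathcomp Require Import ring lra.
Set Implicit Arguments.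
Unset Strict Implicit.
Unset Printing Implicit Defensive.
Import Order.TTheory GRing.Theory Num.Theory.
Import numFieldNormedType.Exports.
Local Open Scope classical_set_scope.
Local Open Scope ring_scope.

(* Let tau be the first argmin of the bridge X, and ]a, b[ a time interval. Given
   the bridge outside ]a, b[, the value X_t is Gaussian, and if moreover X stays
   above its minimum m on ]a, b[ the reflection principle and Stein's identity
   give its conditional mean: linear interpolation plus a repulsion from m. As
   long as the Vervaat transform up to time s has not explored ]a, b[, the events
   of its filtration are, on this event, events outside ]a, b[. Letting b = 1 or
   b -> tau and the length of the step t - a -> 0, one gets for every S in F_s
     E[1_S (V_t - V_s)] = E[1_S int_s^t c_u du],
   where c_u is the sum of the slope towards the endpoint (at time 1 or tau) and
   of a term bounded by 1 / (X - m). It is integrable since E[1 / (X_r - m)] is at most of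
   order r^(-1/2) + (1 - r)^(-1/2); for the slope towards X_tau, of constant sign,
   integrability follows from the identity itself by monotone convergence.
   If b_u is the conditional expectation of c on the predictable sigma-algebra
   (a Radon-Nikodym density), then A_t = int_0^t b_u du is adapted and V - A is a
   martingale. *)

(** * Stein's identity for normal densities *)

(** The argmin is not a stopping time and the filtration of the transform starts from it, so the
    Markov property of the bridge is of no direct help. No conditional law of the whole path is
    formed: everything is an identity between integrals over [S] in F_s. The obstacle is that both
    the minimum and the argmin depend on the path inside ]a, b[. It is overcome by the level
    [outer_min], the minimum over the complement, which the noise inside cannot influence: as long
    as the path inside exceeds it, minimum and argmin are determined outside, and equality is a null
    event ([tie_null]). The drift c found in this way depends on the minimum, the argmin and the end
    value, hence on the future; this is why a projection comes last. The order of E[1 / (X_r - m)]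
    comes from P(X_r - m < e^2) = O(e^3): staying above X_r - e^2 on the longer side of r costs e^2,
    while on the shorter side, of length L, only e / sqrt L is kept, so that the bound is integrable
    in r. *)

Section gaussian_density.
Context {R : realType}.
Local Notation mu := lebesgue_measure.
Implicit Types s a b x : R.

Local Notation pdf s := (normal_pdf (0:R) s).

Lemma normal_pdf0E s x : s != 0 ->
  pdf s x = normal_peak s * expR (- x ^+ 2 / (s ^+ 2 *+ 2)).
Proof. by move=> s0; rewrite normal_pdfE// /normal_fun subr0. Qed.

Lemma is_derive_expR_comp (g : R -> R) (x dg : R) : is_derive x 1 g dg ->
  is_derive x 1 (fun y => expR (g y)) (dg * expR (g x)).
Proof.
move=> dgx; apply: (is_derive_eq (is_derive1_comp (is_derive_expR (g x)) dgx)).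
by rewrite mulrC.
Qed.

Lemma is_derive_normal_pdf s x : s != 0 ->
  is_derive x 1 (pdf s) (- (x / s ^+ 2) * pdf s x).
Proof.
move=> s0.
rewrite (_ : pdf s =
    fun y => normal_peak s * expR ((- (s ^+ 2 *+ 2)^-1) * (y * y))); last first.
  apply/funext => y; rewrite normal_pdf0E//; congr (_ * expR _).
  by rewrite -expr2; field.
have dg : is_derive x 1 (fun y => (- (s ^+ 2 *+ 2)^-1) * (y * y)) (- (x / s ^+ 2)).
  apply: is_derive_eq; rewrite /GRing.scale/=.
  by field.
have dh := is_derive_expR_comp dg.
apply: is_derive_eq; rewrite /GRing.scale/=.
by ring.
Qed.

Lemma continuous_normal_pdf0 s : s != 0 -> continuous (pdf s).
Proof. exact: continuous_normal_pdf. Qed.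

(** Integration by parts: the derivative of [pdf s] is -(x / s^2) [pdf s], so the integrand is the
    derivative of -s^2 f [pdf s]. *)
Lemma stein_itv s a b (f f' : R -> R) : s != 0 -> a < b ->
  (forall x : R, is_derive x 1 f (f' x)) -> continuous f' ->
  (\int[mu]_(x in `[a, b]) ((x * f x - s ^+ 2 * f' x) * pdf s x)%:E =
   (s ^+ 2 * (f a * pdf s a - f b * pdf s b))%:E)%E.
Proof.
move=> s0 ab df cf'.
have cf : continuous f.
  move=> x; apply: differentiable_continuous; apply/derivable1_diffP.
  by have [] := df x.
pose F := fun x => - s ^+ 2 * (f x * pdf s x).
have dF x : is_derive x 1 F ((x * f x - s ^+ 2 * f' x) * pdf s x).
  have ? := df x.
  have ? := is_derive_normal_pdf x s0.
  apply: is_derive_eq.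
  rewrite /GRing.scale/=.
  by field.
rewrite (@continuous_FTC2 _ _ F)//.
- by rewrite -EFinB /F; congr EFin; ring.
- apply: continuous_subspaceT => x.
  apply: cvgM; last exact: continuous_normal_pdf0.
  apply: cvgB; first by apply: cvgM; [exact: cvg_id|exact: cf].
  by apply: cvgM; [exact: cvg_cst|exact: cf'].
- have cF x : {for x, continuous F}.
    apply: differentiable_continuous; apply/derivable1_diffP.
    by have [] := dF x.
  split.
  + by move=> x _; have [] := dF x.
  + by apply: cvg_at_right_filter; exact: cF.
  + by apply: cvg_at_left_filter; exact: cF.
- by move=> x _; rewrite derive1E; have [] := dF x.
Qed.

End gaussian_density.

Section integral_limits.
Context d (T : measurableType d) (R : realType).
Variable mu : {measure set T -> \bar R}.
Implicit Types (D : set T) (f : T -> R).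

Lemma dominated_convergence_real D (f_ : (T -> R)^nat) f (g : T -> R) : measurable D ->
  (forall n, measurable_fun D (f_ n)) -> measurable_fun D f ->
  (forall x, D x -> f_ ^~ x @ \oo --> f x) ->
  mu.-integrable D (EFin \o g) ->
  (forall n x, D x -> `|f_ n x| <= g x) ->
  mu.-integrable D (EFin \o f) /\
  (\int[mu]_(x in D) (f_ n x)%:E @[n --> \oo] --> \int[mu]_(x in D) (f x)%:E)%E.
Proof.
move=> mD mf_ mf ff ig fg.
have [| | | | |] := @dominated_convergence _ _ _ mu D mD
  (fun n => EFin \o f_ n) (EFin \o f) (EFin \o g).
- by move=> n; exact/measurable_EFinP.
- exact/measurable_EFinP.
- by apply: aeW => x Dx; apply: cvg_EFin; [exact: nearW|exact: ff].
- by [].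
- by apply: aeW => x n Dx; rewrite lee_fin fg.
- by [].
Qed.

(** Reduces an integral over an unbounded set, of a function already known to be integrable, to
    bounded intervals where the fundamental theorem of calculus applies. *)
Lemma cvg_integral_sets D (D_ : (set T)^nat) f :
  measurable D -> (forall n, measurable (D_ n)) ->
  (forall n, D_ n `<=` D) -> (forall x, D x -> \forall n \near \oo, D_ n x) ->
  mu.-integrable D (EFin \o f) ->
  (\int[mu]_(x in D_ n) (f x)%:E @[n --> \oo] --> \int[mu]_(x in D) (f x)%:E)%E.
Proof.
move=> mD mD_ sD cD If.
have mf : measurable_fun D f by apply/measurable_EFinP; exact: measurable_int If.
rewrite (_ : (fun n => _) =
    (fun n => (\int[mu]_(x in D) ((f \_ (D_ n)) x)%:E)%E)); last first.
  apply/funext => n; rewrite -[in LHS](setIidl (sD n)).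
  rewrite setIC integral_mkcondr; apply: eq_integral => x _.
  by rewrite restrict_EFin.
have [//|n|//|x Dx||n x Dx|_] := @dominated_convergence_real D (fun n => f \_ (D_ n)) f (Num.norm \o f).
- by rewrite patch_indic; apply: measurable_funM => //.
- apply: cvg_near_cst; near=> n.
  rewrite patchE mem_set//; near: n; exact: cD.
- exact: integrable_norm.
- by rewrite /= patchE; case: ifP => //; rewrite normr0.
- by [].
Unshelve. all: by end_near. Qed.

Lemma Rintegral_eq_sub0 D (f g : T -> R) : measurable D ->
  mu.-integrable D (EFin \o f) -> mu.-integrable D (EFin \o g) ->
  (\int[mu]_(x in D) (f x - g x)%:E = 0)%E ->
  \int[mu]_(x in D) f x = \int[mu]_(x in D) g x.
Proof.
move=> mD If Ig h; apply/eqP; rewrite -subr_eq0 -RintegralB//.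
by rewrite /Rintegral h.
Qed.

Lemma RintegralN D (f : T -> R) : measurable D ->
  mu.-integrable D (EFin \o f) ->
  \int[mu]_(x in D) (- f x) = - \int[mu]_(x in D) f x.
Proof.
move=> mD If; under eq_Rintegral do rewrite -mulN1r.
by rewrite RintegralZl// mulN1r.
Qed.

End integral_limits.

(** * Gaussian integrals over half-lines and the whole line *)

Section gaussian_integrals.
Context {R : realType}.
Local Notation mu := lebesgue_measure.
Implicit Types s a b c x : R.
Local Notation pdf s := (normal_pdf (0:R) s).

Lemma cvg_normal_pdf0y s : s != 0 -> pdf s x @[x --> +oo] --> (0 : R).
Proof.
move=> s0.
have q0 : 0 < Num.sqrt (s ^+ 2 *+ 2) by rewrite sqrtr_gt0 pmulrn_lgt0// exprn_even_gt0.
rewrite (_ : pdf s = fun x => normal_peak s * gauss_fun (x / Num.sqrt (s ^+ 2 *+ 2))); last first.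
  apply/funext => x; rewrite normal_pdf0E// /gauss_fun; congr (_ * expR _).
  rewrite exprMn exprVn sqr_sqrtr; first by rewrite mulNr.
  by rewrite pmulrn_lge0// sqr_ge0.
rewrite -[X in _ --> X](mulr0 (normal_peak s)); apply: cvgM; first exact: cvg_cst.
apply: (@cvg_comp _ _ _ (fun x => x / Num.sqrt (s ^+ 2 *+ 2)) gauss_fun _ (+oo%R)).
  by apply: gt0_cvgMly; [rewrite invr_gt0|exact: cvg_id].
exact: cvg_gauss_fun.
Qed.

Lemma normal_pdf0N s x : s != 0 -> pdf s (- x) = pdf s x.
Proof. by move=> s0; rewrite !normal_pdf0E// sqrrN. Qed.

Lemma cvg_normal_pdf0Ny_nat s (c : R) : s != 0 ->
  pdf s (c + n%:R) @[n --> \oo] --> (0 : R).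
Proof.
move=> s0; apply: (@cvg_comp _ _ _ (fun n => c + n%:R) (pdf s) _ (+oo%R)).
  apply: (@cvg_comp _ _ _ (fun n => n%:R) (fun x => c + x) _ (+oo%R)).
    exact: cvgr_idn.
  by under eq_fun do rewrite addrC; exact: cvg_addrr.
exact: cvg_normal_pdf0y.
Qed.

Lemma integral_abs_normal_pdf s : s != 0 ->
  (\int[mu]_x (`|x| * pdf s x)%:E = (2 * (s ^+ 2 * pdf s 0))%:E)%E.
Proof.
move=> s0.
rewrite ge0_symfun_integralT//; last 3 first.
- by move=> x; rewrite mulr_ge0// normal_pdf_ge0.
- by move=> x; apply: cvgM; [exact: norm_continuous|exact: continuous_normal_pdf0].
- by move=> x /=; rewrite normrN normal_pdf0N.
rewrite EFinM; congr (_ * _)%E.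
rewrite -set_itvcy.
transitivity (\int[mu]_(x in `[0%R, +oo[) (x * pdf s x)%:E)%E.
  by apply: eq_integral => x; rewrite inE/= in_itv/= andbT => x0; rewrite ger0_norm.
pose F := fun x => - s ^+ 2 * pdf s x.
have dF x : is_derive x 1 F (x * pdf s x).
  have ? := is_derive_normal_pdf x s0.
  by apply: is_derive_eq; rewrite /GRing.scale/=; field.
have cF x : {for x, continuous F}.
  apply: differentiable_continuous; apply/derivable1_diffP.
  by have [] := dF x.
rewrite (@ge0_continuous_FTC2y _ _ F 0 0)//.
- by rewrite /F -EFinB; congr EFin; ring.
- by move=> x x0; rewrite mulr_ge0// normal_pdf_ge0.
- apply: continuous_subspaceT => x.
  by apply: cvgM; [exact: cvg_id|exact: continuous_normal_pdf0].
- rewrite -[X in _ --> X](mulr0 (- s ^+ 2)); apply: cvgM; first exact: cvg_cst.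
  exact: cvg_normal_pdf0y.
- by apply: cvg_at_right_filter; exact: cF.
- by move=> x _; rewrite derive1E; have [] := dF x.
Qed.

Lemma integrable_mul_normal_pdf s (f : R -> R) (K L : R) : s != 0 ->
  measurable_fun setT f -> (forall x, `|f x| <= K + L * `|x|) ->
  mu.-integrable setT (fun x => (f x * pdf s x)%:E).
Proof.
move=> s0 mf fK.
have i1 : mu.-integrable setT (fun x => (`|x| * pdf s x)%:E).
  apply/integrableP; split.
    apply/measurable_EFinP; apply: measurable_funM; last exact: measurable_normal_pdf.
    exact: normr_measurable.
  under eq_integral do rewrite gee0_abs ?lee_fin ?mulr_ge0 ?normal_pdf_ge0//.
  by rewrite integral_abs_normal_pdf// ltry.
have i2 : mu.-integrable setT (fun x => (pdf s x)%:E) by exact: integrable_normal_pdf.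
apply: (@le_integrable _ _ _ mu setT measurableT _
  (fun x => (K%:E * (pdf s x)%:E + L%:E * (`|x| * pdf s x)%:E)%E)).
- apply/measurable_EFinP; apply: measurable_funM => //; exact: measurable_normal_pdf.
- move=> x _.
  rewrite -!EFinM -EFinD !abse_EFin lee_fin.
  rewrite normrM (ger0_norm (normal_pdf_ge0 _ _ _)).
  rewrite mulrA -mulrDl normrM (ger0_norm (normal_pdf_ge0 _ _ _)).
  rewrite ler_wpM2r ?normal_pdf_ge0//.
  by apply: le_trans (fK x) _; exact: ler_norm.
- by apply: integrableD => //; exact: integrableZl.
Qed.

(** The boundary term at [c] vanishes because [W c = 0], the one at infinity because [W] is bounded.
    [W] will be a product of two staying probabilities, which agrees with a smooth function only on
    this half-line. *)
Lemma stein_ray s c (K : R) (W W' : R -> R) : s != 0 ->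
  (forall x : R, is_derive x 1 W (W' x)) -> continuous W' -> W c = 0 ->
  (forall x, c <= x -> `|W x| <= 1) -> (forall x, c <= x -> `|W' x| <= K) ->
  (\int[mu]_(x in `[c, +oo[) ((x * W x - s ^+ 2 * W' x) * pdf s x)%:E = 0)%E.
Proof.
move=> s0 dW cW' Wc W1 W'K.
have cW : continuous W.
  move=> x; apply: differentiable_continuous; apply/derivable1_diffP.
  by have [] := dW x.
pose f x := x * W x - s ^+ 2 * W' x.
have mf : measurable_fun setT f.
  apply: continuous_measurable_fun => x.
  apply: cvgB; first by apply: cvgM; [exact: cvg_id|exact: cW].
  by apply: cvgM; [exact: cvg_cst|exact: cW'].
have If : mu.-integrable `[c, +oo[ (fun x => (f x * pdf s x)%:E).
  pose g := f \_ `[c, +oo[.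
  have Ig : mu.-integrable setT (fun x => (g x * pdf s x)%:E).
    apply: (@integrable_mul_normal_pdf _ _ (s ^+ 2 * K) 1) => //.
      by apply/(measurable_restrictT _ _).1 => //; exact: measurable_funTS.
    move=> x; rewrite /g patchE; case: ifPn => [|_].
      rewrite inE/= in_itv/= andbT => cx.
      rewrite mul1r addrC (le_trans (ler_normB _ _))// lerD//.
        by rewrite normrM ler_piMr// W1.
      by rewrite normrM ger0_norm ?sqr_ge0// ler_wpM2l ?sqr_ge0// W'K.
    rewrite normr0 mul1r addr_ge0// mulr_ge0 ?sqr_ge0//.
    by rewrite (le_trans _ (W'K c _)).
  apply: (@eq_integrable _ _ _ mu _ _ (fun x => (g x * pdf s x)%:E)) => //.
    by move=> x xc; rewrite /g patchE xc.
  exact: integrableS Ig.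
have := @cvg_integral_sets _ _ _ mu `[c, +oo[ (fun n => `[c, c + n.+1%:R]%classic)
  (fun x => f x * pdf s x).
move=> /(_ _ _ _ _ If) h.
have {}h : (\int[mu]_(x in `[c, (c + n.+1%:R)%R]) (f x * pdf s x)%:E @[n --> \oo] -->
    \int[mu]_(x in `[c, +oo[) (f x * pdf s x)%:E)%E.
  apply: h => //.
  - by move=> n x /=; rewrite !in_itv/= => /andP[->].
  - move=> x /=; rewrite in_itv/= andbT => cx.
    near=> n; rewrite /= in_itv/= cx/= -lerBlDl.
    near: n; apply: filterS (nbhs_infty_ger (x - c)) => n /= h.
    by rewrite (le_trans h)// ler_nat.
suff : (\int[mu]_(x in `[c, (c + n.+1%:R)%R]) (f x * pdf s x)%:E @[n --> \oo] --> 0)%E.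
  by move=> h0; apply: (cvg_unique _ h h0).
rewrite (_ : (fun n => _) =
  (fun n => (- (s ^+ 2 * (W (c + n.+1%:R) * pdf s (c + n.+1%:R))))%:E)); last first.
  apply/funext => n; rewrite (@stein_itv _ _ _ _ W W')//; last by rewrite ltrDl.
  by rewrite Wc mul0r sub0r mulrN.
apply: cvg_EFin; first exact: nearW.
rewrite -[X in _ --> X]oppr0; apply: cvgN.
rewrite -[X in _ --> X](mulr0 (s ^+ 2)); apply: cvgM; first exact: cvg_cst.
apply: (@squeeze_cvgr _ _ _ _ (fun n => - pdf s (c + n.+1%:R)) (fun n => pdf s (c + n.+1%:R))).
- near=> n; rewrite -ler_norml normrM (ger0_norm (normal_pdf_ge0 _ _ _)).
  by rewrite ler_piMl ?normal_pdf_ge0// W1// lerDl.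
- rewrite -[X in _ --> X]oppr0; apply: cvgN.
  by have := cvg_normal_pdf0Ny_nat c s0; rewrite -(cvg_shiftS (fun n => pdf s (c + n%:R))).
- by have := cvg_normal_pdf0Ny_nat c s0; rewrite -(cvg_shiftS (fun n => pdf s (c + n%:R))).
Unshelve. all: by end_near. Qed.

Lemma mgf_normal_pdf s c : s != 0 ->
  (\int[mu]_x (expR (c * x) * pdf s x)%:E = (expR (c ^+ 2 * s ^+ 2 / 2))%:E)%E.
Proof.
move=> s0.
(* Completing the square turns the integrand into a constant times the density of mean c s^2. *)
transitivity (\int[mu]_x ((expR (c ^+ 2 * s ^+ 2 / 2))%:E * (normal_pdf (c * s ^+ 2) s x)%:E))%E.
  apply: eq_integral => x _; rewrite -EFinM; congr EFin.
  rewrite !normal_pdfE// /normal_fun mulrCA [in RHS]mulrCA; congr (_ * _).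
  by rewrite -!expRD; congr expR; field.
rewrite ge0_integralZl//; last 2 first.
- by apply/measurable_EFinP; exact: measurable_normal_pdf.
- by move=> x _; rewrite lee_fin normal_pdf_ge0.
by rewrite integral_normal_pdf mule1.
Qed.

Lemma stein_line s (K : R) (W W' : R -> R) : s != 0 ->
  (forall x : R, is_derive x 1 W (W' x)) -> continuous W' ->
  (forall x, `|W x| <= 1) -> (forall x, `|W' x| <= K) ->
  (\int[mu]_x ((x * W x - s ^+ 2 * W' x) * pdf s x)%:E = 0)%E.
Proof.
move=> s0 dW cW' W1 W'K.
have cW : continuous W.
  move=> x; apply: differentiable_continuous; apply/derivable1_diffP.
  by have [] := dW x.
pose f x := x * W x - s ^+ 2 * W' x.
have mf : measurable_fun setT f.
  apply: continuous_measurable_fun => x.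
  apply: cvgB; first by apply: cvgM; [exact: cvg_id|exact: cW].
  by apply: cvgM; [exact: cvg_cst|exact: cW'].
have If : mu.-integrable setT (fun x => (f x * pdf s x)%:E).
  apply: (@integrable_mul_normal_pdf _ _ (s ^+ 2 * K) 1) => //.
  move=> x; rewrite mul1r addrC (le_trans (ler_normB _ _))// lerD//.
    by rewrite normrM ler_piMr// W1.
  by rewrite normrM ger0_norm ?sqr_ge0// ler_wpM2l ?sqr_ge0// W'K.
have := @cvg_integral_sets _ _ _ mu setT (fun n => `[- n.+1%:R, n.+1%:R]%classic)
  (fun x => f x * pdf s x).
move=> /(_ _ _ _ _ If) h.
have {}h : (\int[mu]_(x in `[(- n.+1%:R)%R, n.+1%:R%R]) (f x * pdf s x)%:E @[n --> \oo] -->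
    \int[mu]_x (f x * pdf s x)%:E)%E.
  apply: h => //.
  - move=> x _; near=> n; rewrite /= in_itv/= -ler_norml.
    near: n; apply: filterS (nbhs_infty_ger `|x|) => n /= h.
    by rewrite (le_trans h)// ler_nat.
suff : (\int[mu]_(x in `[(- n.+1%:R)%R, n.+1%:R%R]) (f x * pdf s x)%:E @[n --> \oo] --> 0)%E.
  by move=> h0; apply: (cvg_unique _ h h0).
rewrite (_ : (fun n => _) =
  (fun n => (s ^+ 2 * ((W (- n.+1%:R) - W n.+1%:R) * pdf s n.+1%:R))%:E)); last first.
  apply/funext => n; rewrite (@stein_itv _ _ _ _ W W')//; last first.
    by apply: (@lt_trans _ _ 0); rewrite ?oppr_lt0 ltr0n.
  by rewrite normal_pdf0N// mulrBl.
have c0 : pdf s n.+1%:R @[n --> \oo] --> (0 : R).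
  have := cvg_normal_pdf0Ny_nat 0 s0; rewrite -(cvg_shiftS (fun n => pdf s (0 + n%:R))).
  by under eq_fun do rewrite add0r.
apply: cvg_EFin; first exact: nearW.
rewrite -[X in _ --> X](mulr0 (s ^+ 2)); apply: cvgM; first exact: cvg_cst.
apply: (@squeeze_cvgr _ _ _ _ (fun n => - (2 * pdf s n.+1%:R)) (fun n => 2 * pdf s n.+1%:R)).
- near=> n; rewrite -ler_norml normrM (ger0_norm (normal_pdf_ge0 _ _ _)).
  rewrite ler_wpM2r ?normal_pdf_ge0// (le_trans (ler_normB _ _))//.
  by rewrite -[2]/(1 + 1) lerD.
- rewrite -[X in _ --> X]oppr0; apply: cvgN; rewrite -[X in _ --> X](mulr0 2).
  by apply: cvgM => //; exact: cvg_cst.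
- rewrite -[X in _ --> X](mulr0 2).
  by apply: cvgM => //; exact: cvg_cst.
Unshelve. all: by end_near. Qed.

(* The Fourier transform a |-> E cos (a X + b) of a centred Gaussian X solves
   phi' = - a s^2 phi by Stein's identity; the phase b handles cos and sin together. *)
Lemma fourier_normal_pdf s a b : s != 0 ->
  (\int[mu]_x (cos (a * x + b) * pdf s x)%:E =
   (cos b * expR (- (a ^+ 2 * s ^+ 2 / 2)))%:E)%E.
Proof.
move=> s0.
pose phi a := (\int[mu]_x (cos (a * x + b) * pdf s x))%R.
have mlin a' : measurable_fun setT (fun x : R => a' * x + b).
  by apply: measurable_funD => //; exact: measurable_funM.
have Icos a' : mu.-integrable setT (fun x => (cos (a' * x + b) * pdf s x)%:E).
  apply: (@integrable_mul_normal_pdf _ _ 1 0) => //.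
    apply: measurableT_comp => //.
    exact: continuous_measurable_fun (@continuous_cos R).
  by move=> x; rewrite mul0r addr0 ler_norml cos_geN1 cos_le1.
have Isin a' : mu.-integrable setT (fun x => (x * sin (a' * x + b) * pdf s x)%:E).
  apply: (@integrable_mul_normal_pdf _ _ 0 1) => //.
    apply: measurable_funM => //; apply: measurableT_comp => //.
    exact: continuous_measurable_fun (@continuous_sin R).
  by move=> x; rewrite mul1r add0r normrM ler_piMr// ler_norml sin_geN1 sin_le1.
have dcos (x a' : R) : is_derive a' 1 (fun a => cos (a * x + b) * pdf s x)
    (- (x * sin (a' * x + b) * pdf s x)).
  have d1 : is_derive a' 1 (fun a => a * x + b) x.
    by apply: is_derive_eq; rewrite /GRing.scale/=; ring.
  have d2 : is_derive a' 1 (fun a => cos (a * x + b)) (- sin (a' * x + b) * x).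
    exact: (is_derive1_comp (is_derive_cos _) d1).
  by apply: is_derive_eq; rewrite /GRing.scale/=; ring.
have dphi a' : is_derive a' 1 phi (- (a' * s ^+ 2) * phi a').
  have -> : - (a' * s ^+ 2) * phi a' =
      (\int[mu]_x (- (x * sin (a' * x + b) * pdf s x)))%R.
    rewrite (RintegralN measurableT (Isin a')) mulNr; congr (- _).
    rewrite -(RintegralZl (a' * s ^+ 2) measurableT (Icos a')).
    apply/esym; apply: Rintegral_eq_sub0 => //.
    - exact: Isin.
    - by have := integrableZl measurableT (a' * s ^+ 2) (Icos a').
    rewrite -[RHS](@stein_line s `|a'| (fun x => sin (a' * x + b))
      (fun x => a' * cos (a' * x + b)))//.
    - by apply: eq_integral => x _; congr EFin; ring.
    - move=> x; have d1 : is_derive x 1 (fun x => a' * x + b) a'.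
        by apply: is_derive_eq; rewrite /GRing.scale/=; ring.
      apply: (is_derive_eq (is_derive1_comp (is_derive_sin _) d1)).
      by rewrite mulrC.
    - move=> x; apply: cvgM; first exact: cvg_cst.
      apply: (@cvg_comp _ _ _ (fun x => a' * x + b) cos _ (nbhs (a' * x + b))).
        apply: cvgD; last exact: cvg_cst.
        by apply: cvgM; [exact: cvg_cst|exact: cvg_id].
      exact: continuous_cos.
    - by move=> x; rewrite ler_norml sin_geN1 sin_le1.
    - move=> x; rewrite normrM ler_piMr//.
      by rewrite ler_norml cos_geN1 cos_le1.
  have d1E (x y : R) : partial1of2 (fun a x => cos (a * x + b) * pdf s x) x y =
      - (y * sin (x * y + b) * pdf s y).
    by rewrite /partial1of2 derive1E; have [] := dcos y x.
  (* Dominates the derivative in [a] uniformly in [a], which allows differentiation under the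
     integral. *)
  pose G x := `|x| * pdf s x.
  have IG : mu.-integrable setT (EFin \o G).
    apply: (@integrable_mul_normal_pdf _ _ 0 1) => //.
    by move=> x; rewrite normr_id add0r mul1r.
  have G0 x : 0 <= G x by rewrite mulr_ge0// normal_pdf_ge0.
  have Ga (x y : R) : (`](a' - 1), (a' + 1)[%classic : set R) x -> setT y ->
      `|partial1of2 (fun a x => cos (a * x + b) * pdf s x) x y| <= G y.
    move=> _ _; rewrite d1E normrN !normrM (ger0_norm (normal_pdf_ge0 _ _ _)).
    rewrite ler_wpM2r ?normal_pdf_ge0// ler_piMr//.
    by rewrite ler_norml sin_geN1 sin_le1.
  have Ia' : (`](a' - 1), (a' + 1)[%classic : set R) a'.
    by rewrite /= in_itv/=; lra.
  have D1 := @derivable_under_integral R _ _ mu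
    (fun a x => cos (a * x + b) * pdf s x) setT measurableT a' _ _ Ia'
    (fun x _ => Icos x) (fun x y _ _ => @ex_derive _ _ _ _ _ _ _ (dcos y x)) G G0 IG Ga.
  have D2 := @differentiation_under_integral R _ _ mu
    (fun a x => cos (a * x + b) * pdf s x) setT measurableT a' _ _ Ia'
    (fun x _ => Icos x) (fun x y _ _ => @ex_derive _ _ _ _ _ _ _ (dcos y x)) G G0 IG Ga.
  apply: DeriveDef => //.
  rewrite -derive1E D2; apply: eq_Rintegral => x _; exact: d1E.
(* Dividing [phi] by exp(-a^2 s^2 / 2) leaves a function of zero derivative, hence a constant, read
   off at 0. *)
pose g a := phi a * expR (a ^+ 2 * s ^+ 2 / 2).
have dg a' : is_derive a' 1 g 0.
  have ? := dphi a'.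
  have d2 : is_derive a' 1 (fun a => a * a * (s ^+ 2 / 2)) (a' * s ^+ 2).
    by apply: is_derive_eq; rewrite /GRing.scale/=; field.
  have d3 := is_derive_expR_comp d2.
  rewrite (_ : g = fun a => phi a * expR (a * a * (s ^+ 2 / 2))); last first.
    by apply/funext => z; rewrite /g expr2 mulrA.
  by apply: is_derive_eq; rewrite /GRing.scale/=; ring.
have ga : g a = g 0 by exact: is_derive_0_is_cst.
have p0 : phi 0 = cos b.
  rewrite /phi; under eq_Rintegral do rewrite mul0r add0r.
  rewrite RintegralZl//; last exact: integrable_normal_pdf.
  by rewrite /Rintegral integral_normal_pdf mulr1.
have {}ga : phi a = cos b * expR (- (a ^+ 2 * s ^+ 2 / 2)).
  move: ga; rewrite /g p0 expr0n/= mul0r mul0r expR0 mulr1 => <-.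
  by rewrite -[RHS]mulrA -expRD subrr expR0 mulr1.
by rewrite -ga /phi /Rintegral fineK//; apply: integrable_fin_num.
Qed.

End gaussian_integrals.

(** * Trigonometric functions and independence *)

Section bounded_convergence.
Context d (T : measurableType d) (R : realType) (P : probability T R).

Lemma bounded_integrable (f : T -> R) (M : R) : measurable_fun setT f ->
  (forall w, `|f w| <= M) -> P.-integrable setT (EFin \o f).
Proof.
move=> mf fM; apply: (@le_integrable _ _ _ P setT measurableT _ (EFin \o cst M)).
- exact/measurable_EFinP.
- by move=> w _ /=; rewrite lee_fin (le_trans (fM w))// ler_norm.
- exact: finite_measure_integrable_cst.
Qed.

Lemma bounded_convergence_Rintegral (f_ : (T -> R)^nat) (f : T -> R) (M : R) :
  (forall n, measurable_fun setT (f_ n)) ->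
  (forall n w, `|f_ n w| <= M) ->
  (forall w, f_ ^~ w @ \oo --> f w) ->
  measurable_fun setT f /\
  ((\int[P]_w f_ n w)%R @[n --> \oo] --> (\int[P]_w f w)%R).
Proof.
move=> mf_ fM ff.
have mf : measurable_fun setT f.
  apply/measurable_EFinP.
  apply: (@emeasurable_fun_cvg _ _ _ _ (fun n => EFin \o f_ n)).
    by move=> n; exact/measurable_EFinP.
  by move=> w _; apply: cvg_EFin; [exact: nearW|exact: ff].
split => //.
have [||If h] := @dominated_convergence_real _ _ _ P setT f_ f (cst M) measurableT mf_ mf (fun x _ => ff x).
- exact: finite_measure_integrable_cst.
- by [].
by apply: fine_cvg; rewrite fineK//; exact: integrable_fin_num If.
Qed.

End bounded_convergence.

Section trigonometric_closure.
Context {T : Type} {R : realType}.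
Implicit Types (Z : set (T -> R)) (f g : T -> R) (C : set T).

(** A functional monotone class. If [Z] is a linear space, it contains the indicator of every event
    generated by [Z]; on the other hand the identity E[f g] = E[f] E[g] passes through each
    constructor. Independence thus follows from finitely many cosines and sines, without a
    uniqueness theorem for characteristic functions. *)
Inductive trig_closure Z : (T -> R) -> Prop :=
| trig_cos z : Z z -> trig_closure Z (fun w => cos (z w))
| trig_sin z : Z z -> trig_closure Z (fun w => sin (z w))
| trig_add f g : trig_closure Z f -> trig_closure Z g ->
    trig_closure Z (fun w => f w + g w)
| trig_scale c f : trig_closure Z f -> trig_closure Z (fun w => c * f w)
| trig_lim (g_ : nat -> T -> R) f (M : R) : (forall n, trig_closure Z (g_ n)) ->
    (forall n w, `|g_ n w| <= M) -> (forall w, g_ ^~ w @ \oo --> f w) ->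
    trig_closure Z f.

Lemma cvg_norm_le (u : nat -> R) (l M : R) : (forall n, `|u n| <= M) ->
  u @ \oo --> l -> `|l| <= M.
Proof.
move=> uM ul; have cu : (fun n => `|u n|) @ \oo --> `|l| by exact: cvg_norm ul.
rewrite -(cvg_lim (@Rhausdorff R) cu); apply: limr_le; last exact: nearW.
by apply/cvg_ex; exists `|l|.
Qed.

Lemma trig_closure_bounded Z f : trig_closure Z f ->
  exists M : R, forall w, `|f w| <= M.
Proof.
elim=> {f} [z _|z _|f g _ [M fM] _ [N gN]|c f _ [M fM]|g_ f M _ _ gM gf].
- by exists 1 => w; rewrite ler_norml cos_geN1 cos_le1.
- by exists 1 => w; rewrite ler_norml sin_geN1 sin_le1.
- by exists (M + N) => w; rewrite (le_trans (ler_normD _ _))// lerD.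
- by exists (`|c| * M) => w; rewrite normrM ler_wpM2l.
- by exists M => w; exact: cvg_norm_le (gf w).
Qed.

Lemma eq_trig_closure Z f g : f =1 g -> trig_closure Z f -> trig_closure Z g.
Proof. by move=> /funext ->. Qed.

Variable Z : set (T -> R).
Hypothesis Z0 : Z (fun=> 0).
Hypothesis ZB : forall y z, Z y -> Z z -> Z (fun w => y w - z w).
Hypothesis ZZ : forall c z, Z z -> Z (fun w => c * z w).

Let ZD y z : Z y -> Z z -> Z (fun w => y w + z w).
Proof.
move=> Zy Zz; rewrite (_ : (fun w => _) = (fun w => y w - (-1) * z w)).
  by apply: ZB => //; exact: ZZ.
by apply/funext => w; rewrite mulN1r opprK.
Qed.

(** On generators the product-to-sum formulas stay in the class because [Z] is closed under sums and
    differences; in the limit cases the other factor is bounded. *)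
Lemma trig_closureM f g : trig_closure Z f -> trig_closure Z g ->
  trig_closure Z (fun w => f w * g w).
Proof.
move=> Zf Zg; elim: Zf => {f} [y Zy|y Zy|f1 f2 Zf1 h1 Zf2 h2|c f Zf h|f_ f M Zf h fM ff].
- elim: Zg => {g} [z Zz|z Zz|g1 g2 Zg1 h1 Zg2 h2|c g Zg h|g_ g M Zg h gM gg].
  + apply: (@eq_trig_closure Z (fun w => 2^-1 * (cos (y w + z w) + cos (y w - z w)))).
      by move=> w; rewrite cosD cosB; field.
    by apply: trig_scale; apply: trig_add; apply: trig_cos; [exact: ZD|exact: ZB].
  + apply: (@eq_trig_closure Z (fun w => 2^-1 * (sin (z w + y w) + sin (z w - y w)))).
      by move=> w; rewrite sinD sinB; field.
    by apply: trig_scale; apply: trig_add; apply: trig_sin; [exact: ZD|exact: ZB].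
  + apply: (@eq_trig_closure Z (fun w => cos (y w) * g1 w + cos (y w) * g2 w)).
      by move=> w; rewrite mulrDr.
    exact: trig_add.
  + apply: (@eq_trig_closure Z (fun w => c * (cos (y w) * g w))).
      by move=> w; ring.
    exact: trig_scale.
  + apply: (@trig_lim _ (fun n w => cos (y w) * g_ n w) _ M) => //.
      move=> n w; rewrite normrM (le_trans _ (gM n w))// ler_piMl//.
      by rewrite ler_norml cos_geN1 cos_le1.
    by move=> w; apply: cvgM => //; exact: cvg_cst.
- elim: Zg => {g} [z Zz|z Zz|g1 g2 Zg1 h1 Zg2 h2|c g Zg h|g_ g M Zg h gM gg].
  + apply: (@eq_trig_closure Z (fun w => 2^-1 * (sin (y w + z w) + sin (y w - z w)))).
      by move=> w; rewrite sinD sinB; field.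
    by apply: trig_scale; apply: trig_add; apply: trig_sin; [exact: ZD|exact: ZB].
  + apply: (@eq_trig_closure Z (fun w => 2^-1 * (cos (y w - z w) + (-1) * cos (y w + z w)))).
      by move=> w; rewrite cosB cosD; field.
    apply: trig_scale; apply: trig_add; first by apply: trig_cos; exact: ZB.
    by apply: trig_scale; apply: trig_cos; exact: ZD.
  + apply: (@eq_trig_closure Z (fun w => sin (y w) * g1 w + sin (y w) * g2 w)).
      by move=> w; rewrite mulrDr.
    exact: trig_add.
  + apply: (@eq_trig_closure Z (fun w => c * (sin (y w) * g w))).
      by move=> w; ring.
    exact: trig_scale.
  + apply: (@trig_lim _ (fun n w => sin (y w) * g_ n w) _ M) => //.
      move=> n w; rewrite normrM (le_trans _ (gM n w))// ler_piMl//.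
      by rewrite ler_norml sin_geN1 sin_le1.
    by move=> w; apply: cvgM => //; exact: cvg_cst.
- apply: (@eq_trig_closure Z (fun w => f1 w * g w + f2 w * g w)).
    by move=> w; rewrite mulrDl.
  exact: trig_add.
- apply: (@eq_trig_closure Z (fun w => c * (f w * g w))).
    by move=> w; ring.
  exact: trig_scale.
- have [N gN] := trig_closure_bounded Zg.
  apply: (@trig_lim _ (fun n w => f_ n w * g w) _ (M * N)) => //.
    by move=> n w; rewrite normrM ler_pM.
  by move=> w; apply: cvgM => //; exact: cvg_cst.
Qed.

Lemma trig_closure_cst (c : R) : trig_closure Z (fun=> c).
Proof.
apply: (@eq_trig_closure Z (fun w => c * cos ((fun=> 0) w))).
  by move=> w; rewrite cos0 mulr1.
by apply: trig_scale; apply: trig_cos.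
Qed.

Lemma trig_closureX f n : trig_closure Z f -> trig_closure Z (fun w => f w ^+ n).
Proof.
move=> Zf; elim: n => [|n ih].
  exact: (@eq_trig_closure Z (fun=> 1)) (trig_closure_cst 1).
apply: (@eq_trig_closure Z (fun w => f w * f w ^+ n)).
  by move=> w; rewrite exprS.
exact: trig_closureM.
Qed.

Lemma trig_closureB f g : trig_closure Z f -> trig_closure Z g ->
  trig_closure Z (fun w => f w - g w).
Proof.
move=> Zf Zg; apply: (@eq_trig_closure Z (fun w => f w + (-1) * g w)).
  by move=> w; rewrite mulN1r.
by apply: trig_add => //; exact: trig_scale.
Qed.

Lemma bernoulli_ge (x : R) m : 0 <= x <= 1 -> 1 - m%:R * x <= (1 - x) ^+ m.
Proof.
move=> /andP[x0 x1]; elim: m => [|m ih]; first by rewrite mul0r subr0 expr0.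
rewrite exprS; have h : 0 <= (1 - x) ^+ m by rewrite exprn_ge0// subr_ge0.
have h1 : (1 - x) ^+ m <= 1 by rewrite exprn_ile1 ?subr_ge0// gerBl.
have -> : m.+1%:R = m%:R + 1 :> R by rewrite -natr1.
by nra.
Qed.

(** The companion of Bernoulli's inequality: (1 - x)^m <= (1 + x)^-m <= 1 / (1 + m x). *)
Lemma bernoulli_le (x : R) m : 0 <= x <= 1 -> (1 - x) ^+ m * (1 + m%:R * x) <= 1.
Proof.
move=> /andP[x0 x1]; elim: m => [|m ih]; first by rewrite mul0r addr0 expr0 mul1r.
rewrite exprS; have h : 0 <= (1 - x) ^+ m by rewrite exprn_ge0// subr_ge0.
rewrite (le_trans _ ih)// -mulrA mulrCA ler_wpM2l//.
have -> : m.+1%:R = m%:R + 1 :> R by rewrite -natr1.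
by have : 0 <= m%:R :> R by []; nra.
Qed.

Lemma cvg_nat_geometric (q : R) : 0 <= q < 1 -> n%:R * q ^+ n @[n --> \oo] --> (0 : R).
Proof.
move=> /andP[q0 q1].
have [->|qn0] := eqVneq q 0.
  apply: cvg_near_cst; near=> n.
  rewrite expr0n; have -> : (n == 0)%N = false.
    by apply/negbTE; rewrite -lt0n; near: n; exact: nbhs_infty_gt.
  by rewrite mulr0.
have {}q0 : 0 < q by rewrite lt_neqAle eq_sym qn0.
(* With p = sqrt q one has n q^n = (n p^n) p^n, where p^n tends to 0 and n p^n is bounded, by
   Bernoulli's inequality for 1 / p. *)
pose p := Num.sqrt q.
have p0 : 0 < p by rewrite sqrtr_gt0.
have p1 : p < 1 by rewrite -sqrtr1 ltr_sqrt.
have pE : q = p * p by rewrite -expr2 sqr_sqrtr// ltW.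
pose K := (p^-1 - 1)^-1.
have pv : 0 < p^-1 - 1 by rewrite subr_gt0 invf_gt1.
have bnd n : n%:R * p ^+ n <= K.
  rewrite /K -[leRHS]mul1r ler_pdivlMr//.
  have h := @bernoulli_le (1 - p) n.
  have : 1 + n%:R * (p^-1 - 1) <= p ^- n.
    elim: n {h} => [|n ih]; first by rewrite mul0r addr0 expr0 invr1.
    rewrite exprS invfM.
    have -> : n.+1%:R = n%:R + 1 :> R by rewrite -natr1.
    have n0 : 0 <= n%:R :> R by [].
    apply: (@le_trans _ _ (p^-1 * (1 + n%:R * (p^-1 - 1)))).
      have := mulr_ge0 n0 (sqr_ge0 (p^-1 - 1)).
      rewrite expr2; lra.
    by rewrite ler_wpM2l ?invr_ge0 ?(ltW p0).
  move=> {}h; have pn : 0 < p ^+ n by rewrite exprn_gt0.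
  have : n%:R * (p^-1 - 1) <= p ^- n by lra.
  by move=> {}h; rewrite mulrAC -ler_pdivlMr// mul1r.
apply: (@squeeze_cvgr _ _ _ _ (fun=> 0) (fun n => K * p ^+ n)).
- near=> n; rewrite mulr_ge0//= ?exprn_ge0 ?(ltW q0)//.
  by rewrite pE exprMn mulrA ler_wpM2r ?exprn_ge0 ?(ltW p0).
- exact: cvg_cst.
- rewrite -[X in _ --> X](mulr0 K); apply: cvgM; first exact: cvg_cst.
  by apply: cvg_expr; rewrite ger0_norm// ltW.
Unshelve. all: by end_near. Qed.

(* The polynomials of the elementary proof of the Stone-Weierstrass theorem
   (Brosowski-Deutsch), with one more factor n to make the limit at 1/2 equal to 0. *)
Lemma cvg_step_polynomial (v : R) : 0 <= v <= 1 ->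
  (1 - v ^+ n) ^+ (n * 2 ^ n)%N @[n --> \oo] --> ((v < 2^-1)%R%:R : R).
Proof.
move=> /andP[v0 v1].
have vn n : 0 <= v ^+ n <= 1 by rewrite exprn_ge0//= exprn_ile1.
(* Bernoulli's inequalities involve the exponent times v^n, that is n (2 v)^n: it tends to 0 for v <
   1/2 and is at least n for v >= 1/2. *)
have mE n : (n * 2 ^ n)%:R * v ^+ n = n%:R * (2 * v) ^+ n.
  by rewrite natrM natrX exprMn mulrA.
have [v2|v2] := ltP v 2^-1.
- apply: (@squeeze_cvgr _ _ _ _ (fun n => 1 - n%:R * (2 * v) ^+ n) (fun=> 1)).
  + near=> n; rewrite -mE bernoulli_ge//=.
    by have /andP[? ?] := vn n; rewrite exprn_ile1 ?subr_ge0// gerBl.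
  + rewrite -[X in _ --> X](subr0 1); apply: cvgB; first exact: cvg_cst.
    by apply: cvg_nat_geometric; lra.
  + exact: cvg_cst.
- apply: (@squeeze_cvgr _ _ _ _ (fun=> 0) (fun n => n.+1%:R^-1)).
  + near=> n; have /andP[h0 h1] := vn n.
    rewrite exprn_ge0 ?subr_ge0//= -[leRHS]mul1r ler_pdivlMr//.
    apply: le_trans (bernoulli_le (n * 2 ^ n) (vn n)).
    rewrite ler_wpM2l ?exprn_ge0 ?subr_ge0// mE -natr1 addrC lerD2l.
    by rewrite ler_peMr// exprn_ege1//; lra.
  + exact: cvg_cst.
  + exact: cvg_harmonic.
Unshelve. all: by end_near. Qed.

(** The function (1 - sin) / 2 has values in [0, 1] and is below 1/2 exactly where the sine is
    positive, so the step polynomials in it converge to the indicator. *)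
Lemma trig_closure_sin_gt0 (z : T -> R) (a c : R) : Z z ->
  trig_closure Z (fun w => (0 < sin (a * (z w - c)))%R%:R).
Proof.
move=> Zz.
have h : trig_closure Z (fun w => (1 - sin (a * (z w - c))) / 2).
  apply: (@eq_trig_closure Z (fun w => 2^-1 * (1 - (cos (a * c) * sin (a * z w)
      - sin (a * c) * cos (a * z w))))).
    move=> w; have -> : a * (z w - c) = a * z w - a * c by ring.
    by rewrite sinD cosN sinN; ring.
  apply: trig_scale; apply: trig_closureB; first exact: trig_closure_cst.
  by apply: trig_closureB; apply: trig_scale; [apply: trig_sin|apply: trig_cos]; exact: ZZ.
pose v w := (1 - sin (a * (z w - c))) / 2.
have v01 w : 0 <= v w <= 1.
  by have := sin_geN1 (a * (z w - c)); have := sin_le1 (a * (z w - c)); rewrite /v; lra.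
apply: (@trig_lim _ (fun n w => (1 - v w ^+ n) ^+ (n * 2 ^ n)) _ 1).
- move=> n; apply: trig_closureX; apply: trig_closureB; first exact: trig_closure_cst.
  exact: trig_closureX.
- move=> n w; have /andP[? ?] := v01 w.
  have h0 : 0 <= v w ^+ n by rewrite exprn_ge0.
  have h1 : v w ^+ n <= 1 by rewrite exprn_ile1.
  rewrite ger0_norm; first by apply: exprn_ile1; lra.
  by apply: exprn_ge0; lra.
- move=> w; rewrite (_ : (0 < _) = (v w < 2^-1)); last by rewrite /v; apply/idP/idP; lra.
  exact: cvg_step_polynomial.
Qed.

(** Once |z - c| < (n + 1) pi, the sine of (z - c) / (n + 1) has the sign of z - c: letting the
    frequency tend to 0 removes the periodicity. *)
Lemma trig_closure_gt (z : T -> R) (c : R) : Z z ->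
  trig_closure Z (fun w => (c < z w)%R%:R).
Proof.
move=> Zz.
apply: (@trig_lim _ (fun n w => (0 < sin (n.+1%:R^-1 * (z w - c)))%R%:R) _ 1).
- by move=> n; exact: trig_closure_sin_gt0.
- by move=> n w; case: (0 < _) => /=; rewrite ?normr1 ?normr0.
- move=> w; apply: cvg_near_cst; near=> n.
  have n0 : 0 < n.+1%:R :> R by [].
  have h : `|z w - c| < n.+1%:R * pi.
    apply: (@lt_trans _ _ n.+1%:R); last by rewrite ltr_pMr// (lt_le_trans _ (pi_ge2 R))// ltr1n.
    apply: (@lt_le_trans _ _ n%:R); last by rewrite ler_nat.
    by near: n; exact: nbhs_infty_gtr.
  have pn : n.+1%:R^-1 * `|z w - c| < pi by rewrite mulrC ltr_pdivrMr// mulrC.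
  congr (_%:R).
  have [cz|zc|<-] := ltgtP c (z w).
  + rewrite sin_gt0_pi// mulr_gt0 ?invr_gt0 ?subr_gt0//=.
    by rewrite gtr0_norm ?subr_gt0 in pn.
  + rewrite (_ : (0 < _) = false)//; apply/negbTE; rewrite -leNgt -opprB mulrN sinN oppr_le0 sin_ge0_pi//.
    rewrite mulr_ge0 ?invr_ge0 ?subr_ge0 ?ltW//=.
    by rewrite ltr0_norm ?subr_lt0// opprB in pn.
  + by rewrite subrr mulr0 sin0 ltxx.
Unshelve. all: by end_near. Qed.

Lemma sigma_algebra_trig_closure :
  sigma_algebra setT [set C | trig_closure Z (\1_C)].
Proof.
split => /=.
- apply: (@eq_trig_closure Z (fun=> 0)) (trig_closure_cst 0).
  by move=> w; rewrite indic0.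
- move=> C ZC; apply: (@eq_trig_closure Z (fun w => 1 - \1_C w)).
    by move=> w; rewrite setTD !indicE in_setC; case: (w \in C); rewrite /= ?subrr ?subr0.
  by apply: trig_closureB => //; exact: trig_closure_cst.
- move=> F ZF.
  (* Indicator that none of the first n events occurs, obtained from products; its complement
     increases to the indicator of the union. *)
  pose g n w := \prod_(i < n) (1 - \1_(F i) w) : R.
  have Zg n : trig_closure Z (g n).
    elim: n => [|n ih].
      apply: (@eq_trig_closure Z (fun=> 1)) (trig_closure_cst 1).
      by move=> w; rewrite /g big_ord0.
    apply: (@eq_trig_closure Z (fun w => g n w * (1 - \1_(F n) w))).
      by move=> w; rewrite /g big_ord_recr.
    apply: trig_closureM => //; apply: trig_closureB; first exact: trig_closure_cst.
    exact: ZF.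
  apply: (@trig_lim _ (fun n w => 1 - g n w) _ 1).
  + by move=> n; apply: trig_closureB => //; exact: trig_closure_cst.
  + move=> n w; have : 0 <= g n w <= 1.
      rewrite /g; elim/big_ind : _ => [|x y /andP[x0 x1] /andP[y0 y1]|i _].
      * by rewrite ler01 lexx.
      * by rewrite mulr_ge0//= mulr_ile1.
      * by rewrite indicE; case: (w \in _); rewrite /= ?subrr ?subr0 ?lexx ?ler01.
    by rewrite ler_norml; lra.
  + move=> w; apply: cvg_near_cst.
    have [[k _ Fkw]|nF] := pselect ((\bigcup_k F k) w).
      near=> n; have kn : (k < n)%N by near: n; exact: nbhs_infty_gt.
      rewrite indicE mem_set/=; last by exists k.
      by rewrite /g (bigD1 (Ordinal kn))//= indicE mem_set//= subrr mul0r subr0.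
    near=> n; rewrite indicE memNset//= /g big1 ?subrr// => i _.
    by rewrite indicE memNset ?subr0// => Fiw; apply: nF; exists i.
Unshelve. all: by end_near. Qed.

Lemma trig_closure_preimage (z : T -> R) (A : set R) : Z z -> measurable A ->
  trig_closure Z (\1_(z @^-1` A)).
Proof.
move=> Zz mA.
pose D := [set A : set R | trig_closure Z (\1_(z @^-1` A))].
have sD : sigma_algebra setT D.
  have [h0 hC hU] := sigma_algebra_trig_closure.
  split => /=.
  - by rewrite /D/= preimage_set0.
  - by move=> C DC; have := hC _ DC; rewrite /D/= !setTD preimage_setC.
  - by move=> F DF; have := hU (fun i => z @^-1` F i) DF; rewrite /D/= preimage_bigcup.
have : (@RGenOInfty.G R).-sigma.-measurable A by rewrite -RGenOInfty.measurableE.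
suff sub : <<s @RGenOInfty.G R >> `<=` D by exact: sub.
apply: smallest_sub; first exact: sD.
move=> _ [c ->] /=.
apply: (@eq_trig_closure Z (fun w => (c < z w)%R%:R)); last exact: trig_closure_gt.
move=> w; rewrite indicE; congr (_%:R); congr nat_of_bool.
by apply/idP/idP; rewrite inE /= in_itv/= andbT.
Qed.

End trigonometric_closure.

Section trigonometric_independence.
Context d (T : measurableType d) (R : realType) (P : probability T R).
Local Notation "''E' f" := (\int[P]_w f w)%R (at level 10, f at level 9).

Lemma measurable_trig_closure (Z : set (T -> R)) f :
  (forall z, Z z -> measurable_fun setT z) ->
  trig_closure Z f -> measurable_fun setT f.
Proof.
move=> mZ; elim=> {f} [z Zz|z Zz|f g _ mf _ mg|c f _ mf|g_ f M _ mg gM gf].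
- exact: measurableT_comp (continuous_measurable_fun (@continuous_cos R)) (mZ _ Zz).
- exact: measurableT_comp (continuous_measurable_fun (@continuous_sin R)) (mZ _ Zz).
- exact: measurable_funD.
- exact: measurable_funM.
- by apply: (@measurable_fun_cvg _ _ _ _ g_) => // w _; exact: gf.
Qed.

Lemma trig_closure_integrable (Z : set (T -> R)) f :
  (forall z, Z z -> measurable_fun setT z) ->
  trig_closure Z f -> P.-integrable setT (EFin \o f).
Proof.
move=> mZ Zf; have [M fM] := trig_closure_bounded Zf.
exact: bounded_integrable (measurable_trig_closure mZ Zf) fM.
Qed.

Let prod_integrable (Y Z : set (T -> R)) f g :
  (forall y, Y y -> measurable_fun setT y) ->
  (forall z, Z z -> measurable_fun setT z) ->
  trig_closure Y f -> trig_closure Z g ->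
  P.-integrable setT (EFin \o (fun w => f w * g w)).
Proof.
move=> mY mZ Yf Zg.
have [M fM] := trig_closure_bounded Yf; have [N gN] := trig_closure_bounded Zg.
apply: (@bounded_integrable _ _ _ P _ (M * N)).
  apply: measurable_funM; first exact: measurable_trig_closure mY Yf.
  exact: measurable_trig_closure mZ Zg.
by move=> w; rewrite normrM ler_pM.
Qed.

(** For fixed [g] the factorisation is linear in f and stable under bounded limits, so cosines and
    sines suffice. It is used for one argument and then, with the roles exchanged, for the other. *)
Let step (Y Z : set (T -> R)) g :
  (forall y, Y y -> measurable_fun setT y) ->
  (forall z, Z z -> measurable_fun setT z) ->
  trig_closure Z g ->
  (forall y, Y y -> 'E (fun w => cos (y w) * g w) = 'E (cos \o y) * 'E g) ->
  (forall y, Y y -> 'E (fun w => sin (y w) * g w) = 'E (sin \o y) * 'E g) ->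
  forall f, trig_closure Y f -> 'E (fun w => f w * g w) = 'E f * 'E g.
Proof.
move=> mY mZ Zg hc hs f.
elim=> {f} [y Yy|y Yy|f1 f2 Yf1 h1 Yf2 h2|c f Yf h|f_ f M Yf h fM ff].
- exact: hc.
- exact: hs.
- under eq_Rintegral do rewrite mulrDl.
  have I1 := prod_integrable mY mZ Yf1 Zg; have I2 := prod_integrable mY mZ Yf2 Zg.
  rewrite (RintegralD measurableT I1 I2) h1 h2 RintegralD ?mulrDl//.
    exact: (trig_closure_integrable mY Yf1).
  exact: (trig_closure_integrable mY Yf2).
- under eq_Rintegral do rewrite -mulrA.
  have I1 := prod_integrable mY mZ Yf Zg.
  rewrite (RintegralZl _ measurableT I1).
  by rewrite h RintegralZl ?mulrA//; exact: (trig_closure_integrable mY Yf).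
- have mf n := measurable_trig_closure mY (Yf n).
  have mg := measurable_trig_closure mZ Zg.
  have [N gN] := trig_closure_bounded Zg.
  have [_ c1] := @bounded_convergence_Rintegral _ _ _ P f_ f M mf fM ff.
  have [|||_ c2] := @bounded_convergence_Rintegral _ _ _ P (fun n w => f_ n w * g w) (fun w => f w * g w) (M * N).
  + by move=> n; exact: measurable_funM.
  + by move=> n w; rewrite normrM ler_pM.
  + by move=> w; apply: cvgM; [exact: ff|exact: cvg_cst].
  have c3 : 'E (f_ n) * 'E g @[n --> \oo] --> 'E f * 'E g.
    by apply: cvgM; [exact: c1|exact: cvg_cst].
  apply: (cvg_unique _ c2); first exact: Rhausdorff.
  rewrite (_ : (fun n => _) = (fun n => 'E (f_ n) * 'E g)); first exact: c3.
  by apply/funext => n; exact: h.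
Qed.

Lemma trig_closure_independent (Y Z : set (T -> R)) :
  (forall y, Y y -> measurable_fun setT y) ->
  (forall z, Z z -> measurable_fun setT z) ->
  (forall y z, Y y -> Z z ->
    [/\ 'E (fun w => cos (y w) * cos (z w)) = 'E (cos \o y) * 'E (cos \o z),
        'E (fun w => cos (y w) * sin (z w)) = 'E (cos \o y) * 'E (sin \o z),
        'E (fun w => sin (y w) * cos (z w)) = 'E (sin \o y) * 'E (cos \o z) &
        'E (fun w => sin (y w) * sin (z w)) = 'E (sin \o y) * 'E (sin \o z)]) ->
  forall f g, trig_closure Y f -> trig_closure Z g ->
  'E (fun w => f w * g w) = 'E f * 'E g.
Proof.
move=> mY mZ h f g Yf Zg; apply: (step mY mZ Zg) => // y Yy.
- under eq_Rintegral do rewrite mulrC.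
  rewrite mulrC; apply: (step mZ mY) => //.
  + exact: trig_cos.
  + move=> z Zz; have [h1 _ _ _] := h y z Yy Zz.
    by under eq_Rintegral do rewrite mulrC; rewrite mulrC; exact: h1.
  + move=> z Zz; have [_ h1 _ _] := h y z Yy Zz.
    by under eq_Rintegral do rewrite mulrC; rewrite mulrC; exact: h1.
- under eq_Rintegral do rewrite mulrC.
  rewrite mulrC; apply: (step mZ mY) => //.
  + exact: trig_sin.
  + move=> z Zz; have [_ _ h1 _] := h y z Yy Zz.
    by under eq_Rintegral do rewrite mulrC; rewrite mulrC; exact: h1.
  + move=> z Zz; have [_ _ _ h1] := h y z Yy Zz.
    by under eq_Rintegral do rewrite mulrC; rewrite mulrC; exact: h1.
Qed.

Lemma trig_closure_independent_sets (Y Z : set (T -> R)) A B :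
  (forall f g, trig_closure Y f -> trig_closure Z g ->
    'E (fun w => f w * g w) = 'E f * 'E g) ->
  measurable A -> measurable B ->
  trig_closure Y (\1_A) -> trig_closure Z (\1_B) ->
  (P (A `&` B) = P A * P B)%E.
Proof.
move=> h mA mB YA ZB; have := h _ _ YA ZB.
have E1 (C : set T) : measurable C -> 'E (\1_C : T -> R) = fine (P C).
  by move=> mC; rewrite /Rintegral integral_indic// setIT.
rewrite (_ : (fun w => _) = \1_(A `&` B)); last by rewrite indicI.
rewrite !E1//; last exact: measurableI.
move=> hh; have := congr1 EFin hh; rewrite EFinM !fineK ?fin_num_measure//.
exact: measurableI.
Qed.

End trigonometric_independence.

(** * Noise of the bridge inside an interval *)

Section lebesgue_translation.
Context {R : realType}.
Local Notation mu := (@lebesgue_measure R).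
Local Open Scope ereal_scope.

Lemma lebesgue_measure_shift (a : R) (A : set R) : measurable A ->
  mu ((fun x => x + a)%R @^-1` A) = mu A.
Proof.
move=> mA.
have mf : measurable_fun setT (fun x : measurableTypeR R => (x + a)%R : measurableTypeR R).
  exact: measurable_funD.
pose f : {mfun measurableTypeR R >-> measurableTypeR R} :=
  HB.pack (fun x : measurableTypeR R => (x + a)%R : measurableTypeR R)
    (isMeasurableFun.Build _ _ _ _ _ mf).
apply/esym.
apply: (@lebesgue_measure_unique _ (pushforward mu f)) => //.
move=> X [[u v] _ <-].
rewrite /= /pushforward/=.
rewrite (_ : _ @^-1` _ = `](u - a)%R, (v - a)%R]%classic); last first.
  by apply/seteqP; split => x /=; rewrite !in_itv/= ltrBlDr lerBrDr.
rewrite !lebesgue_measure_itv/= !lte_fin ltrD2r.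
by case: ifP => // _; rewrite -!EFinD; congr EFin; ring.
Qed.

Lemma ge0_integral_shift (a : R) (f : R -> \bar R) : measurable_fun setT f ->
  (forall x, 0 <= f x) ->
  \int[mu]_x f (x + a)%R = \int[mu]_x f x.
Proof.
move=> mf f0.
have mg : measurable_fun setT (fun x : measurableTypeR R => (x + a)%R : measurableTypeR R).
  exact: measurable_funD.
pose g : {mfun measurableTypeR R >-> measurableTypeR R} :=
  HB.pack (fun x : measurableTypeR R => (x + a)%R : measurableTypeR R)
    (isMeasurableFun.Build _ _ _ _ _ mg).
have := @ge0_integral_pushforward _ _ _ _ _ _ mg mu setT f measurableT mf
  (fun x _ => f0 x).
rewrite preimage_setT => <-.
by apply: eq_measure_integral => A mA _; exact: lebesgue_measure_shift.
Qed.

Lemma integral_shift (a : R) (f : R -> \bar R) : measurable_fun setT f ->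
  \int[mu]_x f (x + a)%R = \int[mu]_x f x.
Proof.
move=> mf; rewrite integralE [RHS]integralE; congr (_ - _).
- rewrite -(@ge0_integral_shift a f^\+)//; last exact: measurable_funepos.
  by apply: eq_integral => x _; rewrite !funeposE.
- rewrite -(@ge0_integral_shift a f^\-)//; last exact: measurable_funeneg.
  by apply: eq_integral => x _; rewrite !funenegE.
Qed.

End lebesgue_translation.

Section law_with_density.
Context d (T : measurableType d) (R : realType) (P : probability T R).
Local Notation mu := (@lebesgue_measure R).
Local Open Scope ereal_scope.

(** The law of [X] is dominated by the Lebesgue measure, and its Radon-Nikodym derivative equals [p]
    almost everywhere because both have the same integral over every set. *)
Lemma ge0_integral_density (X : T -> R) (p : R -> R) (F : R -> \bar R) :
  measurable_fun setT X -> measurable_fun setT p -> (forall x, 0 <= p x)%R ->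
  (forall A, measurable A -> P (X @^-1` A) = \int[mu]_(x in A) (p x)%:E) ->
  measurable_fun setT F -> (forall x, 0 <= F x) ->
  \int[P]_w F (X w) = \int[mu]_x (F x * (p x)%:E).
Proof.
move=> mX mp p0 law mF F0.
have mX' : @measurable_fun _ _ T (measurableTypeR R) setT X by exact: mX.
pose X' : {mfun T >-> measurableTypeR R} :=
  HB.pack (X : T -> measurableTypeR R) (isMeasurableFun.Build _ _ _ _ _ mX').
pose nu := distribution P X'.
have nuE A : measurable A -> nu A = \int[mu]_(x in A) (p x)%:E by exact: law.
have mp' : measurable_fun setT (fun x : measurableTypeR R => (p x)%:E).
  exact/measurable_EFinP.
have Ip : mu.-integrable setT (fun x => (p x)%:E).
  apply/integrableP; split => //.
  under eq_integral do rewrite gee0_abs ?lee_fin ?p0//.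
  by rewrite -nuE// [ltLHS](@probability_setT _ _ _ nu) ltry.
have dom : nu `<< mu.
  apply/null_content_dominatesP => A mA A0; rewrite nuE//.
  by apply: null_set_integral => //; exact: measurable_funTS.
transitivity (\int[nu]_x F x).
  by rewrite /nu ge0_integral_distribution.
rewrite -(Radon_Nikodym_SigmaFinite.change_of_variables dom)//.
apply: ge0_ae_eq_integral => //.
- apply: emeasurable_funM => //.
  exact: measurable_int (Radon_Nikodym_SigmaFinite.f_integrable dom).
- exact: emeasurable_funM.
- by move=> x _; rewrite mule_ge0// Radon_Nikodym_SigmaFinite.f_ge0.
- by move=> x _; rewrite mule_ge0// lee_fin.
apply: ae_eqe_mul2l.
apply: integral_ae_eq => //.
- exact: Radon_Nikodym_SigmaFinite.f_integrable.
- by move=> E _ mE; rewrite -nuE//; apply/esym; exact: Radon_Nikodym_SigmaFinite.f_integral.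
Qed.

Lemma integral_density (X : T -> R) (p : R -> R) (F : R -> R) :
  measurable_fun setT X -> measurable_fun setT p -> (forall x, 0 <= p x)%R ->
  (forall A, measurable A -> P (X @^-1` A) = \int[mu]_(x in A) (p x)%:E) ->
  measurable_fun setT F ->
  \int[P]_w (F (X w))%:E = \int[mu]_x (F x * p x)%:E.
Proof.
move=> mX mp p0 law mF.
have mF' : measurable_fun setT (EFin \o F) by exact/measurable_EFinP.
rewrite integralE [RHS]integralE; congr (_ - _).
- have := @ge0_integral_density X p (EFin \o F)^\+ mX mp p0 law
    (measurable_funepos mF') (fun x => funepos_ge0 _ x).
  move=> h; transitivity (\int[P]_w (EFin \o F)^\+ (X w)).
    by apply: eq_integral => w _; rewrite !funeposE.
  rewrite h; apply: eq_integral => x _.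
  by rewrite !funeposE/= -!EFin_max -EFinM maxr_pMl// mul0r.
- have := @ge0_integral_density X p (EFin \o F)^\- mX mp p0 law
    (measurable_funeneg mF') (fun x => funeneg_ge0 _ x).
  move=> h; transitivity (\int[P]_w (EFin \o F)^\- (X w)).
    by apply: eq_integral => w _; rewrite !funenegE.
  rewrite h; apply: eq_integral => x _.
  by rewrite !funenegE/= -!EFin_max -EFinM maxr_pMl// mul0r mulNr.
Qed.

End law_with_density.

Section gaussian_law_integrals.
Context d (T : measurableType d) (R : realType) (P : probability T R).
Local Notation mu := (@lebesgue_measure R).

(** A single formula covers the Dirac and the normal case, so degenerate linear combinations need no
    separate treatment later. *)
Lemma gaussian_law_cos (X : T -> R) (m v b : R) : measurable_fun setT X -> 0 <= v ->
  (forall A, measurable A -> P (X @^-1` A) = gaussian_law m v A) ->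
  (\int[P]_w cos (X w - m + b) = cos b * expR (- (v / 2)))%R.
Proof.
move=> mX v0 law.
have mc : measurable_fun setT (fun x : R => cos (x - m + b)).
  apply: measurableT_comp; first exact: continuous_measurable_fun (@continuous_cos R).
  by apply: measurable_funD => //; exact: measurable_funB.
have [vE|vn0] := eqVneq v 0.
  have h : P (X @^-1` [set m]) = 1%E.
    by rewrite law// /gaussian_law vE eqxx diracE mem_set.
  transitivity (\int[P]_w cos b)%R; last first.
    rewrite /Rintegral integral_cst//= probability_setT mule1.
    by rewrite /= vE mul0r oppr0 expR0 mulr1.
  rewrite /Rintegral; congr fine; apply: ae_eq_integral => //.
    by apply/measurable_EFinP; exact: measurableT_comp mc mX.
  have mS : measurable (X @^-1` [set m]) by rewrite -[X in measurable X]setTI; exact: mX.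
  exists (~` (X @^-1` [set m])); split.
  + exact: measurableC.
  + have e := probability_setC P mS; rewrite h subee// in e; exact: e.
  + move=> w /= hw hX; apply: hw => _.
    by rewrite hX subrr add0r.
have {}v0 : 0 < v by rewrite lt_neqAle eq_sym vn0.
have s0 : Num.sqrt v != 0 by rewrite gt_eqF// sqrtr_gt0.
have E : (\int[P]_w (cos (X w - m + b))%:E = (cos b * expR (- (v / 2)))%:E)%E.
  rewrite (@integral_density _ _ _ P X (normal_pdf m (Num.sqrt v)) (fun x => cos (x - m + b)))//.
  - rewrite -(integral_shift m)/=; last first.
      by apply/measurable_EFinP; apply: measurable_funM => //; exact: measurable_normal_pdf.
    transitivity (\int[mu]_x (cos (1 * x + b) * normal_pdf 0 (Num.sqrt v) x)%:E)%E.
      apply: eq_integral => x _; rewrite addrK mul1r; congr (_ * _)%:E.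
      by rewrite !normal_pdfE// /normal_fun addrK subr0.
    rewrite fourier_normal_pdf// sqr_sqrtr; last exact: ltW.
    by rewrite expr1n mul1r.
  - exact: measurable_normal_pdf.
  - by move=> x; exact: normal_pdf_ge0.
  - by move=> A mA; rewrite law// /gaussian_law gt_eqF.
by rewrite /Rintegral E.
Qed.

End gaussian_law_integrals.

Section bridge_independence.
Context d (T : measurableType d) (R : realType) (P : probability T R).
Variables (lambda : R) (B : R -> {RV P >-> R}).
Hypothesis hB : brownian_bridge lambda B.
Local Notation cov := (fun s t : R => Num.min s t - s * t).
Implicit Types (L : seq (R * R)).

(* Centred linear combinations of values of the bridge, given as lists of
   (coefficient, time) pairs. *)
Definition lincomb L (w : T) : R := \sum_(p <- L) p.1 * (B p.2 w - lambda * p.2).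
Definition lincov L1 L2 : R := \sum_(p <- L1) \sum_(q <- L2) p.1 * q.1 * cov p.2 q.2.

Lemma measurable_lincomb L : measurable_fun setT (lincomb L).
Proof.
elim: L => [|p L ih].
  by rewrite /lincomb; under eq_fun do rewrite big_nil; exact: measurable_cst.
rewrite /lincomb; under eq_fun do rewrite big_cons.
by apply: measurable_funD => //; apply: measurable_funM => //; exact: measurable_funB.
Qed.

Lemma lincomb_cat L1 L2 w : lincomb (L1 ++ L2) w = lincomb L1 w + lincomb L2 w.
Proof. by rewrite /lincomb big_cat. Qed.

Lemma lincov_cat L1 L2 : lincov (L1 ++ L2) (L1 ++ L2) =
  lincov L1 L1 + 2 * lincov L1 L2 + lincov L2 L2.
Proof.
have C : lincov L2 L1 = lincov L1 L2.
  rewrite /lincov exchange_big/=; apply: eq_bigr => p _; apply: eq_bigr => q _.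
  by rewrite minC; ring.
have D K1 K2 K3 : lincov K1 (K2 ++ K3) = lincov K1 K2 + lincov K1 K3.
  by rewrite /lincov -big_split/=; apply: eq_bigr => p _; rewrite big_cat.
by rewrite {1}/lincov big_cat/= -!/(lincov _ _) !D C; ring.
Qed.

Definition scale_lin (c : R) L := [seq (c * p.1, p.2) | p <- L].

Lemma lincomb_scale c L w : lincomb (scale_lin c L) w = c * lincomb L w.
Proof.
rewrite /lincomb /scale_lin big_map mulr_sumr; apply: eq_bigr => p _ /=.
by rewrite mulrA.
Qed.

Lemma lincov_scalel c L1 L2 : lincov (scale_lin c L1) L2 = c * lincov L1 L2.
Proof.
rewrite /lincov /scale_lin big_map mulr_sumr; apply: eq_bigr => p _ /=.
by rewrite mulr_sumr; apply: eq_bigr => q _; ring.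
Qed.

Lemma lincov_scaler c L1 L2 : lincov L1 (scale_lin c L2) = c * lincov L1 L2.
Proof.
rewrite /lincov mulr_sumr; apply: eq_bigr => p _ /=.
by rewrite /scale_lin big_map mulr_sumr; apply: eq_bigr => q _ /=; ring.
Qed.

Definition lin_times L (D : set R) := forall p, p \in L -> D p.2.

Lemma lincomb_law L : lin_times L [set t : R | 0 <= t <= 1] ->
  forall A, measurable A ->
  P ((fun w => lincomb L w + lambda * \sum_(p <- L) p.1 * p.2) @^-1` A) =
  gaussian_law (lambda * \sum_(p <- L) p.1 * p.2) (lincov L L) A.
Proof.
move=> hL A mA; have [_ _ gB] := hB.
pose n := size L; pose p0 : R * R := (0, 0).
have nE (V : nmodType) (F : R * R -> V) : \sum_(p <- L) F p = \sum_(i < n) F (nth p0 L i).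
  by rewrite (big_nth p0) big_mkord.
have := gB n (fun i => (nth p0 L i).2) (fun i => (nth p0 L i).1) _ A mA.
rewrite /lincov !nE.
have -> : (fun w => lincomb L w + lambda * \sum_(i < n) (nth p0 L i).1 * (nth p0 L i).2) =
    (fun w => \sum_(i < n) (nth p0 L i).1 * B (nth p0 L i).2 w).
  apply/funext => w; rewrite /lincomb nE mulr_sumr -big_split/=.
  by apply: eq_bigr => i _; ring.
move=> ->; last by move=> i; apply: hL; rewrite mem_nth.
have -> : \sum_(i < n) (nth p0 L i).1 * (lambda * (nth p0 L i).2) =
    lambda * \sum_(i < n) (nth p0 L i).1 * (nth p0 L i).2.
  by rewrite mulr_sumr; apply: eq_bigr => i _; ring.
by congr (gaussian_law _ _ A); apply: eq_bigr => i _; rewrite nE.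
Qed.

(** [Num.sqrt] of a negative number is 0, and the normal density of deviation 0 is by convention the
    uniform one on [0, 1]. *)
Lemma gaussian_law_lt0 (m v : R) (A : set R) : v < 0 -> measurable A ->
  gaussian_law m v A = lebesgue_measure (`[0, 1]%classic `&` A).
Proof.
move=> v0 mA; rewrite /gaussian_law lt_eqF// /normal_prob -integral_indic//.
by apply: eq_integral => x _; rewrite /normal_pdf ltr0_sqrtr// eqxx.
Qed.

Lemma lin_times_scale c L D : lin_times L D -> lin_times (scale_lin c L) D.
Proof. by move=> hL p /mapP[q /hL ? ->]. Qed.

(* A negative variance would make both S and 2 S uniform on [0, 1]. *)
Lemma lincov_ge0 L : lin_times L [set t : R | 0 <= t <= 1] -> 0 <= lincov L L.
Proof.
move=> hL; rewrite leNgt; apply/negP => v0.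
have h1 := lincomb_law hL; have h2 := lincomb_law (@lin_times_scale 2 _ _ hL).
have mI (x y : R) : measurable `]x, y]%classic by [].
have := h2 `](1:R), 2]%classic (mI _ _).
rewrite gaussian_law_lt0//; last by rewrite lincov_scalel lincov_scaler; lra.
have -> : ((fun w => lincomb (scale_lin 2 L) w +
    lambda * \sum_(p <- scale_lin 2 L) p.1 * p.2) @^-1` `](1:R), 2]) =
  ((fun w => lincomb L w + lambda * \sum_(p <- L) p.1 * p.2) @^-1` `](2^-1 : R), 1]).
  apply/seteqP; split => w /=; rewrite !in_itv/= lincomb_scale /scale_lin big_map/=;
    (have -> : \sum_(p <- L) 2 * p.1 * p.2 = 2 * \sum_(p <- L) p.1 * p.2
       by rewrite mulr_sumr; apply: eq_bigr => p _; rewrite mulrA);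
    by move=> /andP[? ?]; apply/andP; split; lra.
rewrite h1// gaussian_law_lt0//.
rewrite (_ : `[0, 1] `&` `]1, 2] = set0 :> set R); last first.
  by rewrite -subset0 => x /=; rewrite !in_itv/=; lra.
rewrite (_ : `[0, 1] `&` `]2^-1, 1] = `]2^-1, 1]%classic :> set R); last first.
  by apply/seteqP; split => x /=; rewrite !in_itv/=; lra.
rewrite measure0 lebesgue_measure_itv/= lte_fin ifT; last by lra.
by rewrite -EFinD => -[] ?; lra.
Qed.

Lemma expectation_lincomb_cos L (b : R) : lin_times L [set t : R | 0 <= t <= 1] ->
  (\int[P]_w cos (lincomb L w + b) = cos b * expR (- (lincov L L / 2)))%R.
Proof.
move=> hL; set c := lambda * \sum_(p <- L) p.1 * p.2.
have mX : measurable_fun setT (fun w => lincomb L w + c).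
  by apply: measurable_funD => //; exact: measurable_lincomb.
rewrite -(gaussian_law_cos b mX (lincov_ge0 hL) (lincomb_law hL)).
by apply: eq_Rintegral => w _; rewrite addrK.
Qed.

(** The product of cosines is half the sum of the cosines of the sum and of the difference; with
    zero covariance these two combinations have the same variance, the sum of the variances. The
    phases [a] and [b] make the statement cover sines as well. *)
Lemma lincomb_uncorrelated L1 L2 :
  lin_times L1 [set t : R | 0 <= t <= 1] -> lin_times L2 [set t : R | 0 <= t <= 1] ->
  lincov L1 L2 = 0 -> forall a b : R,
  (\int[P]_w (cos (lincomb L1 w + a) * cos (lincomb L2 w + b)) =
   (\int[P]_w cos (lincomb L1 w + a)) * (\int[P]_w cos (lincomb L2 w + b)))%R.
Proof.
move=> h1 h2 c12 a b.
have h2' := @lin_times_scale (-1) _ _ h2.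
have hcat (L L' : seq (R * R)) D : lin_times L D -> lin_times L' D -> lin_times (L ++ L') D.
  by move=> hL hL' p; rewrite mem_cat => /orP[/hL|/hL'].
have mc L c : measurable_fun setT (fun w => cos (lincomb L w + c)).
  apply: measurableT_comp; first exact: continuous_measurable_fun (@continuous_cos R).
  by apply: measurable_funD => //; exact: measurable_lincomb.
have Ic L c : P.-integrable setT (EFin \o (fun w => cos (lincomb L w + c))).
  apply: (@bounded_integrable _ _ _ P _ 1) => // w.
  by rewrite ler_norml cos_geN1 cos_le1.
transitivity (\int[P]_w (2^-1 * (cos (lincomb (L1 ++ L2) w + (a + b)) +
    cos (lincomb (L1 ++ scale_lin (-1) L2) w + (a - b)))))%R.
  apply: eq_Rintegral => w _; rewrite !lincomb_cat lincomb_scale.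
  have -> : lincomb L1 w + lincomb L2 w + (a + b) =
     (lincomb L1 w + a) + (lincomb L2 w + b) by ring.
  have -> : lincomb L1 w + -1 * lincomb L2 w + (a - b) =
     (lincomb L1 w + a) - (lincomb L2 w + b) by ring.
  move: (lincomb L1 w + a) (lincomb L2 w + b) => x y.
  by rewrite cosB cosD; field.
rewrite RintegralZl//; last by apply: (integrableD measurableT (Ic _ _) (Ic _ _)).
rewrite RintegralD// !expectation_lincomb_cos//; [|exact: hcat..].
rewrite !lincov_cat !lincov_scaler !lincov_scalel c12 cosB cosD.
have -> : - ((lincov L1 L1 + 2 * 0 + lincov L2 L2) / 2) =
   - (lincov L1 L1 / 2) + - (lincov L2 L2 / 2) by field.
have -> : - ((lincov L1 L1 + 2 * (-1 * 0) + -1 * (-1 * lincov L2 L2)) / 2) =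
   - (lincov L1 L1 / 2) + - (lincov L2 L2 / 2) by field.
by rewrite expRD; field.
Qed.

Definition outside_gen (a b : R) : set (set T) :=
  \bigcup_(r in [set r : R | (0 <= r <= a) || (b <= r <= 1)])
    preimage_set_system setT (B r) measurable.

(** Deviation of the bridge at [t] from its chord over [a, b]; for a < t < b it is distributed as
    the value at [t] of a bridge from 0 to 0 over [a, b]. *)
Definition bridge_noise (a t b : R) (w : T) : R :=
  B t w - ((b - t) / (b - a) * B a w + (t - a) / (b - a) * B b w).

Variables a t b : R.
Hypotheses (a0 : 0 <= a) (at_ : a < t) (tb : t < b) (b1 : b <= 1).

Local Ltac blra := move: (a0) (at_) (tb) (b1); lra.

Let Lxi : seq (R * R) := [:: (1, t); (- ((b - t) / (b - a)), a); (- ((t - a) / (b - a)), b)].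

Let xiE w : bridge_noise a t b w = lincomb Lxi w.
Proof.
rewrite /lincomb /Lxi !big_cons big_nil/= /bridge_noise.
have : b - a != 0 by rewrite subr_eq0 gt_eqF// (lt_trans at_).
by move=> ba; field.
Qed.

Let Lxi01 : lin_times Lxi [set t : R | 0 <= t <= 1].
Proof. by move=> p; rewrite !inE => /or3P[] /eqP -> /=; blra. Qed.

Definition noise_var := (t - a) * (b - t) / (b - a).

Lemma noise_var_gt0 : 0 < noise_var.
Proof. rewrite /noise_var; apply: divr_gt0; last by rewrite subr_gt0 (lt_trans at_).
by apply: mulr_gt0; rewrite subr_gt0. Qed.

Let vxi : lincov Lxi Lxi = noise_var.
Proof.
have ba : b - a != 0 by rewrite subr_eq0 gt_eqF// (lt_trans at_).
rewrite /lincov /Lxi !big_cons !big_nil/= !minxx.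
rewrite !(@min_l _ _ a) ?(@min_r _ _ t a) ?(@min_r _ _ b a) ?(@min_l _ _ t b) ?(@min_r _ _ b t) ?(ltW at_) ?(ltW tb) ?(ltW (lt_trans at_ tb))//.
by rewrite /noise_var; field.
Qed.

(** For r outside ]a, b[ the covariance with time r is an affine function of the other time on
    [a, b], and the noise measures the deviation from linear interpolation. *)
Let cxi (r : R) : (0 <= r <= a) || (b <= r <= 1) -> lincov Lxi [:: (1, r)] = 0.
Proof.
have ba : b - a != 0 by rewrite subr_eq0 gt_eqF// (lt_trans at_).
move=> hr; rewrite /lincov /Lxi !big_cons !big_nil/=.
case/orP: hr => /andP[r0 r1].
  rewrite !min_r; [|blra|blra|blra].
  by field.
rewrite !min_l; [|blra|blra|blra].
by field.
Qed.

Let Yset : set (T -> R) := [set y | exists c, y = fun w => c * bridge_noise a t b w].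
Let Zset : set (T -> R) := [set z | exists2 L,
  lin_times L [set r : R | (0 <= r <= a) || (b <= r <= 1)] & z = lincomb L].

Let out01 (r : R) : (0 <= r <= a) || (b <= r <= 1) -> 0 <= r <= 1.
Proof. by case/orP => /andP[? ?]; apply/andP; split; blra. Qed.

Let lin_times_out L : lin_times L [set r : R | (0 <= r <= a) || (b <= r <= 1)] ->
  lin_times L [set r : R | 0 <= r <= 1].
Proof. by move=> h p /h/= /out01. Qed.

Lemma measurable_bridge_noise : measurable_fun setT (bridge_noise a t b).
Proof.
by rewrite (_ : bridge_noise a t b = lincomb Lxi);
  [exact: measurable_lincomb|apply/funext => w; exact: xiE].
Qed.

Let mYset y : Yset y -> measurable_fun setT y.
Proof. by move=> [c ->]; apply: measurable_funM => //; exact: measurable_bridge_noise. Qed.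

Let mZset z : Zset z -> measurable_fun setT z.
Proof. by move=> [L _ ->]; exact: measurable_lincomb. Qed.

Let cov_out L : lin_times L [set r : R | (0 <= r <= a) || (b <= r <= 1)] ->
  lincov Lxi L = 0.
Proof.
elim: L => [_|p L ih hL].
  by rewrite /lincov big1// => q _; rewrite big_nil.
have hp : (0 <= p.2 <= a) || (b <= p.2 <= 1) by apply: hL; rewrite inE eqxx.
rewrite -cat1s /lincov.
transitivity (p.1 * lincov Lxi [:: (1, p.2)] + lincov Lxi L).
  rewrite /lincov mulr_sumr -big_split/=; apply: eq_bigr => q _.
  by rewrite big_cons big_seq1/=; ring.
rewrite cxi// mulr0 add0r; apply: ih => q qL; apply: hL.
by rewrite inE qL orbT.
Qed.

Let sincos (x : R) : sin x = cos (x + - (pi / 2)).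
Proof. by rewrite cosB cos_pihalf sin_pihalf mulr0 add0r mulr1. Qed.

Let indep_fun f g : trig_closure Yset f -> trig_closure Zset g ->
  (\int[P]_w (f w * g w) = (\int[P]_w f w) * (\int[P]_w g w))%R.
Proof.
apply: trig_closure_independent => // _ _ [c ->] [L hL ->].
have E : (fun w => c * bridge_noise a t b w) = lincomb (scale_lin c Lxi).
  by apply/funext => w; rewrite lincomb_scale xiE.
have h := @lincomb_uncorrelated (scale_lin c Lxi) L (@lin_times_scale c _ _ Lxi01)
  (lin_times_out hL).
rewrite lincov_scalel cov_out// mulr0 in h.
have Ew w : c * bridge_noise a t b w = lincomb (scale_lin c Lxi) w by rewrite -E.
have K u v f1 g1 : (forall x : R, f1 x = cos (x + u)) -> (forall x : R, g1 x = cos (x + v)) ->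
    (\int[P]_w (f1 (c * bridge_noise a t b w) * g1 (lincomb L w)) =
     (\int[P]_w f1 (c * bridge_noise a t b w)) * (\int[P]_w g1 (lincomb L w)))%R.
  move=> hf hg; under eq_Rintegral do rewrite hf hg Ew.
  rewrite (h erefl); congr (_ * _); apply: eq_Rintegral => w _.
    by rewrite hf Ew.
  by rewrite hg.
have s0 x : cos x = cos (x + 0) :> R by rewrite addr0.
by split; [apply: (K 0 0)|apply: (K 0 (- (pi / 2)))|apply: (K (- (pi / 2)) 0)|
  apply: (K (- (pi / 2)) (- (pi / 2)))].
Qed.

Let Z0 : Zset (fun=> 0).
Proof.
exists [::]; first by move=> p.
by apply/funext => w; rewrite /lincomb big_nil.
Qed.

Let ZB y z : Zset y -> Zset z -> Zset (fun w => y w - z w).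
Proof.
move=> [L1 h1 ->] [L2 h2 ->]; exists (L1 ++ scale_lin (-1) L2).
  move=> p; rewrite mem_cat => /orP[/h1//|].
  exact: lin_times_scale.
by apply/funext => w; rewrite lincomb_cat lincomb_scale mulN1r.
Qed.

Let ZZ c z : Zset z -> Zset (fun w => c * z w).
Proof.
move=> [L h ->]; exists (scale_lin c L); first exact: lin_times_scale.
by apply/funext => w; rewrite lincomb_scale.
Qed.

Let Y0 : Yset (fun=> 0).
Proof. by exists 0; apply/funext => w; rewrite mul0r. Qed.

Let YB y z : Yset y -> Yset z -> Yset (fun w => y w - z w).
Proof. by move=> [c ->] [c' ->]; exists (c - c'); apply/funext => w; rewrite mulrBl. Qed.

Let YZ c z : Yset z -> Yset (fun w => c * z w).
Proof. by move=> [c' ->]; exists (c * c'); apply/funext => w; rewrite mulrA. Qed.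

Lemma outside_gen_sub : <<s outside_gen a b >> `<=` @measurable _ T.
Proof.
apply: smallest_sub; first exact: sigma_algebra_measurable.
move=> _ [r _] [A mA <-]; exact: measurable_funP.
Qed.

Lemma bridge_noise_independent (A : set R) (C : set T) :
  measurable A -> <<s outside_gen a b >> C ->
  (P (bridge_noise a t b @^-1` A `&` C) = P (bridge_noise a t b @^-1` A) * P C)%E.
Proof.
move=> mA hC.
apply: (@trig_closure_independent_sets _ _ _ P Yset Zset _ _ indep_fun).
- by rewrite -[X in measurable X]setTI; exact: measurable_bridge_noise.
- exact: outside_gen_sub.
- apply: trig_closure_preimage => //; exists 1.
  by apply/funext => w; rewrite mul1r.
- move: C hC; apply: smallest_sub; first exact: sigma_algebra_trig_closure.
  move=> _ [r hr] [D mD <-] /=; rewrite setTI.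
  (* [lincomb] is centred, so the target set is translated by the mean lambda r. *)
  rewrite (_ : B r @^-1` D =
    lincomb [:: (1, r)] @^-1` ((fun x => x + lambda * r) @^-1` D)); last first.
    apply/seteqP; split => w /=; rewrite /lincomb big_seq1/= mul1r subrK//.
  apply: trig_closure_preimage => //.
    by exists [:: (1, r)] => // p; rewrite inE => /eqP ->.
  rewrite -[X in measurable X]setTI.
  by apply: (measurable_funD (@measurable_id _ _ _) (@measurable_cst _ _ _ _ _ _)).
Qed.

Lemma bridge_noise_law (A : set R) : measurable A ->
  P (bridge_noise a t b @^-1` A) =
  (\int[lebesgue_measure]_(x in A) (normal_pdf 0 (Num.sqrt noise_var) x)%:E)%E.
Proof.
move=> mA; have ba : b - a != 0 by rewrite subr_eq0 gt_eqF// (lt_trans at_).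
have := lincomb_law Lxi01 mA; rewrite vxi.
have -> : lambda * \sum_(p <- Lxi) p.1 * p.2 = 0.
  by rewrite /Lxi !big_cons big_nil/=; field.
rewrite /gaussian_law gt_eqF ?noise_var_gt0//.
move=> h; rewrite -[RHS]/(normal_prob 0 _ A) -h; congr (P _); apply/seteqP.
by split => w /=; rewrite xiE addr0.
Qed.

(* Freezing: conditionally on the sigma-algebra outside ]a, b[, the noise is an
   independent centred Gaussian. *)
Lemma ge0_freeze d' (T' : measurableType d') (Y : T -> T') (F : R * T' -> \bar R) :
  (forall A, measurable A -> <<s outside_gen a b >> (Y @^-1` A)) ->
  measurable_fun setT F -> (forall x, 0 <= F x)%E ->
  (\int[P]_w F (bridge_noise a t b w, Y w) =
   \int[P]_w \int[lebesgue_measure]_x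
     (F (x, Y w) * (normal_pdf 0 (Num.sqrt noise_var) x)%:E))%E.
Proof.
move=> YG mF F0.
have mY : measurable_fun setT Y.
  by move=> _ A mA; rewrite setTI; apply: outside_gen_sub; exact: YG.
have mxi := measurable_bridge_noise.
pose X' : {mfun T >-> R} := HB.pack (bridge_noise a t b)
  (isMeasurableFun.Build _ _ _ _ _ mxi).
pose Y' : {mfun T >-> T'} := HB.pack Y (isMeasurableFun.Build _ _ _ _ _ mY).
have mXY : measurable_fun setT (fun w => (bridge_noise a t b w, Y w)).
  exact: measurable_fun_pair.
pose XY' : {mfun T >-> (R * T')%type} := HB.pack (fun w => (bridge_noise a t b w, Y w))
  (isMeasurableFun.Build _ _ _ _ _ mXY).
have E A : measurable A ->
  (distribution P X' \x distribution P Y')%E A = distribution P XY' A.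
  move: A.
  apply: product_measure_unique => A C mA mC.
  rewrite /distribution /pushforward/= -bridge_noise_independent//.
    exact: YG.
transitivity (\int[distribution P XY']_z F z)%E.
  by rewrite ge0_integral_distribution.
transitivity (\int[(distribution P X' \x distribution P Y')%E]_z F z)%E.
  by apply: eq_measure_integral => A mA _; apply/esym; exact: E.
rewrite fubini_tonelli2//.
rewrite ge0_integral_distribution//.
- apply: eq_integral => w _ /=; rewrite /fubini_G/=.
  rewrite ge0_integral_distribution//.
  + rewrite (@ge0_integral_density _ _ _ P (bridge_noise a t b)
      (normal_pdf 0 (Num.sqrt noise_var)) (fun x => F (x, Y w)))//.
    * exact: measurable_normal_pdf.
    * by move=> x; exact: normal_pdf_ge0.
    * exact: bridge_noise_law.
    * exact: measurableT_comp.
  + exact: measurableT_comp.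
- exact: measurable_fun_fubini_tonelli_G.
- by move=> y; apply: integral_ge0 => x _.
Qed.

End bridge_independence.

(** * Dyadic grids and paths clamped to the unit interval *)

Section path_analysis.
Context {R : realType}.
Implicit Types (f : R -> R) (a b s q : R).

Lemma continuous_unif_itv f a b (e : R) : continuous f -> 0 < e ->
  exists2 d : R, 0 < d & forall x y, a <= x <= b -> `|x - y| < d -> `|f x - f y| < e.
Proof.
move=> cf e0.
(* Compactness in its near-covering form, the modulus being a parameter that tends to 0 from the
   right. Only x is confined to [a, b]. *)
have /compact_near_coveringP/(_ R (0^'+) (fun d x => forall y, `|x - y| < d -> `|f x - f y| < e) _) h :
  compact `[a, b] by exact: segment_compact.
have [x _|] := h.
  have e20 : 0 < e / 2 by rewrite divr_gt0.
  have /cvgrPdist_lt/(_ _ e20) := cf x.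
  move=> -[d /= d0 hd].
  exists (ball x (d / 2), [set r : R | 0 < r < d / 2]).
    split => /=; first by apply: nbhsx_ballx; rewrite divr_gt0.
    rewrite /nbhs/= /at_right /within/= near_simpl.
    exists (d / 2); first by rewrite /= divr_gt0.
    move=> r /=; rewrite sub0r normrN => hr r0; rewrite r0/=.
    by rewrite gtr0_norm in hr.
  move=> [x' r] /= [xx' /andP[r0 rd]] y xy.
  have h1 : `|f x - f x'| < e / 2.
    apply: hd => /=; apply: lt_le_trans xx' _.
    by rewrite ler_pdivrMr// ler_peMr ?(ltW d0)// ler1n.
  have h2 : `|f x - f y| < e / 2.
    apply: hd => /=; rewrite (_ : x - y = (x - x') + (x' - y)); last by ring.
    rewrite (le_lt_trans (ler_normD _ _))// [ltRHS](splitr d) ltrD//.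
    exact: lt_trans xy rd.
  rewrite (_ : f x' - f y = - (f x - f x') + (f x - f y)); last by ring.
  by rewrite (le_lt_trans (ler_normD _ _))// normrN [ltRHS](splitr e) ltrD.
move=> d /= d0 hd.
exists (d / 2); first by rewrite divr_gt0.
move=> x y xab xy; apply: (hd (d / 2)) => //=.
- by rewrite sub0r normrN gtr0_norm ?divr_gt0// ltr_pdivrMr// ltr_pMr// ltr1n.
- by rewrite divr_gt0.
Qed.

Definition dyadic_grid a s n (k : nat) : R := a + (s - a) * (k%:R / 2 ^+ n).

Lemma dyadic_grid0 a s n : dyadic_grid a s n 0 = a.
Proof. by rewrite /dyadic_grid mul0r mulr0 addr0. Qed.

Lemma dyadic_grid_itv a s n k : a <= s -> (k <= 2 ^ n)%N -> a <= dyadic_grid a s n k <= s.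
Proof.
move=> as_ kn; rewrite /dyadic_grid lerDl mulr_ge0 ?subr_ge0//=.
rewrite -lerBrDl ler_piMr ?subr_ge0// ler_pdivrMr ?exprn_gt0// mul1r.
by rewrite -natrX ler_nat.
Qed.

Lemma dyadic_grid_step a s n k : dyadic_grid a s n k.+1 - dyadic_grid a s n k = (s - a) / 2 ^+ n.
Proof. by rewrite /dyadic_grid -natr1; ring. Qed.

Lemma dyadic_grid_lt a s n j k : a < s -> (j < k)%N ->
  dyadic_grid a s n j < dyadic_grid a s n k.
Proof.
move=> as_ jk; rewrite /dyadic_grid ltrD2l ltr_pM2l ?subr_gt0//.
by rewrite ltr_pM2r ?invr_gt0 ?exprn_gt0// ltr_nat.
Qed.

Lemma cvg_dyadic_mesh (c : R) : c / 2 ^+ n @[n --> \oo] --> (0 : R).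
Proof.
rewrite -[X in _ --> X](mulr0 c); apply: cvgM; first exact: cvg_cst.
under eq_fun do rewrite -exprVn.
by apply: cvg_expr; rewrite ger0_norm ?invr_ge0//; lra.
Qed.

Lemma dyadic_grid_dense a s q (d : R) : a < s -> a <= q <= s -> 0 < d ->
  \forall n \near \oo, exists2 k, (k <= 2 ^ n)%N & `|q - dyadic_grid a s n k| < d.
Proof.
move=> as_ /andP[aq qs] d0.
have := cvg_dyadic_mesh (s - a) => /cvgrPdist_lt/(_ _ d0).
apply: filterS => n; rewrite sub0r normrN.
have n2 : 0 < 2 ^+ n :> R by rewrite exprn_gt0.
have sa : 0 < s - a by rewrite subr_gt0.
rewrite gtr0_norm ?divr_gt0// => hn.
pose x := (q - a) / (s - a) * 2 ^+ n.
have x0 : 0 <= x by rewrite mulr_ge0 ?(ltW n2)// divr_ge0 ?subr_ge0// ltW.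
have /andP[t1 t2] := truncn_itv x0.
exists (Num.truncn x).
  rewrite -(ler_nat R) natrX (le_trans t1)// ler_piMl ?(ltW n2)//.
  by rewrite ler_pdivrMr// mul1r lerD2r.
have qE : q = a + (s - a) * (x / 2 ^+ n).
  by rewrite /x; field; rewrite !gt_eqF.
rewrite /dyadic_grid {1}qE.
rewrite (_ : _ - _ = (s - a) / 2 ^+ n * (x - (Num.truncn x)%:R)); last by ring.
apply: le_lt_trans hn.
rewrite normrM gtr0_norm ?divr_gt0// ler_piMr ?ltW ?divr_gt0//.
by rewrite ger0_norm ?subr_ge0//; rewrite -natr1 in t2; lra.
Qed.

(** A strict inequality is an open condition, so a grid point close to q inherits it; for this
    reason hitting is later defined by a strict inequality. *)
Lemma dyadic_strict_hit f a s (m : R) : continuous f -> a < s ->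
  (exists q, a <= q <= s /\ f q < m) ->
  \forall n \near \oo, exists2 k, (k <= 2 ^ n)%N & f (dyadic_grid a s n k) < m.
Proof.
move=> cf as_ [q [qas fq]].
have /cvgrPdist_lt/(_ (m - f q)) := cf q; rewrite subr_gt0 => /(_ fq).
move=> -[d /= d0 hd].
apply: filterS (dyadic_grid_dense as_ qas d0) => n [k kn hk].
exists k => //; have := hd _ hk => /=.
by rewrite ltr_distl => /andP[]; lra.
Qed.

(** The bridge is controlled on [0, 1] only; clamping the time yields paths that are continuous on
    the whole line and constant on either side. *)
Definition clamp01 (t : R) : R := Num.max 0 (Num.min 1 t).

Lemma clamp01_itv t : 0 <= clamp01 t <= 1.
Proof. by rewrite /clamp01 le_max lexx ge_max ler01/= ge_min lexx. Qed.

Lemma clamp01_id t : 0 <= t <= 1 -> clamp01 t = t.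
Proof. by move=> /andP[t0 t1]; rewrite /clamp01 min_r// max_r. Qed.

Lemma continuous_clamp01 : continuous clamp01.
Proof.
move=> t; apply: (@continuous_max R R (fun=> 0) (fun t => Num.min 1 t)).
  exact: cvg_cst.
by apply: (@continuous_min R R (fun=> 1) id); [exact: cvg_cst|exact: cvg_id].
Qed.

Lemma continuous_clamped f : {within `[0, 1], continuous f} ->
  continuous (f \o clamp01).
Proof.
move=> cf t.
have c01 : `[0, 1]%classic (clamp01 t) by rewrite /= in_itv/= clamp01_itv.
move/subspace_continuousP : cf => /(_ _ c01) cf.
apply: (@cvg_comp _ _ _ clamp01 f _ (within `[0, 1] (nbhs (clamp01 t)))) => //.
move=> U hU.
have h2 : \forall x \near t, (`[0, 1]%classic (clamp01 x) -> U (clamp01 x)).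
  exact: (@continuous_clamp01 t _ hU).
apply: (filterS _ h2) => x h; apply: h.
by rewrite /= in_itv/= clamp01_itv.
Qed.

End path_analysis.

(** * Probability of staying above a level *)

Section indicator_measurability.
Context d (T : measurableType d) (R : realType).

Lemma measurable_boolR (f : T -> bool) : measurable_fun setT f ->
  measurable_fun setT (fun w => (f w)%:R : R).
Proof.
move=> mf; apply: (measurableT_comp (f := fun b : bool => b%:R : R)) => //.
Qed.

End indicator_measurability.

Section hitting.
Context d (T : measurableType d) (R : realType) (P : probability T R).
Variables (lambda : R) (B : R -> {RV P >-> R}).
Hypothesis hB : brownian_bridge lambda B.

Definition bpath (q : R) (w : T) : R := B (clamp01 q) w.
Local Notation X := bpath.
Local Notation outT a b := (g_sigma_algebraType (outside_gen B a b)).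

Lemma continuous_bpath w : continuous (X ^~ w).
Proof. by have [cB _ _] := hB; exact: continuous_clamped (cB w). Qed.

Lemma measurable_bpath q : measurable_fun setT (X q).
Proof. exact: measurable_funP. Qed.

Lemma outside_bpath (a b q : R) : 0 <= a -> b <= 1 -> (q <= a) || (b <= q) ->
  measurable_fun setT (X q : outT a b -> R).
Proof.
move=> a0 b1 hq _ A mA; rewrite setTI; apply: sub_sigma_algebra.
exists (clamp01 q) => /=.
  have /andP[q0 q1] := clamp01_itv q; rewrite q0 q1 /clamp01 !andbT/=.
  case/orP : hq => hq; apply/orP; [left|right].
    by rewrite ge_max a0/= ge_min hq orbT.
  by rewrite le_max le_min b1 hq/= orbT.
by exists A => //; rewrite setTI.
Qed.

Lemma outside_mono d' (T' : measurableType d') (a b a' b' : R) (f : T -> T') :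
  a <= a' -> b' <= b ->
  measurable_fun setT (f : outT a b -> T') -> measurable_fun setT (f : outT a' b' -> T').
Proof.
move=> aa bb mf _ A mA; have := mf measurableT A mA.
apply: smallest_sub; first exact: smallest_sigma_algebra.
move=> _ [r /= hr] [C mC <-]; apply: sub_sigma_algebra.
exists r => /=; last by exists C.
case/orP : hr => /andP[h1 h2]; apply/orP; [left|right].
  by rewrite h1 (le_trans h2).
by rewrite h2 (le_trans bb).
Qed.

Lemma outside_measurable d' (T' : measurableType d') (a b : R) (f : T -> T') :
  measurable_fun setT (f : outT a b -> T') -> measurable_fun setT f.
Proof. by move=> mf _ A mA; apply: (@outside_gen_sub _ _ _ _ B a b); exact: mf. Qed.

Lemma bpath_freeze d' (T' : measurableType d') (a t b : R) (Y : T -> T')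
    (F : R * T' -> \bar R) :
  0 <= a -> a < t -> t < b -> b <= 1 ->
  measurable_fun setT (Y : outT a b -> T') ->
  measurable_fun setT F -> (forall x, 0 <= F x)%E ->
  (\int[P]_w F ((X t w - ((b - t) / (b - a) * X a w + (t - a) / (b - a) * X b w))%R, Y w) =
   \int[P]_w \int[lebesgue_measure]_x
     (F (x, Y w) * (normal_pdf 0 (Num.sqrt (noise_var a t b)) x)%:E))%E.
Proof.
move=> a0 at_ tb b1 mY mF F0.
rewrite -(@ge0_freeze _ _ _ _ _ _ hB _ _ _ a0 at_ tb b1 _ _ _ _ _ mF F0); last first.
  by move=> A mA; rewrite -[_ @^-1` _]setTI; exact: mY.
apply: eq_integral => w _; rewrite /bridge_noise /bpath.
by rewrite !clamp01_id//; lra.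
Qed.

(** Given the bridge outside ]r, b[, the exponential at time s is log-normal, and the Gaussian
    moment generating function gives its mean, the exponential at time r. So this is a martingale in
    time up to b, with the level [m] and the end value frozen, and it equals 1 whenever the path is
    at the level. *)
Lemma bridge_exp_martingale (r s b : R) (phi m : T -> R) :
  0 <= r -> r < s -> s < b -> b <= 1 ->
  (forall w, 0 <= phi w) ->
  measurable_fun setT (phi : outT r b -> R) -> measurable_fun setT (m : outT r b -> R) ->
  (\int[P]_w (phi w * expR (- (2 * (X s w - m w) * (X b w - m w) / (b - s))))%:E =
   \int[P]_w (phi w * expR (- (2 * (X r w - m w) * (X b w - m w) / (b - r))))%:E)%E.
Proof.
move=> r0 rs sb b1 phi0 mphi mm.
have mXr : measurable_fun setT (X r : outT r b -> R) by apply: outside_bpath; rewrite ?lexx.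
have mXb : measurable_fun setT (X b : outT r b -> R) by apply: outside_bpath; rewrite ?lexx ?orbT.
pose Y w : R * (R * R) := (phi w, (X r w - m w, X b w - m w)).
have mY : measurable_fun setT (Y : outT r b -> R * (R * R)).
  apply: measurable_fun_pair => //.
  by apply: measurable_fun_pair; exact: measurable_funB.
pose c1 := (b - s) / (b - r); pose c2 := (s - r) / (b - r).
(* Freezing needs a function that is non-negative everywhere; the absolute value ensures this and
   leaves the values of [phi] unchanged. *)
pose F (z : R * (R * (R * R))) : \bar R := (`|z.2.1| *
  expR (- (2 * (z.1 + (c1 * z.2.2.1 + c2 * z.2.2.2)) * z.2.2.2 / (b - s))))%:E.
have m1 : measurable_fun setT (fun z : R * (R * (R * R)) => z.1) by exact: measurable_fst.
have m2 : measurable_fun setT (fun z : R * (R * (R * R)) => z.2.1).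
  exact: measurableT_comp measurable_fst measurable_snd.
have m3 : measurable_fun setT (fun z : R * (R * (R * R)) => z.2.2.1).
  by apply: measurableT_comp measurable_fst _; exact: measurableT_comp measurable_snd measurable_snd.
have m4 : measurable_fun setT (fun z : R * (R * (R * R)) => z.2.2.2).
  by apply: measurableT_comp measurable_snd _; exact: measurableT_comp measurable_snd measurable_snd.
have mF : measurable_fun setT F.
  apply/measurable_EFinP; apply: measurable_funM.
    exact: measurableT_comp.
  apply: measurableT_comp => //; apply: measurableT_comp => //.
  do 2 (apply: measurable_funM => //).
  apply: measurable_funM => //; apply: measurable_funD => //.
  by apply: measurable_funD; exact: measurable_funM.
have F0 z : (0 <= F z)%E by rewrite lee_fin mulr_ge0// expR_ge0.
have br : b - r != 0 by rewrite subr_eq0 gt_eqF// (lt_trans rs).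
have bs : b - s != 0 by rewrite subr_eq0 gt_eqF.
have := bpath_freeze r0 rs sb b1 mY mF F0.
have sv := noise_var_gt0 rs sb.
have s0 : Num.sqrt (noise_var r s b) != 0 by rewrite gt_eqF// sqrtr_gt0.
move=> h; transitivity (\int[P]_w F
   ((X s w - ((b - s) / (b - r) * X r w + (s - r) / (b - r) * X b w))%R, Y w))%E.
  apply: eq_integral => w _; rewrite /F/= ger0_norm//.
  have -> : X s w - ((b - s) / (b - r) * X r w + (s - r) / (b - r) * X b w) +
    (c1 * (X r w - m w) + c2 * (X b w - m w)) = X s w - m w.
    by rewrite /c1 /c2; field.
  by [].
rewrite h; apply: eq_integral => w _.
pose x := X r w - m w; pose y := X b w - m w.
transitivity (\int[lebesgue_measure]_z
  ((phi w * expR (- (2 * (c1 * x + c2 * y) * y / (b - s))))%:E *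
   (expR (- (2 * y / (b - s)) * z) * normal_pdf 0 (Num.sqrt (noise_var r s b)) z)%:E))%E.
  apply: eq_integral => z _; rewrite /F/= -!EFinM ger0_norm//; congr EFin.
  rewrite [RHS]mulrA -[in RHS](mulrA (phi w)) -expRD -/x -/y.
  have -> // : - (2 * (z + (c1 * x + c2 * y)) * y / (b - s)) =
    - (2 * (c1 * x + c2 * y) * y / (b - s)) + - (2 * y / (b - s)) * z.
  by field.
rewrite ge0_integralZl//.
- rewrite mgf_normal_pdf// sqr_sqrtr ?(ltW sv)// -EFinM; congr EFin.
  rewrite -[LHS]mulrA -expRD -/x -/y /c1 /c2 /noise_var.
  have -> // : - (2 * ((b - s) / (b - r) * x + (s - r) / (b - r) * y) * y / (b - s)) +
    (- (2 * y / (b - s))) ^+ 2 * ((s - r) * (b - s) / (b - r)) / 2 =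
    - (2 * x * y / (b - r)).
  by field; rewrite br bs.
- apply/measurable_EFinP; apply: measurable_funM; last exact: measurable_normal_pdf.
  by apply: measurableT_comp => //; exact: measurable_funM.
- by move=> z _; rewrite lee_fin mulr_ge0// ?expR_ge0 ?normal_pdf_ge0.
- by rewrite lee_fin mulr_ge0// expR_ge0.
Qed.

Definition no_hit (g : nat -> R) (m : T -> R) (k : nat) (w : T) : bool :=
  all (fun j => m w <= X (g j) w) (iota 0 k).
Definition first_hit (g : nat -> R) (m : T -> R) (k : nat) (w : T) : bool :=
  no_hit g m k w && (X (g k) w < m w).

Lemma no_hitS g m k w : no_hit g m k.+1 w = no_hit g m k w && (m w <= X (g k) w).
Proof. by rewrite /no_hit -addn1 iotaD all_cat/= add0n andbT. Qed.

Lemma no_hitP g m k w : reflect (forall j, (j < k)%N -> m w <= X (g j) w) (no_hit g m k w).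
Proof.
apply: (iffP allP) => h j; first by move=> jk; apply: h; rewrite mem_iota add0n.
by rewrite mem_iota add0n => /h.
Qed.

Lemma sum_first_hit g m N w : \sum_(k < N) (first_hit g m k w)%:R = (~~ no_hit g m N w)%:R :> R.
Proof.
elim: N => [|N ih]; first by rewrite big_ord0.
rewrite big_ord_recr/= ih no_hitS /first_hit; case: (no_hit g m N w) => /=.
  by rewrite add0r leNgt negbK.
by rewrite addr0.
Qed.

Lemma outside_no_hit g (m : T -> R) k (c b : R) : 0 <= c -> b <= 1 ->
  (forall j, (j < k)%N -> g j <= c) ->
  measurable_fun setT (m : outT c b -> R) ->
  measurable_fun setT (no_hit g m k : outT c b -> bool).
Proof.
move=> c0 b1 hg mm; elim: k hg => [|k ih] hg.
  by rewrite (_ : no_hit g m 0 = fun=> true).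
rewrite (_ : no_hit g m k.+1 = fun w => no_hit g m k w && (m w <= X (g k) w)); last first.
  by apply/funext => w; exact: no_hitS.
apply: measurable_and; first by apply: ih => j jk; apply: hg; rewrite ltnS ltnW.
apply: measurable_fun_ler => //.
by apply: outside_bpath; rewrite ?hg.
Qed.

Lemma outside_fhit g (m : T -> R) k (c b : R) : 0 <= c -> b <= 1 ->
  (forall j, (j <= k)%N -> g j <= c) ->
  measurable_fun setT (m : outT c b -> R) ->
  measurable_fun setT (first_hit g m k : outT c b -> bool).
Proof.
move=> c0 b1 hg mm; apply: measurable_and.
  by apply: outside_no_hit => // j jk; apply: hg; exact: ltnW.
by apply: measurable_fun_ltr => //; apply: outside_bpath; rewrite ?hg.
Qed.

Definition below (a s : R) (m : T -> R) (w : T) : bool :=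
  `[< exists q, a <= q <= s /\ X q w < m w >].

Lemma cvg_no_hit a s m w : a < s ->
  \forall n \near \oo, ~~ no_hit (dyadic_grid a s n) m (2 ^ n).+1 w = below a s m w.
Proof.
move=> as_; rewrite /below; case: asboolP => [h|h].
  have := dyadic_strict_hit (@continuous_bpath w) as_ h; apply: filterS => n [k kn hk].
  by apply/negP => /no_hitP/(_ k kn); rewrite leNgt hk.
near=> n; apply/negbTE/negPn/no_hitP => k kn; rewrite leNgt; apply/negP => hk.
apply: h; exists (dyadic_grid a s n k); split => //.
by apply: dyadic_grid_itv => //; exact: ltW.
Unshelve. all: by end_near. Qed.

Lemma measurable_below a s m : a < s -> measurable_fun setT m ->
  measurable_fun setT (fun w => (below a s m w)%:R : R).
Proof.
move=> as_ mm.
apply: (@measurable_fun_cvg _ _ _ _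
  (fun n w => (~~ no_hit (dyadic_grid a s n) m (2 ^ n).+1 w)%:R : R)).
  move=> n; apply: measurable_boolR; apply: measurable_neg.
  move: (2 ^ n).+1 => k; elim: k => [|k ih].
    by rewrite (_ : no_hit _ m 0 = fun=> true).
  rewrite (_ : no_hit _ m k.+1 = fun w => no_hit (dyadic_grid a s n) m k w &&
     (m w <= X (dyadic_grid a s n k) w)); last first.
    by apply/funext => w; exact: no_hitS.
  by apply: measurable_and => //; apply: measurable_fun_ler => //; exact: measurable_bpath.
move=> w _; apply: cvg_near_cst; near=> n; congr (_%:R); congr nat_of_bool.
by near: n; exact: cvg_no_hit.
Unshelve. all: by end_near. Qed.

(** * Reflection principle by optional stopping on dyadic grids *)

Section reflection.
Variables (a b : R) (m psi : T -> R).
Hypotheses (a0 : 0 <= a) (ab : a < b) (b1 : b <= 1).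
Hypothesis mm : measurable_fun setT (m : outT a b -> R).
Hypothesis mpsi : measurable_fun setT (psi : outT a b -> R).
Hypothesis psi0 : forall w, 0 <= psi w.
Hypothesis psi_ab : forall w, psi w != 0 -> m w < X a w /\ m w < X b w.
Hypothesis Ipsi : P.-integrable setT (EFin \o psi).

Local Notation M q w := (expR (- (2 * (X q w - m w) * (X b w - m w) / (b - q)))).

Let mM q : measurable_fun setT (fun w => M q w).
Proof.
have mm' := outside_measurable mm.
apply: measurableT_comp => //; apply: measurableT_comp => //.
apply: measurable_funM => //; apply: measurable_funM; last first.
  by apply: measurable_funB => //; exact: measurable_bpath.
by apply: measurable_funM => //; apply: measurable_funB => //; exact: measurable_bpath.
Qed.

Let mpsi' : measurable_fun setT psi. Proof. exact: outside_measurable mpsi. Qed.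

Let psiM_integrable q : a <= q -> q < b ->
  P.-integrable setT (fun w => (psi w * M q w)%:E).
Proof.
move=> aq qb; apply/integrableP; split.
  by apply/measurable_EFinP; exact: measurable_funM.
under eq_integral do rewrite gee0_abs ?lee_fin ?mulr_ge0 ?expR_ge0//.
have ha : (\int[P]_w (psi w * M a w)%:E < +oo)%E.
  apply: le_lt_trans (_ : \int[P]_w (psi w)%:E < +oo)%E.
    apply: ge0_le_integral => //.
    - by move=> w _; rewrite lee_fin mulr_ge0// expR_ge0.
    - by apply/measurable_EFinP; exact: measurable_funM.
    - exact/measurable_EFinP.
    move=> w _; rewrite lee_fin; have [->|/psi_ab[h1 h2]] := eqVneq (psi w) 0.
      by rewrite mul0r.
    rewrite ler_piMr// -expR0 ler_expR oppr_le0.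
    by rewrite divr_ge0 ?mulr_ge0// ?subr_ge0 ?ltW.
  have /integrableP[_] := Ipsi.
  by under eq_integral do rewrite gee0_abs ?lee_fin//.
have [->//|aq'] := eqVneq q a.
by rewrite (@bridge_exp_martingale a q b)// lt_neqAle eq_sym aq'.
Qed.

(** Optional stopping: that the first grid hit occurs at the k-th point c is known from the path
    outside ]c, b[, so on this event the martingale may be moved from s back to c. *)
Let fhit_exp (s : R) (n k : nat) (e : T -> bool) : a < s -> s < b -> (k <= 2 ^ n)%N ->
  measurable_fun setT (e : outT (dyadic_grid a s n k) b -> bool) ->
  (\int[P]_w (psi w * (first_hit (dyadic_grid a s n) m k w && e w)%:R * M s w)%:E =
   \int[P]_w (psi w * (first_hit (dyadic_grid a s n) m k w && e w)%:R *
     M (dyadic_grid a s n k) w)%:E)%E.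
Proof.
move=> as_ sb kn me; set c := dyadic_grid a s n k.
have /andP[ac cs] : a <= c <= s by apply: dyadic_grid_itv => //; exact: ltW.
have [->//|cs'] := eqVneq c s.
apply: bridge_exp_martingale => //.
- exact: le_trans ac.
- by rewrite lt_neqAle cs'.
- by move=> w; rewrite mulr_ge0.
- apply: measurable_funM; first exact: (outside_mono ac (lexx b) mpsi).
  apply: measurable_boolR; apply: measurable_and => //.
  apply: outside_fhit => //; first exact: le_trans ac.
    move=> j jk; rewrite /c; have [->//|jk'] := eqVneq j k.
    by apply/ltW/dyadic_grid_lt => //; rewrite ltn_neqAle jk'.
  exact: (outside_mono ac (lexx b) mm).
- exact: (outside_mono ac (lexx b) mm).
Qed.

Let mMout c q : a <= c -> q <= c -> measurable_fun setT ((fun w => M q w) : outT c b -> R).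
Proof.
move=> ac qc; have c0 := le_trans a0 ac.
have mm' := outside_mono ac (lexx b) mm.
have mXb : measurable_fun setT (X b : outT c b -> R) by apply: outside_bpath; rewrite ?lexx ?orbT.
have mXq : measurable_fun setT (X q : outT c b -> R) by apply: outside_bpath; rewrite ?qc.
apply: measurableT_comp => //; apply: measurableT_comp => //.
apply: measurable_funM => //; apply: measurable_funM; last exact: measurable_funB.
by apply: measurable_funM => //; exact: measurable_funB.
Qed.

Let mfirst_hit g k : measurable_fun setT (first_hit g m k).
Proof.
apply: measurable_and; last first.
  by apply: measurable_fun_ltr; [exact: measurable_bpath|exact: outside_measurable mm].
elim: k => [|k ih]; first by rewrite (_ : no_hit g m 0 = fun=> true).
rewrite (_ : no_hit g m k.+1 = fun w => no_hit g m k w && (m w <= X (g k) w)); last first.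
  by apply/funext => w; exact: no_hitS.
apply: measurable_and => //.
by apply: measurable_fun_ler; [exact: outside_measurable mm|exact: measurable_bpath].
Qed.

Let M_ge1 q w : q < b -> psi w != 0 -> X q w < m w -> 1 <= M q w.
Proof.
move=> qb /psi_ab[_ h2] h1; rewrite -expR0 ler_expR oppr_ge0.
rewrite pmulr_lle0 ?invr_gt0 ?subr_gt0// pmulr_lle0 ?subr_gt0//.
by rewrite pmulr_rle0// subr_le0 ltW.
Qed.

Let hitE s n (f : T -> R) w :
  psi w * (~~ no_hit (dyadic_grid a s n) m (2 ^ n).+1 w)%:R * f w =
  \sum_(k < (2 ^ n).+1) psi w * (first_hit (dyadic_grid a s n) m k w)%:R * f w.
Proof. by rewrite -sum_first_hit mulr_sumr mulr_suml. Qed.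

(** At a first hit the path is below the level while its end value is above, so the exponential is
    at least 1 there; [fhit_exp] carries the bound to time s. *)
Let hit_lower s n : a < s -> s < b ->
  (\int[P]_w (psi w * (~~ no_hit (dyadic_grid a s n) m (2 ^ n).+1 w)%:R)%:E <=
   \int[P]_w (psi w * (~~ no_hit (dyadic_grid a s n) m (2 ^ n).+1 w)%:R * M s w)%:E)%E.
Proof.
move=> as_ sb.
under eq_integral do rewrite -[X in X%:E]mulr1 (hitE _ _ (fun=> 1)) -sumEFin.
under [leRHS]eq_integral do rewrite (hitE _ _ (fun w => M s w)) -sumEFin.
rewrite !ge0_integral_sum//; last 4 first.
- move=> k; apply/measurable_EFinP; apply: measurable_funM; last exact: mM.
  by apply: measurable_funM => //; exact: measurable_boolR.
- by move=> k w _; rewrite lee_fin !mulr_ge0// expR_ge0.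
- move=> k; apply/measurable_EFinP; apply: measurable_funM => //.
  by apply: measurable_funM => //; exact: measurable_boolR.
- by move=> k w _; rewrite lee_fin !mulr_ge0.
apply: lee_sum => k _.
have kn : (k <= 2 ^ n)%N by rewrite -ltnS.
have E1 q : (\int[P]_w (psi w * (first_hit (dyadic_grid a s n) m k w)%:R * M q w)%:E =
    \int[P]_w (psi w * (first_hit (dyadic_grid a s n) m k w && true)%:R * M q w)%:E)%E.
  by apply: eq_integral => w _; rewrite andbT.
rewrite (E1 s) (@fhit_exp s n k (fun=> true) as_ sb kn (@measurable_cst _ _ _ _ _ _)) -E1.
apply: ge0_le_integral => //.
- by move=> w _; rewrite lee_fin !mulr_ge0.
- apply/measurable_EFinP; apply: measurable_funM => //.
  by apply: measurable_funM => //; exact: measurable_boolR.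
- apply/measurable_EFinP; apply: measurable_funM; last exact: mM.
  by apply: measurable_funM => //; exact: measurable_boolR.
move=> w _; rewrite lee_fin.
have [->|pw] := eqVneq (psi w) 0; first by rewrite !mul0r.
case hk : (first_hit _ _ _ _); last by rewrite !mulr0 !mul0r.
rewrite ler_wpM2l ?mulr_ge0// M_ge1//; last by case/andP : hk.
apply: le_lt_trans sb.
by have /andP[] := dyadic_grid_itv (ltW as_) kn.
Qed.

(** As first hits are disjoint events, this is the indicator that the overshoot at the first grid
    hit brings the exponential above 1 + e. *)
Let bad s n (e : R) w : R := \sum_(k < (2 ^ n).+1)
  (first_hit (dyadic_grid a s n) m k w && (1 + e < M (dyadic_grid a s n k) w))%:R.

Let mbad s n e : measurable_fun setT (bad s n e).
Proof.
apply: measurable_sum => k; apply: measurable_boolR; apply: measurable_and => //.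
by apply: measurable_fun_ltr => //; exact: mM.
Qed.

Let hit_upper s n (e : R) : a < s -> s < b -> 0 < e ->
  (\int[P]_w (psi w * (~~ no_hit (dyadic_grid a s n) m (2 ^ n).+1 w)%:R * M s w)%:E <=
   (1 + e)%:E * \int[P]_w (psi w * (~~ no_hit (dyadic_grid a s n) m (2 ^ n).+1 w)%:R)%:E +
   \int[P]_w (psi w * bad s n e w * M s w)%:E)%E.
Proof.
move=> as_ sb e0.
have e1 : 0 <= 1 + e by lra.
under eq_integral do rewrite (hitE _ _ (fun w => M s w)) -sumEFin.
under [X in (_ <= _ * X + _)%E]eq_integral do rewrite -[X in X%:E]mulr1 (hitE _ _ (fun=> 1)) -sumEFin.
under [X in (_ <= _ + X)%E]eq_integral do rewrite /bad mulr_sumr mulr_suml -sumEFin.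
rewrite !ge0_integral_sum//; last 6 first.
- move=> k; apply/measurable_EFinP; apply: measurable_funM; last exact: mM.
  apply: measurable_funM => //; apply: measurable_boolR; apply: measurable_and => //.
  by apply: measurable_fun_ltr => //; exact: mM.
- by move=> k w _; rewrite lee_fin !mulr_ge0// expR_ge0.
- move=> k; apply/measurable_EFinP; apply: measurable_funM => //.
  by apply: measurable_funM => //; exact: measurable_boolR.
- by move=> k w _; rewrite lee_fin !mulr_ge0.
- move=> k; apply/measurable_EFinP; apply: measurable_funM; last exact: mM.
  by apply: measurable_funM => //; exact: measurable_boolR.
- by move=> k w _; rewrite lee_fin !mulr_ge0// expR_ge0.
rewrite ge0_sume_distrr; last first.
  by move=> k _; apply: integral_ge0 => w _; rewrite lee_fin !mulr_ge0.
rewrite -big_split/=; apply: lee_sum => k _.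
have kn : (k <= 2 ^ n)%N by rewrite -ltnS.
have /andP[ac cs] := dyadic_grid_itv (ltW as_) kn.
set c := dyadic_grid a s n k in ac cs *.
have mfM (u : T -> bool) q : measurable_fun setT u ->
    measurable_fun setT (fun w => (psi w * (u w)%:R * M q w)%:E).
  move=> mu; apply/measurable_EFinP; apply: measurable_funM; last exact: mM.
  by apply: measurable_funM => //; exact: measurable_boolR.
have mle : measurable_fun setT (fun w => M c w <= 1 + e).
  by apply: measurable_fun_ler => //; exact: mM.
have mlt : measurable_fun setT (fun w => 1 + e < M c w).
  by apply: measurable_fun_ltr => //; exact: mM.
rewrite (_ : (\int[P]_w (psi w * (first_hit (dyadic_grid a s n) m k w)%:R * M s w)%:E =
  \int[P]_w (psi w * (first_hit (dyadic_grid a s n) m k w && (M c w <= 1 + e))%R%:R * M s w)%:E +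
  \int[P]_w (psi w * (first_hit (dyadic_grid a s n) m k w && (1 + e < M c w))%R%:R * M s w)%:E)%E);
  last first.
  rewrite -ge0_integralD//; last 4 first.
  - by move=> w _; rewrite lee_fin !mulr_ge0// expR_ge0.
  - by apply: mfM; exact: measurable_and.
  - by move=> w _; rewrite lee_fin !mulr_ge0// expR_ge0.
  - by apply: mfM; exact: measurable_and.
  apply: eq_integral => w _; rewrite -EFinD; congr EFin.
  rewrite (leNgt (M c w)); case: (first_hit _ _ _ _); case: (1 + e < M c w); rewrite /=; ring.
apply: leeD => //.
rewrite (@fhit_exp s n k (fun w => M c w <= 1 + e) as_ sb kn); last first.
  by apply: measurable_fun_ler => //; exact: mMout.
rewrite -ge0_integralZl//; last 2 first.
- apply/measurable_EFinP; apply: measurable_funM => //.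
  by apply: measurable_funM => //; exact: measurable_boolR.
- by move=> w _; rewrite lee_fin !mulr_ge0.
apply: ge0_le_integral => //.
- by move=> w _; rewrite lee_fin !mulr_ge0// expR_ge0.
- by apply: mfM; exact: measurable_and.
- apply: measurable_funeM; apply/measurable_EFinP; apply: measurable_funM => //.
  by apply: measurable_funM => //; exact: measurable_boolR.
move=> w _; rewrite -EFinM lee_fin mulr1.
case hk : (first_hit (dyadic_grid a s n) m k w); last by rewrite /= !(mulr0n, mulr0, mul0r).
rewrite /=; have [h|_] := leP (M c w) (1 + e); last by rewrite mulr0 mul0r mulr1 mulr_ge0.
by rewrite !mulr1 mulrC ler_wpM2r.
Qed.

Let cvg_bad s (e : R) w : a < s -> s < b -> 0 < e -> psi w != 0 ->
  \forall n \near \oo, bad s n e w = 0.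
Proof.
move=> as_ sb e0 pw; have [ha hb] := psi_ab pw.
pose y := X b w - m w; have y0 : 0 < y by rewrite subr_gt0.
(* Chosen so that an overshoot below [eta] at a time c <= s keeps the exponent 2 eta y / (b - c)
   below ln (1 + e). *)
pose eta := ln (1 + e) * (b - s) / (2 * y).
have l0 : 0 < ln (1 + e) by rewrite ln_gt0// ltrDl.
have bs : 0 < b - s by rewrite subr_gt0.
have eta0 : 0 < eta by rewrite divr_gt0 ?mulr_gt0.
have [dl dl0 hd] := continuous_unif_itv a s (@continuous_bpath w) eta0.
have := cvg_dyadic_mesh (s - a) => /cvgrPdist_lt/(_ _ dl0).
apply: filterS => n; rewrite sub0r normrN => hn.
rewrite /bad big1// => -[[|k] kn] _ /=.
  (* No hit occurs at the first grid point, since [psi] lives where the path exceeds the level at a.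
     At later points the previous one was not a hit, so the overshoot is at most the oscillation
     over one mesh. *)
  rewrite /first_hit dyadic_grid0.
  by rewrite (ltNge (X a w)) (ltW ha)/= ?andbF.
case hk : (first_hit _ _ _ _) => //=.
have kn' : (k.+1 <= 2 ^ n)%N by [].
have /andP[ac cs] := dyadic_grid_itv (ltW as_) kn'.
have /andP[/no_hitP/(_ k (ltnSn k)) h1 h2] := hk.
set c := dyadic_grid a s n k.+1 in ac cs h2 hk *.
have h3 : `|X (dyadic_grid a s n k) w - X c w| < eta.
  apply: hd; first by apply: dyadic_grid_itv; [exact: ltW|exact: ltnW].
  by rewrite distrC dyadic_grid_step.
have h4 : m w - X c w < eta by move: h3; rewrite ltr_norml => /andP[_ ?]; lra.
rewrite (_ : (1 + e < _)%R = false)//; apply/negbTE; rewrite -leNgt.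
have e1 : 0 < 1 + e by lra.
rewrite -[leRHS](lnK (x := 1 + e)) ?posrE// ler_expR -/y.
rewrite (_ : - _ = (2 * (m w - X c w) * y) / (b - c)); last by ring.
have bc : 0 < b - c by rewrite subr_gt0 (le_lt_trans cs).
rewrite ler_pdivrMr//.
apply: (@le_trans _ _ (2 * eta * y)).
  by rewrite ler_wpM2r ?(ltW y0)// ler_wpM2l// ltW.
rewrite /eta (_ : 2 * _ * y = ln (1 + e) * (b - s)); last by field; rewrite gt_eqF.
by rewrite ler_wpM2l ?(ltW l0)// lerD2l lerN2.
Qed.

Let bfhit w s n e : bad s n e w <= (~~ no_hit (dyadic_grid a s n) m (2 ^ n).+1 w)%:R.
Proof.
rewrite -sum_first_hit; apply: ler_sum => k _.
by rewrite ler_nat; case: (first_hit _ _ _ _) => //=; case: (_ < _)%R.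
Qed.

(** As the mesh tends to 0 the overshoot disappears, and the two grid bounds meet: the exponential
    counts as 1 on the event of hitting before s. *)
Let below_integral s : a < s -> s < b ->
  (\int[P]_w (psi w * (below a s m w)%:R)%:E =
   \int[P]_w (psi w * (below a s m w)%:R * M s w)%:E)%E.
Proof.
move=> as_ sb.
have mm' := outside_measurable mm.
have mb : measurable_fun setT (fun w => (below a s m w)%:R : R) by exact: measurable_below.
have mN n : measurable_fun setT
    (fun w => (~~ no_hit (dyadic_grid a s n) m (2 ^ n).+1 w)%:R : R).
  under eq_fun do rewrite -sum_first_hit.
  by apply: measurable_sum => k; exact: measurable_boolR.
have IM := psiM_integrable (ltW as_) sb.
have nb1 (u : bool) : `|u%:R| <= 1 :> R by case: u; rewrite ?normr0 ?normr1.
have [||w _||n w _|_ L1] := @dominated_convergence_real _ _ R P setT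
    (fun n w => psi w * (~~ no_hit (dyadic_grid a s n) m (2 ^ n).+1 w)%:R)
    (fun w => psi w * (below a s m w)%:R) psi measurableT.
- by move=> n; exact: measurable_funM.
- exact: measurable_funM.
- apply: cvg_near_cst; near=> n; congr (_ * _); congr (_%:R); congr nat_of_bool.
  by near: n; exact: cvg_no_hit.
- exact: Ipsi.
- by rewrite normrM (ger0_norm (psi0 w)) ler_piMr.
have [||w _||n w _|_ L2] := @dominated_convergence_real _ _ R P setT
    (fun n w => psi w * (~~ no_hit (dyadic_grid a s n) m (2 ^ n).+1 w)%:R * M s w)
    (fun w => psi w * (below a s m w)%:R * M s w) (fun w => psi w * M s w) measurableT.
- by move=> n; apply: measurable_funM; [exact: measurable_funM|exact: mM].
- by apply: measurable_funM; [exact: measurable_funM|exact: mM].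
- apply: cvg_near_cst; near=> n; congr (_ * _ * _); congr (_%:R); congr nat_of_bool.
  by near: n; exact: cvg_no_hit.
- exact: IM.
- rewrite !normrM (ger0_norm (psi0 w)) (ger0_norm (expR_ge0 _)) ler_wpM2r ?expR_ge0//.
  by rewrite ler_piMr.
have L3 (e : R) : 0 < e -> (\int[P]_w (psi w * bad s n e w * M s w)%:E @[n --> \oo] --> 0)%E.
  move=> e0.
  have [||w _||n w _|_] := @dominated_convergence_real _ _ R P setT
      (fun n w => psi w * bad s n e w * M s w) (fun w => 0)
      (fun w => psi w * M s w) measurableT.
  - by move=> n; apply: measurable_funM; [exact: measurable_funM|exact: mM].
  - exact: measurable_cst.
  - apply: cvg_near_cst; have [->|pw] := eqVneq (psi w) 0.
      by apply: nearW => n; rewrite !mul0r.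
    by apply: filterS (cvg_bad as_ sb e0 pw) => n ->; rewrite mulr0 mul0r.
  - exact: IM.
  - have b0 : 0 <= bad s n e w by rewrite sumr_ge0.
    rewrite !normrM (ger0_norm (psi0 w)) (ger0_norm (expR_ge0 _)) ler_wpM2r ?expR_ge0//.
    rewrite ler_piMr// ger0_norm//; apply: le_trans (bfhit _ _ _ _) _.
    by case: (~~ _).
  by rewrite integral0.
have fin1 : (\int[P]_w (psi w * (below a s m w)%:R)%:E \is a fin_num)%E.
  apply: integrable_fin_num => //.
  apply: (le_integrable measurableT _ _ Ipsi).
    by apply/measurable_EFinP; exact: measurable_funM.
  move=> w _ /=; rewrite lee_fin normrM (ger0_norm (psi0 w)) ler_piMr//.
apply/eqP; rewrite eq_le; apply/andP; split.
  apply: (lee_cvg_to L1 L2); apply: nearW => n; exact: hit_lower.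
have h (e : R) : 0 < e -> (\int[P]_w (psi w * (below a s m w)%:R * M s w)%:E <=
    (1 + e)%:E * \int[P]_w (psi w * (below a s m w)%:R)%:E)%E.
  move=> e0; rewrite -[leRHS]adde0.
  apply: (lee_cvg_to L2).
    apply: cvgeD; [by rewrite fin_num_adde_defl// |by apply: cvgeZl; [|exact: L1]|exact: (L3 e e0)].
  by apply: nearW => n; exact: hit_upper.
set J := (\int[P]_w (psi w * (below a s m w)%:R)%:E)%E.
rewrite -/J in fin1 h.
have J0 : (0 <= J)%E by apply: integral_ge0 => w _; rewrite lee_fin mulr_ge0.
rewrite -(fineK fin1); apply/lee_addgt0Pr => e e0.
(* The summand 1 in the denominator covers the case of a null integral. *)
have e'0 : 0 < e / (fine J + 1) by rewrite divr_gt0// ltr_wpDl// fine_ge0.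
apply: (le_trans (h _ e'0)); rewrite -(fineK fin1) -EFinM -EFinD lee_fin /= mulrDl mul1r lerD2l.
rewrite mulrAC ler_pdivrMr; last by rewrite ltr_wpDl// fine_ge0.
by rewrite ler_pM2l// lerDl.
Unshelve. all: by end_near. Qed.

Let below_last w s : a < s -> s < b -> below a s m w -> below a b m w.
Proof.
move=> as_ sb /asboolP[q [/andP[aq qs] hq]]; apply/asboolP; exists q; split => //.
by rewrite aq (le_trans qs) ?ltW.
Qed.

(** The martingale is evaluated at s < b and s tends to b. Paths that have hit the level count for
    1; on the others the exponent tends to minus infinity because the end value exceeds the level,
    so they contribute nothing in the limit. *)
Lemma reflection_integral :
  (\int[P]_w (psi w * (below a b m w)%:R)%:E = \int[P]_w (psi w * M a w)%:E)%E.
Proof.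
pose s_ (n : nat) : R := b - (b - a) / n.+2%:R.
have n2 (n : nat) : (0 : R) < n.+2%:R by rewrite ltr0n.
have ba : 0 < b - a by rewrite subr_gt0.
have as_ n : a < s_ n.
  rewrite /s_ ltrBrDl -ltrBrDr ltr_pdivrMr// ltr_pMr//.
  by rewrite ltr1n.
have sb n : s_ n < b by rewrite /s_ gtrBl divr_gt0.
have cs : s_ n @[n --> \oo] --> b.
  rewrite -[X in _ --> X]subr0; apply: cvgB; first exact: cvg_cst.
  rewrite -[X in _ --> X](mulr0 (b - a)); apply: cvgM; first exact: cvg_cst.
  by have := @cvg_harmonic R; rewrite -cvg_shiftS.
have mm' := outside_measurable mm.
have mb s : a < s -> measurable_fun setT (fun w => (below a s m w)%:R : R).
  by move=> ?; exact: measurable_below.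
have mnb s : a < s -> measurable_fun setT (fun w => (~~ below a s m w)%:R : R).
  move=> h; rewrite (_ : (fun w => _) = (fun w => 1 - (below a s m w)%:R)).
    by apply: measurable_funB => //; exact: mb.
  by apply/funext => w; case: below; rewrite ?subr0 ?subrr.
have nb1 (u : bool) : `|u%:R| <= 1 :> R by case: u; rewrite ?normr0 ?normr1.
have key n : (\int[P]_w (psi w * (below a (s_ n) m w)%:R)%:E +
    \int[P]_w (psi w * (~~ below a (s_ n) m w)%:R * M (s_ n) w)%:E =
    \int[P]_w (psi w * M a w)%:E)%E.
  rewrite below_integral// -ge0_integralD//; last 4 first.
  - by move=> w _; rewrite lee_fin !mulr_ge0// expR_ge0.
  - apply/measurable_EFinP; apply: measurable_funM; last exact: mM.
    by apply: measurable_funM => //; exact: mb.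
  - by move=> w _; rewrite lee_fin !mulr_ge0// expR_ge0.
  - apply/measurable_EFinP; apply: measurable_funM; last exact: mM.
    by apply: measurable_funM => //; exact: mnb.
  rewrite -(@bridge_exp_martingale a (s_ n) b psi m)//.
  apply: eq_integral => w _; rewrite -EFinD -mulrDl -mulrDr.
  by case: (below _ _ _ _); rewrite /= ?addr0 ?add0r mulr1.
have [||w _||n w _|_ L1] := @dominated_convergence_real _ _ R P setT
    (fun n w => psi w * (below a (s_ n) m w)%:R)
    (fun w => psi w * (below a b m w)%:R) psi measurableT.
- by move=> n; apply: measurable_funM => //; exact: mb.
- by apply: measurable_funM => //; exact: mb.
- apply: cvg_near_cst; have [->|pw] := eqVneq (psi w) 0.
    by apply: nearW => n; rewrite !mul0r.
  have [ha hb] := psi_ab pw.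
  case hw : (below a b m w); last first.
    apply: nearW => n; case hn : (below a (s_ n) m w) => //.
    by rewrite (below_last _ _ hn) in hw.
  move/asboolP : hw => [q [/andP[aq qb] hq]].
  have {}qb : q < b.
    by rewrite lt_neqAle qb andbT; apply/eqP => qE; move: hq; rewrite qE ltNge (ltW hb).
  have /cvgrPdist_lt/(_ (b - q)) := cs; rewrite subr_gt0 => /(_ qb).
  apply: filterS => n; rewrite gtr0_norm ?subr_gt0// => hn.
  suff -> : below a (s_ n) m w by [].
  by apply/asboolP; exists q; split => //; rewrite aq; lra.
- exact: Ipsi.
- by rewrite normrM (ger0_norm (psi0 w)) ler_piMr.
have [||w _||n w _|_] := @dominated_convergence_real _ _ R P setT
    (fun n w => psi w * (~~ below a (s_ n) m w)%:R * M (s_ n) w)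
    (fun w => 0) psi measurableT.
- move=> n; apply: measurable_funM; last exact: mM.
  by apply: measurable_funM => //; exact: mnb.
- exact: measurable_cst.
- have [->|pw] := eqVneq (psi w) 0.
    by under eq_fun do rewrite !mul0r; exact: cvg_cst.
  have [ha hb] := psi_ab pw.
  set y := X b w - m w; have y0 : 0 < y by rewrite subr_gt0.
  have cx : X (s_ n) w - m w @[n --> \oo] --> y.
    apply: cvgB; last exact: cvg_cst.
    exact: (cvg_comp _ _ cs (@continuous_bpath w b)).
  (* Upper bound from exp(-u) <= 1 / u, where u = 2 (X_s - m) (X_b - m) / (b - s) tends to
     infinity. *)
  have h0 : psi w * ((b - s_ n) / (2 * (X (s_ n) w - m w) * y)) @[n --> \oo] --> (0 : R).
    have -> : 0 = psi w * ((b - b) / (2 * y * y)) by rewrite subrr mul0r mulr0.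
    apply: cvgM; first exact: cvg_cst.
    apply: cvgM; first by apply: cvgB; [exact: cvg_cst|exact: cs].
    apply: cvgV; first by rewrite !mulf_neq0// gt_eqF.
    apply: cvgM; last exact: cvg_cst.
    by apply: cvgM; [exact: cvg_cst|exact: cx].
  apply: (squeeze_cvgr _ (cvg_cst 0) h0).
  have /cvgrPdist_lt/(_ _ y0) := cx; apply: filterS => n hn.
  have xn : 0 < X (s_ n) w - m w.
    by move: hn; rewrite ltr_norml => /andP[_ ?]; lra.
  rewrite !mulr_ge0 ?expR_ge0//= -mulrA ler_wpM2l//.
  apply: (@le_trans _ _ (M (s_ n) w)).
    by rewrite ler_piMl ?expR_ge0//; case: (~~ _).
  rewrite -[leRHS]invrK expRN lef_pV2 ?posrE ?expR_gt0//; last first.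
    by rewrite invr_gt0 divr_gt0 ?subr_gt0// !mulr_gt0.
  rewrite invf_div; apply: le_trans (expR_ge1Dx _).
  by rewrite lerDr.
- exact: Ipsi.
- rewrite !normrM (ger0_norm (psi0 w)) (ger0_norm (expR_ge0 _)).
  have [->|pw] := eqVneq (psi w) 0; first by rewrite !mul0r.
  rewrite -mulrA ler_piMr//; have [ha hb] := psi_ab pw.
  case hn : (below a (s_ n) m w); first by rewrite normr0 mul0r.
  rewrite normr1 mul1r -[leRHS]expR0 ler_expR oppr_le0.
  rewrite divr_ge0 ?subr_ge0 ?(ltW (sb n))// mulr_ge0 ?subr_ge0 ?(ltW hb)// mulr_ge0// subr_ge0.
  rewrite leNgt; apply/negP => h; move/negP : hn; apply; apply/asboolP.
  by exists (s_ n); rewrite lexx ltW.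
move=> L2.
have L3 : (\int[P]_w (psi w * (below a (s_ n) m w)%:R)%:E +
    \int[P]_w (psi w * (~~ below a (s_ n) m w)%:R * M (s_ n) w)%:E @[n --> \oo] -->
    \int[P]_w (psi w * (below a b m w)%:R)%:E + 0)%E.
  apply: cvgeD => //; first by rewrite fin_num_adde_defl.
  by have -> : (0 = \int[P]_w (0%R)%:E)%E by rewrite integral0.
rewrite (funext key) in L3.
rewrite -[LHS]adde0.
exact: (cvg_unique (@ereal_hausdorff R) L3 (cvg_cst _)).
Qed.

End reflection.

Definition above (a b : R) (m : T -> R) (w : T) : bool :=
  `[< forall q, a <= q <= b -> m w < X q w >].

(** A continuous path that exceeds m strictly on a compact interval exceeds m + e for small e. The
    form on the right has the strict inequalities at both ends that [reflection_integral]
    requires. *)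
Lemma cvg_above a b (m : T -> R) w (e : nat -> R) : a <= b ->
  (forall n, 0 < e n) -> e n @[n --> \oo] --> 0 ->
  \forall n \near \oo, above a b m w = [&& ~~ below a b (fun w => m w + e n) w,
    m w + e n < X a w & m w + e n < X b w].
Proof.
move=> ab e0 ce; rewrite /above; case: asboolP => [h|h]; last first.
  apply: nearW => n; apply/esym/negbTE/negP => /and3P[+ _ _]; move/asboolP; apply.
  apply: contrapT => h1; apply: h => q qab; rewrite ltNge; apply/negP => h2.
  apply: h1; exists q; split => //; apply: (le_lt_trans h2).
  by rewrite ltrDl.
have [c cab cmin] : exists2 c, c \in `[a, b] & forall t, t \in `[a, b] -> X c w <= X t w.
  by apply: EVT_min => //; apply: continuous_subspaceT; exact: continuous_bpath.
have /cvgrPdist_lt/(_ (X c w - m w)) := ce; rewrite subr_gt0.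
have mc : m w < X c w by apply: h; move: cab; rewrite in_itv.
move=> /(_ mc); apply: filterS => n; rewrite sub0r normrN gtr0_norm// => hn.
apply/esym/and3P.
have hq q : a <= q <= b -> m w + e n < X q w.
  by move=> qab; apply: lt_le_trans (cmin q _); [lra|rewrite in_itv].
split; [|by apply: hq; rewrite lexx|by apply: hq; rewrite lexx andbT].
apply/negP => /asboolP[q [/hq + ]]; lra.
Qed.

Lemma measurable_above a b m : a < b -> measurable_fun setT m ->
  measurable_fun setT (fun w => (above a b m w)%:R : R).
Proof.
move=> ab mm.
apply: (@measurable_fun_cvg _ _ _ _ (fun n w =>
  [&& ~~ below a b (fun w => m w + n.+1%:R^-1) w,
    m w + n.+1%:R^-1 < X a w & m w + n.+1%:R^-1 < X b w]%:R : R)).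
  move=> n; under eq_fun do rewrite -[[&& _, _ & _]]/((~~ _) && (_ && _)) -mulnb natrM.
  have mn : measurable_fun setT (fun w => m w + n.+1%:R^-1) by exact: measurable_funD.
  apply: measurable_funM.
    rewrite (_ : (fun w => _) = (fun w => 1 - (below a b (fun w => m w + n.+1%:R^-1) w)%:R)).
      by apply: measurable_funB => //; exact: measurable_below.
    by apply/funext => w; case: below; rewrite ?subr0 ?subrr.
  apply: measurable_boolR; apply: measurable_and.
    by apply: measurable_fun_ltr => //; exact: measurable_bpath.
  by apply: measurable_fun_ltr => //; exact: measurable_bpath.
move=> w _; apply: cvg_near_cst; near=> n; congr (_%:R); congr nat_of_bool; apply/esym.
near: n; apply: (@cvg_above a b m w (fun n => n.+1%:R^-1)); first exact: ltW.
  by move=> n; rewrite invr_gt0.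
exact: cvg_harmonic.
Unshelve. all: by end_near. Qed.

(* Probability that a bridge of length L between x and y stays positive. *)
Definition stay (L x y : R) : R := 1 - expR (- (2 * Num.max x 0 * Num.max y 0 / L)).

Lemma stay_pos (L x y : R) : 0 <= x -> 0 <= y -> stay L x y = 1 - expR (- (2 * x * y / L)).
Proof. by move=> x0 y0; rewrite /stay !max_l. Qed.

Lemma stay_le0l (L x y : R) : x <= 0 -> stay L x y = 0.
Proof. by move=> x0; rewrite /stay max_r// mulr0 !mul0r oppr0 expR0 subrr. Qed.

Lemma stay_le0r (L x y : R) : y <= 0 -> stay L x y = 0.
Proof. by move=> y0; rewrite /stay (max_r y0)// mulr0 !mul0r oppr0 expR0 subrr. Qed.

Lemma stay_itv (L x y : R) : 0 < L -> 0 <= stay L x y <= 1.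
Proof.
move=> L0; rewrite /stay subr_ge0 gerBl expR_ge0 andbT -expR0 ler_expR oppr_le0.
by rewrite divr_ge0 ?(ltW L0)// !mulr_ge0// le_max lexx orbT.
Qed.

Lemma continuous_stay (L x y : R) (e : nat -> R) : e n @[n --> \oo] --> 0 ->
  stay L (x - e n) (y - e n) @[n --> \oo] --> stay L x y.
Proof.
move=> ce; have cm (z : R) : Num.max (z - e n) 0 @[n --> \oo] --> Num.max z 0.
  have h : z - e n @[n --> \oo] --> z.
    by rewrite -[X in _ --> X]subr0; apply: cvgB => //; exact: cvg_cst.
  apply: (@cvg_comp _ _ _ (fun n => z - e n) (fun z : R => Num.max z 0) _ _ _ h).
  by apply: (@continuous_max R R id (fun=> 0)); [exact: cvg_id|exact: cvg_cst].
apply: cvgB; first exact: cvg_cst.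
apply: (@cvg_comp _ _ _
  (fun n => - (2 * Num.max (x - e n) 0 * Num.max (y - e n) 0 / L)) (@expR R));
  last exact: continuous_expR.
apply: cvgN; apply: cvgM; last exact: cvg_cst.
by apply: cvgM => //; apply: cvgM => //; exact: cvg_cst.
Qed.

Lemma measurable_stay d' (T' : measurableType d') (L : R) (f g : T' -> R) :
  measurable_fun setT f -> measurable_fun setT g ->
  measurable_fun setT (fun w => stay L (f w) (g w)).
Proof.
move=> mf mg; apply: measurable_funB => //; apply: measurableT_comp => //.
apply: measurableT_comp => //; apply: measurable_funM => //.
apply: measurable_funM; last exact: measurable_maxr.
by apply: measurable_funM => //; exact: measurable_maxr.
Qed.

(** The reflection principle is applied at the level m + 1/(n + 1), with [phi] cut to the event that
    both ends exceed it; where they do not, [stay] vanishes. Both sides then converge by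
    domination. *)
Lemma ge0_above_integral (a b : R) (m phi : T -> R) :
  0 <= a -> a < b -> b <= 1 ->
  measurable_fun setT (m : outT a b -> R) -> measurable_fun setT (phi : outT a b -> R) ->
  (forall w, 0 <= phi w) -> P.-integrable setT (EFin \o phi) ->
  (\int[P]_w (phi w * (above a b m w)%:R)%:E =
   \int[P]_w (phi w * stay (b - a) (X a w - m w) (X b w - m w))%:E)%E.
Proof.
move=> a0 ab b1 mm mphi phi0 Iphi.
have mm' := outside_measurable mm; have mphi' := outside_measurable mphi.
pose e (n : nat) : R := n.+1%:R^-1.
have e0 n : 0 < e n by rewrite invr_gt0.
have ce : e n @[n --> \oo] --> (0 : R) by exact: cvg_harmonic.
have mXa : measurable_fun setT (X a : outT a b -> R) by apply: outside_bpath; rewrite ?lexx.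
have mXb : measurable_fun setT (X b : outT a b -> R) by apply: outside_bpath; rewrite ?lexx ?orbT.
have nb1 (u : bool) : `|u%:R| <= 1 :> R by case: u; rewrite ?normr0 ?normr1.
have ba : 0 < b - a by rewrite subr_gt0.
pose mn n w := m w + e n.
pose u n w := (mn n w < X a w) && (mn n w < X b w).
pose psi n w := phi w * (u n w)%:R.
have mmn n : measurable_fun setT (mn n : outT a b -> R) by exact: measurable_funD.
have mu n : measurable_fun setT (u n : outT a b -> bool).
  by apply: measurable_and; exact: measurable_fun_ltr.
have mpsi n : measurable_fun setT (psi n : outT a b -> R).
  by apply: measurable_funM => //; exact: measurable_boolR.
have mpsi' n := outside_measurable (mpsi n).
have mmn' n := outside_measurable (mmn n).
have Ipsi n : P.-integrable setT (EFin \o psi n).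
  apply: (le_integrable measurableT _ _ Iphi); first exact/measurable_EFinP.
  by move=> w _ /=; rewrite lee_fin normrM ler_piMr.
have psi0 n w : 0 <= psi n w by rewrite mulr_ge0.
have key n : (\int[P]_w (psi n w * (~~ below a b (mn n) w)%:R)%:E =
   \int[P]_w (phi w * stay (b - a) (X a w - mn n w) (X b w - mn n w))%:E)%E.
  have pn w : psi n w != 0 -> mn n w < X a w /\ mn n w < X b w.
    rewrite /psi; case hu : (u n w); last by rewrite mulr0 eqxx.
    by move=> _; apply/andP.
  have := reflection_integral a0 ab b1 (mmn n) (mpsi n) (psi0 n) pn (Ipsi n).
  set J1 := (X in X = _ -> _); set J2 := (X in _ = X -> _) => J12.
  have mb : measurable_fun setT (fun w => (below a b (mn n) w)%:R : R).
    exact: measurable_below.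
  have I1 : P.-integrable setT (fun w => (psi n w * (below a b (mn n) w)%:R)%:E).
    apply: (le_integrable measurableT _ _ (Ipsi n)).
      by apply/measurable_EFinP; exact: measurable_funM.
    by move=> w _ /=; rewrite lee_fin normrM ler_piMr.
  pose Mn w := stay (b - a) (X a w - mn n w) (X b w - mn n w).
  have mMn : measurable_fun setT Mn.
    by apply: measurable_stay; apply: measurable_funB => //; exact: measurable_bpath.
  have I2 : P.-integrable setT (fun w => (psi n w * Mn w)%:E).
    apply: (le_integrable measurableT _ _ (Ipsi n)).
      by apply/measurable_EFinP; exact: measurable_funM.
    move=> w _ /=; have /andP[s0 s1] := stay_itv (X a w - mn n w) (X b w - mn n w) ba.
    by rewrite lee_fin normrM ler_piMr// ger0_norm.
  have E1 : (\int[P]_w (psi n w * (~~ below a b (mn n) w)%:R)%:E =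
      \int[P]_w (psi n w)%:E - J1)%E.
    rewrite /J1 -(integralB measurableT (Ipsi n) I1); apply: eq_integral => w _.
    rewrite -EFinB; congr EFin.
    by case: (below _ _ _ _); rewrite ?mulr0 ?mulr1 ?subr0 ?subrr.
  have E2 : (\int[P]_w (psi n w * Mn w)%:E = \int[P]_w (psi n w)%:E - J2)%E.
    have -> : J2 = (\int[P]_w (psi n w - psi n w * Mn w)%:E)%E.
      apply: eq_integral => w _; congr EFin.
      have [->|/pn[h1 h2]] := eqVneq (psi n w) 0; first by rewrite !mul0r subrr.
      by rewrite /Mn stay_pos ?subr_ge0 ?ltW//; ring.
    under [X in (_ - X)%E]eq_integral do rewrite EFinB.
    rewrite (integralB measurableT (Ipsi n) I2).
    have f1 := integrable_fin_num measurableT (Ipsi n).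
    have f2 := integrable_fin_num measurableT I2.
    move: f1 f2; rewrite /comp.
    case: (integral _ _ _) => // x _; case: (integral _ _ _) => // y _.
    by rewrite -!EFinB; congr EFin; ring.
  rewrite E1 J12 -E2; apply: eq_integral => w _; congr EFin.
  rewrite /psi /Mn; case hu : (u n w); first by rewrite mulr1.
  rewrite mulr0 mul0r; move/negbT: hu; rewrite negb_and -!leNgt => /orP[h|h].
    by rewrite stay_le0l ?mulr0// subr_le0.
  by rewrite stay_le0r ?mulr0// subr_le0.
have [||w _||n w _|_ L1] := @dominated_convergence_real _ _ R P setT
    (fun n w => psi n w * (~~ below a b (mn n) w)%:R)
    (fun w => phi w * (above a b m w)%:R) phi measurableT.
- move=> n; apply: measurable_funM => //.
  rewrite (_ : (fun w => _) = (fun w => 1 - (below a b (mn n) w)%:R)).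
    by apply: measurable_funB => //; exact: measurable_below.
  by apply/funext => w; case: below; rewrite ?subr0 ?subrr.
- by apply: measurable_funM => //; exact: measurable_above.
- apply: cvg_near_cst.
  have := cvg_above m w (ltW ab) e0 ce; apply: filterS => n ->.
  rewrite /psi /u -mulrA -natrM mulnb andbC.
  by case: (~~ _); rewrite //= ?andbF.
- exact: Iphi.
- rewrite normrM; apply: (@le_trans _ _ (psi n w)).
    by rewrite (ger0_norm (psi0 _ _)) ler_piMr.
  by rewrite /psi ler_piMr//; case: (u n w).
have [||w _||n w _|_ L2] := @dominated_convergence_real _ _ R P setT
    (fun n w => phi w * stay (b - a) (X a w - mn n w) (X b w - mn n w))
    (fun w => phi w * stay (b - a) (X a w - m w) (X b w - m w)) phi measurableT.
- move=> n; apply: measurable_funM => //.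
  by apply: measurable_stay; apply: measurable_funB => //; exact: measurable_bpath.
- apply: measurable_funM => //.
  by apply: measurable_stay; apply: measurable_funB => //; exact: measurable_bpath.
- apply: cvgM; first exact: cvg_cst.
  have := @continuous_stay (b - a) (X a w - m w) (X b w - m w) e ce.
  by apply: cvg_trans; apply: near_eq_cvg; apply: nearW => n; rewrite /mn !opprD !addrA.
- exact: Iphi.
- have /andP[s0 s1] := stay_itv (X a w - mn n w) (X b w - mn n w) ba.
  by rewrite normrM (ger0_norm (phi0 _)) ler_piMr// ger0_norm.
rewrite (funext key) in L1.
exact: (cvg_unique (@ereal_hausdorff R) L1 L2).
Qed.

Lemma above_integral (a b : R) (m phi : T -> R) :
  0 <= a -> a < b -> b <= 1 ->
  measurable_fun setT (m : outT a b -> R) -> measurable_fun setT (phi : outT a b -> R) ->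
  P.-integrable setT (EFin \o phi) ->
  (\int[P]_w (phi w * (above a b m w)%:R)%:E =
   \int[P]_w (phi w * stay (b - a) (X a w - m w) (X b w - m w))%:E)%E.
Proof.
move=> a0 ab b1 mm mphi Iphi.
have mm' := outside_measurable mm.
have ba : 0 < b - a by rewrite subr_gt0.
pose p w := Num.max (phi w) 0; pose q w := Num.max (- phi w) 0.
have pqE w : phi w = p w - q w.
  rewrite /p /q; have [h|h] := leP 0 (phi w).
    by rewrite max_r ?subr0// oppr_le0.
  by rewrite max_l ?sub0r ?opprK// oppr_ge0 ltW.
have mp : measurable_fun setT (p : outT a b -> R) by exact: measurable_maxr.
have mq : measurable_fun setT (q : outT a b -> R).
  by apply: measurable_maxr => //; exact: measurableT_comp.
have p0 w : 0 <= p w by rewrite le_max lexx orbT.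
have q0 w : 0 <= q w by rewrite le_max lexx orbT.
have pphi w : p w <= `|phi w| by rewrite ge_max ler_norm normr_ge0.
have qphi w : q w <= `|phi w| by rewrite ge_max -normrN ler_norm normr_ge0.
have mp' := outside_measurable mp; have mq' := outside_measurable mq.
have Ip : P.-integrable setT (EFin \o p).
  apply: (le_integrable measurableT _ _ Iphi); first exact/measurable_EFinP.
  by move=> w _ /=; rewrite lee_fin ger0_norm.
have Iq : P.-integrable setT (EFin \o q).
  apply: (le_integrable measurableT _ _ Iphi); first exact/measurable_EFinP.
  by move=> w _ /=; rewrite lee_fin ger0_norm.
have split (f : T -> R) : measurable_fun setT f -> (forall w, 0 <= f w <= 1) ->
    (\int[P]_w (phi w * f w)%:E = \int[P]_w (p w * f w)%:E - \int[P]_w (q w * f w)%:E)%E.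
  move=> mf f01.
  have hI r : (forall w, 0 <= r w) -> P.-integrable setT (EFin \o r) ->
      P.-integrable setT (fun w => (r w * f w)%:E).
    move=> r0 Ir; have mr := measurable_int _ Ir; move/measurable_EFinP : mr => mr.
    apply: (le_integrable measurableT _ _ Ir).
      by apply/measurable_EFinP; exact: measurable_funM.
    move=> w _ /=; have /andP[f0 f1] := f01 w.
    by rewrite lee_fin normrM ler_piMr// ger0_norm.
  rewrite -(integralB measurableT (hI _ p0 Ip) (hI _ q0 Iq)).
  by apply: eq_integral => w _; rewrite -EFinB -mulrBl -pqE.
rewrite split; [|exact: measurable_above|by move=> w; case: (above _ _ _ _); rewrite ?lexx ?ler01].
rewrite split; last first.
- by move=> w; exact: stay_itv.
- by apply: measurable_stay; apply: measurable_funB => //; exact: measurable_bpath.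
by rewrite !ge0_above_integral.
Qed.

End hitting.

(** * Minimum and first argmin of a path *)

Section path_minimum.
Context {R : realType}.
Implicit Type f : R -> R.

Definition pmin f (a b : R) : R := inf [set f q | q in `[a, b]].

Lemma pmin_attained f a b : continuous f -> a <= b ->
  exists2 c, a <= c <= b & pmin f a b = f c.
Proof.
move=> cf ab; have [|c cab cmin] := @EVT_min R f a b ab.
  exact: continuous_subspaceT.
exists c; first by move: cab; rewrite in_itv.
apply/eqP; rewrite eq_le; apply/andP; split.
  apply: ge_inf; last by exists c.
  by exists (f c) => _ [q /= qab <-]; exact: cmin.
apply: lb_le_inf; first by exists (f c), c.
by move=> _ [q /= qab <-]; exact: cmin.
Qed.

Lemma pmin_le f a b q : continuous f -> a <= q <= b -> pmin f a b <= f q.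
Proof.
move=> cf qab; have ab : a <= b by case/andP : qab; exact: le_trans.
have [|c cab cmin] := @EVT_min R f a b ab; first exact: continuous_subspaceT.
apply: ge_inf; last by exists q => //=; rewrite in_itv.
by exists (f c) => _ [p /= pab <-]; exact: cmin.
Qed.

Lemma lt_pmin f a b x : continuous f -> a <= b ->
  (x < pmin f a b) <-> (forall q, a <= q <= b -> x < f q).
Proof.
move=> cf ab; split => [h q qab|h]; first exact: (lt_le_trans h (pmin_le cf qab)).
by have [c cab ->] := pmin_attained cf ab; exact: h.
Qed.

Lemma pmin_lt f a b x : continuous f -> a <= b ->
  (pmin f a b < x) <-> (exists q, a <= q <= b /\ f q < x).
Proof.
move=> cf ab; split => [h|[q [qab fq]]].
  by have [c cab E] := pmin_attained cf ab; exists c; split => //; rewrite -E.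
exact: le_lt_trans (pmin_le cf qab) fq.
Qed.

Lemma pmin_split f a b c : continuous f -> a <= b -> b <= c ->
  pmin f a c = Num.min (pmin f a b) (pmin f b c).
Proof.
move=> cf ab bc; have ac := le_trans ab bc.
apply/eqP; rewrite eq_le le_min; apply/andP; split; [apply/andP; split|].
- have [q /andP[aq qb] ->] := pmin_attained cf ab.
  by apply: pmin_le => //; rewrite aq (le_trans qb).
- have [q /andP[bq qc] ->] := pmin_attained cf bc.
  by apply: pmin_le => //; rewrite qc (le_trans ab).
have [q /andP[aq qc] ->] := pmin_attained cf ac.
rewrite ge_min; have [qb|bq] := leP q b.
  by rewrite pmin_le ?aq.
by rewrite (@pmin_le _ b c) ?(ltW bq) ?orbT.
Qed.

Section argmin.
Variable f : R -> R.
Hypothesis cf : continuous f.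

Lemma first_argmin_eq (t : R) : 0 <= t <= 1 -> (forall q, 0 <= q <= 1 -> f t <= f q) ->
  (forall q, 0 <= q -> q < t -> f t < f q) -> first_argmin f = t.
Proof.
move=> t01 tmin tfirst; have At : argmin_set f t by [].
have lb : lbound (argmin_set f) t.
  move=> q [q01 qmin]; rewrite leNgt; apply/negP => qt.
  have /andP[q0 _] := q01; have := tfirst q q0 qt.
  by rewrite ltNge qmin.
apply/eqP; rewrite eq_le; apply/andP; split; first by apply: ge_inf => //; exists t.
by apply: lb_le_inf => //; exists t.
Qed.

(** The minimisers on [0, 1] form a closed set, which therefore contains its infimum. *)
Lemma first_argmin_exists : exists t : R,
  [/\ 0 <= t <= 1, f t = pmin f 0 1 & forall q, 0 <= q -> q < t -> f t < f q].
Proof.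
have [c c01 cE] := pmin_attained cf (@ler01 R).
pose A := [set q : R | 0 <= q <= 1] `&` f @^-1` [set pmin f 0 1].
have A0 : A !=set0 by exists c.
have clA : closed A.
  apply: closedI.
    rewrite (_ : [set q : R | _] = `[0, 1]%classic); last by apply/seteqP; split => q /=; rewrite in_itv.
    exact: itv_closed.
  by apply: closed_comp => [q _|]; [exact: cf|exact: closed_eq].
have lbA : has_lbound A by exists 0 => q [/andP[]].
have At : A (inf A).
  have : closure A (inf A).
    move=> V [e /= e0 eV].
    have [q Aq qe] := inf_adherent e0 (conj A0 lbA).
    exists q; split => //; apply: eV => /=.
    have h : inf A <= q by apply: ge_inf.
    by rewrite distrC ger0_norm ?subr_ge0// ltrBlDl.
  by move/closure_id : clA => <-.
exists (inf A); have [t01 tE] := At; split => // q q0 qt.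
rewrite lt_neqAle [in X in _ && X]tE pmin_le ?andbT//; last first.
  by rewrite q0 (le_trans (ltW qt))//; case/andP : t01.
apply/negP => /eqP qE; move: (qt); rewrite ltNge => /negP; apply; apply: ge_inf => //.
split; last by rewrite /= -qE.
by rewrite /= q0 (le_trans (ltW qt))//; case/andP : t01.
Qed.

Lemma first_argmin_itv : 0 <= first_argmin f <= 1.
Proof.
have [t [t01 tE tf]] := first_argmin_exists.
by rewrite (first_argmin_eq t01 _ tf)// => q q01; rewrite tE; exact: pmin_le.
Qed.

Lemma first_argminE : f (first_argmin f) = pmin f 0 1.
Proof.
have [t [t01 tE tf]] := first_argmin_exists.
by rewrite (first_argmin_eq t01 _ tf)// => q q01; rewrite tE; exact: pmin_le.
Qed.

Lemma first_argmin_lt q : 0 <= q -> q < first_argmin f -> pmin f 0 1 < f q.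
Proof.
have [t [t01 tE tf]] := first_argmin_exists.
rewrite (first_argmin_eq t01 _ tf); last by move=> p p01; rewrite tE; exact: pmin_le.
by move=> q0 qt; rewrite -tE; exact: tf.
Qed.

(** Expresses the events of the argmin by comparing two minima over fixed intervals; this is how its
    measurability is obtained. *)
Lemma first_argmin_le (t : R) : 0 <= t <= 1 ->
  (first_argmin f <= t) = (pmin f 0 t <= pmin f 0 1).
Proof.
move=> /andP[t0 t1]; apply/idP/idP => [h|].
  rewrite -first_argminE; apply: pmin_le => //.
  by have /andP[-> _] := first_argmin_itv.
apply: contraTT; rewrite -!ltNge => h; apply/lt_pmin => // q /andP[q0 qt].
by apply: first_argmin_lt => //; exact: le_lt_trans qt h.
Qed.

End argmin.

Lemma eq_first_argmin f g : (forall q, 0 <= q <= 1 -> f q = g q) ->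
  first_argmin f = first_argmin g.
Proof.
move=> fg; congr inf; apply/seteqP; split => t [t01 tm]; split => // s s01.
  by rewrite -!fg// tm.
by rewrite !fg// tm.
Qed.

End path_minimum.

Section continuous_process.
Context d (T : measurableType d) (R : realType).
Variable Y : R -> T -> R.
Hypothesis cY : forall w, continuous (Y ^~ w).

Lemma measurable_pmin (a b : R) : a <= b ->
  (forall q, a <= q <= b -> measurable_fun setT (Y q)) ->
  measurable_fun setT (fun w => pmin (Y ^~ w) a b).
Proof.
move=> ab mY _; apply: (measurability _ (RGenInftyO.measurableE R)) => //.
move=> _ [_ [x ->] <-]; rewrite setTI.
have [abE|ab'] := eqVneq a b.
  rewrite (_ : _ @^-1` _ = [set w | Y a w < x]); last first.
    apply/seteqP; split => w /=; rewrite in_itv/=.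
      move/(pmin_lt _ (@cY w) ab) => [q []]; rewrite -abE => /andP[h1 h2].
      by rewrite (_ : q = a)//; apply/eqP; rewrite eq_le h1 h2.
    by move=> h; apply/(pmin_lt _ (@cY w) ab); exists a; rewrite lexx.
  rewrite -[X in measurable X]setTI; have := mY a; rewrite lexx ab => /(_ isT) mYa.
  rewrite (_ : [set w | _] = Y a @^-1` `]-oo, x[); first exact: mYa.
  by apply/seteqP; split => w /=; rewrite in_itv.
have {}ab' : a < b by rewrite lt_neqAle ab'.
rewrite (_ : _ @^-1` _ = \bigcup_n \bigcup_(k in [set k | (k <= 2 ^ n)%N])
    (Y (dyadic_grid a b n k) @^-1` `]-oo, x[)); last first.
  apply/seteqP; split => w /=; rewrite ?in_itv/=.
    move/(pmin_lt _ (@cY w) ab) => h.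
    have [n _ /(_ n (leqnn n))[k kn hk]] := dyadic_strict_hit (@cY w) ab' h.
    by exists n => //; exists k => //=; rewrite in_itv.
  move=> [n _ [k /= kn]]; rewrite in_itv/= => hk.
  apply/(pmin_lt _ (@cY w) ab); exists (dyadic_grid a b n k); split => //.
  exact: dyadic_grid_itv.
apply: bigcupT_measurable => n; apply: bigcup_measurable => k /= kn.
rewrite -[X in measurable X]setTI; apply: mY => //; exact: dyadic_grid_itv.
Qed.

Hypothesis mY : forall q, measurable_fun setT (Y q).

Lemma measurable_first_argmin : measurable_fun setT (fun w => first_argmin (Y ^~ w)).
Proof.
move=> _; apply: (measurability _ (RGenOInfty.measurableE R)) => //.
move=> _ [_ [t ->] <-]; rewrite setTI.
have [t0|t0] := ltP t 0.
  rewrite (_ : _ @^-1` _ = setT)//; apply/seteqP; split => w //= _.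
  rewrite in_itv/= andbT; apply: (lt_le_trans t0).
  by have /andP[] := first_argmin_itv (@cY w).
have [t1|t1] := ltP 1 t.
  rewrite (_ : _ @^-1` _ = set0)//; apply/seteqP; split => w //=.
  rewrite in_itv/= andbT ltNge => /negP; apply.
  by apply: le_trans (ltW t1); have /andP[] := first_argmin_itv (@cY w).
rewrite (_ : _ @^-1` _ = [set w | pmin (Y ^~ w) 0 1 < pmin (Y ^~ w) 0 t]); last first.
  apply/seteqP; split => w /=; rewrite in_itv/= andbT !ltNge (first_argmin_le (@cY w)) ?t0//.
rewrite -[X in measurable X]setTI.
have m1 : measurable_fun setT (fun w => pmin (Y ^~ w) 0 1 < pmin (Y ^~ w) 0 t).
  by apply: measurable_fun_ltr; apply: measurable_pmin.
exact: (m1 measurableT [set true]).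
Qed.

(** Rounding the time down to multiples of 1/(n + 1) leaves countably many measurable pieces, and
    path continuity gives the limit. *)
Lemma measurable_eval_joint : measurable_fun setT (fun z : R * T => Y z.1 z.2).
Proof.
pose q (n : nat) (r : R) : R := (Num.floor (r * n.+1%:R))%:~R / n.+1%:R.
apply: (@measurable_fun_cvg _ _ _ _ (fun n (z : R * T) => Y (q n z.1) z.2)).
  move=> n _ A mA; rewrite setTI.
  rewrite (_ : _ @^-1` _ = \bigcup_(k : int)
    (`[(k%:~R / n.+1%:R)%R, ((k + 1)%:~R / n.+1%:R)%R[%classic `*` (Y (k%:~R / n.+1%:R) @^-1` A))).
    apply: countable_bigcupT_measurable => // k; apply: measurableX => //.
    by rewrite -[X in measurable X]setTI; exact: mY.
  apply/seteqP; split => -[r w] /=.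
    move=> h; exists (Num.floor (r * n.+1%:R)) => //; split => //=.
    by rewrite in_itv/= ler_pdivrMr// ltr_pdivlMr// floor_itv.
  move=> [k _ [/= + h]]; rewrite in_itv/= ler_pdivrMr// ltr_pdivlMr// => kr.
  by rewrite /q (floor_def kr).
move=> [r w] _ /=.
apply: (@cvg_comp _ _ _ (fun n => q n r) (Y ^~ w)); last exact: cY.
apply: (@squeeze_cvgr _ _ _ _ (fun n => r - n.+1%:R^-1) (fun=> r)).
- apply: nearW => n; rewrite /q; have /andP[h1 h2] := floor_itv (r * n.+1%:R).
  rewrite ler_pdivrMr// h1 andbT ler_pdivlMr// mulrBl mulVf//.
  by rewrite lerBlDr -[leRHS]/(_ + 1%:~R) -intrD ltW.
- rewrite -[X in _ --> X]subr0; apply: cvgB; first exact: cvg_cst.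
  exact: cvg_harmonic.
- exact: cvg_cst.
Qed.

Lemma measurable_eval (th : T -> R) : measurable_fun setT th ->
  measurable_fun setT (fun w => Y (th w) w).
Proof.
move=> mth.
apply: (@measurableT_comp _ _ _ _ _ _ _ setT (fun w => (th w, w)) measurable_eval_joint).
exact: measurable_fun_pair.
Qed.

End continuous_process.

(** * Moment bounds near the minimum *)

Lemma measurable_invr (R : realType) : measurable_fun setT (@GRing.inv R).
Proof.
have -> : [set: R] = [set x | x != 0] `|` [set 0].
  by apply/seteqP; split => x //= _; case: (eqVneq x 0); [right|left].
have o0 : open [set x : R | x != 0].
  rewrite (_ : [set x | _] = ~` [set 0]); last by apply/seteqP; split => x /= /eqP.
  by apply: closed_openC; exact: closed_eq.
apply/measurable_funU => //; first exact: open_measurable.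
split; last exact: measurable_fun_set1.
by apply: open_continuous_measurable_fun => // x; rewrite inE => x0; exact: cvgV.
Qed.

Section comparison_sets.
Context d (T : measurableType d) (R : realType).

Lemma measurable_ltset (f g : T -> R) : measurable_fun setT f -> measurable_fun setT g ->
  measurable [set w | f w < g w].
Proof.
by move=> mf mg; have /(_ measurableT [set true] I) := measurable_fun_ltr mf mg; rewrite setTI.
Qed.

Lemma measurable_leset (f g : T -> R) : measurable_fun setT f -> measurable_fun setT g ->
  measurable [set w | f w <= g w].
Proof.
by move=> mf mg; have /(_ measurableT [set true] I) := measurable_fun_ler mf mg; rewrite setTI.
Qed.

Lemma integral_bool (P : probability T R) (u : T -> bool) : measurable [set w | u w] ->
  (\int[P]_w ((u w)%:R : R)%:E = P [set w | u w])%E.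
Proof.
move=> mu; rewrite -[in RHS](setIT [set w | u w]) -integral_indic//.
apply: eq_integral => w _; rewrite indicE; congr ((_%:R)%:E).
by congr nat_of_bool; apply/idP/idP; rewrite inE.
Qed.

End comparison_sets.

Section dyadic_tail.
Context d (T : measurableType d) (R : realType) (P : probability T R).

(** A layer-cake estimate: [Z] is dominated pointwise by weights on level sets whose weighted
    probabilities form a geometric series of sum C. *)
Lemma dyadic_tail_bound (Z : T -> R) (A : (set T)^nat) (a : nat -> R) (c0 C : R) :
  measurable_fun setT Z -> (forall w, 0 <= Z w) -> (forall k, measurable (A k)) ->
  (forall k, 0 <= a k) -> 0 <= c0 -> 0 <= C ->
  (forall w, exists n, Z w <= c0 + \sum_(k < n) a k * \1_(A k) w) ->
  (forall k, ((a k)%:E * P (A k) <= (C / 2 ^+ k.+1)%:E)%E) ->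
  (\int[P]_w (Z w)%:E <= (c0 + C)%:E)%E.
Proof.
move=> mZ Z0 mA a0 c00 C0 hZ hP.
pose f k w : \bar R := (a k * \1_(A k) w)%:E.
have f0 k w : (0 <= f k w)%E by rewrite lee_fin mulr_ge0.
have mf k : measurable_fun setT (f k).
  apply/measurable_EFinP; apply: measurable_funM => //.
have mS : measurable_fun setT (fun w => \sum_(0 <= k <oo) f k w)%E.
  by apply: ge0_emeasurable_sum.
apply: (@le_trans _ _ (\int[P]_w (c0%:E + \sum_(0 <= k <oo) f k w))%E).
  apply: ge0_le_integral => //.
  - by move=> w _; rewrite lee_fin.
  - exact/measurable_EFinP.
  - by apply: emeasurable_funD.
  move=> w _; have [n /le_trans h] := hZ w.
  apply: (@le_trans _ _ (c0%:E + \sum_(0 <= k < n) f k w)%E).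
    by rewrite big_mkord sumEFin -EFinD lee_fin h.
  by rewrite leeD2l//; apply: nneseries_lim_ge.
rewrite ge0_integralD//; last by move=> w _; apply: nneseries_ge0.
rewrite EFinD; apply: leeD.
  by rewrite integral_cst//= probability_setT mule1.
rewrite integral_nneseries//.
apply: (@le_trans _ _ (\sum_(0 <= k <oo) (0 + (C / (2 ^ k.+1)%:R)%:E))%E).
  apply: lee_nneseries => [k _ _|k _]; first exact: integral_ge0.
  under eq_integral do rewrite /f EFinM.
  rewrite ge0_integralZl; last 4 first.
  - exact: measurableT.
  - by apply/measurable_EFinP; exact: measurable_indic.
  - by move=> w _; rewrite lee_fin.
  - by rewrite lee_fin.
  by rewrite integral_indic// setIT add0e natrX.
apply: (le_trans (epsilon_trick _ _ C0)) => //.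
by rewrite eseries0 ?add0e.
Qed.

(** If n is least with D >= 4^-(n+1), then 1 / D <= 4^(n+1), so the weights 4^(k+1) on the sets D <
    4^-k dominate. A tail of order e^3 at the level e^2, with e = 2^-k, gives 4^(k+1) C 8^-k = 8 C /
    2^(k+1). Where D is 0 the inverse is 0 by convention. *)
Lemma inv_tail_bound (D : T -> R) (C : R) : measurable_fun setT D -> (forall w, 0 <= D w) ->
  0 <= C -> (forall k, (P [set w | (D w < (2^-1 ^+ k) ^+ 2)%R] <= (C * (2^-1 ^+ k) ^+ 3)%:E)%E) ->
  (\int[P]_w ((D w)^-1)%:E <= (1 + 8 * C)%:E)%E.
Proof.
move=> mD D0 C0 hC.
apply: (@dyadic_tail_bound (fun w => (D w)^-1)
  (fun k => [set w | D w < (2^-1 ^+ k) ^+ 2]) (fun k => 4 ^+ k.+1)) => //.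
- by apply: measurableT_comp => //; exact: measurable_invr.
- by move=> w; rewrite invr_ge0.
- by move=> k; exact: measurable_ltset.
- by rewrite mulr_ge0.
- move=> w; set Dw := D w; have := D0 w; rewrite -/Dw le_eqVlt => /predU1P[<-|Dp].
    by exists 0%N; rewrite invr0 big_ord0 addr0.
  have [D1|D1] := leP 1 Dw.
    by exists 0%N; rewrite big_ord0 addr0 invf_le1.
  have sq k : (2^-1 ^+ k) ^+ 2 = (4 ^+ k)^-1 :> R.
    by rewrite -exprM mulnC exprM exprVn -natrX exprVn.
  have ex : exists n, (4 ^+ n.+1)^-1 <= Dw.
    have [n hn] : exists n, Dw^-1 <= 4 ^+ n.+1.
      have Di0 : 0 <= Dw^-1 by rewrite invr_ge0 ltW.
      exists (Num.truncn Dw^-1); have /andP[_ /ltW h] := truncn_itv Di0.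
      by apply: (le_trans h); rewrite -natrX ler_nat; apply/ltnW/ltn_expl.
    by exists n; rewrite -[leRHS]invrK lef_pV2 ?posrE ?invr_gt0 ?exprn_gt0.
  case: (ex_minnP ex) => n hn nmin; exists n.+1.
  rewrite big_ord_recr/=; set Sg := \sum_(_ < _) _.
  have Sg0 : 0 <= Sg by apply: sumr_ge0 => k _; rewrite mulr_ge0.
  rewrite indicE mem_set ?mulr1; last first.
    rewrite /= -/Dw sq; case: n {hn Sg Sg0} nmin => [|n] nmin; first by rewrite invr1.
    by rewrite ltNge; apply/negP => /nmin; rewrite ltnn.
  have : Dw^-1 <= 4 ^+ n.+1 by rewrite -[leRHS]invrK lef_pV2 ?posrE ?invr_gt0 ?exprn_gt0.
  lra.
move=> k; have h0 : 0 < 2^-1 ^+ k :> R by rewrite exprn_gt0.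
apply: (@le_trans _ _ ((4 ^+ k.+1)%:E * (C * (2^-1 ^+ k) ^+ 3)%:E)%E).
  by apply: lee_wpmul2l; [rewrite lee_fin exprn_ge0|exact: hC].
rewrite -EFinM lee_fin.
have -> : 4 ^+ k.+1 = 4 * (2 ^+ k) ^+ 2 :> R.
  have e4 : 4 = 2 ^+ 2 :> R by rewrite expr2; lra.
  by rewrite e4 exprS -!exprM mulnC.
suff -> : 4 * (2 ^+ k) ^+ 2 * (C * (2^-1 ^+ k) ^+ 3) = 8 * C / 2 ^+ k.+1 by [].
have -> : 2^-1 ^+ k = (2 ^+ k)^-1 :> R by rewrite exprVn.
by rewrite (exprS 2 k); field; rewrite expf_neq0.
Qed.

End dyadic_tail.

Section bridge_extrema.
Context d (T : measurableType d) (R : realType) (P : probability T R).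

Lemma brownian_bridge_opp (lambda : R) (B : R -> {RV P >-> R}) :
  brownian_bridge lambda B ->
  exists B' : R -> {RV P >-> R}, brownian_bridge (- lambda) B' /\ forall t w, B' t w = - B t w.
Proof.
move=> [cB B0 gB].
have mN t : measurable_fun setT (fun w => - B t w) by exact: measurableT_comp.
pose B' t : {RV P >-> R} := HB.pack (fun w => - B t w) (isMeasurableFun.Build _ _ _ _ _ (mN t)).
exists B'; split => //; split.
- move=> w; move: (cB w) => /subspace_continuousP cBw; apply/subspace_continuousP => t t01.
  exact: cvgN (cBw t t01).
- by move=> w; rewrite /= B0 oppr0.
move=> n t a ht A mA.
have := gB n t (fun i => - a i) ht A mA.
rewrite (_ : \sum_(i < n) - a i * (lambda * t i) = \sum_(i < n) a i * (- lambda * t i)).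
  rewrite (_ : \sum_(i < n) \sum_(j < n) _ = \sum_(i < n) \sum_(j < n)
      a i * a j * (Num.min (t i) (t j) - t i * t j)).
    move=> <-; rewrite (_ : (fun w => _) = fun w => \sum_(i < n) - a i * B (t i) w)//.
    by apply/funext => w; apply: eq_bigr => i _ /=; rewrite mulrN mulNr.
  by apply: eq_bigr => i _; apply: eq_bigr => j _; rewrite mulrNN.
by apply: eq_bigr => i _; ring.
Qed.

Section one_bridge.
Variables (lambda : R) (B : R -> {RV P >-> R}).
Hypothesis hB : brownian_bridge lambda B.
Local Notation X := (bpath B).

Lemma bpath0 w : X 0 w = 0.
Proof. by have [_ B0 _] := hB; rewrite /bpath clamp01_id ?lexx ?ler01. Qed.

Lemma bpath_end_prob : P [set w | X 1 w != lambda] = 0%E.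
Proof.
have [_ _ gB] := hB.
have := gB 1%N (fun=> 1) (fun=> 1) (fun=> introT andP (conj ler01 (lexx 1))) [set lambda].
have -> : (fun w => \sum_(i < 1) 1 * B 1 w) = B 1.
  by apply/funext => w; rewrite big_ord1 mul1r.
rewrite !big_ord1 !mulr1 minxx subrr mulr0 /gaussian_law eqxx mul1r => /(_ (measurable_set1 _)).
rewrite diracE mem_set// => h.
have mB : measurable (B 1 @^-1` [set lambda]).
  by rewrite -[X in measurable X]setTI; apply: measurable_funP => //; exact: measurable_set1.
have := probability_setC P mB; rewrite h subee// => <-.
congr (P _); apply/seteqP; split => w /=; rewrite /bpath clamp01_id ?lexx ?ler01//.
  by move/eqP.
by move=> h2; apply/eqP.
Qed.

Lemma aboveE a b (m : T -> R) w : a <= b -> above B a b m w = (m w < pmin (X ^~ w) a b).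
Proof.
move=> ab; apply/asboolP/idP => [h|/(lt_pmin _ (@continuous_bpath _ _ _ _ _ _ hB w) ab)//].
exact/(lt_pmin _ (@continuous_bpath _ _ _ _ _ _ hB w) ab).
Qed.

(** The formula for staying above a level over [0, 1], where the initial value is 0 and the final
    value almost surely lambda, so that the probability involved is a constant. *)
Lemma pmin_tail (c : R) : 0 <= c -> 0 <= lambda + c ->
  P [set w | pmin (X ^~ w) 0 1 <= - c] = (expR (- (2 * c * (lambda + c))))%:E.
Proof.
move=> c0 lc0.
have mp : measurable_fun setT (fun w => pmin (X ^~ w) 0 1).
  by apply: measurable_pmin => // w; exact: (@continuous_bpath _ _ _ _ _ _ hB w).
have mS : measurable [set w | - c < pmin (X ^~ w) 0 1].
  exact: measurable_ltset.
have Ic : P.-integrable setT (EFin \o (fun _ : T => 1 : R)).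
  apply: (@bounded_integrable _ _ _ P _ 1) => // w; by rewrite normr1.
have := @ge0_above_integral _ _ _ _ _ _ hB 0 1 (fun=> - c) (fun=> 1) (lexx _) ltr01
  (lexx _) (measurable_cst _) (measurable_cst _) (fun=> ler01) Ic.
under eq_integral do rewrite mul1r aboveE//.
have -> : (\int[P]_w ((- c < pmin (X ^~ w) 0 1)%R%:R : R)%:E =
    P [set w | (- c < pmin (X ^~ w) 0 1)%R])%E.
  exact: integral_bool.
rewrite (@ae_eq_integral _ _ _ P setT (fun=> (1 - expR (- (2 * c * (lambda + c))))%:E))//;
  last 2 first.
- apply/measurable_EFinP; apply: measurable_funM => //.
  by apply: measurable_stay; apply: measurable_funB => //; exact: measurable_bpath.
- exists [set w | X 1 w != lambda]; split.
  + rewrite (_ : [set w | _] = ~` (X 1 @^-1` [set lambda])); last first.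
      by apply/seteqP; split => w /= /eqP.
    apply: measurableC; rewrite -[X in measurable X]setTI.
    by apply: measurable_bpath => //; exact: measurable_set1.
  + exact: bpath_end_prob.
  move=> w /= h; apply/eqP => E; apply: h => _; rewrite E bpath0 subr0 opprK add0r mul1r.
  by rewrite stay_pos// divr1.
rewrite integral_cst//= probability_setT mule1 => h.
rewrite (_ : [set w | _] = ~` [set w | - c < pmin (X ^~ w) 0 1]); last first.
  by apply/seteqP; split => w /=; rewrite leNgt => /negP.
by rewrite probability_setC// h -EFinB; congr EFin; ring.
Qed.

End one_bridge.

Variables (lambda : R) (B : R -> {RV P >-> R}).
Hypothesis hB : brownian_bridge lambda B.
Local Notation X := (bpath B).

(** The supremum of |X|, written with two minima because the staying formula gives the law of a
    minimum; the opposite of a bridge is a bridge. *)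
Definition psup (w : T) : R :=
  Num.max (- pmin (X ^~ w) 0 1) (- pmin (fun q => - X q w) 0 1).

Let cX w : continuous (X ^~ w). Proof. exact: (@continuous_bpath _ _ _ _ _ _ hB). Qed.
Let cNX w : continuous (fun q => - X q w). Proof. by move=> q; apply: cvgN; exact: cX. Qed.

Lemma bpath_clamp q w : X q w = X (clamp01 q) w.
Proof. by rewrite /bpath (clamp01_id (clamp01_itv _)). Qed.

Lemma psup_ge q w : `|X q w| <= psup w.
Proof.
rewrite bpath_clamp; have c01 := clamp01_itv q.
have h1 := pmin_le (@cX w) c01; have h2 := pmin_le (@cNX w) c01.
rewrite ler_norml /psup lerNl !le_max !lerN2 h1/=.
by rewrite [X in _ || X]lerNr h2 orbT.
Qed.

Lemma psup_ge0 w : 0 <= psup w.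
Proof. exact: le_trans (normr_ge0 _) (psup_ge 0 w). Qed.

Lemma measurable_psup : measurable_fun setT psup.
Proof.
apply: measurable_maxr; apply: measurableT_comp => //; apply: measurable_pmin => //.
by move=> q _; apply: measurableT_comp => //; exact: measurable_bpath.
Qed.

Lemma psup_tail (k : nat) : `|lambda| + 1 <= k%:R ->
  (P [set w | (k%:R <= psup w)%R] <= (2 * 4^-1 ^+ k)%:E)%E.
Proof.
move=> hk; have := ler_norm lambda; have := ler_norm (- lambda); rewrite normrN => l1 l2.
have k0 : (0 : R) <= k%:R by [].
(* As l + k >= 1 the exponent is at least 2 k in absolute value, and exp 1 >= 2 gives the base 4. *)
have ex (l : R) : `|l| <= `|lambda| -> expR (- (2 * k%:R * (l + k%:R))) <= 4^-1 ^+ k :> R.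
  move=> hl; have := ler_norm (- l); rewrite normrN => l3.
  rewrite expRN exprVn lef_pV2 ?posrE ?expR_gt0 ?exprn_gt0//.
  apply: (@le_trans _ _ (expR (k%:R * 2))); last first.
    rewrite ler_expR; have : (1 : R) <= l + k%:R by lra.
    by move=> h; rewrite -[leLHS]mulr1 (mulrC k%:R) ler_wpM2l// mulr_ge0.
  rewrite expRM_natl lerXn2r ?nnegrE ?expR_ge0//.
  have h1 := @expR_ge1Dx R 1.
  rewrite (_ : 2 = 1 + 1 :> R)// expRD; have e1 : 2 <= expR 1 :> R by lra.
  by rewrite (_ : 4 = 2 * 2 :> R) ?ler_pM//; lra.
have [B' [hB' B'E]] := brownian_bridge_opp hB.
have E w : (fun q => - X q w) = (bpath B') ^~ w.
  by apply/funext => q; rewrite /bpath B'E.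
have m1 (Y : R -> T -> R) : (forall w, continuous (Y ^~ w)) -> (forall q, measurable_fun setT (Y q)) ->
    measurable [set w | pmin (Y ^~ w) 0 1 <= - k%:R].
  by move=> cY mY; apply: measurable_leset => //; exact: measurable_pmin.
have cB' w : continuous (bpath B' ^~ w) by exact: (@continuous_bpath _ _ _ _ _ _ hB').
rewrite (_ : [set w | _] = [set w | pmin (X ^~ w) 0 1 <= - k%:R] `|`
    [set w | pmin (bpath B' ^~ w) 0 1 <= - k%:R]); last first.
  apply/seteqP; split => w /=; rewrite /psup le_max -E !(lerNr (k%:R)).
    by move=> /orP.
  by move=> h; apply/orP.
apply: le_trans (measureU2 _ _ _) _.
- by apply: m1 => // q; exact: measurable_bpath.
- by apply: m1 => // q; exact: measurable_bpath.
have g1 : 0 <= lambda + k%:R by lra.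
have g2 : 0 <= - lambda + k%:R by lra.
have h1 := pmin_tail hB k0 g1; have h2 := pmin_tail hB' k0 g2.
apply: (@le_trans _ _ ((expR (- (2 * k%:R * (lambda + k%:R))))%:E +
  (expR (- (2 * k%:R * (- lambda + k%:R))))%:E)%E).
  by apply: leeD; [rewrite -h1|rewrite -h2].
rewrite -EFinD lee_fin (_ : 2 * 4^-1 ^+ k = 4^-1 ^+ k + 4^-1 ^+ k :> R); last by ring.
by rewrite lerD// ex// normrN.
Qed.

Lemma integral_psup2 : (\int[P]_w ((psup w) ^+ 2)%:E < +oo)%E.
Proof.
(* The levels start where the tail bound becomes available. *)
pose N0 := (Num.truncn (`|lambda| + 1)).+1.
have hN k : `|lambda| + 1 <= (N0 + k)%:R.
  have l0 : 0 <= `|lambda| + 1 by rewrite addr_ge0.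
  have /andP[_ /ltW h] := truncn_itv l0.
  by apply: (le_trans h); rewrite ler_nat leq_addr.
apply: (@le_lt_trans _ _ (N0%:R ^+ 2 + 8)%:E); last by rewrite ltry.
(* The weights 2 k + 1 are differences of consecutive squares, so their sum over the levels reached
   telescopes to a bound of the square of [psup]. *)
have sumE j : (N0 + j)%:R ^+ 2 = N0%:R ^+ 2 + \sum_(k < j) ((N0 + k)%:R * 2 + 1) :> R.
  elim: j => [|j ih]; first by rewrite big_ord0 addn0 addr0.
  by rewrite big_ord_recr/= addrA -ih addnS -natr1; ring.
apply: (@dyadic_tail_bound _ _ _ P (fun w => psup w ^+ 2)
  (fun k => [set w | (N0 + k)%:R <= psup w]) (fun k => (N0 + k)%:R * 2 + 1)) => //.
- by apply: measurable_funX; exact: measurable_psup.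
- by move=> w; rewrite exprn_ge0// psup_ge0.
- by move=> k; apply: measurable_leset => //; exact: measurable_psup.
- move=> w; have /andP[h1 h2] := truncn_itv (psup_ge0 w).
  set n := Num.truncn (psup w) in h1 h2.
  have sq : psup w ^+ 2 <= n.+1%:R ^+ 2.
    by rewrite lerXn2r ?nnegrE ?psup_ge0// ltW.
  exists (n.+1 - N0)%N; apply: (le_trans sq).
  have [nN|Nn] := leqP n.+1 N0.
    have -> : (n.+1 - N0 = 0)%N by apply/eqP; rewrite subn_eq0.
    by rewrite big_ord0 addr0 -!natrX ler_nat leq_exp2r.
  rewrite -{1}(subnKC (ltnW Nn)) sumE lerD2l; apply: ler_sum => k _.
  rewrite indicE mem_set ?mulr1//=; apply: le_trans h1.
  have := ltn_ord k; rewrite ler_nat => kn; rewrite -ltnS.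
  by rewrite -ltn_subRL.
move=> k; apply: (@le_trans _ _ (((N0 + k)%:R * 2 + 1)%:E * (2 * 4^-1 ^+ (N0 + k))%:E)%E).
  by apply: lee_wpmul2l; [rewrite lee_fin addr_ge0// mulr_ge0|exact: psup_tail].
rewrite -EFinM lee_fin; set m := (N0 + k)%N.
have m2 : m%:R * 2 + 1 <= 2 * 2 ^+ m :> R.
  rewrite -natrX -!natrM natr1 ler_nat -ltnS muln2.
  have : (m < 2 ^ m)%N by exact: ltn_expl.
  by move: (2 ^ m)%N => z mz; rewrite ltnS mul2n ltn_double.
apply: (@le_trans _ _ (2 * 2 ^+ m * (2 * 4^-1 ^+ m))).
  by rewrite ler_wpM2r// mulr_ge0// exprn_ge0.
have -> : 2 * 2 ^+ m * (2 * 4^-1 ^+ m) = 4 / 2 ^+ m :> R.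
  rewrite (_ : 4 = 2 * 2 :> R); last by ring.
  by rewrite invfM exprMn !exprVn; field; rewrite expf_neq0.
have -> : 8 / 2 ^+ k.+1 = 4 / 2 ^+ k :> R.
  by rewrite exprS; field; rewrite expf_neq0.
rewrite ler_pM2l// lef_pV2 ?posrE ?exprn_gt0// ler_weXn2l//; first by rewrite ler1n.
exact: leq_addl.
Qed.

Local Notation gm w := (pmin (X ^~ w) 0 1).

Let mX q : measurable_fun setT (X q). Proof. exact: measurable_bpath. Qed.

Lemma measurable_gmin : measurable_fun setT (fun w => gm w).
Proof. by apply: measurable_pmin => // w; exact: cX. Qed.

Lemma gmin_le q w : gm w <= X q w.
Proof. by rewrite bpath_clamp; apply: pmin_le; [exact: cX|exact: clamp01_itv]. Qed.

Lemma integral_psupD2 (c : R) : 0 <= c ->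
  (\int[P]_w ((c + 2 * psup w) ^+ 2)%:E < +oo)%E.
Proof.
move=> c0; have mS := measurable_psup.
apply: (@le_lt_trans _ _ (\int[P]_w ((2 * c ^+ 2)%:E + 8%:E * ((psup w) ^+ 2)%:E))%E).
  apply: ge0_le_integral => //.
  - by move=> w _; rewrite lee_fin exprn_ge0// addr_ge0// mulr_ge0// psup_ge0.
  - apply/measurable_EFinP; apply: measurable_funX; apply: measurable_funD => //.
    exact: measurable_funM.
  - apply: emeasurable_funD => //; apply: measurable_funeM.
    by apply/measurable_EFinP; exact: measurable_funX.
  move=> w _; rewrite -EFinM -EFinD lee_fin.
  by have := sqr_ge0 (c - 2 * psup w); rewrite !expr2; lra.
rewrite ge0_integralD; last 5 first.
- exact: measurableT.
- by move=> w _; rewrite lee_fin mulr_ge0// exprn_ge0.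
- exact: measurable_cst.
- by move=> w _; rewrite mule_ge0// lee_fin exprn_ge0// psup_ge0.
- apply: measurable_funeM; apply/measurable_EFinP; exact: measurable_funX.
rewrite integral_cst//= probability_setT mule1 ge0_integralZl//; last 2 first.
- by apply/measurable_EFinP; exact: measurable_funX.
- by move=> w _; rewrite lee_fin exprn_ge0// psup_ge0.
rewrite lte_add_pinfty// ?ltry// lte_mul_pinfty//.
exact: integral_psup2.
Qed.

Lemma integrable_psup : P.-integrable setT (EFin \o psup).
Proof.
apply/integrableP; split; first by apply/measurable_EFinP; exact: measurable_psup.
apply: le_lt_trans (integral_psupD2 ler01).
apply: ge0_le_integral => //.
- by apply: measurableT_comp => //; apply/measurable_EFinP; exact: measurable_psup.
- apply/measurable_EFinP; apply: measurable_funX; apply: measurable_funD => //.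
  by apply: measurable_funM => //; exact: measurable_psup.
move=> w _ /=; rewrite lee_fin ger0_norm ?psup_ge0//.
by have := psup_ge0 w; have := sqr_ge0 (psup w); rewrite !expr2; lra.
Qed.

Lemma measurable_pmin_outside (a b u v : R) : 0 <= a -> b <= 1 -> u <= v ->
  (v <= a) || (b <= u) ->
  measurable_fun setT ((fun w => pmin (X ^~ w) u v) : g_sigma_algebraType (outside_gen B a b) -> R).
Proof.
move=> a0 b1 uv h.
apply: (@measurable_pmin _ (g_sigma_algebraType (outside_gen B a b)) R X) => //.
move=> q /andP[uq qv]; apply: outside_bpath => //; case/orP : h => h; apply/orP; [left|right].
  exact: le_trans qv h.
exact: le_trans h uq.
Qed.

(** The event says that the path stays above X_r - dl on both sides of r. This level depends on X_r
    only, so the staying formula applies to [r, 1] and then to [0, r]. *)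
Lemma gmin_near_prob (r dl : R) : 0 < r -> r < 1 -> 0 < dl ->
  (P [set w | (X r w - gm w < dl)%R] =
   \int[P]_w (stay r (X 0 w - X r w + dl) dl * stay (1 - r) dl (X 1 w - X r w + dl))%:E)%E.
Proof.
move=> r0 r1 dl0; pose th w := X r w - dl.
have t1 w : X r w - th w = dl by rewrite /th opprB addrC subrK.
have t2 q w : X q w - th w = X q w - X r w + dl by rewrite /th opprB addrA addrAC.
have oX a b q : 0 <= a -> b <= 1 -> (q <= a) || (b <= q) ->
  measurable_fun setT (X q : g_sigma_algebraType (outside_gen B a b) -> R) := @outside_bpath _ _ _ _ B a b q.
have mth1 : measurable_fun setT (th : g_sigma_algebraType (outside_gen B r 1) -> R).
  by apply: measurable_funB => //; apply: oX; rewrite ?lexx ?(ltW r0).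
have mth2 : measurable_fun setT (th : g_sigma_algebraType (outside_gen B 0 r) -> R).
  by apply: measurable_funB => //; apply: oX; rewrite ?lexx ?orbT ?(ltW r1).
have mb1 : measurable_fun setT
    ((fun w => (above B 0 r th w)%:R) : g_sigma_algebraType (outside_gen B r 1) -> R).
  apply: measurable_boolR.
  rewrite (_ : above B 0 r th = fun w => th w < pmin (X ^~ w) 0 r); last first.
    by apply/funext => w; rewrite (aboveE hB)// ltW.
  apply: measurable_fun_ltr => //; apply: measurable_pmin_outside => //; rewrite ?(ltW r0) ?lexx//.
have mth := outside_measurable mth1.
have mf1 : measurable_fun setT ((fun w => stay (1 - r) dl (X 1 w - X r w + dl)) :
    g_sigma_algebraType (outside_gen B 0 r) -> R).
  apply: measurable_stay => //; apply: measurable_funD => //; apply: measurable_funB.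
    by apply: oX; rewrite ?lexx ?(ltW r1) ?orbT.
  by apply: oX; rewrite ?lexx ?(ltW r1) ?orbT.
have I1 : P.-integrable setT (fun w => ((above B 0 r th w)%:R : R)%:E).
  apply: (@bounded_integrable _ _ _ P _ 1); first exact: outside_measurable mb1.
  by move=> w; case: (above _ _ _ _ _); rewrite ?normr1 ?normr0.
have s01 x y : 0 <= stay (1 - r) x y <= 1 by apply: stay_itv; rewrite subr_gt0.
have I2 : P.-integrable setT (fun w => (stay (1 - r) dl (X 1 w - X r w + dl))%:E).
  apply: (@bounded_integrable _ _ _ P _ 1); first exact: outside_measurable mf1.
  by move=> w; have /andP[h1 h2] := s01 dl (X 1 w - X r w + dl); rewrite ger0_norm.
have := @ge0_above_integral _ _ _ _ _ _ hB r 1 th _ (ltW r0) r1 (lexx _) mth1 mb1 (fun=> ler0n _ _) I1.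
have := @ge0_above_integral _ _ _ _ _ _ hB 0 r th _ (lexx _) r0 (ltW r1) mth2 mf1
  (fun w => proj1 (andP (s01 _ _))) I2.
rewrite subr0 => e2 e1.
transitivity (\int[P]_w ((above B 0 r th w)%:R * (above B r 1 th w)%:R)%:E)%E.
  rewrite -integral_bool; last by apply: measurable_ltset => //; apply: measurable_funB => //; exact: measurable_gmin.
  apply: eq_integral => w _; rewrite -natrM mulnb; congr ((_%:R)%:E); congr nat_of_bool.
  rewrite !(aboveE hB) ?(ltW r0) ?(ltW r1)// /th (@pmin_split _ _ 0 r 1 (@cX w) (ltW r0) (ltW r1)).
  by rewrite ltrBlDl -ltrBlDr lt_min.
rewrite e1; transitivity (\int[P]_w (stay (1 - r) dl (X 1 w - X r w + dl) * (above B 0 r th w)%:R)%:E)%E.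
  by apply: eq_integral => w _; rewrite t1 t2 mulrC.
by rewrite e2; apply: eq_integral => w _; rewrite t1 t2 mulrC.
Qed.

Lemma stayC (L x y : R) : stay L x y = stay L y x.
Proof. by rewrite /stay -!mulrA (mulrA (Num.max x 0)) (mulrC (Num.max x 0)) -!mulrA. Qed.

Lemma stay_le_lin (L x y k : R) : 0 < L -> 0 <= y -> 0 <= k -> x <= k ->
  stay L x y <= 2 * k * y / L.
Proof.
move=> L0 y0 k0 xk; rewrite /stay (max_l y0).
have h := @expR_ge1Dx R (- (2 * Num.max x 0 * y / L)).
apply: (@le_trans _ _ (2 * Num.max x 0 * y / L)); first by lra.
rewrite ler_wpM2r ?invr_ge0 ?(ltW L0)// ler_wpM2r// ler_wpM2l//.
by rewrite ge_max xk.
Qed.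

(** A probability bounded by z^2 is bounded by z. Half of the power of e is given up in order to
    have L^(-1/2), integrable near 0, in place of 1 / L. *)
Lemma stay_le_sqrt (L x e k : R) : 0 < L -> 0 < e -> 1 <= k -> x <= k ->
  stay L x (e ^+ 2) <= 2 * k * e / Num.sqrt L.
Proof.
move=> L0 e0 k1 xk; have k0 : 0 <= k by exact: le_trans k1.
set z := 2 * k * e / Num.sqrt L.
have sL : 0 < Num.sqrt L by rewrite sqrtr_gt0.
have z0 : 0 <= z by rewrite divr_ge0 ?(ltW sL)// !mulr_ge0// ltW.
have /andP[_ s1] := stay_itv x (e ^+ 2) L0.
have [z1|z1] := leP 1 z; first exact: le_trans s1 z1.
apply: (le_trans (stay_le_lin L0 (exprn_ge0 2 (ltW e0)) k0 xk)).
apply: (@le_trans _ _ (z ^+ 2)); last by rewrite expr2 ler_piMr// ltW.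
rewrite /z !exprMn exprVn sqr_sqrtr ?(ltW L0)//.
rewrite ler_wpM2r ?invr_ge0 ?(ltW L0)// ler_wpM2r ?exprn_ge0 ?(ltW e0)//.
rewrite -exprMn expr2 ler_peMr ?mulr_ge0//; lra.
Qed.

Definition edge_weight (r : R) : R := (Num.sqrt r)^-1 + (Num.sqrt (1 - r))^-1.

Lemma edge_weight_ge0 r : 0 <= edge_weight r.
Proof. by rewrite addr_ge0// invr_ge0 sqrtr_ge0. Qed.

Definition psup_moment : R := fine (\int[P]_w ((1 + 2 * psup w) ^+ 2)%:E).

Lemma psup_momentE : (\int[P]_w ((1 + 2 * psup w) ^+ 2)%:E = psup_moment%:E)%E.
Proof.
rewrite /psup_moment fineK// ge0_fin_numE ?integral_psupD2//.
by apply: integral_ge0 => w _; rewrite lee_fin sqr_ge0.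
Qed.

Lemma psup_moment_ge0 : 0 <= psup_moment.
Proof. by rewrite fine_ge0// integral_ge0// => w _; rewrite lee_fin sqr_ge0. Qed.

(** For r <= 1/2 the right side has length at least 1/2 and gives e^2 through [stay_le_lin], while
    the left side gives e / sqrt r through [stay_le_sqrt]. The other case is symmetric. *)
Lemma gmin_near_bound (r e : R) : 0 < r -> r < 1 -> 0 < e -> e <= 1 ->
  (P [set w | (X r w - gm w < e ^+ 2)%R] <= (8 * e ^+ 3 * psup_moment * edge_weight r)%:E)%E.
Proof.
move=> r0 r1 e0 e1; have r1' : 0 < 1 - r by rewrite subr_gt0.
have e20 : 0 < e ^+ 2 by rewrite exprn_gt0.
have e21 : e ^+ 2 <= 1 by rewrite exprn_ile1// ltW.
rewrite gmin_near_prob//.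
have -> : (8 * e ^+ 3 * psup_moment * edge_weight r)%:E =
    ((8 * e ^+ 3 * edge_weight r)%:E * \int[P]_w ((1 + 2 * psup w) ^+ 2)%:E)%E.
  by rewrite psup_momentE -EFinM; congr EFin; ring.
have mk : measurable_fun setT (fun w => ((1 + 2 * psup w) ^+ 2)%:E).
  apply/measurable_EFinP; apply: measurable_funX; apply: measurable_funD => //.
  by apply: measurable_funM => //; exact: measurable_psup.
have c0 : 0 <= 8 * e ^+ 3 * edge_weight r.
  by rewrite mulr_ge0 ?edge_weight_ge0// mulr_ge0// exprn_ge0// ltW.
rewrite -ge0_integralZl//; last by move=> w _; rewrite lee_fin sqr_ge0.
apply: ge0_le_integral => //.
- move=> w _; have /andP[h1 _] := stay_itv (X 0 w - X r w + e ^+ 2) (e ^+ 2) r0.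
  have /andP[h2 _] := stay_itv (e ^+ 2) (X 1 w - X r w + e ^+ 2) r1'.
  by rewrite lee_fin mulr_ge0.
- apply/measurable_EFinP; apply: measurable_funM; apply: measurable_stay => //;
    by apply: measurable_funD => //; exact: measurable_funB.
- exact: measurable_funeM.
move=> w _; rewrite -EFinM lee_fin.
set k := 1 + 2 * psup w.
have S0 := psup_ge0 w.
have k1 : 1 <= k by rewrite /k; lra.
have k0 : 0 <= k by lra.
have hx q : X q w - X r w + e ^+ 2 <= k.
  have := psup_ge q w; have := psup_ge r w; rewrite !ler_norml => /andP[a1 a2] /andP[b1 b2].
  by rewrite /k; lra.
have kk : 8 * e ^+ 3 * edge_weight r * k ^+ 2 =
    4 * k ^+ 2 * e ^+ 3 * (2 / Num.sqrt r) + 4 * k ^+ 2 * e ^+ 3 * (2 / Num.sqrt (1 - r)).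
  by rewrite /edge_weight; ring.
have s1 := stay_itv (X 0 w - X r w + e ^+ 2) (e ^+ 2) r0.
have s2 := stay_itv (e ^+ 2) (X 1 w - X r w + e ^+ 2) r1'.
have p0 u : 0 <= 4 * k ^+ 2 * e ^+ 3 * (2 / Num.sqrt u).
  by rewrite !mulr_ge0 ?invr_ge0 ?sqrtr_ge0 ?exprn_ge0// ltW.
rewrite kk; have [h|h] := leP r (1 / 2).
  apply: (@le_trans _ _ (4 * k ^+ 2 * e ^+ 3 * (2 / Num.sqrt r))); last by rewrite lerDl.
  apply: (@le_trans _ _ ((2 * k * e / Num.sqrt r) * (2 * k * e ^+ 2 / (1 - r)))).
    apply: ler_pM; [by case/andP : s1|by case/andP : s2|exact: stay_le_sqrt|].
    by rewrite stayC; apply: stay_le_lin => //; exact: ltW.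
  rewrite (_ : _ * _ = 4 * k ^+ 2 * e ^+ 3 * ((1 - r)^-1 / Num.sqrt r)); last by ring.
  rewrite ler_wpM2l ?mulr_ge0 ?exprn_ge0 ?(ltW e0)// ler_wpM2r ?invr_ge0 ?sqrtr_ge0//.
  rewrite -[leRHS]invrK lef_pV2 ?posrE ?invr_gt0//; lra.
apply: (@le_trans _ _ (4 * k ^+ 2 * e ^+ 3 * (2 / Num.sqrt (1 - r)))); last by rewrite lerDr.
apply: (@le_trans _ _ ((2 * k * e ^+ 2 / r) * (2 * k * e / Num.sqrt (1 - r)))).
  apply: ler_pM; [by case/andP : s1|by case/andP : s2| |].
    by apply: stay_le_lin => //; exact: ltW.
  by rewrite stayC; apply: stay_le_sqrt.
rewrite (_ : _ * _ = 4 * k ^+ 2 * e ^+ 3 * (r^-1 / Num.sqrt (1 - r))); last by ring.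
rewrite ler_wpM2l ?mulr_ge0 ?exprn_ge0 ?(ltW e0)// ler_wpM2r ?invr_ge0 ?sqrtr_ge0//.
rewrite -[leRHS]invrK lef_pV2 ?posrE ?invr_gt0//; lra.
Qed.

Lemma integral_inv_gmin (r : R) : 0 < r -> r < 1 ->
  (\int[P]_w ((X r w - gm w)^-1)%:E <= (1 + 64 * psup_moment * edge_weight r)%:E)%E.
Proof.
move=> r0 r1.
have -> : 64 * psup_moment * edge_weight r = 8 * (8 * psup_moment * edge_weight r) by ring.
apply: inv_tail_bound.
- by apply: measurable_funB => //; exact: measurable_gmin.
- by move=> w; rewrite subr_ge0 gmin_le.
- by rewrite !mulr_ge0 ?psup_moment_ge0 ?edge_weight_ge0.
move=> k; have h0 : 0 < 2^-1 ^+ k :> R by rewrite exprn_gt0.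
have h1 : 2^-1 ^+ k <= 1 :> R by rewrite exprn_ile1// invf_le1// ler1n.
apply: (le_trans (gmin_near_bound r0 r1 h0 h1)); rewrite lee_fin le_eqVlt; apply/orP; left; apply/eqP; ring.
Qed.

Lemma integral_bridge_noise_abs (r : R) : 0 < r -> r < 1 ->
  (\int[P]_w (`|bridge_noise B 0 r 1 w|)%:E <= (Num.sqrt (r * (1 - r)))%:E)%E.
Proof.
move=> r0 r1; have r1' : 0 < 1 - r by rewrite subr_gt0.
have vE : noise_var 0 r 1 = r * (1 - r) by rewrite /noise_var !subr0 divr1.
set s := Num.sqrt (r * (1 - r)).
have s0 : 0 < s by rewrite sqrtr_gt0 mulr_gt0.
have := @ge0_integral_density _ _ _ P (bridge_noise B 0 r 1) (normal_pdf 0 s)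
  (fun x => (`|x|)%:E).
move=> ->; last 6 first.
- exact: measurable_bridge_noise.
- exact: measurable_normal_pdf.
- by move=> x; exact: normal_pdf_ge0.
- by move=> A mA; have := @bridge_noise_law _ _ _ _ _ _ hB 0 r 1 (lexx 0) r0 r1 (lexx 1) A mA; rewrite vE.
- by apply/measurable_EFinP; exact: normr_measurable.
- by move=> x; rewrite lee_fin.
under eq_integral do rewrite -EFinM.
rewrite integral_abs_normal_pdf ?gt_eqF// lee_fin.
rewrite normal_pdf0E ?gt_eqF// expr0n/= oppr0 mul0r expR0 mulr1 /normal_peak.
(* The bound pi >= 2 makes the peak 1 / sqrt (2 pi s^2) at most 1 / (2 s), so the mean absolute
   value is at most s. *)
have pk : (Num.sqrt (s ^+ 2 * pi *+ 2))^-1 <= (2 * s)^-1.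
  rewrite lef_pV2 ?posrE ?mulr_gt0//; last first.
    by rewrite sqrtr_gt0 mulrn_wgt0// mulr_gt0 ?exprn_gt0// pi_gt0.
  rewrite -[leLHS]ger0_norm ?mulr_ge0 ?(ltW s0)// -sqrtr_sqr ler_wsqrtr//.
  have -> : (2 * s) ^+ 2 = s ^+ 2 * 4 by ring.
  rewrite -(mulr_natr (s ^+ 2 * pi) 2) -mulrA ler_wpM2l ?exprn_ge0 ?(ltW s0)//.
  by have := pi_ge2 R; lra.
apply: (@le_trans _ _ (2 * (s ^+ 2 / (2 * s)))).
  by rewrite ler_wpM2l// ler_wpM2l ?exprn_ge0 ?(ltW s0).
rewrite le_eqVlt; apply/orP; left; apply/eqP.
by field; rewrite gt_eqF.
Qed.

(** As X_0 = 0, the increment X_1 - X_r is (1 - r) X_1 minus the noise at r over [0, 1], whose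
    deviation is sqrt (r (1 - r)). Divided by 1 - r, this is of order (1 - r)^(-1/2). *)
Lemma integral_end_increment (r : R) : 0 < r -> r < 1 ->
  (\int[P]_w (`|X 1 w - X r w|)%:E <=
   ((1 - r) * psup_moment + Num.sqrt (r * (1 - r)))%:E)%E.
Proof.
move=> r0 r1; have r1' : 0 < 1 - r by rewrite subr_gt0.
apply: (@le_trans _ _ (\int[P]_w ((1 - r)%:E * ((1 + 2 * psup w) ^+ 2)%:E +
    (`|bridge_noise B 0 r 1 w|)%:E))%E).
  apply: ge0_le_integral => //.
  - by apply/measurable_EFinP; apply: measurableT_comp => //; exact: measurable_funB.
  - apply: emeasurable_funD.
      apply: measurable_funeM; apply/measurable_EFinP; apply: measurable_funX.
      by apply: measurable_funD => //; apply: measurable_funM => //; exact: measurable_psup.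
    apply/measurable_EFinP; apply: measurableT_comp => //; exact: measurable_bridge_noise.
  move=> w _; rewrite -EFinM -EFinD lee_fin.
  rewrite (_ : X 1 w - X r w = (1 - r) * X 1 w - bridge_noise B 0 r 1 w); last first.
    rewrite /bridge_noise; have := bpath0 hB w; rewrite /bpath !clamp01_id ?lexx ?ler01 ?(ltW r0) ?(ltW r1)// => ->.
    by field.
  apply: (le_trans (ler_normB _ _)); rewrite lerD2r normrM gtr0_norm// ler_wpM2l ?(ltW r1')//.
  apply: (le_trans (psup_ge 1 w)); have := psup_ge0 w; have := sqr_ge0 (psup w); rewrite !expr2; lra.
rewrite ge0_integralD//; last 3 first.
- move=> w _; by rewrite mule_ge0 ?lee_fin ?sqr_ge0 ?(ltW r1').
- apply: measurable_funeM; apply/measurable_EFinP; apply: measurable_funX.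
  by apply: measurable_funD => //; apply: measurable_funM => //; exact: measurable_psup.
- apply/measurable_EFinP; apply: measurableT_comp => //; exact: measurable_bridge_noise.
rewrite ge0_integralZl//; last 3 first.
- apply/measurable_EFinP; apply: measurable_funX.
  by apply: measurable_funD => //; apply: measurable_funM => //; exact: measurable_psup.
- by move=> w _; rewrite lee_fin sqr_ge0.
- by rewrite lee_fin ltW.
rewrite psup_momentE -EFinM EFinD leeD2l//.
exact: integral_bridge_noise_abs.
Qed.

Lemma integral_end_slope (r : R) : 0 < r -> r < 1 ->
  (\int[P]_w (`|(X 1 w - X r w) / (1 - r)|)%:E <= (psup_moment + edge_weight r)%:E)%E.
Proof.
move=> r0 r1; have r1' : 0 < 1 - r by rewrite subr_gt0.
under eq_integral do rewrite normrM normfV (gtr0_norm r1') mulrC EFinM.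
rewrite ge0_integralZl//; last 2 first.
- by apply/measurable_EFinP; apply: measurableT_comp => //; exact: measurable_funB.
- by rewrite lee_fin invr_ge0 ltW.
apply: (@le_trans _ _ ((1 - r)^-1%:E * ((1 - r) * psup_moment + Num.sqrt (r * (1 - r)))%:E)%E).
  by apply: lee_wpmul2l; [rewrite lee_fin invr_ge0 ltW|exact: integral_end_increment].
rewrite -EFinM lee_fin mulrDr mulKf ?gt_eqF// lerD2l.
have sr : 0 < Num.sqrt (1 - r) by rewrite sqrtr_gt0.
rewrite /edge_weight sqrtrM ?(ltW r0)//.
have -> : (1 - r)^-1 * (Num.sqrt r * Num.sqrt (1 - r)) = Num.sqrt r / Num.sqrt (1 - r).
  rewrite -{1}(sqr_sqrtr (ltW r1')); by field; rewrite gt_eqF.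
apply: (@le_trans _ _ (1 / Num.sqrt (1 - r))); last by rewrite div1r lerDr invr_ge0 sqrtr_ge0.
rewrite ler_wpM2r ?invr_ge0 ?sqrtr_ge0//.
by rewrite -[leRHS]sqrtr1 ler_wsqrtr// ltW.
Qed.

End bridge_extrema.

(** * Drift of one step above the minimum *)

Lemma sube0_eq (R : realDomainType) (x y : \bar R) : (x - y = 0)%E -> x = y.
Proof.
by case: x => [x||]; case: y => [y||]//; rewrite -EFinB => -[] /eqP; rewrite subr_eq0 => /eqP ->.
Qed.

Section one_step.
Context d (T : measurableType d) (R : realType) (P : probability T R).
Variables (lambda : R) (B : R -> {RV P >-> R}).
Hypothesis hB : brownian_bridge lambda B.
Local Notation X := (bpath B).
Local Notation outT a b := (g_sigma_algebraType (outside_gen B a b)).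
Local Notation above := (above B).

Let cX w : continuous (X ^~ w). Proof. exact: (@continuous_bpath _ _ _ _ _ _ hB). Qed.

(** Truncation and monotone convergence remove the integrability of [phi], which is not known
    beforehand when [phi] contains the unbounded function [drift]. *)
Lemma ge0_above_integral' (a b : R) (m phi : T -> R) :
  0 <= a -> a < b -> b <= 1 ->
  measurable_fun setT (m : outT a b -> R) -> measurable_fun setT (phi : outT a b -> R) ->
  (forall w, 0 <= phi w) ->
  (\int[P]_w (phi w * (above a b m w)%:R)%:E =
   \int[P]_w (phi w * stay (b - a) (X a w - m w) (X b w - m w))%:E)%E.
Proof.
move=> a0 ab b1 mm mphi phi0.
pose f n w := Num.min (phi w) n%:R.
have mf n : measurable_fun setT (f n : outT a b -> R) by exact: measurable_minr.
have f0 n w : 0 <= f n w by rewrite le_min phi0 ler0n.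
have If n : P.-integrable setT (EFin \o f n).
  apply: (@bounded_integrable _ _ _ P _ n%:R); first exact: outside_measurable (mf n).
  by move=> w; rewrite ger0_norm// ge_min lexx orbT.
have key n := ge0_above_integral hB a0 ab b1 mm (mf n) (f0 n) (If n).
have mct (g : T -> R) : measurable_fun setT g -> (forall w, 0 <= g w) ->
    (\int[P]_w (f n w * g w)%:E @[n --> \oo] --> \int[P]_w (phi w * g w)%:E)%E.
  move=> mg g0.
  have cg w : ((f n w * g w)%:E @[n --> \oo] --> (phi w * g w)%:E)%E.
    apply: cvg_EFin; first exact: nearW.
    apply: cvg_near_cst; near=> n; rewrite /f /= min_l//.
    by near: n; exact: nbhs_infty_ger.
  have := @cvg_monotone_convergence _ _ _ P setT measurableT (fun n w => (f n w * g w)%:E).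
  rewrite (_ : (fun x => lim _) = (fun w => (phi w * g w)%:E)); last first.
    by apply/funext => w; apply/cvg_lim.
  apply.
  - move=> n; apply/measurable_EFinP; apply: measurable_funM => //.
    exact: outside_measurable (mf n).
  - by move=> n w _; rewrite lee_fin mulr_ge0.
  move=> w _ i j ij; rewrite lee_fin ler_wpM2r// /f le_min ge_min lexx/=.
  by rewrite ge_min ler_nat ij orbT.
have ba : 0 < b - a by rewrite subr_gt0.
have L1 := mct _ (measurable_above hB ab (outside_measurable mm)) (fun w => ler0n _ _).
have L2 := mct (fun w => stay (b - a) (X a w - m w) (X b w - m w)).
have {}L2 := L2 _ (fun w => proj1 (andP (stay_itv _ _ ba))).
rewrite (funext key) in L1; apply: (cvg_unique (@ereal_hausdorff R) L1); apply: L2.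
have mm' := outside_measurable mm.
by apply: measurable_stay; apply: measurable_funB => //; exact: measurable_bpath.
Unshelve. all: by end_near. Qed.

Lemma above_split (a t b : R) m w : a <= t -> t <= b ->
  above a b m w = above a t m w && above t b m w.
Proof.
move=> at_ tb; have ab := le_trans at_ tb.
by rewrite !(aboveE hB)// (pmin_split (@cX w) at_ tb) lt_min.
Qed.

Lemma outside_above (a b u v : R) m : 0 <= a -> b <= 1 -> u <= v -> (v <= a) || (b <= u) ->
  measurable_fun setT (m : outT a b -> R) ->
  measurable_fun setT ((fun w => (above u v m w)%:R) : outT a b -> R).
Proof.
move=> a0 b1 uv h mm; apply: measurable_boolR.
rewrite (_ : above u v m = fun w => m w < pmin (X ^~ w) u v); last first.
  by apply/funext => w; rewrite (aboveE hB).
by apply: measurable_fun_ltr => //; exact: (measurable_pmin_outside hB).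
Qed.

Section at_time.
Variables (a t b : R) (m : T -> R).
Hypotheses (a0 : 0 <= a) (at_ : a < t) (tb : t < b) (b1 : b <= 1).
Hypothesis mm : measurable_fun setT (m : outT a b -> R).

(** Given the path outside ]a, b[ and the value at [t], the probability of staying above [m] on
    [a, b]: the two sides of [t] are independent. *)
Definition stay2 w := stay (t - a) (X a w - m w) (X t w - m w) *
  stay (b - t) (X t w - m w) (X b w - m w).

Let t0 : 0 <= t. Proof. exact: le_trans a0 (ltW at_). Qed.
Let t1 : t <= 1. Proof. exact: le_trans (ltW tb) b1. Qed.
Let mmt : measurable_fun setT (m : outT a t -> R).
Proof. exact: (outside_mono (lexx a) (ltW tb) mm). Qed.
Let mtm : measurable_fun setT (m : outT t b -> R).
Proof. exact: (outside_mono (ltW at_) (lexx b) mm). Qed.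
Let sL2 : measurable_fun setT
  ((fun w => stay (b - t) (X t w - m w) (X b w - m w)) : outT a t -> R).
Proof.
apply: measurable_stay; apply: measurable_funB => //; apply: outside_bpath => //.
  by rewrite lexx orbT.
by rewrite (ltW tb) orbT.
Qed.
Let mab : measurable_fun setT ((fun w => (above a t m w)%:R) : outT t b -> R).
Proof. by apply: outside_above => //; rewrite ?lexx ?(ltW at_). Qed.

Let st2 x y : 0 <= stay (b - t) x y <= 1. Proof. by apply: stay_itv; rewrite subr_gt0. Qed.

(** The two measurability assumptions let [psi] depend on X_t besides the outer path. The staying
    formula is applied on [t, b], with the event on [a, t] as part of the weight, and then on
    [a, t]. *)
Lemma ge0_two_step (psi : T -> R) : (forall w, 0 <= psi w) ->
  measurable_fun setT (psi : outT a t -> R) -> measurable_fun setT (psi : outT t b -> R) ->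
  (\int[P]_w (psi w * (above a b m w)%:R)%:E = \int[P]_w (psi w * stay2 w)%:E)%E.
Proof.
move=> psi0 m1 m2.
have m3 := measurable_funM m2 mab; have m4 := measurable_funM m1 sL2.
have e1 := ge0_above_integral' t0 tb b1 mtm m3 (fun w => mulr_ge0 (psi0 w) (ler0n _ _)).
have e2 := ge0_above_integral' a0 at_ t1 mmt m4
  (fun w => mulr_ge0 (psi0 w) (proj1 (andP (st2 _ _)))).
transitivity (\int[P]_w (psi w * (above a t m w)%:R * (above t b m w)%:R)%:E)%E.
  apply: eq_integral => w _; rewrite -mulrA -natrM mulnb.
  by rewrite -above_split// ltW.
rewrite e1; transitivity (\int[P]_w (psi w * stay (b - t) (X t w - m w) (X b w - m w) *
   (above a t m w)%:R)%:E)%E; first by apply: eq_integral => w _; rewrite mulrAC.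
rewrite e2; apply: eq_integral => w _; congr EFin.
by rewrite /stay2 -mulrA; congr (_ * _); rewrite mulrC.
Qed.

Lemma two_step (psi : T -> R) : P.-integrable setT (EFin \o psi) ->
  measurable_fun setT (psi : outT a t -> R) -> measurable_fun setT (psi : outT t b -> R) ->
  (\int[P]_w (psi w * (above a b m w)%:R)%:E = \int[P]_w (psi w * stay2 w)%:E)%E.
Proof.
move=> Ipsi m1 m2.
have mpsi := outside_measurable m1.
have m3 := measurable_funM m2 mab; have m4 := measurable_funM m1 sL2.
have I3 : P.-integrable setT (EFin \o (fun w => psi w * (above a t m w)%:R)).
  apply: (le_integrable measurableT _ _ Ipsi).
    by apply/measurable_EFinP; exact: outside_measurable m3.
  move=> w _ /=; rewrite lee_fin normrM ler_piMr//.
  by case: (above _ _ _ _); rewrite ?normr1 ?normr0.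
have I4 : P.-integrable setT (EFin \o (fun w => psi w * stay (b - t) (X t w - m w) (X b w - m w))).
  apply: (le_integrable measurableT _ _ Ipsi).
    by apply/measurable_EFinP; exact: outside_measurable m4.
  move=> w _ /=; rewrite lee_fin normrM ler_piMr//.
  by have /andP[h1 h2] := st2 (X t w - m w) (X b w - m w); rewrite ger0_norm.
have e1 := above_integral hB t0 tb b1 mtm m3 I3.
have e2 := above_integral hB a0 at_ t1 mmt m4 I4.
transitivity (\int[P]_w (psi w * (above a t m w)%:R * (above t b m w)%:R)%:E)%E.
  apply: eq_integral => w _; rewrite -mulrA -natrM mulnb.
  by rewrite -above_split// ltW.
rewrite e1; transitivity (\int[P]_w (psi w * stay (b - t) (X t w - m w) (X b w - m w) *
   (above a t m w)%:R)%:E)%E; first by apply: eq_integral => w _; rewrite mulrAC.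
rewrite e2; apply: eq_integral => w _; congr EFin.
by rewrite /stay2 -mulrA; congr (_ * _); rewrite mulrC.
Qed.

End at_time.

Definition bnoise (a t b : R) w :=
  X t w - ((b - t) / (b - a) * X a w + (t - a) / (b - a) * X b w).

(** Freezing is applied to the positive and the negative part; their inner integrals coincide for
    every frozen value, and integrability under [P] makes the difference meaningful. *)
Lemma freeze_centred d' (T' : measurableType d') (a t b : R) (Y : T -> T')
    (F : R * T' -> R) : 0 <= a -> a < t -> t < b -> b <= 1 ->
  measurable_fun setT (Y : outT a b -> T') -> measurable_fun setT F ->
  P.-integrable setT (fun w => (F (bnoise a t b w, Y w))%:E) ->
  (forall y, (\int[lebesgue_measure]_x
    (F (x, y) * normal_pdf 0 (Num.sqrt (noise_var a t b)) x)%:E = 0)%E) ->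
  (\int[P]_w (F (bnoise a t b w, Y w))%:E = 0)%E.
Proof.
move=> a0 at_ tb b1 mY mF IF F0.
have mFE : measurable_fun setT (EFin \o F) by exact/measurable_EFinP.
have ep := bpath_freeze hB a0 at_ tb b1 mY (measurable_funepos mFE) (fun x => funepos_ge0 _ x).
have en := bpath_freeze hB a0 at_ tb b1 mY (measurable_funeneg mFE) (fun x => funeneg_ge0 _ x).
set pdf := normal_pdf 0 _ in F0 ep en.
rewrite integralE; set Ip := integral _ _ _; set In := integral _ _ _.
have Ep : Ip = (\int[P]_w \int[lebesgue_measure]_x ((EFin \o F)^\+ (x, Y w) * (pdf x)%:E))%E.
  by rewrite -ep; apply: eq_integral => w _; rewrite !funeposE.
have En : In = (\int[P]_w \int[lebesgue_measure]_x ((EFin \o F)^\- (x, Y w) * (pdf x)%:E))%E.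
  by rewrite -en; apply: eq_integral => w _; rewrite !funenegE.
have fn : In \is a fin_num by apply: integrable_neg_fin_num => //.
have -> : Ip = In; last by rewrite subee.
rewrite Ep En; apply: eq_integral => w _.
have := F0 (Y w); rewrite integralE.
have pdf0 x : 0 <= pdf x by exact: normal_pdf_ge0.
rewrite (_ : (\int[lebesgue_measure]_x (fun x => (F (x, Y w) * pdf x)%:E)^\+ x)%E =
  (\int[lebesgue_measure]_x ((EFin \o F)^\+ (x, Y w) * (pdf x)%:E))%E); last first.
  apply: eq_integral => x _.
  by rewrite !funeposE/= -!EFin_max -EFinM maxr_pMl// mul0r.
rewrite (_ : (\int[lebesgue_measure]_x (fun x => (F (x, Y w) * pdf x)%:E)^\- x)%E =
  (\int[lebesgue_measure]_x ((EFin \o F)^\- (x, Y w) * (pdf x)%:E))%E); last first.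
  apply: eq_integral => x _.
  by rewrite !funenegE/= -!EFin_max -EFinM maxr_pMl// mul0r mulNr.
exact: sube0_eq.
Qed.

(* The logarithmic derivative of [stay L x] at [z]. *)
Definition drift (L x z : R) : R := (2 * x / L) / (expR (2 * x * z / L) - 1).

Lemma drift_ge0 L x z : 0 < L -> 0 <= x -> 0 <= z -> 0 <= drift L x z.
Proof.
move=> L0 x0 z0; apply: divr_ge0; first by rewrite divr_ge0 ?(ltW L0)// mulr_ge0.
rewrite subr_ge0 -[leLHS]expR0 ler_expR divr_ge0 ?(ltW L0)//.
by rewrite !mulr_ge0.
Qed.

(** The square of exp(u / 2) >= 1 + u / 2. The second-order term is kept because it makes [drift]
    vanish for short steps. *)
Lemma expR_sub1_ge (u : R) : 0 <= u -> u * (1 + u / 4) <= expR u - 1.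
Proof.
move=> u0; have h := @expR_ge1Dx R (u / 2).
have -> : expR u = expR (u / 2) ^+ 2 by rewrite expr2 -expRD; congr expR; field.
have : (1 + u / 2) ^+ 2 <= expR (u / 2) ^+ 2.
  by rewrite lerXn2r ?nnegrE ?expR_ge0//; lra.
rewrite !expr2; lra.
Qed.

(** With u = 2 x z / L the drift is (u / z) / (exp u - 1), and exp u - 1 >= u (1 + u / 4). The
    factor 1 / z is uniform in L, the other one tends to 0 with L when x and z are positive. *)
Lemma drift_le L x z : 0 < L -> 0 <= x -> 0 <= z ->
  drift L x z <= (z * (1 + x * z / (2 * L)))^-1.
Proof.
move=> L0 x0 z0; rewrite /drift.
have [->|zn] := eqVneq z 0; first by rewrite mulr0 mul0r expR0 subrr invr0 mulr0 mul0r invr0.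
have [->|xn] := eqVneq x 0.
  by rewrite mulr0 !mul0r invr_ge0 mulr_ge0// addr_ge0.
have zp : 0 < z by rewrite lt_neqAle eq_sym zn.
have xp : 0 < x by rewrite lt_neqAle eq_sym xn.
set u := 2 * x * z / L.
have u0 : 0 < u by rewrite divr_gt0// !mulr_gt0.
have E : (z * (1 + x * z / (2 * L)))^-1 = (2 * x / L) / (u * (1 + u / 4)).
  by rewrite /u; field; rewrite !gt_eqF// ?addr_gt0 ?mulr_gt0// !mulr_gt0.
rewrite E ler_wpM2l ?divr_ge0 ?(ltW L0) ?mulr_ge0//.
have p0 : 0 < u * (1 + u / 4) by rewrite mulr_gt0// addr_gt0// divr_gt0.
have h := expR_sub1_ge (ltW u0).
by rewrite lef_pV2 ?posrE//; exact: lt_le_trans p0 h.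
Qed.

Lemma drift_le_inv L x z : 0 < L -> 0 <= x -> 0 <= z -> drift L x z <= z^-1.
Proof.
move=> L0 x0 z0; have [->|zn] := eqVneq z 0.
  by rewrite /drift mulr0 mul0r expR0 subrr invr0 mulr0.
have zp : 0 < z by rewrite lt_neqAle eq_sym zn.
apply: (le_trans (drift_le L0 x0 z0)).
have h : 0 <= x * z / (2 * L) by rewrite divr_ge0 ?mulr_ge0// ltW.
by rewrite lef_pV2 ?posrE ?mulr_gt0 ?ler_pMr//; lra.
Qed.

Lemma measurable_drift d' (T' : measurableType d') (L : R) (f g : T' -> R) :
  measurable_fun setT f -> measurable_fun setT g ->
  measurable_fun setT (fun w => drift L (f w) (g w)).
Proof.
move=> mf mg; apply: measurable_funM.
  by apply: measurable_funM => //; exact: measurable_funM.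
apply: (measurableT_comp (@measurable_invr R)); apply: measurable_funB => //.
apply: measurableT_comp => //; apply: measurable_funM => //.
by apply: measurable_funM => //; exact: measurable_funM.
Qed.

(** * Stein's identity for a product of staying probabilities *)

Section stein.
Variables (L1 L2 : R).
Hypotheses (L10 : 0 < L1) (L20 : 0 < L2).

(** Where all arguments are positive, the derivative in z of [stay L1 x z * stay L2 z y]; elsewhere
    0. *)
Definition dstay (x y z : R) : R := if [&& 0 < x, 0 < y & 0 < z] then
  2 * x / L1 * expR (- (2 * x * z / L1)) * (1 - expR (- (2 * z * y / L2))) +
  2 * y / L2 * expR (- (2 * z * y / L2)) * (1 - expR (- (2 * x * z / L1))) else 0.

Lemma dstayE x y z : dstay x y z =
  stay L1 x z * stay L2 z y * (drift L1 x z + drift L2 y z).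
Proof.
rewrite /dstay; have [x0/=|x0] := ltP 0 x; last by rewrite stay_le0l// !mul0r.
have [y0/=|y0] := ltP 0 y; last by rewrite (@stay_le0r R L2)// mulr0 mul0r.
have [z0/=|z0] := ltP 0 z; last by rewrite stay_le0r// !mul0r.
rewrite !stay_pos ?(ltW x0) ?(ltW y0) ?(ltW z0)// /drift.
rewrite (_ : 2 * y * z / L2 = 2 * z * y / L2); last by ring.
set p := 2 * x * z / L1; set q := 2 * z * y / L2.
have p0 : 0 < p by rewrite divr_gt0// !mulr_gt0.
have q0 : 0 < q by rewrite divr_gt0// !mulr_gt0.
have ep : 1 < expR p by rewrite -[ltLHS]expR0 ltr_expR.
have eq' : 1 < expR q by rewrite -[ltLHS]expR0 ltr_expR.
rewrite !expRN; field.
by rewrite !gt_eqF ?subr_gt0 ?expR_gt0// L10 L20.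
Qed.

Lemma dstay_bound x y z : 0 <= dstay x y z <= 2 * `|x| / L1 + 2 * `|y| / L2.
Proof.
rewrite /dstay; case: ifP => [/and3P[x0 y0 z0]|_]; last first.
  by rewrite lexx addr_ge0// divr_ge0 ?mulr_ge0// ltW.
have e1 (u : R) : 0 <= u -> expR (- u) <= 1 by move=> u0; rewrite -[leRHS]expR0 ler_expR oppr_le0.
have p0 : 0 <= 2 * x * z / L1 by rewrite divr_ge0 ?mulr_ge0// ltW.
have q0 : 0 <= 2 * z * y / L2 by rewrite divr_ge0 ?mulr_ge0// ltW.
have := e1 _ p0; have := e1 _ q0.
have := expR_ge0 (- (2 * x * z / L1)); have := expR_ge0 (- (2 * z * y / L2)).
rewrite !gtr0_norm//.
have x1 : 0 <= 2 * x / L1 by rewrite divr_ge0 ?mulr_ge0// ltW.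
have y1 : 0 <= 2 * y / L2 by rewrite divr_ge0 ?mulr_ge0// ltW.
set u := expR _; set v := expR _; move=> u0 v0 u1 v1.
have h (c s t : R) : 0 <= c -> 0 <= s -> s <= 1 -> 0 <= t -> t <= 1 -> 0 <= c * s * t <= c.
  move=> c0 s0 s1 t0 t1; rewrite !mulr_ge0//=.
  by rewrite -mulrA ler_piMr// mulr_ile1.
have /andP[a1 a2] : 0 <= 2 * x / L1 * v * (1 - u) <= 2 * x / L1 by apply: h => //; lra.
have /andP[b1 b2] : 0 <= 2 * y / L2 * u * (1 - v) <= 2 * y / L2 by apply: h => //; lra.
by rewrite addr_ge0//= lerD.
Qed.

(** The product of staying probabilities vanishes for z0 + v <= 0 and is a product of two factors 1
    - exp on the remaining half-line, so [stein_ray] applies with its end at -z0. *)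
Lemma stein_stay2 (s x y z0 : R) : s != 0 ->
  (\int[lebesgue_measure]_v ((v * (stay L1 x (z0 + v) * stay L2 (z0 + v) y) -
     s ^+ 2 * dstay x y (z0 + v)) * normal_pdf 0 s v)%:E = 0)%E.
Proof.
move=> s0.
have [x0|x0] := ltP 0 x; last first.
  rewrite integral0_eq// => v _.
  by rewrite /dstay ltNge x0/= stay_le0l// !mul0r !mulr0 subrr mul0r.
have [y0|y0] := ltP 0 y; last first.
  rewrite integral0_eq// => v _.
  by rewrite /dstay (ltNge 0 y) y0/= andbF (@stay_le0r R L2)// !mulr0 subrr mul0r.
pose p := 2 * x / L1; pose q := 2 * y / L2.
pose W (v : R) : R := (1 - expR (- (p * (z0 + v)))) * (1 - expR (- (q * (z0 + v)))).
pose W' (v : R) : R := p * expR (- (p * (z0 + v))) * (1 - expR (- (q * (z0 + v)))) +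
  q * expR (- (q * (z0 + v))) * (1 - expR (- (p * (z0 + v)))).
have p0 : 0 < p by rewrite divr_gt0// mulr_gt0.
have q0 : 0 < q by rewrite divr_gt0// mulr_gt0.
have de (r v : R) : is_derive v 1 (fun v => expR (- (r * (z0 + v)))) (- r * expR (- (r * (z0 + v)))).
  apply: is_derive_expR_comp; apply: is_derive_eq.
  by rewrite /GRing.scale/=; ring.
have dW (v : R) : is_derive v 1 (W : R -> R) (W' v).
  have d1 := de p v; have d2 := de q v.
  by apply: is_derive_eq; rewrite /GRing.scale/= /W'; ring.
have ce (r : R) : continuous (fun v => expR (- (r * (z0 + v)))).
  by move=> v; apply: differentiable_continuous; apply/derivable1_diffP; have [] := de r v.
have cW' : continuous W'.
  move=> v; apply: cvgD; (apply: cvgM; [apply: cvgM; [exact: cvg_cst|exact: ce]|]);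
    by apply: cvgB; [exact: cvg_cst|exact: ce].
have ge (r v : R) : 0 < r -> - z0 <= v -> 0 <= expR (- (r * (z0 + v))) <= 1.
  move=> r0 vz; rewrite expR_ge0 -[leRHS]expR0 ler_expR oppr_le0 mulr_ge0 ?(ltW r0)//; lra.
rewrite -[RHS](@stein_ray R s (- z0) (p + q) W W' s0 dW cW'); last 3 first.
- by rewrite /W subrr mulr0 oppr0 expR0 subrr mul0r.
- move=> v vz; have /andP[a1 a2] := ge p v p0 vz; have /andP[b1 b2] := ge q v q0 vz.
  rewrite /W ger0_norm; first by apply: mulr_ile1; lra.
  by rewrite mulr_ge0// subr_ge0.
- move=> v vz; have /andP[a1 a2] := ge p v p0 vz; have /andP[b1 b2] := ge q v q0 vz.
  have h (c s' t : R) : 0 <= c -> 0 <= s' -> s' <= 1 -> 0 <= t -> t <= 1 -> 0 <= c * s' * t <= c.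
    move=> c0 h0 h1 t0 t1; rewrite !mulr_ge0//=.
    by rewrite -mulrA ler_piMr// mulr_ile1.
  rewrite /W' ger0_norm.
    apply: lerD.
      suff /andP[] : 0 <= p * expR (- (p * (z0 + v))) * (1 - expR (- (q * (z0 + v)))) <= p by [].
      by apply: h => //; lra.
    suff /andP[] : 0 <= q * expR (- (q * (z0 + v))) * (1 - expR (- (p * (z0 + v)))) <= q by [].
    by apply: h => //; lra.
  by apply: addr_ge0; apply: mulr_ge0; rewrite ?subr_ge0// mulr_ge0// ltW.
rewrite [RHS]integral_mkcond; apply: eq_integral => v _; rewrite patchE.
have [vz|vz] := leP (- z0) v; last first.
  rewrite memNset/=; last by rewrite in_itv/= andbT leNgt vz.
  have h : z0 + v <= 0 by lra.
  by rewrite /dstay (ltNge 0 (z0 + v)) h/= !andbF stay_le0r// mul0r !mulr0 subrr mul0r.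
rewrite mem_set/=; last by rewrite in_itv/= vz.
have zv : 0 <= z0 + v by lra.
rewrite !stay_pos ?(ltW x0) ?(ltW y0)// /W /W' /dstay x0 y0/=.
have E1 : 2 * x * (z0 + v) / L1 = p * (z0 + v) by rewrite /p; ring.
have E2 : 2 * (z0 + v) * y / L2 = q * (z0 + v) by rewrite /q; ring.
(* At the end z0 + v = 0, where [dstay] is 0 by convention, both terms of [W'] vanish as well. *)
rewrite E1 E2; case: ifPn => // z0'; have -> : z0 + v = 0 by apply/eqP; rewrite eq_le zv leNgt z0'.
by rewrite !(mulr0, oppr0, expR0, subrr, addr0).
Qed.

End stein.

Lemma measurable_dstay (L1 L2 : R) d' (T' : measurableType d') (f g h : T' -> R) :
  0 < L1 -> 0 < L2 ->
  measurable_fun setT f -> measurable_fun setT g -> measurable_fun setT h ->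
  measurable_fun setT (fun w => dstay L1 L2 (f w) (g w) (h w)).
Proof.
move=> L10 L20 mf mg mh; under eq_fun do rewrite dstayE//.
apply: measurable_funM.
  by apply: measurable_funM; exact: measurable_stay.
by apply: measurable_funD; exact: measurable_drift.
Qed.

Lemma bpath_integrable q : P.-integrable setT (EFin \o X q).
Proof.
apply: (le_integrable measurableT _ _ (integrable_psup hB)).
  by apply/measurable_EFinP; exact: measurable_bpath.
by move=> w _ /=; rewrite lee_fin (ger0_norm (psup_ge0 hB w)) (psup_ge hB).
Qed.

Section drift_identity.
Variables (a t b : R) (m phi : T -> R) (C : R).
Hypotheses (a0 : 0 <= a) (at_ : a < t) (tb : t < b) (b1 : b <= 1).
Hypothesis mm : measurable_fun setT (m : outT a b -> R).
Hypothesis mphi : measurable_fun setT (phi : outT a b -> R).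
Hypothesis phi0 : forall w, 0 <= phi w.
Hypothesis phiC : forall w, phi w <= C.
Hypothesis Im : P.-integrable setT (EFin \o m).

Let L1 := t - a.
Let L2 := b - t.
Let L10 : 0 < L1. Proof. by rewrite subr_gt0. Qed.
Let L20 : 0 < L2. Proof. by rewrite subr_gt0. Qed.
Let ab : a < b. Proof. exact: lt_trans at_ tb. Qed.

Let mX q : measurable_fun setT (X q). Proof. exact: measurable_bpath. Qed.
Let mm' := outside_measurable mm.
Let mphi' := outside_measurable mphi.
Let mn : measurable_fun setT (bnoise a t b).
Proof. by apply: measurable_funB => //; apply: measurable_funD => //; exact: measurable_funM. Qed.

Lemma bnoise_integrable : P.-integrable setT (EFin \o bnoise a t b).
Proof.
have h c q : P.-integrable setT (fun w => (c%:E * (X q w)%:E)%E).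
  exact: integrableZl (bpath_integrable q).
rewrite (_ : _ \o _ = (fun w => (X t w)%:E - (((b - t) / (b - a))%:E * (X a w)%:E +
   ((t - a) / (b - a))%:E * (X b w)%:E))%E); last by apply/funext => w.
by apply: integrableB; [|exact: bpath_integrable|exact: integrableD].
Qed.

Let ds w := dstay L1 L2 (X a w - m w) (X b w - m w) (X t w - m w).
Let mds : measurable_fun setT ds.
Proof. by apply: measurable_dstay => //; exact: measurable_funB. Qed.

Let Ids : P.-integrable setT (EFin \o (fun w => phi w * ds w)).
Proof.
have I q : P.-integrable setT (fun w => (`|X q w| + `|m w|)%:E).
  rewrite (_ : (fun w => _) = (fun w => (abse (EFin (X q w)) + abse (EFin (m w)))%E)); last by [].
  apply: integrableD => //; apply: integrable_abse => //; exact: bpath_integrable.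
have I2 : P.-integrable setT (fun w => (C%:E * ((2 / L1)%:E * (`|X a w| + `|m w|)%:E +
    (2 / L2)%:E * (`|X b w| + `|m w|)%:E))%E).
  by apply: integrableZl => //; apply: integrableD => //; apply: integrableZl.
apply: (le_integrable measurableT _ _ I2).
  by apply/measurable_EFinP; exact: measurable_funM.
move=> w _ /=; have /andP[h0 h1] := dstay_bound L10 L20 (X a w - m w) (X b w - m w) (X t w - m w).
have C0 : 0 <= C := le_trans (phi0 w) (phiC w).
rewrite lee_fin ger0_norm ?mulr_ge0//.
apply: le_trans (ler_norm _); apply: ler_pM => //; apply: (le_trans h1).
rewrite !(mulrAC 2 _ (_^-1)); apply: lerD; rewrite ler_wpM2l ?divr_ge0 ?(ltW L10) ?(ltW L20)//; exact: ler_normB.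
Qed.

(** Replacing the event by [stay2] leaves a smooth function of the noise, weighted by the noise
    itself. Stein's identity trades this weight for the variance times the derivative [dstay], which
    is [stay2] times the sum of the two logarithmic derivatives; the event can then be put back. *)
Lemma drift_identity :
  (\int[P]_w (phi w * bnoise a t b w * (above a b m w)%:R)%:E =
   (noise_var a t b)%:E * \int[P]_w (phi w * (drift L1 (X a w - m w) (X t w - m w) +
      drift L2 (X b w - m w) (X t w - m w)) * (above a b m w)%:R)%:E)%E.
Proof.
have s20 : 0 < noise_var a t b := noise_var_gt0 at_ tb.
have oX u v q : 0 <= u -> v <= 1 -> (q <= u) || (v <= q) ->
  measurable_fun setT (X q : outT u v -> R) := @outside_bpath _ _ _ _ B u v q.
have t0 : 0 <= t := le_trans a0 (ltW at_).
have t1 : t <= 1 := le_trans (ltW tb) b1.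
have oat f : measurable_fun setT (f : outT a b -> R) -> measurable_fun setT (f : outT a t -> R).
  by move=> h; exact: (outside_mono (lexx a) (ltW tb) h).
have otb f : measurable_fun setT (f : outT a b -> R) -> measurable_fun setT (f : outT t b -> R).
  by move=> h; exact: (outside_mono (ltW at_) (lexx b) h).
have mXa : measurable_fun setT (X a : outT a b -> R) by apply: oX; rewrite ?lexx.
have mXb : measurable_fun setT (X b : outT a b -> R) by apply: oX; rewrite ?lexx ?orbT.
have mXt1 : measurable_fun setT (X t : outT a t -> R) by apply: oX; rewrite ?lexx ?orbT.
have mXt2 : measurable_fun setT (X t : outT t b -> R) by apply: oX; rewrite ?lexx.
have mi : measurable_fun setT
  ((fun w => (b - t) / (b - a) * X a w + (t - a) / (b - a) * X b w) : outT a b -> R).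
  by apply: measurable_funD; exact: measurable_funM.
pose dr w := drift L1 (X a w - m w) (X t w - m w) + drift L2 (X b w - m w) (X t w - m w).
have Ipsi : P.-integrable setT (EFin \o (fun w => phi w * bnoise a t b w)).
  have I2 := integrableZl measurableT C bnoise_integrable.
  apply: (le_integrable measurableT _ _ I2).
    by apply/measurable_EFinP; exact: measurable_funM.
  move=> w _ /=; rewrite lee_fin !normrM (ger0_norm (phi0 w)) ler_wpM2r//.
  by apply: le_trans (ler_norm _).
rewrite (two_step a0 at_ tb b1 mm Ipsi); last 2 first.
- by apply: measurable_funM; [exact: oat|apply: measurable_funB => //; exact: oat].
- by apply: measurable_funM; [exact: otb|apply: measurable_funB => //; exact: otb].
transitivity ((noise_var a t b)%:E * \int[P]_w (phi w * ds w)%:E)%E; last first.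
  congr (_ * _)%E; set psi := fun w => phi w * (drift L1 (X a w - m w) (X t w - m w) +
    drift L2 (X b w - m w) (X t w - m w)) * (above a b m w)%:R.
  (* [drift] has a sign only at non-negative heights, and [ge0_two_step] needs a non-negative
     weight. Restricting to [A] changes nothing, as [stay2] vanishes off [A] and [above] implies
     [A]. *)
  pose A w : bool := (m w <= X a w) && (m w <= X b w) && (m w <= X t w).
  transitivity (\int[P]_w (phi w * (A w)%:R * dr w * stay2 a t b m w)%:E)%E.
    apply: eq_integral => w _; congr EFin; rewrite /ds dstayE// /stay2 /dr /A.
    have [h1|h1] := leP (m w) (X a w); last first.
      by rewrite stay_le0l ?subr_le0 ?(ltW h1)// !(mul0r, mulr0).
    have [h2|h2] := leP (m w) (X b w); last first.
      by rewrite (@stay_le0r R (b - t)) ?subr_le0 ?(ltW h2)// !(mul0r, mulr0).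
    have [h3|h3] := leP (m w) (X t w); last first.
      by rewrite stay_le0r ?subr_le0 ?(ltW h3)// !(mul0r, mulr0).
    by rewrite /= mulr1 -!mulrA; congr (_ * _); rewrite mulrA mulrC.
  have mA u v : 0 <= u -> v <= 1 -> measurable_fun setT (m : outT u v -> R) ->
      (forall q, q \in [:: a; b; t] -> measurable_fun setT (X q : outT u v -> R)) ->
      measurable_fun setT ((fun w => (A w)%:R) : outT u v -> R).
    move=> u0 v1 mu hq; apply: measurable_boolR.
    apply: measurable_and; last by apply: measurable_fun_ler => //; apply: hq; rewrite !inE eqxx !orbT.
    by apply: measurable_and; apply: measurable_fun_ler => //; apply: hq; rewrite !inE eqxx ?orbT.
  have mdr u v : measurable_fun setT (m : outT u v -> R) ->
      (forall q, q \in [:: a; b; t] -> measurable_fun setT (X q : outT u v -> R)) ->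
      measurable_fun setT (dr : outT u v -> R).
    move=> mu hq; apply: measurable_funD; apply: measurable_drift; apply: measurable_funB => //;
      apply: hq; by rewrite !inE eqxx ?orbT.
  have hat q : q \in [:: a; b; t] -> measurable_fun setT (X q : outT a t -> R).
    by rewrite !inE => /or3P[] /eqP ->; [exact: oat|exact: oat|].
  have htb q : q \in [:: a; b; t] -> measurable_fun setT (X q : outT t b -> R).
    by rewrite !inE => /or3P[] /eqP ->; [exact: otb|exact: otb|].
  rewrite -(ge0_two_step a0 at_ tb b1 mm); last 3 first.
  - move=> w; rewrite -mulrA mulr_ge0// /A.
    case hA : (_ && _ && _); last by rewrite mul0r.
    move/andP : hA => [/andP[h1 h2] h3].
    by rewrite mul1r addr_ge0// drift_ge0// subr_ge0//.
  - by apply: measurable_funM; [apply: measurable_funM; [exact: oat|apply: mA => //; exact: oat]|apply: mdr => //; exact: oat].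
  - by apply: measurable_funM; [apply: measurable_funM; [exact: otb|apply: mA => //; exact: otb]|apply: mdr => //; exact: otb].
  apply: eq_integral => w _; congr EFin; rewrite /psi.
  case hA : (above a b m w); last by rewrite !mulr0.
  rewrite !mulr1 /A; have h : forall q, a <= q <= b -> m w <= X q w.
    by move=> q qab; move/asboolP : hA => /(_ q qab) /ltW.
  by rewrite !h ?lexx ?(ltW at_) ?(ltW tb) ?(ltW ab)// mulr1.
have IE : P.-integrable setT (fun w => (phi w * bnoise a t b w * stay2 a t b m w)%:E).
  apply: (le_integrable measurableT _ _ Ipsi).
    apply/measurable_EFinP; apply: measurable_funM; first exact: measurable_funM.
    by apply: measurable_funM; apply: measurable_stay; exact: measurable_funB.
  move=> w _ /=; rewrite lee_fin [leLHS]normrM ler_piMr// /stay2.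
  have /andP[h1 h2] := stay_itv (X a w - m w) (X t w - m w) L10.
  have /andP[h3 h4] := stay_itv (X t w - m w) (X b w - m w) L20.
  by rewrite ger0_norm ?mulr_ge0// mulr_ile1.
have IE2 : P.-integrable setT (fun w => ((noise_var a t b)%:E * (phi w * ds w)%:E)%E).
  exact: integrableZl Ids.
apply: sube0_eq; rewrite -(integralZl measurableT Ids) -(integralB measurableT IE IE2).
pose mu w := (b - t) / (b - a) * X a w + (t - a) / (b - a) * X b w.
pose Y w : R * (R * (R * R)) := (phi w, (X a w - m w, (X b w - m w, mu w - m w))).
have mY : measurable_fun setT (Y : outT a b -> R * (R * (R * R))).
  apply: measurable_fun_pair => //; apply: measurable_fun_pair; first exact: measurable_funB.
  by apply: measurable_fun_pair; exact: measurable_funB.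
pose F (z : R * (R * (R * (R * R)))) : R := z.2.1 *
  (z.1 * (stay L1 z.2.2.1 (z.2.2.2.2 + z.1) * stay L2 (z.2.2.2.2 + z.1) z.2.2.2.1) -
   Num.sqrt (noise_var a t b) ^+ 2 * dstay L1 L2 z.2.2.1 z.2.2.2.1 (z.2.2.2.2 + z.1)).
have mF : measurable_fun setT F.
  have f1 : measurable_fun setT (fun z : R * (R * (R * (R * R))) => z.1) by exact: measurable_fst.
  have f2 : measurable_fun setT (fun z : R * (R * (R * (R * R))) => z.2.1).
    by apply: measurableT_comp => //; exact: measurable_snd.
  have f22 : measurable_fun setT (fun z : R * (R * (R * (R * R))) => z.2.2).
    by apply: (measurableT_comp (f := snd)) => //; exact: measurable_snd.
  have f3 : measurable_fun setT (fun z : R * (R * (R * (R * R))) => z.2.2.1).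
    by apply: (measurableT_comp (f := fst)).
  have f222 : measurable_fun setT (fun z : R * (R * (R * (R * R))) => z.2.2.2).
    by apply: (measurableT_comp (f := snd)).
  have f4 : measurable_fun setT (fun z : R * (R * (R * (R * R))) => z.2.2.2.1).
    by apply: (measurableT_comp (f := fst)).
  have f5 : measurable_fun setT (fun z : R * (R * (R * (R * R))) => z.2.2.2.2).
    by apply: (measurableT_comp (f := snd)).
  have f6 : measurable_fun setT (fun z : R * (R * (R * (R * R))) => z.2.2.2.2 + z.1).
    exact: measurable_funD.
  apply: measurable_funM => //; apply: measurable_funB.
    by apply: measurable_funM => //; apply: measurable_funM; exact: measurable_stay.
  by apply: measurable_funM => //; exact: measurable_dstay.
have FE w : F (bnoise a t b w, Y w) = phi w * bnoise a t b w * stay2 a t b m w -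
    noise_var a t b * (phi w * ds w).
  rewrite /F /Y/= sqr_sqrtr ?(ltW s20)// (_ : mu w - m w + bnoise a t b w = X t w - m w); last first.
    by rewrite /bnoise /mu; ring.
  by rewrite /stay2 /ds; ring.
under eq_integral do rewrite -EFinM -EFinB -FE.
apply: (freeze_centred a0 at_ tb b1 mY mF).
  under eq_fun do rewrite FE EFinB EFinM.
  exact: integrableB.
move=> [p [x [y z0]]]; rewrite /F/=.
have := stein_stay2 L10 L20 x y z0 (s := Num.sqrt (noise_var a t b)).
rewrite sqrtr_eq0 -ltNge s20 => /(_ isT) h.
have s0 : Num.sqrt (noise_var a t b) != 0 by rewrite gt_eqF// sqrtr_gt0.
under eq_integral do rewrite -mulrA EFinM.
rewrite integralZl//; first by rewrite h mule0.
pose K := 2 * `|x| / L1 + 2 * `|y| / L2.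
apply: (@integrable_mul_normal_pdf _ _ _ (Num.sqrt (noise_var a t b) ^+ 2 * K) 1 s0).
  have mz : measurable_fun setT (fun v : R => z0 + v) by exact: measurable_funD.
  apply: measurable_funB.
    by apply: measurable_funM => //; apply: measurable_funM; exact: measurable_stay.
  by apply: measurable_funM => //; exact: measurable_dstay.
move=> v; rewrite [leRHS]addrC mul1r; apply: (le_trans (ler_normB _ _)); apply: lerD.
  have /andP[h1 h2] := stay_itv x (z0 + v) L10.
  have /andP[h3 h4] := stay_itv (z0 + v) y L20.
  by rewrite normrM ler_piMr// ger0_norm ?mulr_ge0// mulr_ile1.
have /andP[h1 h2] := dstay_bound L10 L20 x y (z0 + v).
by rewrite ger0_norm ?mulr_ge0 ?sqr_ge0// ler_wpM2l// sqr_ge0.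
Qed.

End drift_identity.

End one_step.

(** * Traces of the filtration of the transform *)

Section outside_trace.
Context d (T : measurableType d) (R : realType) (P : probability T R).
Variables (lambda : R) (B : R -> {RV P >-> R}).
Hypothesis hB : brownian_bridge lambda B.
Local Notation X := (bpath B).
Local Notation outT a b := (g_sigma_algebraType (outside_gen B a b)).
Local Notation above := (above B).
Local Notation gm w := (pmin (X ^~ w) 0 1).

Let cX w : continuous (X ^~ w). Proof. exact: (@continuous_bpath _ _ _ _ _ _ hB). Qed.
Let mX q : measurable_fun setT (X q). Proof. exact: measurable_bpath. Qed.

Definition btau (w : T) : R := first_argmin (X ^~ w).

Lemma btauE w : first_argmin (fun s => B s w) = btau w.
Proof. by apply: eq_first_argmin => q q01; rewrite /bpath clamp01_id. Qed.

Lemma btau_itv w : 0 <= btau w <= 1. Proof. exact: first_argmin_itv (@cX w). Qed.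

Lemma bpath_btau w : X (btau w) w = gm w. Proof. exact: first_argminE (@cX w). Qed.

Lemma measurable_btau : measurable_fun setT btau.
Proof. by apply: measurable_first_argmin => // w; exact: cX. Qed.

Lemma bpath_le0 q w : q <= 0 -> X q w = 0.
Proof.
move=> q0; rewrite /bpath /clamp01 (_ : Num.max 0 _ = 0); first by have [_ ->] := hB.
by apply: max_l; rewrite ge_min q0 orbT.
Qed.

Lemma bpath_ge1 q w : 1 <= q -> X q w = X 1 w.
Proof. by move=> q1; rewrite /bpath /clamp01 minxx (min_l q1). Qed.

Lemma vervaat_bpath t w : 0 <= t <= 1 ->
  vervaat (fun s => B s w) t = X (btau w + t) w + X (btau w + t - 1) w - X (btau w) w.
Proof.
move=> /andP[t0 t1]; rewrite /vervaat btauE; have /andP[h0 h1] := btau_itv w.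
have e q : 0 <= q <= 1 -> B q w = X q w by move=> q01; rewrite /bpath clamp01_id.
case: ifPn => [h|]; rewrite ?(e (btau w)) ?h0//.
  rewrite (@bpath_le0 (btau w + t - 1)); last by lra.
  by rewrite addr0 e//; apply/andP; split; lra.
rewrite -ltNge => h; rewrite (@bpath_ge1 (btau w + t)); last by lra.
by rewrite !e ?lexx ?ler01// 1?[X 1 w + _]addrC//; apply/andP; split; lra.
Qed.

(** The staying probability is continuous in the level: the probability of exceeding m - e tends to
    that of exceeding m. So the weak and the strict inequality between m and the minimum have the
    same probability. *)
Lemma tie_null (a b : R) (m : T -> R) : 0 <= a -> a < b -> b <= 1 ->
  measurable_fun setT (m : outT a b -> R) -> P [set w | pmin (X ^~ w) a b = m w] = 0%E.
Proof.
move=> a0 ab b1 mm; have mm' := outside_measurable mm.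
have ba : 0 < b - a by rewrite subr_gt0.
have mp : measurable_fun setT (fun w => pmin (X ^~ w) a b).
  by apply: measurable_pmin => //; exact: ltW.
have I1 : P.-integrable setT (EFin \o (fun _ : T => 1 : R)).
  by apply: (@bounded_integrable _ _ _ P _ 1) => // w; rewrite normr1.
have key (m' : T -> R) : measurable_fun setT (m' : outT a b -> R) ->
    (P [set w | (m' w < pmin (X ^~ w) a b)%R] =
     \int[P]_w (stay (b - a) (X a w - m' w) (X b w - m' w))%:E)%E.
  move=> mm0; have := @ge0_above_integral _ _ _ _ _ _ hB a b m' (fun=> 1) a0 ab b1 mm0 (measurable_cst _) (fun=> ler01) I1.
  under [in X in _ = X -> _]eq_integral do rewrite mul1r.
  move=> <-; rewrite -integral_bool; last first.
    by apply: measurable_ltset => //; exact: outside_measurable mm0.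
  by apply: eq_integral => w _; rewrite mul1r (aboveE hB)// ltW.
pose e (n : nat) : R := - n.+1%:R^-1.
have ce : e n @[n --> \oo] --> (0 : R).
  by rewrite -[X in _ --> X]oppr0; apply: cvgN; exact: cvg_harmonic.
pose me n w := m w + e n.
have mme n : measurable_fun setT (me n : outT a b -> R) by exact: measurable_funD.
have L : ((P [set w | (me n w < pmin (X ^~ w) a b)%R]) @[n --> \oo] -->
    P [set w | (m w < pmin (X ^~ w) a b)%R])%E.
  rewrite key// (funext (fun n => key _ (mme n))).
  have [||w _||n w _|_] := @dominated_convergence_real _ _ R P setT
    (fun n w => stay (b - a) (X a w - me n w) (X b w - me n w))
    (fun w => stay (b - a) (X a w - m w) (X b w - m w)) (fun=> 1) measurableT.
  - move=> n; apply: measurable_stay; apply: measurable_funB => //; exact: outside_measurable (mme n).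
  - by apply: measurable_stay; exact: measurable_funB.
  - have := @continuous_stay R (b - a) (X a w - m w) (X b w - m w) e ce.
    by apply: cvg_trans; apply: near_eq_cvg; apply: nearW => n; rewrite /me !opprD !addrA.
  - exact: I1.
  - by have /andP[h0 h1] := stay_itv (X a w - me n w) (X b w - me n w) ba; rewrite ger0_norm.
  by [].
have mle : measurable [set w | m w <= pmin (X ^~ w) a b] by exact: measurable_leset.
have mlt : measurable [set w | m w < pmin (X ^~ w) a b] by exact: measurable_ltset.
have h1 : (P [set w | (m w <= pmin (X ^~ w) a b)%R] <= P [set w | (m w < pmin (X ^~ w) a b)%R])%E.
  apply: (lee_cvg_to (cvg_cst _) L); apply: nearW => n.
  apply: le_measure; rewrite ?inE//.
    by apply: measurable_ltset => //; exact: outside_measurable (mme n).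
  move=> w /= h; apply: lt_le_trans h; rewrite /me /e.
  by rewrite ltrBlDr ltrDl invr_gt0.
rewrite (_ : [set w | pmin _ _ _ = _] =
  [set w | m w <= pmin (X ^~ w) a b] `\` [set w | m w < pmin (X ^~ w) a b]); last first.
  apply/seteqP; split => w /=; first by move=> ->; rewrite lexx ltxx.
  by move=> [h2 /negP]; rewrite -leNgt => h3; apply/eqP; rewrite eq_le h2 h3.
rewrite measureD//; last by apply: le_lt_trans (probability_le1 P mle) _; rewrite ltry.
rewrite setIidr; last by move=> w /=; exact: ltW.
apply/eqP; rewrite eq_le; apply/andP; split; last first.
  rewrite sube_ge0 ?fin_num_measure//; apply: le_measure; rewrite ?inE//.
  by move=> w /=; exact: ltW.
by rewrite sube_le0.
Qed.

Section interpolated.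
Variables a b : R.
Hypotheses (a0 : 0 <= a) (ab : a < b) (b1 : b <= 1).

(* On ]a, b[ the path is replaced by the chord, so that [chord_path] is measurable for
   the bridge outside ]a, b[. *)
Definition chord_path (q : R) (w : T) : R := X (Num.min q a) w + X (Num.max q b) w - X b w +
  (X b w - X a w) / (b - a) * (Num.max a (Num.min q b) - a).

Lemma chord_pathE q w : (q <= a) || (b <= q) -> chord_path q w = X q w.
Proof.
have nz : b - a != 0 by rewrite subr_eq0 gt_eqF.
case/orP => h; rewrite /chord_path.
  rewrite (min_l h) (max_r (le_trans h (ltW ab))) (min_l (le_trans h (ltW ab))) (max_l h).
  by rewrite subrr mulr0 addr0 addrK.
rewrite (min_r (le_trans (ltW ab) h)) (max_l h) (min_r h) (max_r (ltW ab)).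
by field.
Qed.

Lemma chord_path_ge q w : a <= q <= b -> Num.min (X a w) (X b w) <= chord_path q w.
Proof.
move=> /andP[aq qb]; have nz : b - a != 0 by rewrite subr_eq0 gt_eqF.
have ba : 0 < b - a by rewrite subr_gt0.
rewrite /chord_path (min_r aq) (max_r qb) (min_l qb) (max_r aq).
have -> : X a w + X b w - X b w + (X b w - X a w) / (b - a) * (q - a) =
   ((b - q) * X a w + (q - a) * X b w) / (b - a) by field.
rewrite ler_pdivlMr//.
have h1 : Num.min (X a w) (X b w) <= X a w by rewrite ge_min lexx.
have h2 : Num.min (X a w) (X b w) <= X b w by rewrite ge_min lexx orbT.
have -> : Num.min (X a w) (X b w) * (b - a) =
  (b - q) * Num.min (X a w) (X b w) + (q - a) * Num.min (X a w) (X b w) by ring.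
by apply: lerD; rewrite ler_wpM2l// subr_ge0.
Qed.

Lemma continuous_chord_path w : continuous (chord_path ^~ w).
Proof.
move=> q; rewrite /chord_path.
have c1 : continuous (fun q : R => Num.min q a).
  by move=> x; apply: (@continuous_min R R id (fun=> a)); [exact: cvg_id|exact: cvg_cst].
have c2 : continuous (fun q : R => Num.max q b).
  by move=> x; apply: (@continuous_max R R id (fun=> b)); [exact: cvg_id|exact: cvg_cst].
have c3 : continuous (fun q : R => Num.max a (Num.min q b)).
  move=> x; apply: (@continuous_max R R (fun=> a) (fun q => Num.min q b)); first exact: cvg_cst.
  by apply: (@continuous_min R R id (fun=> b)); [exact: cvg_id|exact: cvg_cst].
apply: cvgD; last first.
  by apply: cvgM; [exact: cvg_cst|apply: cvgB; [exact: c3|exact: cvg_cst]].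
apply: cvgB; last exact: cvg_cst.
apply: cvgD.
  by apply: (@cvg_comp _ _ _ (fun q : R => Num.min q a) (X ^~ w)); [exact: c1|exact: cX].
by apply: (@cvg_comp _ _ _ (fun q : R => Num.max q b) (X ^~ w)); [exact: c2|exact: cX].
Qed.

Lemma outside_chord_path q : measurable_fun setT (chord_path q : outT a b -> R).
Proof.
have oX r : (r <= a) || (b <= r) -> measurable_fun setT (X r : outT a b -> R).
  exact: outside_bpath.
have mXa : measurable_fun setT (X a : outT a b -> R) by apply: oX; rewrite lexx.
have mXb : measurable_fun setT (X b : outT a b -> R) by apply: oX; rewrite lexx orbT.
apply: measurable_funD; last first.
  by apply: measurable_funM => //; apply: measurable_funM => //; exact: measurable_funB.
apply: measurable_funB => //; apply: measurable_funD; apply: oX.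
  by rewrite ge_min lexx orbT.
by rewrite le_max lexx !orbT.
Qed.

Definition outer_min w := Num.min (pmin (X ^~ w) 0 a) (pmin (X ^~ w) b 1).
Definition chord_tau w := first_argmin (chord_path ^~ w).
Definition chord_vervaat u w := chord_path (chord_tau w + u) w + chord_path (chord_tau w + u - 1) w - chord_path (chord_tau w) w.

Lemma outside_outer_min : measurable_fun setT (outer_min : outT a b -> R).
Proof.
by apply: measurable_minr; apply: (measurable_pmin_outside hB); rewrite ?lexx ?orbT.
Qed.

Lemma outside_otau : measurable_fun setT (chord_tau : outT a b -> R).
Proof.
apply: (@measurable_first_argmin _ (outT a b) R chord_path); first exact: continuous_chord_path.
exact: outside_chord_path.
Qed.

Lemma outside_overvaat u : measurable_fun setT (chord_vervaat u : outT a b -> R).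
Proof.
have ev (th : T -> R) : measurable_fun setT (th : outT a b -> R) ->
    measurable_fun setT ((fun w => chord_path (th w) w) : outT a b -> R).
  move=> mth; apply: (@measurable_eval _ (outT a b) R chord_path) => //.
    exact: continuous_chord_path.
  exact: outside_chord_path.
have mt := outside_otau.
apply: measurable_funB; last exact: ev.
by apply: measurable_funD; apply: ev; [|apply: measurable_funB => //]; exact: measurable_funD.
Qed.

Lemma gmin_outer_min w : gm w = Num.min (outer_min w) (pmin (X ^~ w) a b).
Proof.
rewrite (pmin_split (@cX w) a0 (le_trans (ltW ab) b1)) (pmin_split (@cX w) (ltW ab) b1).
by rewrite /outer_min -[RHS]minA; congr Num.min; rewrite minC.
Qed.

Lemma above_outer_min w : above a b outer_min w -> gm w = outer_min w.
Proof. by rewrite (aboveE hB) ?(ltW ab)// gmin_outer_min => h; rewrite min_l// ltW. Qed.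

(** On ]a, b[ the path exceeds the global minimum by assumption and the chord does because its ends
    do, so neither path has a minimiser there; outside they agree. *)
Lemma chord_tau_above w : above a b outer_min w -> chord_tau w = btau w.
Proof.
move=> h; have E := above_outer_min h.
have {}h q : a <= q <= b -> gm w < X q w by rewrite E; move/asboolP: h; exact.
have /andP[t0 t1] := btau_itv w.
have tout : (btau w <= a) || (b <= btau w).
  apply: contraT; rewrite negb_or -!ltNge => /andP[h1 h2].
  by have := h (btau w); rewrite (ltW h1) (ltW h2) bpath_btau ltxx => /(_ isT).
have bt : chord_path (btau w) w = gm w by rewrite chord_pathE// bpath_btau.
have inside q : ~~ ((q <= a) || (b <= q)) -> gm w < chord_path q w.
  rewrite negb_or -!ltNge => /andP[h1 h2].
  apply: lt_le_trans (chord_path_ge w _); last by rewrite (ltW h1) (ltW h2).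
  by rewrite lt_min !h ?lexx ?(ltW ab).
apply: first_argmin_eq; first by rewrite t0 t1.
- move=> q q01; rewrite bt; have [qo|/inside/ltW//] := boolP ((q <= a) || (b <= q)).
  by rewrite chord_pathE//; exact: pmin_le.
move=> q q0 qt; rewrite bt; have [qo|/inside//] := boolP ((q <= a) || (b <= q)).
by rewrite chord_pathE//; exact: first_argmin_lt.
Qed.

(** The transform reads the times tau + u and tau + u - 1. They avoid ]a, b[ either because both
    come before a, or because tau is beyond b and the wrapped times come before a. *)
Lemma chord_vervaat_above (s u : R) w : above a b outer_min w ->
  (btau w + s < a) || ((b < btau w) && (btau w + s - 1 < a)) ->
  0 <= u <= s -> s <= 1 -> chord_vervaat u w = vervaat (fun r => B r w) u.
Proof.
move=> h ev /andP[u0 us] s1; have /andP[t0 t1] := btau_itv w.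
rewrite vervaat_bpath; last by rewrite u0 (le_trans us).
rewrite /chord_vervaat chord_tau_above//.
by case/orP : ev => [ev|/andP[ev1 ev2]]; rewrite !chord_pathE//; apply/orP;
  first [by left; lra|by right; lra].
Qed.

Local Notation V := (fun u w => vervaat (fun r => B r w) u).

(* Up to time s the transform has not yet explored ]a, b[: while the path stays
   above its outer minimum there, the transform computed from [chord_path] agrees with
   the true one on [0, s]. *)
Lemma filtration_trace (s : R) (S : set T) : 0 <= s -> s <= 1 ->
  natural_filtration V s S ->
  exists2 S', <<s outside_gen B a b >> S' & forall w, above a b outer_min w ->
    (btau w + s < a) || ((b < btau w) && (btau w + s - 1 < a)) -> S w <-> S' w.
Proof.
move=> s0 s1.
pose E w := above a b outer_min w /\ ((btau w + s < a) || ((b < btau w) && (btau w + s - 1 < a))).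
pose D := [set S : set T | exists2 S', <<s outside_gen B a b >> S' & forall w, E w -> S w <-> S' w].
suff sub : natural_filtration V s `<=` D.
  by move=> /sub[S' mS' h]; exists S' => // w h1 h2; exact: h.
have sG := smallest_sigma_algebra setT (outside_gen B a b).
apply: smallest_sub.
- split.
  + by exists set0; [case: sG|].
  + move=> S1 [S' mS' h]; exists (setT `\` S'); first by case: sG => _ /(_ _ mS').
    by move=> w Ew; have := h w Ew => -[h1 h2]; split => -[_ n]; split => // /h1 || split => // /h2.
  move=> F hF; have /choice[G hG] n : exists S', <<s outside_gen B a b >> S' /\
      forall w, E w -> F n w <-> S' w.
    by have [S' ? ?] := hF n; exists S'.
  exists (\bigcup_n G n); first by case: sG => _ _; apply => n; exact: (hG n).1.
  by move=> w Ew; split => -[n _ h]; exists n => //; apply/(hG n).2.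
move=> _ [u /= us] [A mA <-]; exists (chord_vervaat u @^-1` A).
  have := outside_overvaat u measurableT mA; rewrite setTI; exact.
move=> w [h ev]; by rewrite setTI /= (@chord_vervaat_above s u).
Qed.

End interpolated.

Local Notation V := (fun u w => vervaat (fun r => B r w) u).

Lemma measurable_vervaat u : 0 <= u <= 1 -> measurable_fun setT (V u).
Proof.
move=> u01 /=; rewrite (_ : (fun w => vervaat _ u) = fun w => X (btau w + u) w + X (btau w + u - 1) w - X (btau w) w); last first.
  by apply/funext => w; exact: vervaat_bpath.
have mt := measurable_btau.
have ev (th : T -> R) : measurable_fun setT th -> measurable_fun setT (fun w => X (th w) w).
  by move=> mth; apply: measurable_eval => // w; exact: cX.
apply: measurable_funB; last exact: ev.
by apply: measurable_funD; apply: ev; [|apply: measurable_funB => //]; exact: measurable_funD.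
Qed.

Lemma natural_filtration_measurable s : s <= 1 -> natural_filtration V s `<=` measurable.
Proof.
move=> s1; apply: smallest_sub; first exact: sigma_algebra_measurable.
move=> _ [u /= us] [A mA <-]; move: us; rewrite in_itv/= => /andP[u0 us].
by apply: measurable_vervaat => //; rewrite u0 (le_trans us).
Qed.

Lemma outer_min_integrable a b : 0 <= a -> a < b -> b <= 1 -> P.-integrable setT (EFin \o outer_min a b).
Proof.
move=> a0 ab b1.
have Is := integrable_psup hB.
apply: (le_integrable measurableT _ _ Is).
  by apply/measurable_EFinP; exact: outside_measurable (outside_outer_min a0 b1).
move=> w _ /=; rewrite lee_fin (ger0_norm (psup_ge0 hB w)).
have h (u v : R) : u <= v -> `|pmin (X ^~ w) u v| <= psup B w.
  by move=> uv; have [c _ ->] := pmin_attained (@cX w) uv; exact: (psup_ge hB).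
by rewrite /outer_min; case: (leP (pmin (X ^~ w) 0 a)) => _; apply: h.
Qed.

(** [D] collects positions of the argmin from which ]a, b[ is unexplored at time s. While the path
    stays above [outer_min] inside, [S], the argmin and the minimum may be replaced by versions
    known outside, and [drift_identity] applies; the rest of the event is null. *)
Lemma drift_trace (a t b s : R) (S : set T) (D : set R) :
  0 <= a -> a < t -> t < b -> b <= 1 -> 0 <= s -> s <= 1 ->
  natural_filtration V s S -> measurable D ->
  (forall w, D (btau w) -> (btau w + s < a) || ((b < btau w) && (btau w + s - 1 < a))) ->
  (\int[P]_w (\1_S w * \1_D (btau w) * bnoise B a t b w)%:E =
   (noise_var a t b)%:E * \int[P]_w (\1_S w * \1_D (btau w) *
     (drift (t - a) (X a w - gm w) (X t w - gm w) +
      drift (b - t) (X b w - gm w) (X t w - gm w)))%:E)%E.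
Proof.
move=> a0 at_ tb b1 s0 s1 FS mD hD; have ab := lt_trans at_ tb.
have mS := natural_filtration_measurable s1 FS.
have [S' mS' hS'] := filtration_trace a0 ab b1 s0 s1 FS.
have mo := outside_outer_min a0 b1; have mo' := outside_measurable mo.
have mt := measurable_btau.
have mgm : measurable_fun setT (fun w => gm w) := measurable_gmin hB.
have mpm : measurable_fun setT (fun w => pmin (X ^~ w) a b).
  by apply: measurable_pmin => //; exact: ltW.
have D0 w : ~ D (btau w) -> \1_D (btau w) = 0 :> R.
  by move=> nD; rewrite indicE memNset.
pose phi w : R := \1_S' w * \1_D (chord_tau a b w).
have mphi : measurable_fun setT (phi : outT a b -> R).
  apply: measurable_funM.
    exact: (@measurable_indic _ (outT a b) R setT S' mS').
  apply: measurableT_comp; first exact: measurable_indic.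
  exact: outside_otau.
have phi0 w : 0 <= phi w by rewrite mulr_ge0.
have phi1 w : phi w <= 1 by rewrite mulr_ile1// indicE lern1 leq_b1.
have phiE w : above a b (outer_min a b) w -> phi w = \1_S w * \1_D (btau w).
  move=> h; rewrite /phi chord_tau_above//.
  have [Dw|nD] := pselect (D (btau w)); last by rewrite D0// !mulr0.
  congr (_ * _); rewrite !indicE; congr (_%:R); congr nat_of_bool.
  by apply/idP/idP; rewrite !inE => ?; apply/(hS' w h (hD w Dw)).
(* With tau outside ]a, b[ the global minimum is reached outside, so failing to stay above
   [outer_min] inside means a tie. *)
have tie w : D (btau w) -> ~~ above a b (outer_min a b) w -> pmin (X ^~ w) a b = outer_min a b w.
  move=> /hD hw; rewrite (aboveE hB) ?(ltW ab)// -leNgt => h.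
  have /andP[t0 t1] := btau_itv w.
  have mg : outer_min a b w <= gm w.
    rewrite -bpath_btau /outer_min ge_min; case/orP : hw => [h1|/andP[h1 _]].
      by rewrite pmin_le//; rewrite t0/=; lra.
    by rewrite (@pmin_le _ _ b 1) ?orbT//; rewrite t1 ltW.
  apply/eqP; rewrite eq_le h/=; apply: (le_trans mg).
  by rewrite (gmin_outer_min a0 ab b1) ge_min lexx orbT.
have N0 := tie_null a0 ab b1 mo.
have mN : measurable [set w | pmin (X ^~ w) a b = outer_min a b w].
  rewrite (_ : [set w | _] = [set w | pmin (X ^~ w) a b <= outer_min a b w] `&`
      [set w | outer_min a b w <= pmin (X ^~ w) a b]); last first.
    apply/seteqP; split => w /=; first by move=> ->; rewrite lexx.
    by move=> [h1 h2]; apply/eqP; rewrite eq_le h1 h2.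
  by apply: measurableI; exact: measurable_leset.
have drop (f g : T -> R) : measurable_fun setT f -> measurable_fun setT g ->
    (forall w, gm w = outer_min a b w -> f w = g w) ->
    (\int[P]_w (\1_S w * \1_D (btau w) * f w)%:E =
     \int[P]_w (phi w * g w * (above a b (outer_min a b) w)%:R)%:E)%E.
  move=> mf mg fg; apply: ae_eq_integral => //.
  - apply/measurable_EFinP; apply: measurable_funM => //; apply: measurable_funM.
      exact: measurable_indic.
    by apply: measurableT_comp => //; exact: measurable_indic.
  - apply/measurable_EFinP; apply: measurable_funM; last exact: (measurable_above hB ab mo').
    by apply: measurable_funM => //; exact: outside_measurable mphi.
  exists [set w | pmin (X ^~ w) a b = outer_min a b w]; split => // w /= hw.
  apply: contrapT => hn; apply: hw => _; congr EFin.
  have [Dw|nD] := pselect (D (btau w)); last first.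
    rewrite D0// mulr0 mul0r.
    have [h|_] := boolP (above a b (outer_min a b) w); last by rewrite mulr0.
    by rewrite phiE// D0// mulr0 !mul0r.
  have h : above a b (outer_min a b) w by apply: contraT => /(tie w Dw).
  by rewrite h mulr1 phiE// (fg w)//; exact: above_outer_min.
have mb : measurable_fun setT (bnoise B a t b).
  by apply: measurable_funB => //; apply: measurable_funD => //; exact: measurable_funM.
rewrite (drop _ (bnoise B a t b) mb mb)//.
rewrite (drop _ (fun w => drift (t - a) (X a w - outer_min a b w) (X t w - outer_min a b w) +
      drift (b - t) (X b w - outer_min a b w) (X t w - outer_min a b w))); last 3 first.
- by apply: measurable_funD; apply: measurable_drift; exact: measurable_funB.
- by apply: measurable_funD; apply: measurable_drift; exact: measurable_funB.
- by move=> w ->.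
apply: (drift_identity hB (C := 1)) => //; exact: outer_min_integrable.
Qed.

End outside_trace.

(** * Infinitesimal steps *)

Section increment_integral.
Context {R : realType}.
Local Notation mu := (@lebesgue_measure R).

Lemma continuous_primitive (f : R -> R) (p : R) : continuous f ->
  exists F : R -> R, forall x, p < x -> is_derive x 1 F (f x).
Proof.
move=> cf; pose F (x : R) : R := \int[mu]_(t in `[p, x]) f t.
exists F => x px; have [||d1 d2] := @continuous_FTC1_closed R f p x (x + 1) _ _ px (cf x).
- by rewrite ltrDl.
- apply: continuous_compact_integrable; first exact: segment_compact.
  exact: continuous_subspaceT.
by apply: DeriveDef; [exact: d1|rewrite -derive1E; exact: d2].
Qed.

(** The integral of (f (r + h) - f r) / h telescopes to the mean of f over [b - h, b] minus its mean
    over [a, a + h], and means are values of f. This turns one-step identities, integrated over r,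
    into an identity for the whole increment. *)
Lemma increment_integral (f : R -> R) (a b h : R) : continuous f -> 0 < h -> a < b - h ->
  exists c1 c2 : R, [/\ b - h <= c1 <= b, a <= c2 <= a + h &
    (\int[mu]_r (((a < r) && (r < b - h))%R%:R * ((f (r + h) - f r) / h))%:E =
     (f c1 - f c2)%:E)%E].
Proof.
(* Starting the primitive at a - 1 leaves room to differentiate at a itself. *)
move=> cf h0 ab; have [F dF] := continuous_primitive (a - 1) cf.
have mvt (x : R) : a <= x -> exists2 c, x <= c <= x + h & F (x + h) - F x = f c * h.
  move=> ax; have xh : x < x + h by rewrite ltrDl.
  have dx y : y \in `]x, (x + h)[ -> is_derive y 1 F (f y).
    by rewrite in_itv/= => /andP[xy _]; apply: dF; lra.
  have [|c] := MVT xh dx.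
    apply: derivable_within_continuous => y; rewrite in_itv/= => /andP[xy _].
    by have [] : is_derive y 1 F (f y) by apply: dF; lra.
  rewrite in_itv/= => /andP[h1 h2] ->; exists c; first by rewrite !ltW.
  by rewrite addrAC subrr add0r.
have [c1 c1i E1] := mvt (b - h) (ltW ab); have [c2 c2i E2] := mvt a (lexx a).
rewrite subrK in c1i E1.
exists c1, c2; split => //.
pose H (x : R) : R := (F (x + h) - F x) / h.
pose g (x : R) : R := (f (x + h) - f x) / h.
have dH (x : R) : a - 1 < x -> is_derive x 1 H (g x).
  move=> ax; have d1 := dF x ax.
  have d2 : is_derive (x + h) 1 F (f (x + h)) by apply: dF; lra.
  have d3 : is_derive x 1 (fun x : R => x + h) 1.
    by apply: is_derive_eq; rewrite addr0.
  have d4 := @is_derive1_comp _ F (fun x : R => x + h) x _ _ d2 d3.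
  rewrite (_ : H = (fun x => h^-1 * (F \o (fun x => x + h)) x - h^-1 * F x)); last first.
    by apply/funext => y; rewrite /H /=; ring.
  by apply: is_derive_eq; rewrite /GRing.scale/= /g; ring.
have cH (x : R) : a - 1 < x -> {for x, continuous H}.
  move=> ax; apply: differentiable_continuous; apply/derivable1_diffP.
  by have [] := dH x ax.
have cg : continuous g.
  move=> x; apply: cvgM; last exact: cvg_cst.
  apply: cvgB; last exact: cf.
  by apply: (@cvg_comp _ _ _ (fun x : R => x + h) f); [apply: cvgD; [exact: cvg_id|exact: cvg_cst]|exact: cf].
have mg D : measurable D -> measurable_fun D (EFin \o g).
  move=> mD; apply/measurable_EFinP; apply: measurable_funTS.
  exact: continuous_measurable_fun.
transitivity (\int[mu]_(r in `[a, (b - h)%R]) (g r)%:E)%E.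
  rewrite integral_itv_bndoo; last by apply: mg.
  rewrite [RHS]integral_mkcond; apply: eq_integral => r _; rewrite patchE.
  case: ifPn => h'; first by move: h'; rewrite inE/= in_itv/= => ->; rewrite mul1r.
  move: h'; rewrite notin_setE/= in_itv/= => /negP/negbTE ->.
  by rewrite mul0r.
rewrite (@continuous_FTC2 R g H)//.
- rewrite -EFinB /H subrK E1 E2; congr EFin; by field; rewrite gt_eqF.
- exact: continuous_subspaceT.
- split.
  + by move=> x; rewrite in_itv/= => /andP[ax _]; have [] : is_derive x 1 H (g x) by apply: dH; lra.
  + by apply: cvg_at_right_filter; apply: cH; lra.
  + by apply: cvg_at_left_filter; apply: cH; lra.
move=> x; rewrite in_itv/= => /andP[ax _]; rewrite derive1E.
have dx : is_derive x 1 H (g x) by apply: dH; lra.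
exact: derive_val.
Qed.

Lemma increment_integral0 (f : R -> R) (a b h : R) : b - h <= a ->
  (\int[mu]_r (((a < r) && (r < b - h))%R%:R * ((f (r + h) - f r) / h))%:E = 0)%E.
Proof.
move=> ba; apply: integral0_eq => r _.
rewrite (_ : (_ && _) = false) ?mul0r//; apply/negbTE; rewrite negb_and -!leNgt.
by have [//|/=] := leP r a => ar; rewrite (le_trans ba)// ltW.
Qed.

Definition moving (f : R -> R) (a b h : R) : R :=
  \int[mu]_r (((a < r) && (r < b - h))%R%:R * ((f (r + h) - f r) / h)).

Lemma movingE (f : R -> R) (a b h : R) : continuous f -> 0 < h ->
  (\int[mu]_r (((a < r) && (r < b - h))%R%:R * ((f (r + h) - f r) / h))%:E =
   (moving f a b h)%:E)%E.
Proof.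
move=> cf h0; rewrite /moving /Rintegral; have [ba|ab] := leP (b - h) a.
  by rewrite increment_integral0.
by have [c1 [c2 [_ _ ->]]] := increment_integral cf h0 ab.
Qed.

Lemma moving_bound (f : R -> R) (a b h M : R) : continuous f -> 0 < h ->
  (forall r, `|f r| <= M) -> `|moving f a b h| <= 2 * M.
Proof.
move=> cf h0 fM; rewrite /moving /Rintegral; have [ba|ab] := leP (b - h) a.
  by rewrite increment_integral0//= normr0 mulr_ge0//; exact: le_trans (fM 0).
have [c1 [c2 [_ _ ->]]] := increment_integral cf h0 ab.
rewrite /= (_ : 2 * M = M + M); last by ring.
by apply: (le_trans (ler_normB _ _)); exact: lerD.
Qed.

(** The maximum covers b <= a, where the domain of integration is empty and the limit must be 0. *)
Lemma cvg_moving (f : R -> R) (a b : R) (h : nat -> R) : continuous f ->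
  (forall n, 0 < h n) -> h n @[n --> \oo] --> 0 ->
  moving f a b (h n) @[n --> \oo] --> f (Num.max a b) - f a.
Proof.
move=> cf h0 ch; have [ab|ab] := ltP a b; last first.
  rewrite subrr; apply: cvg_near_cst; apply: nearW => n.
  by rewrite /moving /Rintegral increment_integral0// lerBlDr (le_trans ab)// lerDl ltW.
apply/cvgrPdist_lt => e e0; have e2 : 0 < e / 2 by rewrite divr_gt0.
have /cvgrPdist_lt/(_ _ e2) [d1 /= d10 hd1] := cf b.
have /cvgrPdist_lt/(_ _ e2) [d2 /= d20 hd2] := cf a.
have ba : 0 < b - a by rewrite subr_gt0.
have hn (d : R) : 0 < d -> \forall n \near \oo, h n < d.
  move=> dp; have /cvgrPdist_lt/(_ _ dp) := ch; apply: filterS => k.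
  by rewrite sub0r normrN gtr0_norm.
near=> n.
have n1 : h n < d1 by near: n; exact: (hn).
have n2 : h n < d2 by near: n; exact: (hn).
have n3 : h n < b - a by near: n; exact: (hn).
have abn : a < b - h n by lra.
rewrite /moving /Rintegral.
have [c1 [c2 [/andP[p1 p2] /andP[q1 q2] ->]]] := increment_integral cf (h0 n) abn.
have k1 : `|f b - f c1| < e / 2.
  by apply: hd1; rewrite /ball_/= ger0_norm; lra.
have k2 : `|f a - f c2| < e / 2.
  by apply: hd2; rewrite /ball_/= ler0_norm; lra.
rewrite /= (_ : f b - f a - (f c1 - f c2) = (f b - f c1) - (f a - f c2)); last by ring.
by apply: (le_lt_trans (ler_normB _ _)); lra.
Unshelve. all: by end_near. Qed.

End increment_integral.

Section joint_integrability.
Context d (T : measurableType d) (R : realType) (P : probability T R).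
Local Notation mu := (@lebesgue_measure R).
Local Notation nu := (mu \x P)%E.

Lemma uniform_le (A : set R) (a c : R) : 0 <= c -> measurable A ->
  A `&` `[0, 1] `<=` `[a, (a + c)] ->
  (uniform_prob (@ltr01 R) A <= c%:E)%E.
Proof.
move=> c0 mA Ac; rewrite /uniform_prob integral_uniform_pdf.
apply: (@le_trans _ _ (\int[mu]_(x in A `&` `[0%R, 1%R]) 1)%E).
  apply: ge0_le_integral => //.
  - exact: measurableI.
  - by move=> x _; rewrite lee_fin uniform_pdf_ge0// ltr01.
  - by apply: measurable_funTS; apply/measurable_EFinP; exact: measurable_uniform_pdf.
  by move=> x [_ /=]; rewrite in_itv/= => x01; rewrite /uniform_pdf x01 subr0 invr1.
rewrite integral_cst; last exact: measurableI.
rewrite mul1e; apply: (@le_trans _ _ (mu `[a, (a + c)%R])).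
  by apply: le_measure; rewrite ?inE//; exact: measurableI.
rewrite lebesgue_measure_itv/= lte_fin; case: ifPn => _; last by rewrite lee_fin.
by rewrite -EFinB addrAC subrr add0r.
Qed.

Definition ind01 (r : R) : R := ((0 < r) && (r < 1))%:R.

Lemma ind01_ge0 r : 0 <= ind01 r. Proof. exact: ler0n. Qed.

Lemma measurable_ind01 : measurable_fun setT ind01.
Proof.
apply: measurable_boolR; apply: measurable_and.
  by apply: measurable_fun_ltr.
by apply: measurable_fun_ltr.
Qed.

Lemma integral_ind01 (f : R -> R) : measurable_fun setT f -> (forall r, 0 <= f r) ->
  (\int[mu]_r (ind01 r * f r)%:E = \int[uniform_prob (@ltr01 R)]_r (f r)%:E)%E.
Proof.
move=> mf f0; rewrite integral_uniform//; last exact/measurable_EFinP.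
rewrite subr0 invr1 mul1e integral_itv_bndoo; last first.
  by apply: measurable_funTS; exact/measurable_EFinP.
rewrite [RHS]integral_mkcond; apply: eq_integral => r _; rewrite patchE /ind01.
case: ifPn => h'; first by move: h'; rewrite inE/= in_itv/= => ->; rewrite mul1r.
by move: h'; rewrite notin_setE/= in_itv/= => /negP/negbTE ->; rewrite mul0r.
Qed.

(** The uniform law on [0, 1] is a probability, so [inv_tail_bound] applies to sqrt g with C = 1:
    sqrt g < e^2 forces g < e^4, of probability at most e^4 <= e^3. Hence the constant 1 + 8. *)
Lemma integral_inv_sqrt (g : R -> R) : measurable_fun setT g ->
  (forall c : R, 0 < c -> (uniform_prob (@ltr01 R) [set r | (g r < c)%R] <= c%:E)%E) ->
  (\int[mu]_r (ind01 r * (Num.sqrt (g r))^-1)%:E <= 9%:E)%E.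
Proof.
move=> mg hg.
have ms : measurable_fun setT (fun r => Num.sqrt (g r)).
  by apply: measurableT_comp => //; apply: continuous_measurable_fun; exact: sqrt_continuous.
rewrite integral_ind01; last 2 first.
- by apply: (measurableT_comp (@measurable_invr R)).
- by move=> r; rewrite invr_ge0 sqrtr_ge0.
have -> : 9 = 1 + 8 * 1 :> R by ring.
apply: (@inv_tail_bound _ _ _ (uniform_prob (@ltr01 R)) (fun r => Num.sqrt (g r)) 1) => //.
move=> k; set c : R := (2^-1 ^+ k) ^+ 2.
have p0 : 0 < 2^-1 ^+ k :> R by rewrite exprn_gt0.
have p1 : 2^-1 ^+ k <= 1 :> R by rewrite exprn_ile1// invf_le1// ler1n.
have c0 : 0 < c by rewrite exprn_gt0.
apply: (@le_trans _ _ (uniform_prob (@ltr01 R) [set r | (g r < c ^+ 2)%R])).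
  apply: le_measure; rewrite ?inE.
  - exact: measurable_ltset.
  - exact: measurable_ltset.
  move=> r /= h; have [g0|g0] := leP (g r) 0; first by rewrite (le_lt_trans g0)// exprn_gt0.
  rewrite -(sqr_sqrtr (ltW g0)) ltrXn2r//; exact: sqrtr_ge0.
apply: (le_trans (hg _ (exprn_gt0 2 c0))); rewrite lee_fin mul1r /c.
move: p0 p1; set p := 2^-1 ^+ k => p0 p1.
by rewrite -(exprM p) ler_wiXn2l// ltW.
Qed.

Lemma integral_edge_weight : (\int[mu]_r (ind01 r * edge_weight r)%:E <= 18%:E)%E.
Proof.
have ms (g : R -> R) : measurable_fun setT g -> measurable_fun setT (fun r => (ind01 r * (Num.sqrt (g r))^-1)%:E).
  move=> mg; apply/measurable_EFinP; apply: measurable_funM; first exact: measurable_ind01.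
  apply: (measurableT_comp (@measurable_invr R)).
  by apply: measurableT_comp => //; apply: continuous_measurable_fun; exact: sqrt_continuous.
have m1 : measurable_fun setT (fun r : R => 1 - r) by exact: measurable_funB.
under eq_integral do rewrite /edge_weight mulrDr EFinD.
rewrite ge0_integralD//; last 4 first.
- by move=> r _; rewrite lee_fin mulr_ge0 ?ind01_ge0// invr_ge0 sqrtr_ge0.
- exact: (ms id).
- by move=> r _; rewrite lee_fin mulr_ge0 ?ind01_ge0// invr_ge0 sqrtr_ge0.
- exact: ms.
have -> : 18 = 9 + 9 :> R by ring.
rewrite EFinD; apply: leeD; apply: integral_inv_sqrt => // c c0.
  apply: (@uniform_le _ 0); [exact: ltW|exact: measurable_ltset|].
  by move=> r [/= h]; rewrite !in_itv/= add0r => /andP[-> _]; exact: ltW.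
apply: (@uniform_le _ (1 - c)); [exact: ltW|exact: measurable_ltset|].
move=> r [/= h]; rewrite !in_itv/= => /andP[_ h1]; apply/andP; split; lra.
Qed.

Lemma joint_ge0_integrable (f : R * T -> R) (c0 c1 : R) : measurable_fun setT f ->
  (forall z, 0 <= f z) -> 0 <= c0 -> 0 <= c1 ->
  (forall r, 0 < r -> r < 1 -> (\int[P]_w (f (r, w))%:E <= (c0 + c1 * edge_weight r)%:E)%E) ->
  nu.-integrable setT (fun z => (ind01 z.1 * f z)%:E).
Proof.
move=> mf f0 c00 c10 hf.
have mi : measurable_fun setT (fun z : R * T => ind01 z.1).
  exact: (measurableT_comp measurable_ind01).
have mif : measurable_fun setT (fun z => (ind01 z.1 * f z)%:E).
  by apply/measurable_EFinP; exact: measurable_funM.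
have if0 z : (0 <= (ind01 z.1 * f z)%:E)%E by rewrite lee_fin mulr_ge0// ind01_ge0.
apply/integrableP; split => //.
under eq_integral do rewrite gee0_abs//.
rewrite fubini_tonelli1//.
apply: (@le_lt_trans _ _ (c0 + c1 * 18)%:E); last by rewrite ltry.
have mf' r : measurable_fun setT (fun w => (f (r, w))%:E).
  by apply/measurable_EFinP; apply: (measurableT_comp mf); exact: measurable_pair1.
have mw : measurable_fun setT (@edge_weight R).
  have msq : measurable_fun setT (@Num.sqrt R).
    by apply: continuous_measurable_fun; exact: sqrt_continuous.
  apply: measurable_funD; apply: (measurableT_comp (@measurable_invr R)) => //.
  by apply: (measurableT_comp msq); exact: measurable_funB.
have mi1 := measurable_ind01.
have E : (\int[mu]_r (c0 * ind01 r + c1 * (ind01 r * edge_weight r))%:E <= (c0 + c1 * 18)%:E)%E.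
  under eq_integral do rewrite EFinD !(EFinM c0) !(EFinM c1).
  rewrite ge0_integralD//; last 4 first.
  - by move=> r _; rewrite mule_ge0// lee_fin ind01_ge0.
  - by apply: measurable_funeM; exact/measurable_EFinP.
  - by move=> r _; rewrite mule_ge0// lee_fin mulr_ge0 ?ind01_ge0 ?edge_weight_ge0.
  - by apply: measurable_funeM; apply/measurable_EFinP; exact: measurable_funM.
  rewrite !ge0_integralZl//; last 4 first.
  - by apply/measurable_EFinP; exact: measurable_funM.
  - by move=> r _; rewrite lee_fin mulr_ge0 ?ind01_ge0 ?edge_weight_ge0.
  - exact/measurable_EFinP.
  - by move=> r _; rewrite lee_fin ind01_ge0.
  have -> : (\int[mu]_r (ind01 r)%:E = 1)%E.
    transitivity (\int[mu]_r (ind01 r * 1)%:E)%E; first by apply: eq_integral => r _; rewrite mulr1.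
    rewrite integral_ind01//.
    by rewrite integral_cst//= mul1e; exact: probability_setT.
  rewrite mule1 EFinD EFinM leeD2l// lee_wpmul2l//; exact: integral_edge_weight.
apply: le_trans E; apply: ge0_le_integral => //.
- by move=> r _; apply: integral_ge0.
- exact: measurable_fun_fubini_tonelli_F.
- apply/measurable_EFinP; apply: measurable_funD; apply: measurable_funM => //.
  exact: measurable_funM.
move=> r _; rewrite /fubini_F /= /ind01; case h : ((0 < r) && (r < 1)) => /=; last first.
  by rewrite integral0_eq ?mul0r ?mulr0 ?addr0// => w _; rewrite mul0r.
case/andP : h => r0 r1; under eq_integral do rewrite mul1r.
by rewrite !mulr1 mul1r; exact: hf.
Qed.

Variables (lambda : R) (B : R -> {RV P >-> R}).
Hypothesis hB : brownian_bridge lambda B.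
Local Notation X := (bpath B).
Local Notation gm w := (pmin (X ^~ w) 0 1).

Let cX w : continuous (X ^~ w). Proof. exact: (@continuous_bpath _ _ _ _ _ _ hB). Qed.
Let mX q : measurable_fun setT (X q). Proof. exact: measurable_bpath. Qed.

Lemma measurable_bpath_joint : measurable_fun setT (fun z : R * T => X z.1 z.2).
Proof. by apply: measurable_eval_joint => // w; exact: cX. Qed.

Let mgm2 : measurable_fun setT (fun z : R * T => gm z.2).
Proof. exact: (measurableT_comp (measurable_gmin hB)). Qed.

Definition height (z : R * T) : R := X z.1 z.2 - gm z.2.

Lemma height_ge0 z : 0 <= height z.
Proof. by rewrite subr_ge0; exact: (gmin_le hB). Qed.

Lemma measurable_height : measurable_fun setT height.
Proof. by apply: measurable_funB => //; exact: measurable_bpath_joint. Qed.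

Lemma inv_height_integrable : nu.-integrable setT (fun z => (ind01 z.1 * (height z)^-1)%:E).
Proof.
apply: (@joint_ge0_integrable _ 1 (64 * psup_moment B)) => //.
- by apply: (measurableT_comp (@measurable_invr R)); exact: measurable_height.
- by move=> z; rewrite invr_ge0 height_ge0.
- by rewrite mulr_ge0//; exact: psup_moment_ge0.
move=> r r0 r1; have := integral_inv_gmin hB r0 r1.
by rewrite /height.
Qed.

Lemma end_slope_integrable :
  nu.-integrable setT (fun z => (ind01 z.1 * `|(X 1 z.2 - X z.1 z.2) / (1 - z.1)|)%:E).
Proof.
apply: (@joint_ge0_integrable (fun z => `|(X 1 z.2 - X z.1 z.2) / (1 - z.1)|) (psup_moment B) 1) => //.
- apply: measurableT_comp => //; apply: measurable_funM.
    apply: measurable_funB; last exact: measurable_bpath_joint.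
    exact: (measurableT_comp (mX 1)).
  apply: (measurableT_comp (@measurable_invr R)).
  by apply: measurable_funB => //; exact: measurable_fst.
- exact: psup_moment_ge0.
by move=> r r0 r1; rewrite mul1r; exact: (integral_end_slope hB).
Qed.

End joint_integrability.

(** * Integration over the starting time of the step and limit of vanishing step length *)

Section drift_limit.
Context d (T : measurableType d) (R : realType) (P : probability T R).
Variables (lambda : R) (B : R -> {RV P >-> R}).
Hypothesis hB : brownian_bridge lambda B.
Local Notation mu := (@lebesgue_measure R).
Local Notation nu := (mu \x P)%E.
Local Notation X := (bpath B).
Local Notation gm w := (pmin (X ^~ w) 0 1).
Local Notation height := (height B).

Let cX w : continuous (X ^~ w). Proof. exact: (@continuous_bpath _ _ _ _ _ _ hB). Qed.
Let mX q : measurable_fun setT (X q). Proof. exact: measurable_bpath. Qed.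

Definition ivl (a b r : R) : R := ((a < r) && (r < b))%:R.

Lemma ivl_itv a b r : 0 <= ivl a b r <= 1.
Proof. by rewrite /ivl; case: ((a < r) && (r < b)); rewrite ?lexx ?ler01. Qed.

Lemma measurable_ivl d' (T' : measurableType d') (f g h : T' -> R) :
  measurable_fun setT f -> measurable_fun setT g -> measurable_fun setT h ->
  measurable_fun setT (fun z => ivl (f z) (g z) (h z)).
Proof.
by move=> mf mg mh; apply: measurable_boolR; apply: measurable_and; exact: measurable_fun_ltr.
Qed.

Lemma psup_joint_integrable (c : R) : nu.-integrable setT (fun z => (ind01 z.1 * (c * psup B z.2))%:E).
Proof.
have h : nu.-integrable setT (fun z => (ind01 z.1 * psup B z.2)%:E).
  apply: (@joint_ge0_integrable _ _ _ P (fun z => psup B z.2) (psup_moment B) 0) => //.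
  - exact: (measurableT_comp (measurable_psup hB)).
  - by move=> z; exact: (psup_ge0 hB).
  - exact: psup_moment_ge0.
  move=> r _ _; rewrite mul0r addr0 -(psup_momentE hB).
  apply: ge0_le_integral => //.
  - by move=> w _; rewrite lee_fin (psup_ge0 hB).
  - by apply/measurable_EFinP; exact: (measurable_psup hB).
  - apply/measurable_EFinP; apply: measurable_funX; apply: measurable_funD => //.
    by apply: measurable_funM => //; exact: (measurable_psup hB).
  move=> w _ /=; rewrite lee_fin.
  by have := psup_ge0 hB w; have := sqr_ge0 (psup B w); rewrite !expr2; lra.
have := integrableZl measurableT c h; congr (_.-integrable _ _).
by apply/funext => z; rewrite -EFinM; congr EFin; ring.
Qed.

Variables (S : set T) (al be : T -> R) (ka : R * T -> R).
Hypothesis mS : measurable S.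
Hypothesis mal : measurable_fun setT al.
Hypothesis mbe : measurable_fun setT be.
Hypothesis mka : measurable_fun setT ka.
Hypothesis al0 : forall w, 0 <= al w.
Hypothesis be1 : forall w, be w <= 1.
Hypothesis ka0 : forall z, 0 <= ka z.
Hypothesis kaH : forall z, ka z <= (height z)^-1.

Let iS (w : T) : R := \1_S w.
Let iS01 w : 0 <= iS w <= 1. Proof. by rewrite /iS indicE; case: (_ \in _); rewrite ?lexx ?ler01. Qed.

(* Per unit of time: the increment over [r, r + h], its expected slope towards
   the value at [be], and the repulsion from the minimum. The last one is
   parametrised by the endpoint r + h of the step, where it is dominated by
   2 / height. *)
Definition step_quotient (h : R) (z : R * T) : R :=
  iS z.2 * (ivl (al z.2) (be z.2 - h) z.1 * ((X (z.1 + h) z.2 - X z.1 z.2) / h)).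
Definition step_slope (h : R) (z : R * T) : R :=
  iS z.2 * (ivl (al z.2) (be z.2 - h) z.1 * ((X (be z.2) z.2 - X z.1 z.2) / (be z.2 - z.1))).
Definition step_repulsion (h : R) (z : R * T) : R :=
  iS z.2 * (ivl (al z.2 + h) (be z.2) z.1 * ((be z.2 - z.1) / (be z.2 - z.1 + h) *
    (drift h (height (z.1 - h, z.2)) (height z) + ka z))).

Let mX2 := measurable_bpath_joint hB.
Let m1 : measurable_fun setT (fun z : R * T => z.1). Proof. exact: measurable_fst. Qed.
Let m2 : measurable_fun setT (fun z : R * T => z.2). Proof. exact: measurable_snd. Qed.
Let mal2 : measurable_fun setT (fun z : R * T => al z.2). Proof. exact: measurableT_comp. Qed.
Let mbe2 : measurable_fun setT (fun z : R * T => be z.2). Proof. exact: measurableT_comp. Qed.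
Let miS : measurable_fun setT (fun z : R * T => iS z.2).
Proof. by apply: measurableT_comp => //; exact: measurable_indic. Qed.
Let mXs (th : R * T -> R) : measurable_fun setT th -> measurable_fun setT (fun z => X (th z) z.2).
Proof.
move=> mth; apply: (measurableT_comp (f := fun z : R * T => X z.1 z.2) mX2 (g := fun z => (th z, z.2))).
exact: measurable_fun_pair.
Qed.
Let mhe := measurable_height hB.

Let mf_h h : measurable_fun setT (step_quotient h).
Proof.
apply: measurable_funM => //; apply: measurable_funM.
  by apply: measurable_ivl => //; exact: measurable_funB.
apply: measurable_funM => //; apply: measurable_funB => //.
by apply: mXs; exact: measurable_funD.
Qed.

Let mg_h h : measurable_fun setT (step_slope h).
Proof.
apply: measurable_funM => //; apply: measurable_funM.
  by apply: measurable_ivl => //; exact: measurable_funB.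
apply: measurable_funM; first by apply: measurable_funB => //; exact: mXs.
by apply: (measurableT_comp (@measurable_invr R)); exact: measurable_funB.
Qed.

Let mk_h h : measurable_fun setT (step_repulsion h).
Proof.
apply: measurable_funM => //; apply: measurable_funM.
  by apply: measurable_ivl => //; exact: measurable_funD.
apply: measurable_funM.
  apply: measurable_funM; first exact: measurable_funB.
  apply: (measurableT_comp (@measurable_invr R)); apply: measurable_funD => //.
  exact: measurable_funB.
apply: measurable_funD => //; apply: measurable_drift => //.
apply: (measurableT_comp (f := height) mhe (g := fun z : R * T => (z.1 - h, z.2))).
by apply: measurable_fun_pair => //; exact: measurable_funB.
Qed.

Let ivl01 w h r : 0 <= h -> ivl (al w) (be w - h) r <= ind01 r.
Proof.
move=> h0; rewrite /ivl /ind01; case: (boolP (_ && _)) => [/andP[h1 h2]|_] /=; last exact: ler0n.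
rewrite (le_lt_trans (al0 w) h1)/= (lt_le_trans h2)//.
by rewrite lerBlDr (le_trans (be1 w))// lerDl.
Qed.

Let ivl01' w h r : 0 <= h -> ivl (al w + h) (be w) r <= ind01 r.
Proof.
move=> h0; rewrite /ivl /ind01; case: (boolP (_ && _)) => [/andP[h1 h2]|_] /=; last exact: ler0n.
rewrite (le_lt_trans _ h1) ?addr_ge0//=.
by rewrite (lt_le_trans h2).
Qed.

Let Xb q1 q2 w : `|X q1 w - X q2 w| <= 2 * psup B w.
Proof.
rewrite (_ : 2 * _ = psup B w + psup B w); last by ring.
by apply: (le_trans (ler_normB _ _)); apply: lerD; exact: (psup_ge hB).
Qed.

Lemma step_quotient_integrable h : 0 < h -> nu.-integrable setT (EFin \o step_quotient h).
Proof.
move=> h0; apply: (le_integrable measurableT _ _ (psup_joint_integrable (2 / h))).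
  by apply/measurable_EFinP; first [exact: mf_h|exact: mg_h].
move=> z _ /=; have /andP[s0 s1] := iS01 z.2.
have /andP[i0 i1] := ivl_itv (al z.2) (be z.2 - h) z.1.
have S0 := psup_ge0 hB z.2.
rewrite lee_fin [leRHS]ger0_norm ?mulr_ge0 ?ind01_ge0 ?invr_ge0 ?(ltW h0)//.
rewrite !normrM (ger0_norm s0) (ger0_norm i0) normfV (gtr0_norm h0).
rewrite -[leRHS]mul1r; apply: ler_pM => //; first by rewrite mulr_ge0// mulr_ge0// invr_ge0 ltW.
apply: ler_pM => //; [by rewrite mulr_ge0// invr_ge0 ltW|exact: ivl01 (ltW h0)|].
by rewrite mulrAC ler_wpM2r ?invr_ge0 ?(ltW h0)//.
Qed.

Lemma step_slope_integrable h : 0 < h -> nu.-integrable setT (EFin \o step_slope h).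
Proof.
move=> h0; apply: (le_integrable measurableT _ _ (psup_joint_integrable (2 / h))).
  by apply/measurable_EFinP; first [exact: mf_h|exact: mg_h].
move=> z _ /=; have /andP[s0 s1] := iS01 z.2.
have /andP[i0 i1] := ivl_itv (al z.2) (be z.2 - h) z.1.
have S0 := psup_ge0 hB z.2.
rewrite lee_fin [leRHS]ger0_norm ?mulr_ge0 ?ind01_ge0 ?invr_ge0 ?(ltW h0)//.
rewrite 2!normrM (ger0_norm s0) (ger0_norm i0).
rewrite -[leRHS]mul1r; apply: ler_pM => //; first by rewrite mulr_ge0.
rewrite {1}/ivl; case: (boolP (_ && _)) => [/andP[h1 h2]|_] /=; last first.
  by rewrite mul0r !mulr_ge0 ?ind01_ge0 ?invr_ge0 ?(ltW h0).
have i01 := ivl01 z.2 z.1 (ltW h0); rewrite /ivl h1 h2/= in i01.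
apply: ler_pM => //.
have b0 : 0 < be z.2 - z.1 by lra.
rewrite normrM normfV (gtr0_norm b0) mulrAC; apply: ler_pM => //.
  by rewrite invr_ge0 ltW.
by rewrite lef_pV2 ?posrE//; lra.
Qed.

Let k_h_bound h z : 0 < h -> 0 <= step_repulsion h z <= ind01 z.1 * (2 * (height z)^-1).
Proof.
move=> h0; have /andP[s0 s1] := iS01 z.2; have H0 := height_ge0 hB z.
rewrite /step_repulsion /ivl; case: (boolP ((al z.2 + h < z.1) && (z.1 < be z.2))) => [/andP[h1 h2]|_] /=; last first.
  by rewrite mul0r mulr0 lexx/= !mulr_ge0 ?ind01_ge0 ?invr_ge0.
have i01 := ivl01' z.2 z.1 (ltW h0); rewrite /ivl h1 h2/= in i01.
have b0 : 0 < be z.2 - z.1 by lra.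
have d0 := drift_ge0 h0 (height_ge0 hB (z.1 - h, z.2)) H0.
have d1 := drift_le_inv h0 (height_ge0 hB (z.1 - h, z.2)) H0.
have q0 : 0 <= (be z.2 - z.1) / (be z.2 - z.1 + h) <= 1.
  rewrite divr_ge0 ?ler_pdivrMr//; lra.
have /andP[q1 q2] := q0.
have dk : 0 <= drift h (height (z.1 - h, z.2)) (height z) + ka z by rewrite addr_ge0.
apply/andP; split; first by rewrite mul1r mulr_ge0// mulr_ge0.
rewrite mul1r; apply: (@le_trans _ _ (2 * (height z)^-1)); last first.
  by rewrite ler_peMl// mulr_ge0// invr_ge0.
rewrite -[leRHS]mul1r; apply: ler_pM => //; first by rewrite mulr_ge0.
rewrite -[leRHS]mul1r; apply: ler_pM => //.
by have := kaH z; lra.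
Qed.

Lemma step_repulsion_integrable h : 0 < h -> nu.-integrable setT (EFin \o step_repulsion h).
Proof.
move=> h0; have := integrableZl measurableT 2 (inv_height_integrable hB) => I.
apply: (le_integrable measurableT _ _ I); first by apply/measurable_EFinP; exact: mk_h.
move=> z _ /=; have /andP[b0 b1] := k_h_bound z h0.
rewrite lee_fin ger0_norm// (le_trans b1)//; apply: le_trans (ler_norm _).
by rewrite mulrCA.
Qed.

(** The one-step identity at a fixed time, supplied later by [post_step] for the path after the
    argmin and by [pre_step] for the path before it. *)
Hypothesis step : forall h r, 0 < h -> h < 1 -> 0 < r -> r < 1 ->
  (\int[P]_w (step_quotient h (r, w) - step_slope h (r, w))%:E = \int[P]_w (step_repulsion h ((r + h)%R, w))%:E)%E.

(** Integrates [step] over r by Fubini. The repulsion is taken at r + h, which translation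
    invariance of the Lebesgue measure brings back to r; for r outside ]0, 1[ all three terms
    vanish. *)
Lemma level_identity h : 0 < h -> h < 1 ->
  (\int[nu]_z (step_quotient h z)%:E - \int[nu]_z (step_slope h z)%:E = \int[nu]_z (step_repulsion h z)%:E)%E.
Proof.
move=> h0 h1; have If := step_quotient_integrable h0; have Ig := step_slope_integrable h0.
have Ifg : nu.-integrable setT (fun z => ((step_quotient h z)%:E - (step_slope h z)%:E)%E) by exact: integrableB.
rewrite -(integralB measurableT If Ig).
rewrite -(@integral12_prod_meas1 _ _ _ _ _ _ _ _ Ifg).
have kh0 z : (0 <= (step_repulsion h z)%:E)%E by rewrite lee_fin; have /andP[] := k_h_bound z h0.
have mk : measurable_fun setT (EFin \o step_repulsion h) by exact/measurable_EFinP.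
rewrite (@fubini_tonelli1 _ _ _ _ _ mu P (EFin \o step_repulsion h) mk kh0).
rewrite -(@ge0_integral_shift _ h (fubini_F P (EFin \o step_repulsion h))); last 2 first.
- exact: measurable_fun_fubini_tonelli_F.
- by move=> x; apply: integral_ge0 => w _; exact: kh0.
apply: eq_integral => r _; rewrite /fubini_F/=.
have [/andP[r0 r1]|r01] := boolP ((0 < r) && (r < 1)).
  rewrite -step//; apply: eq_integral => w _ /=; by rewrite EFinB.
have z0 w : ivl (al w) (be w - h) r = 0.
  have := ivl01 w r (ltW h0); rewrite /ind01 (negbTE r01) => i1.
  by apply/eqP; rewrite eq_le i1; have /andP[] := ivl_itv (al w) (be w - h) r.
rewrite !integral0_eq// => w _; rewrite /step_quotient /step_slope /step_repulsion/= ?z0 ?mul0r ?mulr0 ?sube0//.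
have -> : ivl (al w + h) (be w) (r + h) = ivl (al w) (be w - h) r by rewrite /ivl ltrD2r ltrBrDr.
by rewrite z0 mul0r mulr0.
Qed.

Lemma step_quotient_moving h : 0 < h ->
  (\int[nu]_z (step_quotient h z)%:E = \int[P]_w (iS w * moving (X ^~ w) (al w) (be w) h)%:E)%E /\
  measurable_fun setT (fun w => iS w * moving (X ^~ w) (al w) (be w) h).
Proof.
move=> h0; have If := step_quotient_integrable h0.
have E w : (fubini_G mu (EFin \o step_quotient h) w = (iS w * moving (X ^~ w) (al w) (be w) h)%:E)%E.
  have := movingE (al w) (be w) (@cX w) h0 => Em.
  rewrite EFinM -Em /fubini_G/= /step_quotient/=.
  rewrite /iS indicE; case: (w \in S); first by rewrite mul1e; apply: eq_integral => r _; rewrite mul1r.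
  by rewrite mul0e integral0_eq// => r _; rewrite mul0r.
split.
  by rewrite -(@integral21_prod_meas1 _ _ _ _ _ _ _ _ If); apply: eq_integral => w _; exact: E.
apply/measurable_EFinP.
rewrite (_ : _ \o _ = fubini_G mu (EFin \o step_quotient h)); last by apply/funext => w; rewrite E.
exact: measurable_fubini_G If.
Qed.

Definition slope_term (z : R * T) : R :=
  iS z.2 * (ivl (al z.2) (be z.2) z.1 * ((X (be z.2) z.2 - X z.1 z.2) / (be z.2 - z.1))).
Definition repulsion_term (z : R * T) : R := iS z.2 * (ivl (al z.2) (be z.2) z.1 * ka z).

(** The denominator n + 2 keeps the step length strictly below 1, as [step] requires. *)
Let hn (n : nat) : R := n.+2%:R^-1.
Let hn0 n : 0 < hn n. Proof. by rewrite invr_gt0. Qed.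
Let hn1 n : hn n < 1. Proof. by rewrite invf_lt1// ltr1n. Qed.
Let chn : hn n @[n --> \oo] --> 0.
Proof. by have := @cvg_harmonic R; rewrite -cvg_shiftS. Qed.
Let hn_lt (e : R) : 0 < e -> \forall n \near \oo, hn n < e.
Proof.
move=> e0; have /cvgrPdist_lt/(_ _ e0) := chn; apply: filterS => n.
by rewrite sub0r normrN gtr0_norm.
Qed.

Let cvg_g z : step_slope (hn n) z @[n --> \oo] --> slope_term z.
Proof.
apply: cvg_near_cst.
have [h|h] := ltP z.1 (be z.2).
  have := hn_lt (e := be z.2 - z.1); rewrite subr_gt0 => /(_ h); apply: filterS => n hn'.
  rewrite /step_slope /slope_term /ivl h (_ : (z.1 < be z.2 - hn n)%R = true)//; lra.
apply: nearW => n; rewrite /step_slope /slope_term /ivl (ltNge z.1 (be z.2)) h/= (_ : (z.1 < be z.2 - hn n)%R = false)//.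
by apply/negbTE; rewrite -leNgt (le_trans _ h)// gerBl ltW.
Qed.

Let inv_le (x z h : R) : 0 < x -> 0 < z -> 0 < h ->
  (z * (1 + x * z / (2 * h)))^-1 <= 2 * h / (x * z ^+ 2).
Proof.
move=> x0 z0 h0; have -> : 2 * h / (x * z ^+ 2) = (z * (x * z / (2 * h)))^-1.
  by field; rewrite !gt_eqF.
have p : 0 < x * z / (2 * h) by rewrite divr_gt0 ?mulr_gt0.
set y := x * z / (2 * h) in p *.
have q1 : 0 < z * (1 + y) by rewrite mulr_gt0// addr_gt0.
have q2 : 0 < z * y by rewrite mulr_gt0.
by rewrite lef_pV2 ?posrE// ler_wpM2l ?(ltW z0)// lerDr.
Qed.

(** The conditioning over the short side of the step leaves no trace in the limit: at a positive
    height the bound 2 h / (x z^2) tends to 0, and at height 0 [drift] is 0 by convention. *)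
Let cvg_drift r w : drift (hn n) (height (r - hn n, w)) (height (r, w)) @[n --> \oo] --> 0.
Proof.
have H0 := height_ge0 hB.
have [hz|hz] := eqVneq (height (r, w)) 0.
  apply: cvg_near_cst; apply: nearW => n.
  by rewrite hz /drift mulr0 mul0r expR0 subrr invr0 mulr0.
set z := height (r, w) in hz *; have z0 : 0 < z by rewrite lt_neqAle eq_sym hz H0.
have cx : height (r - hn n, w) @[n --> \oo] --> z.
  rewrite /z /height /=; apply: cvgB; last exact: cvg_cst.
  have cr : r - hn n @[n --> \oo] --> r.
    by rewrite -[X in _ --> X]subr0; apply: cvgB => //; exact: cvg_cst.
  exact: (@cvg_comp _ _ _ (fun n => r - hn n) (X ^~ w) _ _ _ cr (@cX w r)).
have c2 : 2 * hn n / (height (r - hn n, w) * z ^+ 2) @[n --> \oo] --> (0 : R).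
  have -> : 0 = 2 * 0 / (z * z ^+ 2) :> R by rewrite mulr0 mul0r.
  apply: cvgM; first by apply: cvgM => //; exact: cvg_cst.
  apply: cvgV; first by rewrite mulf_neq0// expf_neq0.
  by apply: cvgM => //; exact: cvg_cst.
apply: (squeeze_cvgr _ (cvg_cst 0) c2).
have /cvgrPdist_lt/(_ _ z0) := cx; apply: filterS => n hx.
have x0 : 0 < height (r - hn n, w) by move: hx; rewrite ltr_norml => /andP[_ ?]; lra.
rewrite drift_ge0 ?(ltW x0) ?(ltW z0)//=.
apply: (le_trans (drift_le (hn0 n) (ltW x0) (ltW z0))).
exact: inv_le.
Qed.

Let cvg_k z : step_repulsion (hn n) z @[n --> \oo] --> repulsion_term z.
Proof.
have cd : drift (hn n) (height (z.1 - hn n, z.2)) (height z) @[n --> \oo] --> 0.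
  by case: z => r w; exact: cvg_drift.
rewrite /step_repulsion /repulsion_term; apply: cvgM; first exact: cvg_cst.
have [hb|hb] := ltP z.1 (be z.2); last first.
  apply: cvg_near_cst; apply: nearW => n.
  by rewrite /ivl !(ltNge z.1) hb/= !andbF !mul0r.
have [ha|ha] := ltP (al z.2) z.1; last first.
  apply: cvg_near_cst; apply: nearW => n.
  rewrite /ivl (ltNge (al z.2) z.1) ha/= mul0r (_ : (_ < z.1)%R = false) ?mul0r//.
  by apply/negbTE; rewrite -leNgt (le_trans ha)// lerDl ltW.
apply: cvgM.
  apply: cvg_near_cst; have := hn_lt (e := z.1 - al z.2); rewrite subr_gt0 => /(_ ha).
  apply: filterS => n hn'; rewrite /ivl ha hb (_ : (al z.2 + hn n < z.1)%R = true)//; lra.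
have b0 : be z.2 - z.1 != 0 by rewrite subr_eq0 gt_eqF.
have E : ka z = (be z.2 - z.1) / (be z.2 - z.1 + 0) * (0 + ka z).
  by rewrite addr0 divff// mul1r add0r.
rewrite [X in _ --> X]E; apply: cvgM.
  apply: cvgM; first exact: cvg_cst.
  apply: cvgV; first by rewrite addr0.
  by apply: cvgD => //; exact: cvg_cst.
by apply: cvgD; [exact: cd|exact: cvg_cst].
Qed.

Lemma measurable_slope_term : measurable_fun setT slope_term.
Proof. by apply: (@measurable_fun_cvg _ _ _ _ (fun n => step_slope (hn n))) => [n|z _]; [exact: mg_h|exact: cvg_g]. Qed.

Lemma measurable_repulsion_term : measurable_fun setT repulsion_term.
Proof. by apply: (@measurable_fun_cvg _ _ _ _ (fun n => step_repulsion (hn n))) => [n|z _]; [exact: mk_h|exact: cvg_k]. Qed.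

Let g_h_le h z : 0 < h -> `|step_slope h z| <= `|slope_term z|.
Proof.
move=> h0; rewrite /step_slope /slope_term !normrM; apply: ler_wpM2l => //; apply: ler_wpM2r => //.
rewrite /ivl; case: (boolP (_ && _)) => [/andP[h1 h2]|_] /=; last by rewrite normr0.
by rewrite h1 (_ : z.1 < be z.2)//; lra.
Qed.

Let k_cvg : (\int[nu]_z (step_repulsion (hn n) z)%:E @[n --> \oo] --> \int[nu]_z (repulsion_term z)%:E)%E /\
  nu.-integrable setT (EFin \o repulsion_term).
Proof.
have I := integrableZl measurableT 2 (inv_height_integrable hB).
have [||z _||n z _|I0 L] := @dominated_convergence_real _ _ R nu setT (fun n => step_repulsion (hn n)) repulsion_term
  (fun z => ind01 z.1 * (2 * (height z)^-1)) measurableT.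
- by move=> n; exact: mk_h.
- exact: measurable_repulsion_term.
- exact: cvg_k.
- by move: I; congr (_.-integrable _ _); apply/funext => z; rewrite /= -EFinM mulrCA.
- by have /andP[b0 b1] := k_h_bound z (hn0 n); rewrite ger0_norm.
by split.
Qed.

Lemma repulsion_term_integrable : nu.-integrable setT (EFin \o repulsion_term). Proof. exact: k_cvg.2. Qed.

Let f_cvg : (\int[nu]_z (step_quotient (hn n) z)%:E @[n --> \oo] -->
  \int[P]_w (iS w * (X (Num.max (al w) (be w)) w - X (al w) w))%:E)%E.
Proof.
under eq_fun do rewrite (step_quotient_moving (hn0 _)).1.
have I := integrableZl measurableT 2 (integrable_psup hB).
have [||w _||n w _|_ //] := @dominated_convergence_real _ _ R P setT
  (fun n w => iS w * moving (X ^~ w) (al w) (be w) (hn n))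
  (fun w => iS w * (X (Num.max (al w) (be w)) w - X (al w) w))
  (fun w => 2 * psup B w) measurableT.
- by move=> n; exact: (step_quotient_moving (hn0 n)).2.
- apply: measurable_funM; first exact: measurable_indic.
  by apply: measurable_funB; apply: measurable_eval => //; exact: measurable_maxr.
- apply: cvgM; first exact: cvg_cst.
  by apply: cvg_moving => //; exact: cX.
- exact: I.
have /andP[s0 s1] := iS01 w.
rewrite normrM (ger0_norm s0); apply: le_trans (moving_bound (al w) (be w) (@cX w) (hn0 n) (psup_ge hB ^~ w)).
by rewrite ler_piMl.
Qed.

Lemma limit_identity : nu.-integrable setT (EFin \o slope_term) ->
  (\int[P]_w (iS w * (X (Num.max (al w) (be w)) w - X (al w) w))%:E =
   \int[nu]_z (slope_term z + repulsion_term z)%:E)%E.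
Proof.
move=> Ig0.
have [||z _||n z _|_ Lg] := @dominated_convergence_real _ _ R nu setT (fun n => step_slope (hn n)) slope_term
  (fun z => `|slope_term z|) measurableT.
- by move=> n; exact: mg_h.
- exact: measurable_slope_term.
- exact: cvg_g.
- exact: integrable_norm Ig0.
- exact: g_h_le.
have [Lk Ik0] := k_cvg.
under [RHS]eq_integral do rewrite EFinD.
rewrite (integralD measurableT Ig0 Ik0) addeC.
have fg0 := integrable_fin_num measurableT Ig0.
have fk0 := integrable_fin_num measurableT Ik0.
have L : (\int[nu]_z (step_quotient (hn n) z)%:E @[n --> \oo] -->
    \int[nu]_z (repulsion_term z)%:E + \int[nu]_z (slope_term z)%:E)%E.
  have E n : (\int[nu]_z (step_quotient (hn n) z)%:E = \int[nu]_z (step_repulsion (hn n) z)%:E + \int[nu]_z (step_slope (hn n) z)%:E)%E.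
    rewrite -(level_identity (hn0 n) (hn1 n)) subeK//.
    exact: (integrable_fin_num measurableT (step_slope_integrable (hn0 n))).
  rewrite (funext E); apply: cvgeD => //.
  by rewrite fin_num_adde_defl.
exact: (cvg_unique (@ereal_hausdorff R) f_cvg L).
Qed.

Lemma slope_term_integrable : (forall z, slope_term z <= 0) -> nu.-integrable setT (EFin \o slope_term).
Proof.
move=> g00; apply/integrableP; split; first by apply/measurable_EFinP; exact: measurable_slope_term.
have gn0 h z : 0 < h -> step_slope h z <= 0.
  move=> h0; have := g00 z; rewrite /step_slope /slope_term; have /andP[s0 _] := iS01 z.2.
  rewrite /ivl; case: (boolP ((al z.2 < z.1) && (z.1 < be z.2 - h))) => [/andP[h1 h2]|_] /=; last first.
    by rewrite mul0r mulr0.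
  have -> : z.1 < be z.2 by lra.
  by rewrite h1.
pose A := (\int[nu]_z (ind01 z.1 * (2 * (height z)^-1))%:E)%E.
pose D := (\int[P]_w (2%:E * (psup B w)%:E))%E.
have I1 : nu.-integrable setT (fun z => (ind01 z.1 * (2 * (height z)^-1))%:E).
  have := integrableZl measurableT 2 (inv_height_integrable hB).
  by congr (_.-integrable _ _); apply/funext => z; rewrite /= -EFinM mulrCA.
have I2 := integrableZl measurableT 2 (integrable_psup hB).
have Cfin : (A + D < +oo)%E.
  rewrite ltey_eq fin_numD (integrable_fin_num measurableT I1).
  by rewrite (integrable_fin_num measurableT I2).
(* By [level_identity] the integral of -slope is that of the repulsion, at most A, minus that of the
   quotient, at most D in absolute value. Neither bound depends on n. *)
have gC n : (\int[nu]_z (- step_slope (hn n) z)%:E <= A + D)%E.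
  have Ig := step_slope_integrable (hn0 n); have If := step_quotient_integrable (hn0 n).
  under eq_integral do rewrite EFinN.
  rewrite integralN; last first.
    by rewrite fin_num_adde_defl// fin_numN; exact: integrable_neg_fin_num.
  have ff := integrable_fin_num measurableT If; have fg := integrable_fin_num measurableT Ig.
  have -> : (- (\int[nu]_z (step_slope (hn n) z)%:E) =
      (\int[nu]_z (step_repulsion (hn n) z)%:E) - (\int[nu]_z (step_quotient (hn n) z)%:E))%E.
    by rewrite -(level_identity (hn0 n) (hn1 n)) addeAC subee// add0e.
  apply: leeD.
    apply: le_integral => //; first exact: step_repulsion_integrable.
    by move=> z _; rewrite lee_fin; have /andP[] := k_h_bound z (hn0 n).
  have [-> mm] := step_quotient_moving (hn0 n).
  have bd w : `|iS w * moving (X ^~ w) (al w) (be w) (hn n)| <= 2 * psup B w.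
    have /andP[s0 s1] := iS01 w.
    rewrite normrM (ger0_norm s0); apply: le_trans (moving_bound (al w) (be w) (@cX w) (hn0 n) (psup_ge hB ^~ w)).
    by rewrite ler_piMl.
  have Im : P.-integrable setT (EFin \o (fun w => iS w * moving (X ^~ w) (al w) (be w) (hn n))).
    apply: (le_integrable measurableT _ _ I2); first exact/measurable_EFinP.
    by move=> w _ /=; rewrite lee_fin (le_trans (bd w))// ler_norm.
  rewrite -integralN; last first.
    by rewrite fin_num_adde_defl// fin_numN; exact: integrable_neg_fin_num.
  apply: le_integral => //; first exact: integrableN Im.
  by move=> w _; rewrite -EFinN -EFinM lee_fin (le_trans _ (bd w))// -normrN ler_norm.
have mct : (\int[nu]_z (- step_slope (hn n) z)%:E @[n --> \oo] --> \int[nu]_z (- slope_term z)%:E)%E.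
  have := @cvg_monotone_convergence _ _ _ nu setT measurableT (fun n z => (- step_slope (hn n) z)%:E).
  rewrite (_ : (fun x => lim _) = (fun z => (- slope_term z)%:E)); last first.
    apply/funext => z; apply/cvg_lim => //; apply: cvg_EFin; first exact: nearW.
    by apply: cvgN; exact: cvg_g.
  apply.
  - by move=> n; apply/measurable_EFinP; apply: measurableT_comp => //; exact: mg_h.
  - by move=> n z _; rewrite lee_fin oppr_ge0 gn0.
  move=> z _ i j ij; rewrite lee_fin lerN2.
  have hij : hn j <= hn i by rewrite lef_pV2 ?posrE// ler_nat.
  have := gn0 (hn j) z (hn0 j); rewrite /step_slope /ivl.
  case: (boolP ((al z.2 < z.1) && (z.1 < be z.2 - hn i))) => [/andP[h1 h2] _|_] /=; last first.
    by rewrite mul0r mulr0.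
  have -> : z.1 < be z.2 - hn j by lra.
  by rewrite h1.
under eq_integral do rewrite /= ler0_norm//.
exact: le_lt_trans (cvge_le (nearW _ gC) mct) Cfin.
Qed.

End drift_limit.

(** * Drift identities after and before the argmin *)

Section drift_identities.
Context d (T : measurableType d) (R : realType) (P : probability T R).
Variables (lambda : R) (B : R -> {RV P >-> R}).
Hypothesis hB : brownian_bridge lambda B.
Local Notation mu := (@lebesgue_measure R).
Local Notation nu := (mu \x P)%E.
Local Notation X := (bpath B).
Local Notation gm w := (pmin (X ^~ w) 0 1).
Local Notation height := (height B).
Local Notation tau := (btau B).
Local Notation V := (fun u w => vervaat (fun r => B r w) u).

Let cX w : continuous (X ^~ w). Proof. exact: (@continuous_bpath _ _ _ _ _ _ hB). Qed.
Let mX q : measurable_fun setT (X q). Proof. exact: measurable_bpath. Qed.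
Let mgm : measurable_fun setT (fun w => gm w). Proof. exact: (measurable_gmin hB). Qed.
Let mtau : measurable_fun setT tau. Proof. exact: (measurable_btau hB). Qed.
Let H0 z : 0 <= height z. Proof. exact: (height_ge0 hB). Qed.

(** For a step from r to r + h inside [r, b] this is the chord noise [bnoise B r (r + h) b] divided
    by h. In [step_drift] the factor in front is [noise_var] divided by h. *)
Definition step_noise (r h b : R) w := (X (r + h) w - X r w) / h - (X b w - X r w) / (b - r).
Definition step_drift (r h b : R) w := (b - r - h) / (b - r) *
  (drift h (height (r, w)) (height (r + h, w)) + drift (b - (r + h)) (height (b, w)) (height (r + h, w))).

Lemma measurable_step_noise r h b : measurable_fun setT (step_noise r h b).
Proof. by apply: measurable_funB; apply: measurable_funM => //; exact: measurable_funB. Qed.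

Lemma measurable_step_drift r h b : measurable_fun setT (step_drift r h b).
Proof.
have mh q : measurable_fun setT (fun w => height (q, w)).
  by rewrite /height /=; apply: measurable_funB; [exact: mX|exact: mgm].
by apply: measurable_funM => //; apply: measurable_funD; exact: measurable_drift.
Qed.

Lemma step_noise_bound r h b w : 0 < h -> r + h < b -> `|step_noise r h b w| <= 4 / h * psup B w.
Proof.
move=> h0 rb; have br : h < b - r by lra.
have Xb q1 q2 : `|X q1 w - X q2 w| <= 2 * psup B w.
  rewrite (_ : 2 * _ = psup B w + psup B w); last by ring.
  by apply: (le_trans (ler_normB _ _)); apply: lerD; exact: (psup_ge hB).
have S0 := psup_ge0 hB w.
have -> : 4 / h * psup B w = 2 * psup B w / h + 2 * psup B w / h by ring.
apply: (le_trans (ler_normB _ _)); apply: lerD; rewrite normrM normfV.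
  by rewrite (gtr0_norm h0) ler_wpM2r ?invr_ge0 ?(ltW h0).
have b0 : 0 < b - r by lra.
rewrite (gtr0_norm b0); apply: ler_pM => //; first by rewrite invr_ge0 ltW.
by rewrite lef_pV2 ?posrE// ltW.
Qed.

Lemma step_drift_bound r h b w : 0 < h -> r + h < b ->
  0 <= step_drift r h b w <= 2 * (height (r + h, w))^-1.
Proof.
move=> h0 rb; have b0 : 0 < b - r by lra.
have q : 0 <= (b - r - h) / (b - r) <= 1 by rewrite divr_ge0 ?ler_pdivrMr//; lra.
have l0 : 0 < b - (r + h) by lra.
have a0 := drift_ge0 h0 (H0 (r, w)) (H0 (r + h, w)).
have a1 := drift_le_inv h0 (H0 (r, w)) (H0 (r + h, w)).
have c0 := drift_ge0 l0 (H0 (b, w)) (H0 (r + h, w)).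
have c1 := drift_le_inv l0 (H0 (b, w)) (H0 (r + h, w)).
have /andP[q0 q1] := q.
rewrite /step_drift mulr_ge0 ?addr_ge0//= -[leRHS]mul1r; apply: ler_pM => //.
  by rewrite addr_ge0.
lra.
Qed.

Lemma trace_step (r h b s : R) (S : set T) (D : set R) :
  0 <= r -> 0 < h -> r + h < b -> b <= 1 -> 0 <= s -> s <= 1 ->
  natural_filtration V s S -> measurable D ->
  (forall w, D (tau w) -> (tau w + s < r) || ((b < tau w) && (tau w + s - 1 < r))) ->
  (\int[P]_w (\1_S w * \1_D (tau w) * step_noise r h b w)%:E =
   \int[P]_w (\1_S w * \1_D (tau w) * step_drift r h b w)%:E)%E.
Proof.
move=> r0 h0 rhb b1 s0 s1 FS mD hD.
have rt : r < r + h by rewrite ltrDl.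
have mS := natural_filtration_measurable hB s1 FS.
have := drift_trace hB r0 rt rhb b1 s0 s1 FS mD hD.
have b0 : 0 < b - r by lra.
have miD : measurable_fun setT (fun w => \1_S w * \1_D (tau w) : R).
  apply: measurable_funM; first exact: measurable_indic.
  by apply: measurableT_comp => //; exact: measurable_indic.
have iD01 w : 0 <= (\1_S w * \1_D (tau w) : R) <= 1.
  by rewrite mulr_ge0//= mulr_ile1// indicE lern1 leq_b1.
have Ib := bnoise_integrable hB r (r + h) b.
have mb : measurable_fun setT (bnoise B r (r + h) b).
  by apply/measurable_EFinP; exact: measurable_int Ib.
have I1 : P.-integrable setT (fun w => (\1_S w * \1_D (tau w) * bnoise B r (r + h) b w)%:E).
  apply: (le_integrable measurableT _ _ Ib).
    by apply/measurable_EFinP; exact: measurable_funM.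
  move=> w _ /=; have /andP[i0 i1] := iD01 w.
  by rewrite lee_fin normrM (ger0_norm i0) ler_piMl.
set J1 := (X in X = _ -> _); set J2 := (X in _ = (_ * X)%E -> _) => E.
transitivity (h^-1%:E * J1)%E.
  rewrite /J1 -(integralZl measurableT I1); apply: eq_integral => w _.
  rewrite -EFinM mulrCA; congr ((_ * _)%:E).
  by rewrite /step_noise /bnoise; field; rewrite !gt_eqF.
rewrite E muleA -EFinM /J2 -(ge0_integralZl _ measurableT); last 3 first.
- apply/measurable_EFinP; apply: measurable_funM => //.
  by apply: measurable_funD; apply: measurable_drift; exact: measurable_funB.
- move=> w _; have /andP[i0 i1] := iD01 w.
  rewrite lee_fin mulr_ge0// addr_ge0// drift_ge0 ?subr_gt0//; exact: H0 (_, w).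
- by rewrite lee_fin mulr_ge0 ?invr_ge0 ?(ltW h0)// ltW// noise_var_gt0.
apply: eq_integral => w _; rewrite -EFinM mulrCA; congr ((_ * _)%:E).
rewrite /step_drift /noise_var (_ : r + h - r = h); last by ring.
rewrite mulrA; congr (_ * _); field.
by rewrite !gt_eqF.
Qed.

Lemma measurable_driftL d' (T' : measurableType d') (L f g : T' -> R) :
  measurable_fun setT L -> measurable_fun setT f -> measurable_fun setT g ->
  measurable_fun setT (fun w => drift (L w) (f w) (g w)).
Proof.
move=> mL mf mg; have mLi := measurableT_comp (@measurable_invr R) mL.
apply: measurable_funM.
  by apply: measurable_funM => //; exact: measurable_funM.
apply: (measurableT_comp (@measurable_invr R)); apply: measurable_funB => //.
apply: measurableT_comp => //; apply: measurable_funM => //.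
by apply: measurable_funM => //; exact: measurable_funM.
Qed.

(* The product vanishes for z.1 >= 1, where [drift] has no meaning. *)
Definition end_repulsion (z : R * T) : R := (z.1 < 1)%R%:R * drift (1 - z.1) (height (1, z.2)) (height z).

Let m1 : measurable_fun setT (fun z : R * T => z.1). Proof. exact: measurable_fst. Qed.
Let mhe := measurable_height hB.
Let mX2 := measurable_bpath_joint hB.

Lemma measurable_end_repulsion : measurable_fun setT end_repulsion.
Proof.
apply: measurable_funM.
  by apply: measurable_boolR; apply: measurable_fun_ltr.
apply: measurable_driftL => //; first exact: measurable_funB.
apply: (measurableT_comp (f := height) mhe (g := fun z : R * T => (1, z.2))).
by apply: measurable_fun_pair.
Qed.

Lemma end_repulsion_ge0 z : 0 <= end_repulsion z.
Proof.
by rewrite /end_repulsion; case: ltP => h; rewrite ?mul0r// mul1r drift_ge0// subr_gt0.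
Qed.

Lemma end_repulsion_le z : end_repulsion z <= (height z)^-1.
Proof.
rewrite /end_repulsion; case: ltP => h; last by rewrite mul0r invr_ge0.
by rewrite mul1r drift_le_inv// subr_gt0.
Qed.

(** Here b is 1, and the step is unexplored when tau + s < r, the first alternative of [trace_step].
    For r + h >= 1 both sides vanish. *)
Lemma post_step (s : R) (S : set T) : 0 <= s -> s <= 1 -> natural_filtration V s S ->
  forall h r : R, 0 < h -> h < 1 -> 0 < r -> r < 1 ->
  (\int[P]_w (step_quotient B S (fun w => tau w + s)%R (fun=> 1%R) h (r, w) -
     step_slope B S (fun w => tau w + s)%R (fun=> 1%R) h (r, w))%:E =
   \int[P]_w (step_repulsion B S (fun w => tau w + s)%R (fun=> 1%R) end_repulsion h ((r + h)%R, w))%:E)%E.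
Proof.
move=> s0 s1 FS h r h0 h1 r0 r1.
have [rh|rh] := ltP (r + h) 1; last first.
  rewrite !integral0_eq// => w _; rewrite /step_quotient /step_slope /step_repulsion /ivl/=.
    by rewrite (ltNge (r + h)) rh/= andbF mul0r mulr0.
  by rewrite ltrBrDr (ltNge (r + h)) rh/= andbF !mul0r !mulr0 subrr.
have mD : measurable [set th : R | th + s < r].
  by apply: measurable_ltset => //; exact: measurable_funD.
have := @trace_step r h 1 s S _ (ltW r0) h0 rh (lexx _) s0 s1 FS mD.
move=> E; transitivity (\int[P]_w (\1_S w * \1_[set th : R | (th + s < r)%R] (tau w) * step_noise r h 1 w)%:E)%E.
  apply: eq_integral => w _; congr EFin; rewrite /step_quotient /step_slope /ivl/= ltrBrDr rh andbT.
  rewrite -mulrBr -mulrBr -mulrA /step_noise; congr (_ * (_ * _)).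
  by rewrite indicE; congr (_%:R); congr nat_of_bool; apply/idP/idP; rewrite inE.
rewrite E; last by move=> w /= ->.
apply: eq_integral => w _; congr EFin; rewrite /step_repulsion /ivl/= rh andbT.
rewrite -mulrA; congr (_ * _).
rewrite ltrD2r; congr (_ * _).
  by rewrite indicE; congr (_%:R); congr nat_of_bool; apply/idP/idP; rewrite inE.
rewrite /step_drift /end_repulsion/= rh mul1r addrK (_ : 1 - (r + h) + h = 1 - r); last by ring.
by rewrite opprD addrA.
Qed.

Lemma post_identity (s : R) (S : set T) : 0 <= s -> s <= 1 -> natural_filtration V s S ->
  nu.-integrable setT (EFin \o slope_term B S (fun w => tau w + s)%R (fun=> 1%R)) /\
  (\int[P]_w (\1_S w * (X 1 w - X (tau w + s) w))%:E =
   \int[nu]_z (slope_term B S (fun w => tau w + s)%R (fun=> 1%R) z +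
     repulsion_term S (fun w => tau w + s)%R (fun=> 1%R) end_repulsion z)%:E)%E.
Proof.
move=> s0 s1 FS; have mS := natural_filtration_measurable hB s1 FS.
have mal : measurable_fun setT (fun w => tau w + s) by exact: measurable_funD.
have al0 w : 0 <= tau w + s by rewrite addr_ge0//; have /andP[] := btau_itv hB w.
have Ig : nu.-integrable setT (EFin \o slope_term B S (fun w => tau w + s)%R (fun=> 1%R)).
  apply: (le_integrable measurableT _ _ (end_slope_integrable hB)).
    by apply/measurable_EFinP; apply: (measurable_slope_term hB).
  move=> z _ /=; rewrite lee_fin /slope_term normrM [leRHS]normrM (ger0_norm (ind01_ge0 _)) normr_id.
  rewrite (_ : `|\1_S z.2| = \1_S z.2); last by rewrite ger0_norm.
  rewrite -[leRHS]mul1r; apply: ler_pM => //.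
  rewrite normrM; apply: ler_wpM2r => //.
  have /andP[i0 i1] := ivl_itv (tau z.2 + s) 1 z.1.
  rewrite ger0_norm// /ivl /ind01 ler_nat.
  case: (boolP (tau z.2 + s < z.1)) => //= h; by rewrite (le_lt_trans (al0 z.2) h).
split => //.
have := limit_identity hB mS mal (measurable_cst _) measurable_end_repulsion al0 (fun=> lexx _) end_repulsion_ge0 end_repulsion_le (post_step s0 s1 FS) Ig.
move=> <-; apply: eq_integral => w _; congr ((_ * (_ - _))%:E).
have [h|h] := leP (tau w + s) 1; first by rewrite ?max_r.
by rewrite (bpath_ge1 _ w (ltW h)).
Qed.

(** Cells open on the left and closed on the right contain [th] exactly once, so the sum has a
    single term, taken at the grid point just below [th]. *)
Lemma grid_below (N : nat) (th : R) : 0 < th -> th <= 1 ->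
  exists b : R, [/\ 0 <= b, b < th, th <= b + N.+1%:R^-1 &
    forall F : R -> R, \sum_(k < N.+1)
      ((k%:R / N.+1%:R < th) && (th <= k.+1%:R / N.+1%:R))%:R * F (k%:R / N.+1%:R) = F b].
Proof.
move=> th0 th1.
have N0 : (0 : R) < N.+1%:R by rewrite ltr0n.
have ex : exists k, th <= k.+1%:R / N.+1%:R.
  by exists N; rewrite divff ?gt_eqF.
case: (ex_minnP ex) => k hk kmin.
have kN : (k < N.+1)%N by rewrite ltnS; apply: kmin; rewrite divff ?gt_eqF.
have kth : k%:R / N.+1%:R < th.
  case: k hk kmin {kN} => [|k] hk kmin; first by rewrite mul0r.
  by rewrite ltNge; apply/negP => /kmin; rewrite ltnn.
exists (k%:R / N.+1%:R); split => //.
- by apply: (le_trans hk); rewrite -natr1 mulrDl mul1r.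
move=> F; rewrite (bigD1 (Ordinal kN))//= kth hk mul1r big1 ?addr0// => j jk.
rewrite (_ : (_ && _) = false) ?mul0r//; apply/negbTE/negP => /andP[h1 h2].
have kj := kmin _ h2.
have : (k < j)%N by rewrite ltn_neqAle kj andbT eq_sym; apply: contra jk => /eqP e; apply/eqP/val_inj.
move=> kj'; move: h1; rewrite ltNge => /negP; apply; apply: (le_trans hk).
by rewrite ler_pM2r ?invr_gt0// ler_nat.
Qed.

(** When the far end approaches the minimum the repulsion becomes 1 / z, the drift of a
    three-dimensional Bessel process. The lower bound comes from exp u - 1 <= u exp u. *)
Lemma cvg_drift_inv (L x : nat -> R) (l z : R) : 0 < l -> 0 < z ->
  (forall n, 0 < x n) -> L n @[n --> \oo] --> l -> x n @[n --> \oo] --> 0 ->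
  drift (L n) (x n) z @[n --> \oo] --> z^-1.
Proof.
move=> l0 z0 x0 cL cx.
have ce : expR (- (2 * x n * z / L n)) / z @[n --> \oo] --> z^-1.
  have E : z^-1 = expR (- (2 * 0 * z / l)) / z by rewrite mulr0 !mul0r oppr0 expR0 mul1r.
  rewrite [X in _ --> X]E.
  apply: cvgM; last exact: cvg_cst.
  apply: (@cvg_comp _ _ _ (fun n => - (2 * x n * z / L n)) (@expR R));
    last exact: continuous_expR.
  apply: cvgN; apply: cvgM; last by apply: cvgV => //; rewrite gt_eqF.
  by apply: cvgM; [apply: cvgM => //; exact: cvg_cst|exact: cvg_cst].
apply: (squeeze_cvgr _ ce (cvg_cst _)).
have /cvgrPdist_lt/(_ _ l0) := cL; apply: filterS => n hn.
have Ln : 0 < L n by move: hn; rewrite ltr_norml => /andP[_ ?]; lra.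
rewrite drift_le_inv ?(ltW (x0 n)) ?(ltW z0)// andbT /drift.
set u := 2 * x n * z / L n.
have u0 : 0 < u by rewrite divr_gt0 ?mulr_gt0.
have -> : 2 * x n / L n = u / z by rewrite /u; field; rewrite !gt_eqF.
have e1 : 0 < expR u - 1 by rewrite subr_gt0 -[ltLHS]expR0 ltr_expR.
rewrite ler_pdivlMr// mulrAC ler_wpM2r ?invr_ge0 ?(ltW z0)//.
rewrite mulrBr -expRD addNr expR0 mulr1.
by have := @expR_ge1Dx R (- u); lra.
Qed.

(** The right end should be tau, but [trace_step] needs a deterministic b. The values of tau are cut
    into cells of length 1/(N + 1), b is the left end of the cell, so that b < tau as the second
    alternative of [trace_step] demands, and N tends to infinity. *)
Lemma pre_step (s : R) (S : set T) : 0 <= s -> s <= 1 -> natural_filtration V s S ->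
  forall h r : R, 0 < h -> h < 1 -> 0 < r -> r < 1 ->
  (\int[P]_w (step_quotient B S (fun w => Num.max (s + tau w - 1) 0)%R tau h (r, w) -
     step_slope B S (fun w => Num.max (s + tau w - 1) 0)%R tau h (r, w))%:E =
   \int[P]_w (step_repulsion B S (fun w => Num.max (s + tau w - 1) 0)%R tau (fun z => (height z)^-1) h
     ((r + h)%R, w))%:E)%E.
Proof.
move=> s0 s1 FS h r h0 h1 r0 r1; have mS := natural_filtration_measurable hB s1 FS.
have [rh|rh] := ltP (r + h) 1; last first.
  have tr w : (r + h < tau w) = false.
    by apply/negbTE; rewrite -leNgt (le_trans _ rh)//; have /andP[] := btau_itv hB w.
  rewrite !integral0_eq// => w _; rewrite /step_quotient /step_slope /step_repulsion /ivl/= ?ltrBrDr tr andbF !mul0r !mulr0//.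
  by rewrite subrr.
pose al w := Num.max (s + tau w - 1) 0.
pose C (N : nat) (k : 'I_N.+1) : set R :=
  [set th | (s + th - 1 < r) && ((k%:R / N.+1%:R < th) && (th <= k.+1%:R / N.+1%:R))].
have mC N k : measurable (@C N k).
  have -> : @C N k = [set th | s + th - 1 < r] `&` ([set th | k%:R / N.+1%:R < th] `&`
      [set th | th <= k.+1%:R / N.+1%:R]).
    by apply/seteqP; split => th /=; rewrite /C/=; [move=> /andP[-> /andP[-> ->]]|move=> [-> [-> ->]]].
  apply: measurableI; last first.
    by apply: measurableI; [exact: measurable_ltset|exact: measurable_leset].
  by apply: measurable_ltset => //; apply: measurable_funB => //; exact: measurable_funD.
(* Cells whose left end does not lie beyond the step are discarded; in the limit this amounts to r +
   h < tau. *)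
pose cut (b : R) : R := (r + h < b)%R%:R.
pose Fn N w := \sum_(k < N.+1) \1_S w * \1_(C N k) (tau w) *
  (cut (k%:R / N.+1%:R) * step_noise r h (k%:R / N.+1%:R) w).
pose Gn N w := \sum_(k < N.+1) \1_S w * \1_(C N k) (tau w) *
  (cut (k%:R / N.+1%:R) * step_drift r h (k%:R / N.+1%:R) w).
have cut01 b : 0 <= cut b <= 1 by rewrite /cut; case: (r + h < b); rewrite ?lexx ?ler01.
have i01 (E : set T) w : 0 <= (\1_E w : R) <= 1.
  by rewrite indicE; case: (w \in E); rewrite ?lexx ?ler01.
have j01 (E : set R) w : 0 <= (\1_E w : R) <= 1.
  by rewrite indicE; case: (w \in E); rewrite ?lexx ?ler01.
have noise_b b w : `|cut b * step_noise r h b w| <= 4 / h * psup B w.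
  rewrite /cut; case: ltP => hb; last first.
    by rewrite mul0r normr0 mulr_ge0 ?(psup_ge0 hB)// divr_ge0// ltW.
  by rewrite mul1r; exact: step_noise_bound.
have drift_b b w : 0 <= cut b * step_drift r h b w <= 2 * (height (r + h, w))^-1.
  rewrite /cut; case: ltP => hb; last by rewrite mul0r lexx mulr_ge0// invr_ge0.
  by rewrite mul1r; exact: step_drift_bound.
have mi N k : measurable_fun setT (fun w => \1_S w * \1_(C N k) (tau w) : R).
  apply: measurable_funM; first exact: measurable_indic.
  by apply: measurableT_comp => //; apply: measurable_indic; exact: mC.
have In N k : P.-integrable setT (fun w => (\1_S w * \1_(C N k) (tau w) *
    (cut (k%:R / N.+1%:R) * step_noise r h (k%:R / N.+1%:R) w))%:E).
  have I := integrableZl measurableT (4 / h) (integrable_psup hB).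
  apply: (le_integrable measurableT _ _ I).
    apply/measurable_EFinP; apply: measurable_funM => //; apply: measurable_funM => //.
    exact: measurable_step_noise.
  move=> w _ /=; rewrite lee_fin normrM.
  have /andP[a0 a1] := i01 S w; have /andP[b0 b1] := j01 (C N k) (tau w).
  rewrite (ger0_norm (mulr_ge0 a0 b0)); apply: le_trans (ler_norm _).
  apply: le_trans (noise_b (k%:R / N.+1%:R) w); by rewrite ler_piMl.
have level N : (\int[P]_w (Fn N w)%:E = \int[P]_w (Gn N w)%:E)%E.
  rewrite /Fn /Gn; under eq_integral do rewrite -sumEFin.
  under [RHS]eq_integral do rewrite -sumEFin.
  rewrite integral_sum//.
  rewrite ge0_integral_sum//; last 2 first.
  - move=> k; apply/measurable_EFinP; apply: measurable_funM => //; apply: measurable_funM => //.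
    exact: measurable_step_drift.
  - move=> k w _; have /andP[a0 _] := i01 S w; have /andP[b0 _] := j01 (C N k) (tau w).
    have /andP[d0 _] := drift_b (k%:R / N.+1%:R) w.
    by rewrite lee_fin; apply: mulr_ge0 => //; exact: mulr_ge0.
  apply: eq_bigr => k _; rewrite /cut.
  case: ltP => hk; last by rewrite !integral0_eq// => w _; rewrite mul0r mulr0.
  under eq_integral do rewrite mul1r; under [RHS]eq_integral do rewrite mul1r.
  apply: (@trace_step r h (k%:R / N.+1%:R) s S (C N k)) => //; first exact: ltW.
    by rewrite ler_pdivrMr// mul1r ler_nat ltnW.
  move=> w /andP[q1 /andP[q2 _]]; rewrite q2/=; apply/orP; right; lra.
have grid w : 0 < tau w -> exists b : nat -> R, [/\ forall N, 0 <= b N, forall N, b N < tau w,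
    b N @[N --> \oo] --> tau w,
    forall N, Fn N w = \1_S w * (s + tau w - 1 < r)%R%:R * (cut (b N) * step_noise r h (b N) w) &
    forall N, Gn N w = \1_S w * (s + tau w - 1 < r)%R%:R * (cut (b N) * step_drift r h (b N) w)].
  move=> t0; have /andP[_ t1] := btau_itv hB w.
  have /choice[b hb] : forall N : nat, exists b : R, [/\ 0 <= b, b < tau w, tau w <= b + N.+1%:R^-1 &
    forall F : R -> R, \sum_(k < N.+1)
      ((k%:R / N.+1%:R < tau w) && (tau w <= k.+1%:R / N.+1%:R))%:R * F (k%:R / N.+1%:R) = F b].
    by move=> N; exact: grid_below.
  have sE N (F : R -> R) : \sum_(k < N.+1) \1_S w * \1_(C N k) (tau w) * F (k%:R / N.+1%:R) =
      \1_S w * (s + tau w - 1 < r)%R%:R * F (b N).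
    have [_ _ _ <-] := hb N; rewrite big_distrr/=; apply: eq_bigr => k _.
    rewrite -!mulrA; congr (_ * _); rewrite mulrA; congr (_ * _).
    rewrite -natrM mulnb indicE; congr (_%:R); congr nat_of_bool.
    by apply/idP/idP; rewrite inE.
  exists b; split.
  - by move=> N; have [] := hb N.
  - by move=> N; have [] := hb N.
  - have cl : tau w - N.+1%:R^-1 @[N --> \oo] --> tau w.
      rewrite -[X in _ --> X]subr0; apply: cvgB; first exact: cvg_cst.
      exact: cvg_harmonic.
    apply: (squeeze_cvgr _ cl (cvg_cst _)); apply: nearW => N.
    by have [_ /ltW -> h2 _] := hb N; rewrite andbT lerBlDr.
  - by move=> N; exact: (sE N (fun x => cut x * step_noise r h x w)).
  - by move=> N; exact: (sE N (fun x => cut x * step_drift r h x w)).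
(* An argmin at time 0 lies in no cell, these being open on the left; the limit vanishes too, since
   r + h > 0. *)
have small w : tau w <= 0 -> forall N (k : 'I_N.+1), (\1_(C N k) (tau w) : R) = 0.
  move=> t0 N k; rewrite indicE memNset//= => /andP[_ /andP[h2 _]].
  by move: (lt_le_trans h2 t0); rewrite ltNge divr_ge0.
have ivF w : ivl (al w) (tau w - h) r = (s + tau w - 1 < r)%R%:R * (r + h < tau w)%R%:R.
  by rewrite /ivl /al gt_max r0 andbT ltrBrDr -natrM mulnb.
have ivG w : ivl (al w + h) (tau w) (r + h) = (s + tau w - 1 < r)%R%:R * (r + h < tau w)%R%:R.
  by rewrite /ivl /al ltrD2r gt_max r0 andbT -natrM mulnb.
have cutc w (b : nat -> R) : b N @[N --> \oo] --> tau w -> (forall N, b N < tau w) ->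
    cut (b N) @[N --> \oo] --> ((r + h < tau w)%R%:R : R).
  move=> cb bt; apply: cvg_near_cst; rewrite /cut.
  have [rt|rt] := ltP (r + h) (tau w); last first.
    by apply: nearW => N; rewrite ltNge (le_trans (ltW (bt N))).
  have d0 : 0 < tau w - (r + h) by rewrite subr_gt0.
  have /cvgrPdist_lt/(_ _ d0) := cb; apply: filterS => N hN.
  by rewrite (_ : r + h < b N = true)//; move: hN; rewrite ltr_norml => /andP[_ ?]; lra.
have reassoc (x y z v : R) : x * (y * z * v) = x * y * (z * v) by ring.
have cF w : Fn N w @[N --> \oo] --> step_quotient B S al tau h (r, w) - step_slope B S al tau h (r, w).
  rewrite /step_quotient /step_slope/= ivF -mulrBr -mulrBr.
  have [t0|t0] := leP (tau w) 0.
    apply: cvg_near_cst; apply: nearW => N.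
    rewrite /Fn big1; last by move=> k _; rewrite small// mulr0 mul0r.
    by rewrite (ltNge (r + h)) (le_trans t0) ?mulr0 ?mul0r ?mulr0//; lra.
  have [b [b0 bt cb EF _]] := grid w t0; rewrite (funext EF) reassoc.
  apply: cvgM; first exact: cvg_cst.
  have [rt|rt] := ltP (r + h) (tau w); last first.
    rewrite mul0r; apply: cvg_near_cst; apply: nearW => N.
    by rewrite /cut ltNge (le_trans (ltW (bt N)) rt) mul0r.
  apply: cvgM; first by have := cutc w b cb bt; rewrite rt.
  apply: cvgB; first exact: cvg_cst.
  apply: cvgM; last first.
    by apply: cvgV; [rewrite gt_eqF// subr_gt0; lra|apply: cvgB => //; exact: cvg_cst].
  apply: cvgB; last exact: cvg_cst.
  exact: (@cvg_comp _ _ _ b (X ^~ w) _ _ _ cb (@cX w (tau w))).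
have cG w : Gn N w @[N --> \oo] --> step_repulsion B S al tau (fun z => (height z)^-1) h (r + h, w).
  rewrite /step_repulsion/= ivG.
  have [t0|t0] := leP (tau w) 0.
    apply: cvg_near_cst; apply: nearW => N.
    rewrite /Gn big1; last by move=> k _; rewrite small// mulr0 mul0r.
    by rewrite (ltNge (r + h)) (le_trans t0) ?mulr0 ?mul0r ?mulr0//; lra.
  have [b [b0 bt cb _ EG]] := grid w t0; rewrite (funext EG) reassoc.
  apply: cvgM; first exact: cvg_cst.
  have [rt|rt] := ltP (r + h) (tau w); last first.
    rewrite mul0r; apply: cvg_near_cst; apply: nearW => N.
    by rewrite /cut ltNge (le_trans (ltW (bt N)) rt) mul0r.
  apply: cvgM; first by have := cutc w b cb bt; rewrite rt.
  rewrite (_ : tau w - (r + h) + h = tau w - r); last by ring.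
  rewrite (_ : tau w - (r + h) = tau w - r - h); last by ring.
  rewrite addrK; apply: cvgM.
    apply: cvgM; first by apply: cvgB; [apply: cvgB => //|]; exact: cvg_cst.
    by apply: cvgV; [rewrite gt_eqF// subr_gt0; lra|apply: cvgB => //; exact: cvg_cst].
  apply: cvgD; first exact: cvg_cst.
  apply: (@cvg_drift_inv (fun N => b N - (r + h)) (fun N => height (b N, w)) (tau w - (r + h))).
  - by rewrite subr_gt0.
  - by rewrite /height/= subr_gt0; apply: (first_argmin_lt (@cX w)) => //; lra.
  - by move=> N; rewrite /height/= subr_gt0; exact: (first_argmin_lt (@cX w)).
  - by apply: cvgB => //; exact: cvg_cst.
  have E : 0 = gm w - gm w by rewrite subrr.
  rewrite /height/= [X in _ --> X]E; apply: cvgB; last exact: cvg_cst.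
  rewrite -[X in _ --> X](bpath_btau hB w).
  exact: (@cvg_comp _ _ _ b (X ^~ w) _ _ _ cb (@cX w (tau w))).
have mal : measurable_fun setT al.
  by apply: measurable_maxr => //; apply: measurable_funB => //; exact: measurable_funD.
have al0 w : 0 <= al w by rewrite /al le_max lexx orbT.
have be1 w : tau w <= 1 by have /andP[] := btau_itv hB w.
have mp (f : R * T -> R) q : nu.-integrable setT (EFin \o f) -> measurable_fun setT (fun w => f (q, w)).
  move=> /measurable_int/measurable_EFinP mf; apply: (measurableT_comp mf); exact: measurable_pair1.
have mki : measurable_fun setT (fun z => (height z)^-1).
  by apply: (measurableT_comp (@measurable_invr R)); exact: mhe.
have I4 := integrableZl measurableT (4 / h) (integrable_psup hB).
have [||w _||n w _|_ LF] := @dominated_convergence_real _ _ R P setT Fn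
  (fun w => step_quotient B S al tau h (r, w) - step_slope B S al tau h (r, w))
  (fun w => 4 / h * psup B w) measurableT.
- move=> N; apply: measurable_sum => k; apply/measurable_EFinP; exact: measurable_int (In N k).
- apply: measurable_funB; apply: mp.
    exact: (step_quotient_integrable hB mS mal mtau al0 be1 h0).
  exact: (step_slope_integrable hB mS mal mtau al0 be1 h0).
- exact: cF.
- exact: I4.
- have [t0|t0] := leP (tau w) 0.
    rewrite /Fn big1; last by move=> k _; rewrite small// mulr0 mul0r.
    by rewrite normr0 mulr_ge0 ?(psup_ge0 hB)// divr_ge0// ltW.
  have [b [_ _ _ -> _]] := grid w t0.
  rewrite normrM; apply: le_trans (noise_b (b n) w); rewrite ler_piMl//.
  have /andP[a0 a1] := i01 S w.
  by rewrite ger0_norm ?mulr_ile1 ?mulr_ge0 ?ler0n ?lern1 ?leq_b1.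
have Ih : P.-integrable setT (fun w => ((height (r + h, w))^-1)%:E).
  apply/integrableP; split.
    by apply/measurable_EFinP; apply: (measurableT_comp mki); exact: measurable_pair1.
  under eq_integral do rewrite /= ger0_norm ?invr_ge0//.
  have rh0 : 0 < r + h by lra.
  by apply: le_lt_trans (integral_inv_gmin hB rh0 rh) _; rewrite ltry.
have I2 := integrableZl measurableT 2 Ih.
have [||w _||n w _|_ LG] := @dominated_convergence_real _ _ R P setT Gn
  (fun w => step_repulsion B S al tau (fun z => (height z)^-1) h (r + h, w))
  (fun w => 2 * (height (r + h, w))^-1) measurableT.
- move=> N; apply: measurable_sum => k; apply: measurable_funM => //; apply: measurable_funM => //.
  exact: measurable_step_drift.
- apply: mp; apply: (step_repulsion_integrable hB mS mal mtau mki al0 be1 _ _ h0) => z //.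
  by rewrite invr_ge0.
- exact: cG.
- exact: I2.
- have p0 : 0 <= 2 * (height (r + h, w))^-1 by rewrite mulr_ge0// invr_ge0.
  have [t0|t0] := leP (tau w) 0.
    by rewrite /Gn big1 ?normr0// => k _; rewrite small// mulr0 mul0r.
  have [b [_ _ _ _ ->]] := grid w t0.
  have /andP[d0 d1] := drift_b (b n) w; have /andP[a0 a1] := i01 S w.
  rewrite ger0_norm; last by apply: mulr_ge0 => //; exact: mulr_ge0.
  apply: le_trans d1; rewrite ler_piMl//.
  by rewrite mulr_ile1 ?ler0n ?lern1 ?leq_b1.
rewrite (funext level) in LF.
exact: (cvg_unique (@ereal_hausdorff R) LF LG).
Qed.

Let al_ (s : R) w := Num.max (s + tau w - 1) 0.

Lemma pre_identity (s : R) (S : set T) : 0 <= s -> s <= 1 -> natural_filtration V s S ->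
  nu.-integrable setT (EFin \o slope_term B S (fun w => Num.max (s + tau w - 1) 0)%R tau) /\
  (\int[P]_w (\1_S w * (X (tau w) w - X (tau w + s - 1) w))%:E =
   \int[nu]_z (slope_term B S (fun w => Num.max (s + tau w - 1) 0)%R tau z +
     repulsion_term S (fun w => Num.max (s + tau w - 1) 0)%R tau (fun z => (height z)^-1) z)%:E)%E.
Proof.
move=> s0 s1 FS; have mS := natural_filtration_measurable hB s1 FS.
have mal q : measurable_fun setT (al_ q).
  by apply: measurable_maxr => //; apply: measurable_funB => //; exact: measurable_funD.
have al0 q w : 0 <= al_ q w by rewrite /al_ le_max lexx orbT.
have be1 w : tau w <= 1 by have /andP[] := btau_itv hB w.
have mki : measurable_fun setT (fun z => (height z)^-1).
  by apply: (measurableT_comp (@measurable_invr R)); exact: mhe.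
have ki0 z : 0 <= (height z)^-1 by rewrite invr_ge0.
have FT : natural_filtration V 0 setT.
  by have [h1 h2 _] := smallest_sigma_algebra setT (\bigcup_(s in `[0, 0]) preimage_set_system setT (V s) measurable); rewrite -[setT]setD0; exact: h2.
(* The case of the whole space and s = 0 has the constant sign needed by [slope_term_integrable] and
   dominates all the others. *)
have IT : nu.-integrable setT (EFin \o slope_term B setT (al_ 0) tau).
  apply: (slope_term_integrable hB measurableT (mal 0) mtau mki (al0 0) be1 ki0 (fun=> lexx _)
    (pre_step (lexx _) ler01 FT)) => z.
  rewrite /slope_term indicT mul1r /ivl; case: (boolP ((al_ 0 z.2 < z.1) && (z.1 < tau z.2))) => [/andP[h1 h2]|_]; last first.
    by rewrite mul0r.
  have hX : X (tau z.2) z.2 - X z.1 z.2 <= 0.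
    by rewrite (bpath_btau hB) subr_le0; exact: (gmin_le hB).
  by rewrite mul1r mulr_le0_ge0// invr_ge0 subr_ge0 ltW.
have Ig : nu.-integrable setT (EFin \o slope_term B S (al_ s) tau).
  apply: (le_integrable measurableT _ _ IT).
    by apply/measurable_EFinP; apply: (measurable_slope_term hB).
  move=> z _ /=; rewrite lee_fin /slope_term indicT mul1r normrM (_ : `|\1_S z.2| = \1_S z.2); last by rewrite ger0_norm.
  rewrite -[leRHS]mul1r; apply: ler_pM => //.
  rewrite !normrM; apply: ler_wpM2r => //.
  have /andP[i0 _] := ivl_itv (al_ s z.2) (tau z.2) z.1.
  have /andP[j0 _] := ivl_itv (al_ 0 z.2) (tau z.2) z.1.
  rewrite !ger0_norm// /ivl ler_nat.
  have [h|h] := ltP (al_ s z.2) z.1 => //=.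
  suff -> : al_ 0 z.2 < z.1 by [].
  apply: le_lt_trans h; rewrite /al_ ge_max; apply/andP; split; last by rewrite le_max lexx orbT.
  by rewrite le_max; apply/orP; left; lra.
split => //.
have := limit_identity hB mS (mal s) mtau mki (al0 s) be1 ki0 (fun=> lexx _) (pre_step s0 s1 FS) Ig.
move=> <-; apply: eq_integral => w _; have /andP[t0 t1] := btau_itv hB w.
have -> : Num.max (al_ s w) (tau w) = tau w by apply: max_r; rewrite /al_ ge_max t0 andbT; lra.
congr ((_ * (_ - _))%:E); rewrite /al_ (addrC s).
by have [h|h] := leP (tau w + s - 1) 0 => //; rewrite !(bpath_le0 hB).
Qed.

End drift_identities.

(** * Compensator of the transform *)

Section product_shift.
Context d (T : measurableType d) (R : realType) (P : probability T R).
Local Notation mu := (@lebesgue_measure R).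
Local Notation nu := (mu \x P)%E.
Variable th : T -> R.
Hypothesis mth : measurable_fun setT th.

Let phi (z : R * T) : R * T := (z.1 + th z.2, z.2).

Let mphi : measurable_fun setT phi.
Proof.
apply: measurable_fun_pair; last exact: measurable_snd.
by apply: measurable_funD; [exact: measurable_fst|exact: (measurableT_comp mth)].
Qed.

(** Translation invariance for each fixed w, integrated by Tonelli. It converts the time of the
    bridge into the time of the transform, whose origin tau is random. *)
Lemma ge0_integral_product_shift (f : R * T -> \bar R) : measurable_fun setT f ->
  (forall z, 0 <= f z)%E -> (\int[nu]_z f (phi z) = \int[nu]_z f z)%E.
Proof.
move=> mf f0.
have E := @fubini_tonelli2 _ _ _ _ _ mu P (f \o phi) (measurableT_comp mf mphi) (fun z => f0 (phi z)).
rewrite [LHS]E (@fubini_tonelli2 _ _ _ _ _ mu P f mf f0).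
apply: eq_integral => w _; rewrite /fubini_G /=.
rewrite -(@ge0_integral_shift _ (th w) (fun x => f (x, w)))//.
exact: (measurableT_comp mf (measurable_pair2 w)).
Qed.

Lemma integral_product_shift (f : R * T -> \bar R) : nu.-integrable setT f ->
  nu.-integrable setT (fun z => f (phi z)) /\
  (\int[nu]_z f (phi z) = \int[nu]_z f z)%E.
Proof.
move=> /[dup] If /integrableP[mf fi]; split.
  apply/integrableP; split; first exact: (measurableT_comp mf mphi).
  by rewrite (@ge0_integral_product_shift (fun z => `|f z|%E))//; exact: measurableT_comp.
rewrite integralE [RHS]integralE; congr (_ - _)%E.
  rewrite -(@ge0_integral_product_shift f^\+%E)//; last exact: measurable_funepos.
  by apply: eq_integral => z _; rewrite !funeposE.
rewrite -(@ge0_integral_product_shift f^\-%E)//; last exact: measurable_funeneg.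
by apply: eq_integral => z _; rewrite !funenegE.
Qed.

End product_shift.

Section vervaat_compensator.
Context d (T : measurableType d) (R : realType) (P : probability T R).
Variables (lambda : R) (B : R -> {RV P >-> R}).
Hypothesis hB : brownian_bridge lambda B.
Local Notation mu := (@lebesgue_measure R).
Local Notation nu := (mu \x P)%E.
Local Notation X := (bpath B).
Local Notation gm w := (pmin (X ^~ w) 0 1).
Local Notation height := (height B).
Local Notation tau := (btau B).
Local Notation V := (fun u w => vervaat (fun r => B r w) u).

Let cX w : continuous (X ^~ w). Proof. exact: (@continuous_bpath _ _ _ _ _ _ hB). Qed.
Let mX q : measurable_fun setT (X q). Proof. exact: measurable_bpath. Qed.
Let mtau : measurable_fun setT tau. Proof. exact: (measurable_btau hB). Qed.

(* [bpath] is 0 before time 0 and constant after time 1, which merges the two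
   branches of the Vervaat transform. *)
Definition vpath (t : R) w := X (tau w + t) w + X (tau w + t - 1) w - X (tau w) w.

Lemma continuous_vpath w : continuous (vpath ^~ w).
Proof.
have c1 : continuous (fun t => tau w + t) by move=> t; apply: cvgD; [exact: cvg_cst|exact: cvg_id].
move=> t; apply: cvgB; last exact: cvg_cst.
apply: cvgD.
  exact: (@cvg_comp _ _ _ (fun t => tau w + t) (X ^~ w) _ _ _ (c1 t) (@cX w _)).
have c2 : (tau w + x - 1) @[x --> t] --> tau w + t - 1.
  by apply: cvgB; [exact: c1|exact: cvg_cst].
exact: (@cvg_comp _ _ _ (fun t => tau w + t - 1) (X ^~ w) _ _ _ c2 (@cX w _)).
Qed.

Lemma vervaat_vpath t w : 0 <= t <= 1 -> V t w = vpath t w.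
Proof. exact: (vervaat_bpath hB). Qed.

Lemma vpath0 w : vpath 0 w = 0.
Proof.
have /andP[t0 t1] := btau_itv hB w.
by rewrite /vpath addr0 (bpath_le0 hB w (q := tau w - 1)) ?addr0 ?subrr// subr_le0.
Qed.

Lemma vpath_le t w : `|vpath t w| <= 3 * psup B w.
Proof.
have S q : `|X q w| <= psup B w by exact: (psup_ge hB).
rewrite /vpath (_ : 3 * _ = psup B w + psup B w + psup B w); last by ring.
apply: (le_trans (ler_normB _ _)); apply: lerD => //.
by apply: (le_trans (ler_normD _ _)); apply: lerD.
Qed.

Lemma measurable_vpath t : measurable_fun setT (vpath t).
Proof.
have ev (h : T -> R) : measurable_fun setT h -> measurable_fun setT (fun w => X (h w) w).
  by move=> mh; apply: measurable_eval => // w; exact: cX.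
apply: measurable_funB; last exact: ev.
by apply: measurable_funD; apply: ev; [|apply: measurable_funB => //]; exact: measurable_funD.
Qed.

Lemma vpath_integrable t : P.-integrable setT (EFin \o vpath t).
Proof.
have I := integrableZl measurableT 3 (integrable_psup hB).
apply: (le_integrable measurableT _ _ I).
  by apply/measurable_EFinP; exact: measurable_vpath.
by move=> w _ /=; rewrite lee_fin (le_trans (vpath_le t w))// ler_norm.
Qed.

(** Drift densities in the time of the bridge, [c1] after the argmin and [c2] before it, for the
    whole space and s = 0; general [S] and s only add an indicator. *)
Let c1 (z : R * T) := slope_term B setT (fun w => tau w + 0)%R (fun=> 1%R) z +
  repulsion_term setT (fun w => tau w + 0)%R (fun=> 1%R) (end_repulsion B) z.
Let c2 (z : R * T) := slope_term B setT (fun w => Num.max (0 + tau w - 1) 0)%R tau z +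
  repulsion_term setT (fun w => Num.max (0 + tau w - 1) 0)%R tau (fun z => (height z)^-1) z.

Let FT s : natural_filtration V s setT.
Proof.
have [h1 h2 _] := smallest_sigma_algebra setT
  (\bigcup_(s0 in `[0, s]) preimage_set_system setT (V s0) measurable).
by rewrite -[setT]setD0; exact: h2.
Qed.

Let H0 z : 0 <= height z. Proof. exact: (height_ge0 hB). Qed.

Let mki : measurable_fun setT (fun z => (height z)^-1).
Proof. by apply: (measurableT_comp (@measurable_invr R)); exact: (measurable_height hB). Qed.

Let Ic1 : nu.-integrable setT (EFin \o c1).
Proof.
have [I _] := post_identity hB (lexx 0) ler01 (@FT 0).
have J : nu.-integrable setT (EFin \o repulsion_term setT (fun w => tau w + 0)%R (fun=> 1%R) (end_repulsion B)); last exact: (integrableD measurableT I J).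
apply: (repulsion_term_integrable hB measurableT) => //.
- exact: measurable_funD.
- exact: (measurable_end_repulsion hB).
- by move=> w; rewrite addr0; have /andP[] := btau_itv hB w.
- exact: (end_repulsion_ge0 hB).
- exact: (end_repulsion_le hB).
Qed.

Let Ic2 : nu.-integrable setT (EFin \o c2).
Proof.
have [I _] := pre_identity hB (lexx 0) ler01 (@FT 0).
have J : nu.-integrable setT (EFin \o repulsion_term setT (fun w => Num.max (0 + tau w - 1) 0)%R tau (fun z => (height z)^-1));
  last exact: (integrableD measurableT I J).
apply: (repulsion_term_integrable hB measurableT) => //.
- by apply: measurable_maxr => //; apply: measurable_funB => //; exact: measurable_funD.
- by move=> w; rewrite le_max lexx orbT.
- by move=> w; have /andP[] := btau_itv hB w.
- by move=> z; rewrite invr_ge0.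
Qed.

Let c1E s (S : set T) z : 0 <= s ->
  slope_term B S (fun w => tau w + s)%R (fun=> 1%R) z + repulsion_term S (fun w => tau w + s)%R (fun=> 1%R) (end_repulsion B) z =
  \1_S z.2 * (tau z.2 + s < z.1)%R%:R * c1 z.
Proof.
move=> s0; rewrite /c1 /slope_term /repulsion_term indicT /cst.
have -> : ivl (tau z.2 + s) 1 z.1 = (tau z.2 + s < z.1)%R%:R * ivl (tau z.2 + 0) 1 z.1.
  rewrite /ivl -natrM mulnb; have [h|//] := ltP (tau z.2 + s) z.1.
  by rewrite (_ : tau z.2 + 0 < z.1)//; lra.
by ring.
Qed.

Let c2E s (S : set T) z : 0 <= s ->
  slope_term B S (fun w => Num.max (s + tau w - 1) 0)%R tau z +
    repulsion_term S (fun w => Num.max (s + tau w - 1) 0)%R tau (fun z => (height z)^-1) z =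
  \1_S z.2 * (tau z.2 - 1 + s < z.1)%R%:R * c2 z.
Proof.
move=> s0; rewrite /c2 /slope_term /repulsion_term indicT /cst.
have -> : ivl (Num.max (s + tau z.2 - 1) 0) (tau z.2) z.1 =
    (tau z.2 - 1 + s < z.1)%R%:R * ivl (Num.max (0 + tau z.2 - 1) 0) (tau z.2) z.1.
  rewrite /ivl -natrM mulnb !gt_max (_ : s + tau z.2 - 1 = tau z.2 - 1 + s); last by ring.
  have [h|//] := ltP (tau z.2 - 1 + s) z.1.
  by rewrite (_ : 0 + tau z.2 - 1 < z.1)//; lra.
by ring.
Qed.

(** The time u of the transform corresponds to the time u + tau of the bridge before the wrap and to
    u + tau - 1 after it. *)
Let c (z : R * T) := c1 (z.1 + tau z.2, z.2) + c2 (z.1 + (tau z.2 - 1), z.2).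

Let mtau1 : measurable_fun setT (fun w => tau w - 1).
Proof. exact: measurable_funB. Qed.

Let Ic : nu.-integrable setT (EFin \o c).
Proof.
have [I1 _] := integral_product_shift mtau Ic1.
have [I2 _] := integral_product_shift mtau1 Ic2.
exact: (integrableD measurableT I1 I2).
Qed.

Let cut_integrable (f : R * T -> R) (b : R * T -> bool) (S : set T) : measurable S ->
  measurable_fun setT b -> nu.-integrable setT (EFin \o f) ->
  nu.-integrable setT (fun z => (\1_S z.2 * (b z)%:R * f z)%:E).
Proof.
move=> mS mb If; apply: (le_integrable measurableT _ _ If).
  apply/measurable_EFinP; apply: measurable_funM; last first.
    by apply/measurable_EFinP; exact: measurable_int If.
  apply: measurable_funM; last exact: measurable_boolR.
  by apply: (measurableT_comp (measurable_indic mS)); exact: measurable_snd.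
move=> z _ /=; rewrite lee_fin !normrM ler_piMl// !ger0_norm//.
by rewrite mulr_ile1// lern1 leq_b1.
Qed.

(** The increment from s to 1 is X_1 - X_(tau + s) plus X_tau - X_(tau + s - 1) with clamped times:
    what remains of the path after the argmin and what remains before it. The two drift identities
    then add up. *)
Let tail s (S : set T) : 0 <= s -> s <= 1 -> natural_filtration V s S ->
  (\int[P]_w (\1_S w * (vpath 1 w - vpath s w))%:E =
   \int[nu]_z (\1_S z.2 * (s < z.1)%R%:R * c z)%:E)%E.
Proof.
move=> s0 s1 FS; have mS := natural_filtration_measurable hB s1 FS.
have [_ E1] := post_identity hB s0 s1 FS; have [_ E2] := pre_identity hB s0 s1 FS.
pose F1 (z : R * T) := (\1_S z.2 * (tau z.2 + s < z.1)%R%:R * c1 z)%:E.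
pose F2 (z : R * T) := (\1_S z.2 * (tau z.2 - 1 + s < z.1)%R%:R * c2 z)%:E.
have mb1 : measurable_fun setT (fun z : R * T => tau z.2 + s < z.1).
  apply: measurable_fun_ltr; last exact: measurable_fst.
  by apply: measurable_funD => //; exact: (measurableT_comp mtau).
have IF1 : nu.-integrable setT F1 := cut_integrable mS mb1 Ic1.
have mb2 : measurable_fun setT (fun z : R * T => tau z.2 - 1 + s < z.1).
  apply: measurable_fun_ltr; last exact: measurable_fst.
  by apply: measurable_funD => //; exact: (measurableT_comp mtau1).
have IF2 : nu.-integrable setT F2 := cut_integrable mS mb2 Ic2.
have [J1 K1] := integral_product_shift mtau IF1.
have [J2 K2] := integral_product_shift mtau1 IF2.
transitivity (\int[nu]_z F1 z + \int[nu]_z F2 z)%E; last first.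
  rewrite -K1 -K2 -integralD//; apply: eq_integral => z _; rewrite -EFinD; congr EFin.
  rewrite /= /c (addrC (tau z.2)) ltrD2r (addrC (tau z.2 - 1)) ltrD2r; by ring.
have <- : (\int[P]_w (\1_S w * (X 1 w - X (tau w + s) w))%:E = \int[nu]_z F1 z)%E.
  by rewrite E1; apply: eq_integral => z _; rewrite c1E.
have <- : (\int[P]_w (\1_S w * (X (tau w) w - X (tau w + s - 1) w))%:E = \int[nu]_z F2 z)%E.
  by rewrite E2; apply: eq_integral => z _; rewrite c2E.
have ev (h : T -> R) : measurable_fun setT h -> measurable_fun setT (fun w => X (h w) w).
  by move=> mh; apply: measurable_eval => // w; exact: cX.
have Id (h1 h2 : T -> R) : measurable_fun setT h1 -> measurable_fun setT h2 ->
    P.-integrable setT (fun w => (\1_S w * (X (h1 w) w - X (h2 w) w))%:E).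
  move=> m1 m2; have I := integrableZl measurableT 2 (integrable_psup hB).
  apply: (le_integrable measurableT _ _ I).
    apply/measurable_EFinP; apply: measurable_funM; first exact: measurable_indic.
    by apply: measurable_funB; exact: ev.
  move=> w _ /=; rewrite lee_fin; apply: le_trans (ler_norm _).
  rewrite normrM ger0_norm// (_ : 2 * _ = psup B w + psup B w); last by ring.
  apply: (@le_trans _ _ `|X (h1 w) w - X (h2 w) w|); first by rewrite ler_piMl.
  by apply: (le_trans (ler_normB _ _)); apply: lerD; exact: (psup_ge hB).
have msum : measurable_fun setT (fun w => tau w + s) by exact: measurable_funD.
have msum1 : measurable_fun setT (fun w => tau w + s - 1) by exact: measurable_funB.
rewrite -(integralD measurableT (Id (fun=> 1) _ (measurable_cst _) msum) (Id _ _ mtau msum1)).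
apply: eq_integral => w _; rewrite -EFinD; congr EFin; rewrite -mulrDr; congr (_ * _).
have /andP[t0 _] := btau_itv hB w.
rewrite /vpath (bpath_ge1 _ w (q := tau w + 1)) ?addrK; last by lra.
by ring.
Qed.

Lemma vervaat_compensator : exists c : R * T -> R, nu.-integrable setT (EFin \o c) /\
  forall (s t : R) (S : set T), 0 <= s -> s <= t -> t <= 1 -> natural_filtration V s S ->
  (\int[P]_w (\1_S w * (vpath t w - vpath s w))%:E =
   \int[nu]_z (\1_S z.2 * ((s < z.1) && (z.1 <= t))%R%:R * c z)%:E)%E.
Proof.
exists c; split; first exact: Ic.
move=> s t S s0 st t1 FS; have mS := natural_filtration_measurable hB (le_trans st t1) FS.
have FtS : natural_filtration V t S.
  move: S FS {mS}; apply: sub_smallest2r; first exact: smallest_sigma_algebra.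
  move=> A [u us hA]; exists u => //.
  by move: us; rewrite /= !in_itv/= => /andP[-> us]; exact: le_trans us st.
have t0 := le_trans s0 st.
have Es := tail s0 (le_trans st t1) FS; have Et := tail t0 t1 FtS.
have mlt q : measurable_fun setT (fun z : R * T => (q < z.1)%R).
  by apply: measurable_fun_ltr => //; exact: measurable_fst.
have Is q : P.-integrable setT (fun w => (\1_S w * (vpath 1 w - vpath q w))%:E).
  have I := integrableB measurableT (vpath_integrable 1) (vpath_integrable q).
  apply: (le_integrable measurableT _ _ I).
    apply/measurable_EFinP; apply: measurable_funM; first exact: measurable_indic.
    by apply: measurable_funB; exact: measurable_vpath.
  by move=> w _ /=; rewrite lee_fin normrM ger0_norm// ler_piMl.
transitivity (\int[P]_w (\1_S w * (vpath 1 w - vpath s w))%:E -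
  \int[P]_w (\1_S w * (vpath 1 w - vpath t w))%:E)%E.
  rewrite -(integralB measurableT (Is s) (Is t)); apply: eq_integral => w _.
  by rewrite -EFinB; congr EFin; ring.
rewrite Es Et -(integralB measurableT (cut_integrable mS (mlt s) Ic) (cut_integrable mS (mlt t) Ic)).
apply: eq_integral => z _; rewrite -EFinB; congr EFin; rewrite -mulrBl; congr (_ * _).
rewrite -mulrBr; congr (_ * _).
have [h|h] := leP z.1 t; have [h'|h'] := ltP s z.1; rewrite ?subr0 ?subrr//.
by exfalso; lra.
Qed.

End vervaat_compensator.

(** * Predictable projection of the compensator *)

Section coarse_density.
Context d (T : measurableType d) (R : realType) (m : {measure set T -> \bar R}).
Variable G : set (set T).
Hypothesis sG : G `<=` measurable.
Hypothesis sf : exists2 F : (set T)^nat, setT = \bigcup_i F i &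
  forall i, <<s G >> (F i) /\ (m (F i) < +oo)%E.
Local Notation T' := (g_sigma_algebraType G).

Let sub (A : set T) : <<s G >> A -> measurable A.
Proof. by move: A; apply: smallest_sub => //; exact: sigma_algebra_measurable. Qed.

(** The identity, seen as a map onto the space with the smaller sigma-algebra; pushing forward along
    it compares integrals for the two structures. *)
Definition coarse_map (x : T) : T' := x.

Lemma measurable_coarse_map : measurable_fun setT coarse_map.
Proof. by move=> _ A mA; rewrite setTI; exact: sub. Qed.

Definition coarse_measure (A : set T') : \bar R := m A.

Let coarse0 : coarse_measure set0 = 0%E. Proof. exact: measure0. Qed.

Let coarse_ge0 A : (0 <= coarse_measure A)%E. Proof. exact: measure_ge0. Qed.

Let coarse_sigma : semi_sigma_additive coarse_measure.
Proof.
move=> F mF tF mUF; apply: (@measure_semi_sigma_additive _ _ _ m) => //.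
  by move=> n; apply: sub; exact: mF.
exact: sub.
Qed.

HB.instance Definition _ := isMeasure.Build _ _ _ coarse_measure coarse0 coarse_ge0 coarse_sigma.

Let coarse_sigma_finite : sigma_finite setT coarse_measure.
Proof. exact: sf. Qed.

HB.instance Definition _ := @Measure_isSigmaFinite.Build _ _ _ coarse_measure coarse_sigma_finite.

Let pushed : {measure set T' -> \bar R} :=
  @measure_function_pushforward__canonical__measure_function_Measure _ _ _ _ _ m _ measurable_coarse_map.

Lemma ge0_integral_coarse (f : T -> \bar R) : measurable_fun setT (f : T' -> \bar R) ->
  (forall x, (0 <= f x)%E) -> (\int[coarse_measure]_x f x = \int[m]_x f x)%E.
Proof.
move=> mf f0.
have E : (\int[pushed]_x f x = \int[m]_x f x)%E.
  exact: (@ge0_integral_pushforward _ _ _ _ _ _ measurable_coarse_map m setT f measurableT mf (fun x _ => f0 x)).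
rewrite -E; exact: (@eq_measure_integral _ _ _ setT pushed).
Qed.

Variable c : T -> \bar R.
Hypothesis Ic : m.-integrable setT c.

Definition coarse_charge (A : set T') : \bar R := (\int[m]_(x in A) c x)%E.

Let charge0' : coarse_charge set0 = 0%E. Proof. exact: (charge0 (induced_charge Ic)). Qed.

Let charge_fin A : measurable A -> coarse_charge A \is a fin_num.
Proof. by move=> /sub mA; exact: (fin_num_measure (induced_charge Ic)). Qed.

Let charge_sigma : semi_sigma_additive coarse_charge.
Proof.
move=> F mF tF mUF; apply: (charge_semi_sigma_additive (s := induced_charge Ic)) => //.
  by move=> n; apply: sub; exact: mF.
exact: sub.
Qed.

HB.instance Definition _ := isCharge.Build _ _ _ coarse_charge charge0' charge_fin charge_sigma.

(** The conditional expectation of [c] for a sigma-finite measure: the density, with respect to the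
    restricted measure, of the charge that sends A to the integral of [c] over A. *)
Lemma coarse_density : exists b : T -> R,
  [/\ measurable_fun setT (b : T' -> R), m.-integrable setT (EFin \o b) &
   forall A, <<s G >> A -> (\int[m]_(x in A) (b x)%:E = \int[m]_(x in A) c x)%E].
Proof.
have dom : coarse_charge `<< coarse_measure.
  apply/null_content_dominatesP => A mA A0; have mA' := sub mA.
  apply: null_set_integral => //.
  apply: measurable_funTS; exact: measurable_int Ic.
pose g := Radon_Nikodym coarse_charge coarse_measure.
have gf x : g x \is a fin_num by exact: Radon_Nikodym_fin_num.
have Ig : coarse_measure.-integrable setT g by exact: Radon_Nikodym_integrable.
pose b (x : T) : R := fine (g x).
have bE x : (b x)%:E = g x by rewrite /b fineK.
have mb : measurable_fun setT (b : T' -> R).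
  by apply: measurableT_comp => //; exact: measurable_int Ig.
have mbm : measurable_fun setT b.
  by move=> _ A mA; rewrite setTI; apply: sub; rewrite -[X in _ X]setTI; exact: mb.
have Ib : m.-integrable setT (EFin \o b).
  apply/integrableP; split; first exact/measurable_EFinP.
  have [_ lt] := integrableP _ _ _ Ig.
  rewrite -(@ge0_integral_coarse (fun x => `|(b x)%:E|%E))//.
    by under eq_integral do rewrite bE.
  by apply: measurableT_comp => //; exact/measurable_EFinP.
exists b; split => // A mA.
have EA : (\int[m]_(x in A) c x = \int[coarse_measure]_(x in A) g x)%E := Radon_Nikodym_integral dom mA.
rewrite EA.
have mb' : measurable_fun setT ((EFin \o b) : T' -> \bar R) by exact/measurable_EFinP.
have Ib' : m.-integrable (coarse_map @^-1` A) ((EFin \o b) \o coarse_map).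
  by apply: (integrableS measurableT _ _ Ib) => //; exact: sub.
have E : (\int[pushed]_(x in A) (b x)%:E = \int[m]_(x in A) (b x)%:E)%E.
  exact: (@integral_pushforward _ _ _ _ _ _ measurable_coarse_map m A (EFin \o b) mb' Ib' mA).
rewrite -E; transitivity (\int[coarse_measure]_(x in A) (b x)%:E)%E.
  by apply: eq_measure_integral => D _ _.
by apply: eq_integral => x _; rewrite bE.
Qed.

End coarse_density.

Section path_regularity.
Context {R : realType}.
Local Notation mu := (@lebesgue_measure R).

Lemma continuous_cadlag (f : R -> R) : {within `[0, 1], continuous f} -> cadlag f.
Proof.
move=> /(continuous_within_itvP _ ltr01)[cf c0 c1]; split => t /andP[].
  rewrite le_eqVlt => /predU1P[<- _ //|t0 t1].
  by apply: cvg_at_right_filter; apply: cf; rewrite in_itv/= t0.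
move=> t0; rewrite le_eqVlt => /predU1P[->|t1]; first by apply/cvg_ex; exists (f 1).
apply/cvg_ex; exists (f t).
by apply: cvg_at_left_filter; apply: cf; rewrite in_itv/= t0.
Qed.

Lemma cadlagB (f g : R -> R) : cadlag f -> cadlag g -> cadlag (fun t => f t - g t).
Proof.
move=> [f1 f2] [g1 g2]; split => t t01; first by apply: cvgB; [exact: f1|exact: g1].
by apply: is_cvgB; [exact: f2|exact: g2].
Qed.

(** The primitives of the positive and of the negative part are nondecreasing. *)
Lemma primitive_bounded_variation (f : R -> R) (a b : R) : a < b -> mu.-integrable setT (EFin \o f) ->
  bounded_variation a b (fun t => \int[mu]_(u in `[a, t]) f u).
Proof.
move=> ab If.
have Ip := integrable_funepos measurableT If.
have In := integrable_funeneg measurableT If.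
have I (g : R -> \bar R) z : mu.-integrable setT g -> mu.-integrable `[a, z] g.
  by move=> Ig; apply: integrableS Ig.
have bv (g : R -> \bar R) : (forall x, 0 <= g x)%E -> mu.-integrable setT g ->
    bounded_variation a b (fun t => fine (\int[mu]_(u in `[a, t]) g u)).
  move=> g0 Ig; apply: nondecreasing_bounded_variation => x y _ _ xy.
  apply: fine_le; [exact: integrable_fin_num (I _ x Ig)|exact: integrable_fin_num (I _ y Ig)|].
  apply: ge0_subset_integral => //; first exact: measurable_int (I _ y Ig).
  by apply: subset_itvl; rewrite bnd_simp.
have h1 := bv _ (funepos_ge0 _) Ip; have h2 := bv _ (funeneg_ge0 _) In.
rewrite (_ : (fun t => _) = (fun t => fine (\int[mu]_(u in `[a, t]) (EFin \o f)^\+%E u)) \+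
    \- (fun t => fine (\int[mu]_(u in `[a, t]) (EFin \o f)^\-%E u))).
  exact: (bounded_variationD ab h1 (bounded_variationN h2)).
apply/funext => t; rewrite /Rintegral integralE fineB//.
  exact: integrable_fin_num (I _ t Ip).
exact: integrable_fin_num (I _ t In).
Qed.

End path_regularity.

(** * Predictable sets and the integrated drift *)

Section predictable.
Context d (T : measurableType d) (R : realType) (P : probability T R).
Variable F : R -> set (set T).
Hypothesis hF : filtration F.
Local Notation mu := (@lebesgue_measure R).
Local Notation nu := (mu \x P)%E.

Definition rectangle (s t : R) (S : set T) : set (R * T) :=
  [set z | (s < z.1) && (z.1 <= t) /\ S z.2].

(* The cylinders D x T make the product measure sigma-finite on the generated
   sigma-algebra. *)
Definition predictable_gen : set (set (R * T)) :=
  [set A | (exists s t S, [/\ 0 <= s, s <= t, t <= 1, F s S & A = rectangle s t S]) \/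
    exists2 D : set R, measurable D & A = D `*` setT].

Local Notation Ft t := (g_sigma_algebraType (F t)).

Lemma filtration_measurable t S : 0 <= t <= 1 -> F t S -> measurable S.
Proof. by move=> t01; have [+ _] := hF => /(_ t t01)[_]; apply. Qed.

Lemma filtration_sigma t : 0 <= t <= 1 -> <<s F t>> = F t.
Proof. by move=> t01; have [+ _] := hF => /(_ t t01)[h _]; exact: sigma_algebra_id. Qed.

Lemma rectangleE s t S : rectangle s t S = `]s, t]%classic `*` S.
Proof. by apply/seteqP; split => z /=; rewrite in_itv/=. Qed.

Lemma predictable_gen_measurable : predictable_gen `<=` measurable.
Proof.
move=> A [[s [t [S [s0 st t1 FS ->]]]]|[D mD ->]]; last exact: measurableX.
rewrite rectangleE; apply: measurableX => //.
by apply: filtration_measurable FS; rewrite s0 (le_trans st).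
Qed.

Lemma predictable_sigma_finite : exists2 K : (set (R * T))^nat, setT = \bigcup_i K i &
  forall i, <<s predictable_gen>> (K i) /\ (nu (K i) < +oo)%E.
Proof.
exists (fun n : nat => `[(- n%:R : R), n%:R]%classic `*` setT).
  apply/esym/seteqP; split => // z _; have hn := archi_boundP (normr_ge0 z.1).
  exists (Num.bound `|z.1|) => //; split => //=; rewrite in_itv/= -ler_norml.
  by exact: ltW.
move=> n; split; first by apply: sub_gen_smallest; right; exists `[(- n%:R : R), n%:R]%classic.
have -> : (nu (`[(- n%:R : R)%R, n%:R%R]%classic `*` setT) = mu `[(- n%:R : R)%R, n%:R%R]%classic * P setT)%E.
  exact: product_measure1E.
rewrite probability_setT mule1 lebesgue_measure_itv/=.
by case: ifP => _; rewrite ltry.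
Qed.

(** Predictable sets are progressive: a rectangle starting at or after t misses [0, t], and one
    starting earlier has its base in F_s, contained in F_t. This is what makes [drift_part]
    adapted. *)
Lemma predictable_slice (t : R) (A : set (R * T)) : 0 <= t <= 1 -> <<s predictable_gen>> A ->
  measurable (A `&` (`[0, t]%classic `*` setT) : set (R * Ft t)%type).
Proof.
move=> t01 hA.
have mE : measurable (`[0, t]%classic `*` setT : set (R * Ft t)%type) by exact: measurableX.
pose C : set (set (R * T)) := [set A | measurable (A `&` (`[0, t]%classic `*` setT) : set (R * Ft t)%type)].
suff : <<s predictable_gen>> `<=` C by apply.
apply: smallest_sub.
  split; rewrite /C/=.
  - by rewrite set0I; exact: measurable0.
  - move=> B mB; rewrite setTD.
    rewrite (_ : _ `&` _ = (`[0, t]%classic `*` setT) `\` (B `&` (`[0, t]%classic `*` setT))).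
      exact: measurableD.
    apply/seteqP; split => z /=; first by move=> [nB hz]; split => // -[].
    by move=> [hz nB]; split => // Bz; apply: nB.
  - by move=> K mK; rewrite setI_bigcupl; exact: bigcup_measurable.
move=> E [[s [t' [S [s0 st t1 FS ->]]]]|[D mD ->]]; rewrite /C/=; last first.
  by rewrite -setXI setTI; apply: measurableX => //; exact: measurableI.
have [sT|ts] := leP s t; last first.
  rewrite (_ : _ `&` _ = set0); first exact: measurable0.
  apply/seteqP; split => // z /= [[/andP[h1 _] _] [+ _]]; rewrite in_itv/= => /andP[_ h2].
  by move: (lt_le_trans h1 (le_trans h2 (ltW ts))); rewrite ltxx.
rewrite rectangleE -setXI setIT; apply: measurableX; first exact: measurableI.
rewrite [X in X _]filtration_sigma//; move: FS; apply: hF.2 => //.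
by case/andP : t01.
Qed.

Lemma measurable_wrtP t (Y : T -> R) : 0 <= t <= 1 ->
  measurable_wrt (F t) Y <-> measurable_fun setT (Y : Ft t -> R).
Proof.
move=> t01; split => [h _ A mA|h A mA].
  by rewrite setTI [X in X _]filtration_sigma//; exact: h.
by rewrite -(filtration_sigma t01) -[X in _ X]setTI; exact: h.
Qed.

Variable b : R * T -> R.
Hypothesis mb : measurable_fun setT (b : g_sigma_algebraType predictable_gen -> R).
Hypothesis Ib : nu.-integrable setT (EFin \o b).

Definition drift_part (t : R) (w : T) : R := \int[mu]_(u in `[0, t]) b (u, w).

Lemma drift_part0 w : drift_part 0 w = 0.
Proof. by rewrite /drift_part set_itv1 Rintegral_set1. Qed.

Let cutb (t : R) : R * T -> \bar R := (EFin \o b) \_ (`[0, t]%classic `*` setT).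

Let cutbE (t u : R) w : cutb t (u, w) = ((fun u => (b (u, w))%:E) \_ `[0, t]%classic) u.
Proof.
rewrite /cutb !patchE; congr (if _ then _ else _).
by apply/idP/idP; rewrite !inE/=; [case|].
Qed.

Let drift_partE t w : drift_part t w = fine (fubini_G mu (cutb t) w).
Proof.
rewrite /drift_part /Rintegral integral_mkcond; congr fine; apply: eq_integral => u _.
by rewrite cutbE.
Qed.

Let mcutb t : measurable_fun setT (cutb t).
Proof.
have mD : measurable (`[0, t]%classic `*` setT : set (R * T)) by exact: measurableX.
apply: (measurable_restrictT _ mD).1.
by apply: measurable_funTS; exact: measurable_int Ib.
Qed.

Lemma measurable_drift_part t : measurable_fun setT (drift_part t).
Proof.
have E : drift_part t = fine \o fubini_G mu (cutb t) by apply/funext => w; exact: drift_partE.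
have I : nu.-integrable setT (cutb t).
  apply: (le_integrable measurableT _ _ Ib); first exact: mcutb.
  by move=> z _; rewrite /cutb patchE; case: ifP => // _; rewrite abse0.
by rewrite E; apply: measurableT_comp => //; exact: measurable_fubini_G I.
Qed.

Lemma drift_part_adapted : adapted F drift_part.
Proof.
move=> t t01; apply/measurable_wrtP => //.
have E : drift_part t = fine \o fubini_G mu (cutb t) by apply/funext => w; exact: drift_partE.
rewrite E; apply: measurableT_comp => //.
have mt : measurable_fun setT (cutb t : (R * Ft t)%type -> \bar R).
  have mD : measurable (`[0, t]%classic `*` setT : set (R * Ft t)%type) by exact: measurableX.
  apply: (measurable_restrictT _ mD).1.
  apply/measurable_EFinP => _ A mA; rewrite setIC; apply: predictable_slice => //.
  by rewrite -[X in _ X]setTI; exact: mb.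
(* For each sign Tonelli's theorem gives measurability with respect to [F t] without any
   integrability on the product with the smaller sigma-algebra. *)
rewrite (_ : fubini_G mu (cutb t) = fubini_G mu (cutb t)^\+%E \- fubini_G mu (cutb t)^\-%E)%E.
  apply: emeasurable_funB; apply: measurable_fun_fubini_tonelli_G => //.
    exact: measurable_funepos.
  exact: measurable_funeneg.
by apply/funext => w; rewrite /fubini_G integralE; congr (_ - _)%E; apply: eq_integral => u _;
  rewrite ?funeposE ?funenegE.
Qed.

Lemma drift_part_integrable t : P.-integrable setT (EFin \o drift_part t).
Proof.
apply/integrableP; split; first by apply/measurable_EFinP; exact: measurable_drift_part.
have mb' : measurable_fun setT (fun z : R * T => `|(b z)%:E|%E).
  by apply: measurableT_comp => //; exact: measurable_int Ib.
have [_ lt] := integrableP _ _ _ Ib; apply: le_lt_trans lt.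
rewrite fubini_tonelli2//; apply: ge0_le_integral => //.
- by apply: measurableT_comp => //; apply/measurable_EFinP; exact: measurable_drift_part.
- by apply: measurable_fun_fubini_tonelli_G.
move=> w _; rewrite /= drift_partE.
apply: (@le_trans _ _ `|fubini_G mu (cutb t) w|%E).
  by case: (fubini_G mu (cutb t) w) => [r| |] //=; rewrite normr0 ?leey.
rewrite /fubini_G; apply: (le_trans (le_abse_integral _ _ _)) => //.
  exact: (measurableT_comp (mcutb t) (measurable_pair2 w)).
apply: ge0_le_integral => //.
- apply: measurableT_comp => //; exact: (measurableT_comp (mcutb t) (measurable_pair2 w)).
- exact: (measurableT_comp mb' (measurable_pair2 w)).
by move=> u _; rewrite /cutb patchE; case: ifP => // _; rewrite abse0.
Qed.

(** By Fubini [b] is integrable in time only for almost every w, hence the almost sure form; for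
    such w the primitive is continuous and of bounded variation. *)
Lemma drift_part_regular : {ae P, forall w, cadlag (drift_part ^~ w) /\
  bounded_variation 0 1 (drift_part ^~ w)}.
Proof.
have := ae_integrable2 Ib; apply: filterS => w Iw; split.
  apply: continuous_cadlag; apply: (@parameterized_integral_continuous _ 0 1 (fun u => b (u, w))) => //.
  exact: (integrableS measurableT _ _ Iw).
exact: primitive_bounded_variation ltr01 Iw.
Qed.

Lemma drift_part_increment (s t : R) (S : set T) : 0 <= s -> s <= t -> measurable S ->
  (\int[P]_w (\1_S w * (drift_part t w - drift_part s w))%:E = \int[nu]_(z in rectangle s t S) (b z)%:E)%E.
Proof.
move=> s0 st mS.
have mr : measurable (rectangle s t S) by rewrite rectangleE; exact: measurableX.
have Ir : nu.-integrable setT ((EFin \o b) \_ (rectangle s t S)).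
  by apply/integrable_restrict => //; rewrite setTI; exact: (integrableS measurableT _ _ Ib).
rewrite [RHS]integral_mkcond -(integral21_prod_meas1 Ir).
apply: ae_eq_integral => //.
- apply/measurable_EFinP; apply: measurable_funM; first exact: measurable_indic.
  by apply: measurable_funB; exact: measurable_drift_part.
- exact: measurable_fubini_G Ir.
have := ae_integrable2 Ib; apply: filterS => w Iw _.
have I A : measurable A -> mu.-integrable A (EFin \o (fun u => b (u, w))).
  by move=> mA; exact: (integrableS measurableT _ _ Iw).
have E : drift_part t w - drift_part s w = \int[mu]_(u in `]s, t]) b (u, w).
  by rewrite /drift_part Rintegral_itvB ?bnd_simp//; exact: I.
rewrite E /fubini_G EFinM /Rintegral fineK; last by apply: integrable_fin_num => //; exact: I.
rewrite indicE; have [wS|wS] := boolP (w \in S).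
  rewrite mul1e integral_mkcond; apply: eq_integral => u _; rewrite !patchE.
  congr (if _ then _ else _); apply/idP/idP; rewrite !inE/= in_itv/=; last by case.
  by move: wS; rewrite inE.
rewrite mul0e integral0_eq// => u _; rewrite patchE memNset//= => -[_ Sw].
by move: wS; rewrite notin_setE; apply.
Qed.

End predictable.

(** * The semimartingale decomposition *)

Section decomposition.
Context d (T : measurableType d) (R : realType) (P : probability T R).
Variables (F : R -> set (set T)) (V Y : R -> T -> R) (c : R * T -> R).
Hypothesis hF : filtration F.
Hypothesis VY : forall t w, 0 <= t <= 1 -> V t w = Y t w.
Hypothesis cY : forall w, continuous (Y ^~ w).
Hypothesis Y0 : forall w, Y 0 w = 0.
Hypothesis adV : adapted F V.
Hypothesis IY : forall t, P.-integrable setT (EFin \o Y t).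
Local Notation mu := (@lebesgue_measure R).
Local Notation nu := (mu \x P)%E.
Hypothesis Ic : nu.-integrable setT (EFin \o c).
Hypothesis compensator : forall (s t : R) (S : set T), 0 <= s -> s <= t -> t <= 1 -> F s S ->
  (\int[P]_w (\1_S w * (Y t w - Y s w))%:E = \int[nu]_(z in rectangle s t S) (c z)%:E)%E.

Lemma compensated_semimartingale : semimartingale P F V.
Proof.
(* On every rectangle ]s, t] x S with S in F_s the density [b] has the same integral as [c], and the
   martingale property tests nothing else. *)
have [b [mb Ib Eb]] := @coarse_density _ _ _ nu _ (predictable_gen_measurable hF) (predictable_sigma_finite P F) _ Ic.
pose A := drift_part b.
pose M t w := Y t w - A t w.
have adA : adapted F A := drift_part_adapted hF mb.
have IA t : P.-integrable setT (EFin \o A t) := drift_part_integrable Ib t.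
have A0 w : A 0 w = 0 := drift_part0 b w.
have M0 w : M 0 w = 0 by rewrite /M Y0 A0 subrr.
have adM : adapted F M.
  move=> t t01; apply/(measurable_wrtP hF _ t01).
  apply: measurable_funB; last exact/(measurable_wrtP hF _ t01)/adA.
  rewrite (_ : Y t = V t); first exact/(measurable_wrtP hF _ t01)/adV.
  by apply/funext => w; rewrite VY.
have IM t : P.-integrable setT (EFin \o M t) := integrableB measurableT (IY t) (IA t).
have reg := drift_part_regular Ib.
have martM : martingale P F M.
  split; [exact: adM|by move=> t _; exact: IM|move=> s t s0 st t1].
  have s01 : 0 <= s <= 1 by rewrite s0 (le_trans st).
  have t01 : 0 <= t <= 1 by rewrite (le_trans s0).
  split; [exact: adM|exact: IM|] => S FS.
  have mS := filtration_measurable hF s01 FS.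
  have E1 := compensator s0 st t1 FS.
  have E2 := drift_part_increment Ib s0 st mS.
  have mr : <<s predictable_gen F>> (rectangle s t S).
    by apply: sub_gen_smallest; left; exists s, t, S.
  have I1 (f : R -> T -> R) q : P.-integrable setT (EFin \o f q) ->
      P.-integrable setT (fun w => (\1_S w * f q w)%:E).
    move=> If; apply: (le_integrable measurableT _ _ If).
      apply/measurable_EFinP; apply: measurable_funM; first exact: measurable_indic.
      by apply/measurable_EFinP; exact: measurable_int If.
    by move=> w _ /=; rewrite lee_fin normrM ger0_norm// ler_piMl.
  have toS (f : T -> R) : (\int[P]_(w in S) (f w)%:E = \int[P]_w (\1_S w * f w)%:E)%E.
    rewrite integral_mkcond; apply: eq_integral => w _; rewrite patchE indicE.
    by case: (w \in S); rewrite ?mul1r ?mul0r.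
  have IYA (f : R -> T -> R) : (forall q, P.-integrable setT (EFin \o f q)) ->
      (\int[P]_w (\1_S w * (f t w - f s w))%:E =
       \int[P]_w (\1_S w * f t w)%:E - \int[P]_w (\1_S w * f s w)%:E)%E.
    move=> If; rewrite -integralB//; try exact: I1.
    by apply: eq_integral => w _; rewrite -EFinB -mulrBr.
  have E3 : (\int[P]_w (\1_S w * (M t w - M s w))%:E = 0)%E.
    transitivity (\int[P]_w (\1_S w * (Y t w - Y s w))%:E -
        \int[P]_w (\1_S w * (A t w - A s w))%:E)%E.
      rewrite -integralB//.
      - by apply: eq_integral => w _; rewrite -EFinB; congr EFin; rewrite /M; ring.
      - exact: (I1 (fun _ w => Y t w - Y s w) 0 (integrableB measurableT (IY t) (IY s))).
      - exact: (I1 (fun _ w => A t w - A s w) 0 (integrableB measurableT (IA t) (IA s))).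
    rewrite E1 E2 (Eb _ mr) subee//.
    have mrect : measurable (rectangle s t S) by rewrite rectangleE; exact: measurableX.
    have Irect : nu.-integrable (rectangle s t S) (EFin \o c).
      by apply: (@integrableS _ _ _ nu setT _ _ measurableT mrect _ Ic); exact: subsetT.
    have fin : (\int[nu]_(z in rectangle s t S) (c z)%:E)%E \is a fin_num.
      by apply: (integrable_fin_num _ Irect).
    exact: fin.
  rewrite (toS (M s)) (toS (M t)); apply/esym; apply: sube0_eq.
  by rewrite -(IYA M IM) E3.
split; [exact: hF|exact: adV|exists M, A; split].
- split; [exact: adM| |].
    move: reg; apply: filterS => w [cA _]; apply: cadlagB => //.
    by apply: continuous_cadlag; exact: continuous_subspaceT.
  (* [M] is already a martingale on [0, 1], so the constant time 1 localises it. *)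
  exists (fun _ _ => 1); split.
    split; [move=> n|by move=> n w; exact: lexx|by apply: aeW => w; exists 0%N].
    split => [w|t t01]; first by rewrite ler01 lexx.
    have /andP[t0 t1] := t01; have [[h0 hC _] _] := hF.1 t t01.
    case: (leP 1 t) => h; last first.
      by rewrite (_ : [set w | _] = set0)//; apply/seteqP; split.
    rewrite (_ : [set w | _] = setT); first by rewrite -[setT]setD0; exact: hC.
    by apply/seteqP; split.
  move=> n; have E t : 0 <= t <= 1 -> (fun w => M (Num.min t 1) w - M 0 w) = M t.
    by move=> /andP[_ t1]; apply/funext => w; rewrite M0 subr0 min_l.
  have [h1 h2 h3] := martM; split.
  + by move=> t t01; cbv beta; rewrite (E t t01); exact: (h1 t t01).
  + by move=> t t01; cbv beta; rewrite (E t t01); exact: (h2 t t01).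
  + move=> s t s0 st t1.
    have s01 : 0 <= s <= 1 by rewrite s0 (le_trans st).
    have t01 : 0 <= t <= 1 by rewrite (le_trans s0).
    by cbv beta; rewrite (E s s01) (E t t01); exact: (h3 s t s0 st t1).
- split; [exact: adA|by move: reg; apply: filterS => w []|].
  by move: reg; apply: filterS => w [].
- by move=> w; rewrite M0 A0.
- by move=> t w t01; rewrite !VY ?lexx ?ler01// Y0 add0r subrK.
Qed.

End decomposition.

Theorem corollary4p6 (R : realType) (d : measure_display) (T : measurableType d)
    (P : probability T R) (lambda : R) (B : R -> {RV P >-> R})
    (hB : brownian_bridge lambda B) :
  let V := fun (t : R) (w : T) => vervaat (fun s => B s w) t in
  semimartingale P (natural_filtration V) V.
Proof.
move=> V; have [c [Ic hc]] := vervaat_compensator hB.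
apply: (@compensated_semimartingale _ _ _ _ _ _ (vpath B) c) => //.
- split => [t /andP[t0 t1]|s t s0 st t1].
    split; first exact: smallest_sigma_algebra.
    exact: (natural_filtration_measurable hB).
  apply: sub_smallest2r; first exact: smallest_sigma_algebra.
  move=> A [u us hA]; exists u => //.
  by move: us; rewrite /= !in_itv/= => /andP[-> us]; exact: le_trans us st.
- by move=> t w t01; exact: (vervaat_vpath hB).
- exact: (continuous_vpath hB).
- exact: (vpath0 hB).
- move=> t /andP[t0 t1] A mA; apply: sub_gen_smallest; exists t; first by rewrite /= in_itv/= t0/=.
  by exists A => //; rewrite setTI.
- exact: (vpath_integrable hB).
move=> s t S s0 st t1 FS; rewrite (hc _ _ _ s0 st t1 FS) [RHS]integral_mkcond.
apply: eq_integral => z _; rewrite patchE indicE.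
have [zS|zS] := boolP (z.2 \in S); last first.
  rewrite !mul0r memNset// => -[_ Sz]; move: zS; by rewrite notin_setE; apply.
have [h|h] := boolP ((s < z.1) && (z.1 <= t)).
  by rewrite mem_set ?mul1r//; split => //; move: zS; rewrite inE.
by rewrite mulr0 mul0r memNset// => -[h' _]; move: h; rewrite h'.
Qed.
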